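(* Let $u_0\in L^1(\mathbb{R})\cap BV(\mathbb{R})$ and let $u_{\Delta t}$ be computed by the forward Euler scheme $$u_j^{n+1}=u_j^n-\Delta t\,\mathrm{L}(u^n)_j,\qquad u_j^0=\frac1{\Delta x}\int_{\mathcal{C}_j}u_0(x)\,dx,\qquad j\in\mathbb{Z},$$ (defined in the context) with $\lambda=\Delta t/\Delta x$ fixed such that the discrete flux $g$ satisfies the CFL condition $$\frac{\Delta t}{\Delta x}\bigl(\partial_1 g(u,v)-\partial_2 g(w,v)\bigr)\le 1\qquad\text{for all }u,v,w\in\mathbb{R}.$$ Then there exists a subsequence $\Delta t_k\to0$ such that $u_{\Delta t_k}(t)$ converges in $L^1_{\mathrm{loc}}(\mathbb{R})$ for all $t$ to a function $u\in C([0,T];L^1(\mathbb{R}))$ which is a weak solution of $$\frac{\partial u}{\partial t}+\int_0^\delta \frac{g(u,\tau_h u)-g(\tau_{-h}u,u)}{h}\,\omega_\delta(h)\,dh=0\quad\text{in }\mathbb{R}\times(0,T),\qquad u(x,0)=u_0(x).$$ If additionally $\int_0^\delta\frac{\omega_\delta(h)}{h}\,dh<\infty$, then the whole sequence $u_{\Delta t}$ converges, as $\Delta t\to 0$, towards the unique entropy solution of this problem.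
   Context: Fix $T>0$, $\delta>0$. Notation: $\tau_{\pm h}u(x,t)=u(x\pm h,t)$, $a\vee b=\max(a,b)$, $a\wedge b=\min(a,b)$. Kernel: $\omega_\delta:\mathbb{R}\to\mathbb{R}$ is integrable with $\omega_\delta\ge 0$, $\operatorname{supp}\omega_\delta\subseteq[0,\delta]$, $\int_0^\delta\omega_\delta(h)\,dh=1$. Flux: $g:\mathbb{R}\times\mathbb{R}\to\mathbb{R}$ is consistent with a flux $f$, i.e. $g(u,u)=f(u)$; monotone, i.e. $\partial_1 g\ge 0$, $\partial_2 g\le 0$; and Lipschitz continuous, $|g(u_1,v_1)-g(u_2,v_2)|\le C(|u_1-u_2|+|v_1-v_2|)$. ($\partial_1,\partial_2$ are the partial derivatives, where they exist.) Grid: $\Delta x,\Delta t>0$, $x_j=j\Delta x$, $x_{j+1/2}=(j+\frac12)\Delta x$, $\mathcal{C}_j=(x_{j-1/2},x_{j+1/2})$, $t^n=n\Delta t$, $\mathcal{T}^n=(t^n,t^{n+1})$. Set $u_{\Delta t}(x,t)=u_j^n$ for $(x,t)\in\mathcal{C}_j\times\mathcal{T}^n$ (and at $t=t^n$). Weights: $r=\lfloor\delta/\Delta x\rfloor$, $\mathcal{I}_k=((k-1)\Delta x,k\Delta x)$, $\Phi_i(h)=\max(0,1-|h-i\Delta x|/\Delta x)$ (piecewise linear hat functions), $W_0=\int_{\mathcal{I}_1}\Phi_0(h)\omega_\delta(h)\,dh$, and $W_k=\int_{\mathcal{I}_k\cup\mathcal{I}_{k+1}}\Phi_k(h)\omega_\delta(h)\,dh$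 for $k=1,\dots,r+1$. Reconstruction: for a grid function $(u_j)_{j\in\mathbb{Z}}$ one has approximate slopes $\sigma_j$, $u_j^\pm=u_j\pm\frac12\sigma_j$, which satisfy the standing assumption $-2\le\frac{\sigma_{j+1}-\sigma_j}{u_{j+1}-u_j}\le2$ for all $j$ (understood as $|\sigma_{j+1}-\sigma_j|\le 2|u_{j+1}-u_j|$). In the scheme this holds at each time step $n$ with slopes $\sigma_j^n$. Scheme operator: $$\mathrm{L}(u)_j=\frac{g(u_j^+,u_{j+1}^-)-g(u_{j-1}^+,u_j^-)}{\Delta x}W_0+\sum_{k=1}^{r+1}\frac{g(u_j,u_{j+k})-g(u_{j-k},u_j)}{k\Delta x}W_k.$$ Weak solution: $u\in L^\infty(\mathbb{R}\times(0,T))$ such that for all $\phi\in C_c^\infty(\mathbb{R}\times[0,T))$ $$\int_0^T\!\!\int_{\mathbb{R}}u\,\frac{\partial\phi}{\partial t}\,dx\,dt+\int_{\mathbb{R}}u_0(x)\phi(x,0)\,dx+\int_0^T\!\!\int_{\mathbb{R}}\int_0^\delta\frac{\tau_h\phi-\phi}{h}\,g(u,\tau_hu)\,\omega_\delta(h)\,dh\,dx\,dt=0.$$ Entropy solution: $u\in L^\infty(\mathbb{R}\times(0,T))$ such that for all $c\in\mathbb{R}$ and all nonnegative $\phi\in C_c^\infty(\mathbb{R}\times[0,T))$ $$\int_0^T\!\!\int_{\mathbb{R}}|u-c|\frac{\partial\phi}{\partial t}\,dx\,dt+\int_{\mathbb{R}}|u_0(x)-c|\phi(x,0)\,dx+\int_0^T\!\!\int_{\mathbb{R}}\int_0^\delta\frac{\tau_h\phi-\phi}{h}\,q(u,\tau_hu;c)\,\omega_\delta(h)\,dh\,dx\,dt\ge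 0,$$ where $q(a,b;c)=g(a\vee c,b\vee c)-g(a\wedge c,b\wedge c)$. *)

(* Defs.v *)
From HB Require Import structures.
From mathcomp Require Import all_boot all_order all_algebra.
From mathcomp Require Import all_classical all_reals all_analysis.
Import Order.TTheory GRing.Theory Num.Theory.
Import numFieldNormedType.Exports.

Set Implicit Arguments.
Unset Strict Implicit.
Unset Printing Implicit Defensive.

Local Open Scope classical_set_scope.
Local Open Scope ring_scope.

(* Functions of space and time are curried: [u x t] with x the space variable
   and t the time variable.  Integrals of real-valued functions are
   [Rintegral]s; all integrands to which they are applied below are integrable
   under the hypotheses of the theorem (for the inner iterated integrals, for
   almost every value of the outer variables). *)

Local Notation mu := (@lebesgue_measure _).

Definition strip {R : realType} (T : R) :
    set (measurableTypeR R * measurableTypeR R)%type :=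
  [set z | 0 < z.2 < T].

Definition nonlocal_kernel {R : realType} (delta : R) (w : R -> R) : Prop :=
  [/\ mu.-integrable [set: R] (EFin \o w),
      forall h, 0 <= w h,
      closure [set h | w h != 0] `<=` `[0, delta] &
      \int[mu]_(h in `[0, delta]) w h = 1].

(* [derive1] is only meaningful where the function is derivable, hence the guards:
   a Lipschitz g need not have partial derivatives everywhere. *)
Definition monotone_flux {R : realType} (g : R -> R -> R) : Prop :=
  (forall u v, derivable (g ^~ v) u 1 -> 0 <= derive1 (g ^~ v) u) /\
  (forall u v, derivable (g u) v 1 -> derive1 (g u) v <= 0).

Definition lipschitz_flux {R : realType} (g : R -> R -> R) : Prop :=
  exists C : R, forall u1 u2 v1 v2,
    `|g u1 v1 - g u2 v2| <= C * (`|u1 - u2| + `|v1 - v2|).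

Definition consistent_flux {R : realType} (g : R -> R -> R) (f : R -> R) :
  Prop := forall u, g u u = f u.

Definition CFL {R : realType} (lambda : R) (g : R -> R -> R) : Prop :=
  forall u v w, derivable (g ^~ v) u 1 -> derivable (g w) v 1 ->
    lambda * (derive1 (g ^~ v) u - derive1 (g w) v) <= 1.

Definition TV_line {R : realType} (f : R -> R) : \bar R :=
  ereal_sup [set total_variation ab.1 ab.2 f | ab in
    [set ab : R * R | ab.1 <= ab.2]].

(* Elements of L^1(R) n BV(R) are classes modulo a.e. equality, so finite total
   variation is required of some representative only. *)
Definition L1_BV {R : realType} (f : R -> R) : Prop :=
  mu.-integrable [set: R] (EFin \o f) /\
  exists2 v : R -> R, {ae mu, forall x, f x = v x} & (TV_line v < +oo)%E.

Definition cell {R : realType} (dx : R) (j : int) : set R :=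
  `](j%:~R - 2^-1) * dx, (j%:~R + 2^-1) * dx[.

Definition I_ {R : realType} (dx : R) (k : nat) : set R :=
  `](k%:R - 1) * dx, k%:R * dx[.

Definition hat {R : realType} (dx : R) (i : nat) (h : R) : R :=
  Num.max 0 (1 - `|h - i%:R * dx| / dx).

Definition weight {R : realType} (w : R -> R) (dx : R) (k : nat) : R :=
  \int[mu]_(h in if k == 0%N then I_ dx 1 else I_ dx k `|` I_ dx k.+1)
    (hat dx k h * w h).

Definition recm {R : realType} (u s : int -> R) (j : int) : R :=
  u j - 2^-1 * s j.
Definition recp {R : realType} (u s : int -> R) (j : int) : R :=
  u j + 2^-1 * s j.

Definition scheme_op {R : realType} (delta : R) (w : R -> R) (g : R -> R -> R)
    (dx : R) (s u : int -> R) (j : int) : R :=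
  let r := Num.truncn (delta / dx) in
  (g (recp u s j) (recm u s (j + 1)) - g (recp u s (j - 1)) (recm u s j)) / dx
    * weight w dx 0
  + \sum_(1 <= k < r.+2)
      (g (u j) (u (j + k%:Z)) - g (u (j - k%:Z)) (u j)) / (k%:R * dx)
        * weight w dx k.

(* [sigma n] are the slopes used at time step n. *)
Fixpoint forward_euler {R : realType} (delta : R) (w : R -> R)
    (g : R -> R -> R) (u0 : R -> R) (dx dt : R) (sigma : nat -> int -> R)
    (n : nat) : int -> R :=
  if n is m.+1 then
    let um := forward_euler delta w g u0 dx dt sigma m in
    fun j => um j - dt * scheme_op delta w g dx (sigma m) um j
  else fun j => dx^-1 * \int[mu]_(x in cell dx j) u0 x.

Definition admissible_slopes {R : realType} (u s : int -> R) : Prop :=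
  forall j : int, `|s (j + 1) - s j| <= 2 * `|u (j + 1) - u j|.

(* Value u_j^n for x in the half-open cell [x_{j-1/2}, x_{j+1/2}) and t in
   [t^n, t^{n+1}); the cell interfaces form a Lebesgue-null set. *)
Definition piecewise_constant {R : realType} (dx dt : R)
    (U : nat -> int -> R) (x t : R) : R :=
  U (Num.truncn (t / dt)) (Num.floor (x / dx + 2^-1)).

Definition partial_x {R : realType} (phi : R -> R -> R) : R -> R -> R :=
  fun x t => derive1 (phi ^~ t) x.
Definition partial_t {R : realType} (phi : R -> R -> R) : R -> R -> R :=
  fun x t => derive1 (phi x) t.

Fixpoint Ck {R : realType} (n : nat) (phi : R -> R -> R) : Prop :=
  continuous (fun z : R * R => phi z.1 z.2) /\
  if n is m.+1 then
    [/\ forall x t : R, derivable (phi ^~ t) x 1,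
        forall x t : R, derivable (phi x) t 1,
        Ck m (partial_x phi) & Ck m (partial_t phi)]
  else True.

(* C_c^oo(R x [0, T)) is taken as the restrictions to t >= 0 of functions in
   C_c^oo(R x (-oo, T)); only the values for t >= 0 enter the weak and entropy
   formulations. *)
Definition test_function {R : realType} (T : R) (phi : R -> R -> R) : Prop :=
  [/\ forall n, Ck n phi,
      compact (closure [set z : R * R | phi z.1 z.2 != 0]) &
      closure [set z : R * R | phi z.1 z.2 != 0] `<=` [set z | z.2 < T]].

Definition Linfty_strip {R : realType} (T : R) (u : R -> R -> R) : Prop :=
  measurable_fun (strip T)
    (fun z : measurableTypeR R * measurableTypeR R => u z.1 z.2) /\
  exists M : R, {ae (mu \x mu)%E, forall z, strip T z -> `|u z.1 z.2| <= M}.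

Definition weak_solution {R : realType} (T delta : R) (w : R -> R)
    (g : R -> R -> R) (u0 : R -> R) (u : R -> R -> R) : Prop :=
  Linfty_strip T u /\
  forall phi, test_function T phi ->
    \int[mu]_(t in `]0, T[) \int[mu]_x (u x t * partial_t phi x t)
    + \int[mu]_x (u0 x * phi x 0)
    + \int[mu]_(t in `]0, T[) \int[mu]_x \int[mu]_(h in `[0, delta])
        ((phi (x + h) t - phi x t) / h * g (u x t) (u (x + h) t) * w h)
    = 0.

Definition entropy_flux {R : realType} (g : R -> R -> R) (a b c : R) : R :=
  g (Num.max a c) (Num.max b c) - g (Num.min a c) (Num.min b c).

(* Nonnegativity is asked on t >= 0 only, in accordance with [test_function]. *)
Definition entropy_solution {R : realType} (T delta : R) (w : R -> R)
    (g : R -> R -> R) (u0 : R -> R) (u : R -> R -> R) : Prop :=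
  Linfty_strip T u /\
  forall (c : R) phi, test_function T phi ->
    (forall x t : R, 0 <= t -> 0 <= phi x t) ->
    0 <=
    \int[mu]_(t in `]0, T[) \int[mu]_x (`|u x t - c| * partial_t phi x t)
    + \int[mu]_x (`|u0 x - c| * phi x 0)
    + \int[mu]_(t in `]0, T[) \int[mu]_x \int[mu]_(h in `[0, delta])
        ((phi (x + h) t - phi x t) / h
         * entropy_flux g (u x t) (u (x + h) t) c * w h).

Definition C_L1 {R : realType} (T : R) (u : R -> R -> R) : Prop :=
  (forall t : R, t \in `[0, T] -> mu.-integrable [set: R] (EFin \o (u ^~ t))) /\
  (forall t : R, t \in `[0, T] ->
    (\int[mu]_x `|u x s - u x t|%:E)%E @[s --> within `[0, T] (nbhs t)]
      --> 0%E).

Definition cvg_L1loc {R : realType} {I : Type} (F : set_system I)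
    (v : I -> R -> R) (l : R -> R) : Prop :=
  forall K : set R, compact K ->
    (\int[mu]_(x in K) `|v i x - l x|%:E)%E @[i --> F] --> 0%E.

(* Main.v *)
Require Import Defs.
From HB Require Import structures.
From mathcomp Require Import all_boot all_order all_algebra.
From mathcomp Require Import all_classical all_reals all_analysis.
From mathcomp Require Import measurable_realfun.
From mathcomp Require Import zify ring lra.
Import Order.TTheory GRing.Theory Num.Theory.
Import numFieldNormedType.Exports.

Set Implicit Arguments.
Unset Strict Implicit.
Unset Printing Implicit Defensive.

Local Open Scope classical_set_scope.
Local Open Scope ring_scope.

(** The scheme is a consistent, total variation diminishing perturbation of a
    monotone scheme, and the theorem follows from the compactness that this
    provides, together with a uniqueness argument for the limit.

    What makes it work is that the nonlocal flux is singular only through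
    [1 / h], and that a quantity of order [dx / h] integrated against the
    kernel is bounded by [kmass dx], the integral of [min 1 (2 dx / h)] against
    [w].  Since [w] is integrable, [kmass dx] tends to 0 with [dx]
    ([kmass_cvg0]).  It bounds the sum of the coefficients [weight k / k] of
    the scheme ([weight_stride_sum]), hence for small [dx] the scheme is total
    variation diminishing, also with the reconstructed values, and Lipschitz
    continuous in time in L^1 ([step_zvar], [step_znorm]).  It also bounds the
    L^1 size of the whole reconstructed term, for all admissible slopes
    ([recon_error_sum]): up to this error the scheme is monotone and satisfies
    a discrete Kruzhkov inequality ([cell_update_entropy]).

    Compactness ([compactness]) is a quantitative diagonal argument: by
    Tychonoff's theorem a subsequence is close to one function at the points of
    finer and finer meshes, and the bounds in space and time turn this into
    fast convergence in L^1 on bounded windows, uniformly in time, hence into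
    convergence almost everywhere at every time.

    In the limit, summation by parts moves the differences of the scheme onto
    the test function; a sum over [k] against the weights is a quadrature
    formula for the integral in [h], with an error of order [kmass dx + dx]
    ([quadrature_error], [defect_cvg]).  The limit is thus a weak and an entropy
    solution ([scheme_compactness]).

    If [w h / h] is integrable, the nonlocal term is a bounded operator.  An
    entropy solution bounded by [M], tested with the constants [M] and [- M],
    satisfies linear identities for nonnegative test functions [a x * b t]
    ([entropy_tensor]).  For the difference of two solutions these identities
    improve a bound [k exp (m t)] to [(k / 2) exp (m t)] ([contraction_step]),
    so that the difference vanishes ([contraction_zero]).  Uniqueness upgrades
    the convergence of subsequences to convergence of the whole family. *)

(** * Integrals of real-valued functions *)

Section real_integrals.
Context d (T : measurableType d) (R : realType).
Variable mu : {measure set T -> \bar R}.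
Implicit Types (D : set T) (f g : T -> R).

Lemma integrable_dominated D f g : measurable D -> measurable_fun D f ->
  mu.-integrable D (EFin \o g) -> (forall x, D x -> `|f x| <= g x) ->
  mu.-integrable D (EFin \o f).
Proof.
move=> mD mf ig fg; apply: (le_integrable mD _ _ ig).
  exact/measurable_EFinP.
by move=> x Dx /=; rewrite lee_fin (le_trans (fg _ Dx))// ler_norm.
Qed.

Lemma integrable_bounded D f (M : R) : measurable D -> (mu D < +oo)%E ->
  measurable_fun D f -> (forall x, D x -> `|f x| <= M) ->
  mu.-integrable D (EFin \o f).
Proof.
move=> mD Doo mf fM; apply: measurable_bounded_integrable => //.
by exists M; split; [exact: num_real|move=> x Mx y Dy /=; exact: le_trans (fM _ Dy) (ltW Mx)].
Qed.

Lemma integrable_mulM D f g (M : R) : measurable D -> measurable_fun D f ->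
  (forall x, D x -> `|f x| <= M) -> mu.-integrable D (EFin \o g) ->
  mu.-integrable D (EFin \o (fun x => f x * g x)).
Proof.
move=> mD mf fM ig.
apply: (integrable_dominated (g := fun x => M * `|g x|)) => //.
- apply: measurable_funM => //; apply/measurable_EFinP; exact: measurable_int ig.
- have := integrableZl mD M (integrable_norm ig).
  by apply: eq_integrable => // x _.
- by move=> x Dx; rewrite normrM ler_wpM2r// fM.
Qed.

Lemma le_norm_Rintegral D f g : measurable D -> measurable_fun D f ->
  mu.-integrable D (EFin \o g) -> (forall x, D x -> `|f x| <= g x) ->
  `|\int[mu]_(x in D) f x| <= \int[mu]_(x in D) g x.
Proof.
move=> mD mf ig fg; have if_ := integrable_dominated mD mf ig fg.
rewrite (le_trans (le_normr_Rintegral mD if_))// le_Rintegral//.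
have := integrable_norm if_.
by apply: eq_integrable => // x _.
Qed.

Lemma Rintegral_sum D (I : Type) (s : seq I) (F : I -> T -> R) : measurable D ->
  (forall i, mu.-integrable D (EFin \o F i)) ->
  \int[mu]_(x in D) (\sum_(i <- s) F i x) = \sum_(i <- s) \int[mu]_(x in D) F i x.
Proof.
move=> mD iF; elim: s => [|i s IH].
  rewrite big_nil (_ : (fun x => _) = cst 0); last first.
    by apply/funext => x; rewrite big_nil.
  by rewrite Rintegral_cst// mul0r.
rewrite big_cons -IH -RintegralD//.
  by apply: eq_Rintegral => x _; rewrite big_cons.
have := integrable_sum mD s (P := xpredT) (fun i _ => iF i).
by apply: eq_integrable => // x _ /=; rewrite sumEFin.
Qed.

Lemma ae_eq_Rintegral D f g : measurable D -> measurable_fun D f ->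
  measurable_fun D g -> {ae mu, forall x, D x -> f x = g x} ->
  \int[mu]_(x in D) f x = \int[mu]_(x in D) g x.
Proof.
move=> mD mf mg fg; congr fine; apply: ae_eq_integral => //.
- exact/measurable_EFinP.
- exact/measurable_EFinP.
- by apply: filterS fg => x /= h Dx; rewrite h.
Qed.

Lemma Rintegral_dominated_cvg D (f : nat -> T -> R) (l g : T -> R) :
  measurable D -> (forall n, measurable_fun D (f n)) -> measurable_fun D l ->
  mu.-integrable D (EFin \o g) ->
  {ae mu, forall x, D x -> f n x @[n --> \oo] --> l x} ->
  (forall n x, D x -> `|f n x| <= g x) ->
  mu.-integrable D (EFin \o l) /\
  (\int[mu]_(x in D) f n x) @[n --> \oo] --> \int[mu]_(x in D) l x.
Proof.
move=> mD mf ml ig fl fg.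
have fl' : {ae mu, forall x, D x -> (EFin \o f n) x @[n --> \oo] --> (EFin \o l) x}.
  by apply: filterS fl => x /= h0 Dx; apply: cvg_EFin; [exact: nearW|exact: h0].
have fg' : {ae mu, forall x n, D x -> (`|(EFin \o f n) x| <= (EFin \o g) x)%E}.
  by apply: aeW => x n Dx /=; rewrite lee_fin fg.
have mf' n : measurable_fun D (EFin \o f n) by apply/measurable_EFinP.
have ml' : measurable_fun D (EFin \o l) by apply/measurable_EFinP.
have [il _ h] := dominated_convergence mD mf' ml' fl' ig fg'.
split => //; apply: fine_cvg; rewrite fineK; first exact: h.
exact: integrable_fin_num.
Qed.

End real_integrals.

Section translation.
Context {R : realType}.
Local Notation mu := (@lebesgue_measure R).
Local Notation TR := (measurableTypeR R).

Lemma measurable_shift (a : R) : measurable_fun [set: TR] (fun x : TR => (x + a : TR)).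
Proof. by apply: measurable_funD. Qed.

(** By uniqueness of the measure that gives each interval its length. *)
Lemma lebesgue_pushforward_shift (a : R) (A : set TR) : measurable A ->
  pushforward mu (fun x : TR => (x + a : TR)) A = mu A.
Proof.
move=> mA; pose f : TR -> TR := fun x => x + a.
have mf : measurable_fun [set: TR] f := measurable_shift a.
pose fI := isMeasurableFun.Build _ _ _ _ _ mf.
pose fM : {mfun TR >-> TR} := HB.pack f fI.
apply/esym; apply: (@lebesgue_measure_unique _ (pushforward mu fM)) => //.
move=> _ [[x y] _ <-] /=.
change (mu `]x, y]%classic = mu (f @^-1` `]x, y]%classic)).
have -> : f @^-1` `]x, y]%classic = `]x - a, y - a]%classic.
  by apply/seteqP; split => z /=; rewrite /f !in_itv/= ltrBlDr lerBrDr.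
by rewrite !lebesgue_measure_itv/= !lte_fin ltrD2r; case: ifP => // _; congr EFin; ring.
Qed.

Lemma ge0_integral_shift (a : R) (f : TR -> \bar R) :
  measurable_fun [set: TR] f -> (forall x, (0 <= f x)%E) ->
  (\int[mu]_x f (x + a)%R = \int[mu]_x f x)%E.
Proof.
move=> mf f0.
have := @ge0_integral_pushforward _ _ _ _ _ _ (measurable_shift a) mu setT f measurableT mf (fun y _ => f0 y).
rewrite preimage_setT => <-.
apply: eq_measure_integral; first exact: measurable_shift.
by move=> ? A mA _; exact: lebesgue_pushforward_shift.
Qed.

Lemma integral_shift (a : R) (f : TR -> \bar R) :
  measurable_fun [set: TR] f ->
  (\int[mu]_x f (x + a)%R = \int[mu]_x f x)%E.
Proof.
move=> mf; rewrite integralE [RHS]integralE; congr (_ - _)%E.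
  rewrite -(ge0_integral_shift a (measurable_funepos mf)) => [|x]; last exact: funepos_ge0.
  by rewrite (funepos_comp f (fun x : TR => x + a : TR)).
rewrite -(ge0_integral_shift a (measurable_funeneg mf)) => [|x]; last exact: funeneg_ge0.
  by rewrite (funeneg_comp f (fun x : TR => x + a : TR)).
Qed.

Lemma Rintegral_shift (a : R) (f : TR -> R) : measurable_fun [set: TR] f ->
  \int[mu]_x f (x + a) = \int[mu]_x f x.
Proof.
move=> mf; congr fine; apply: (integral_shift a (f := EFin \o f)).
exact/measurable_EFinP.
Qed.

End translation.

Lemma measurable_inv (R : realType) :
  measurable_fun [set: measurableTypeR R] ((fun x => x^-1) : measurableTypeR R -> R).
Proof.
rewrite -(setUv [set 0 : measurableTypeR R]); apply/measurable_funU.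
- exact: measurable_set1.
- by apply: measurableC; exact: measurable_set1.
split; first exact: measurable_fun_set1.
apply: open_continuous_measurable_fun.
  by apply: closed_openC; exact: closed_eq.
move=> x; rewrite inE => /= /eqP x0; exact: inv_continuous.
Qed.

Section fubini.
Context d1 d2 (T1 : measurableType d1) (T2 : measurableType d2) (R : realType).
Variables (m1 : {sigma_finite_measure set T1 -> \bar R})
          (m2 : {sigma_finite_measure set T2 -> \bar R}).
Local Notation m12 := (m1 \x m2)%E.
Implicit Types f : T1 * T2 -> R.

(** The weak formulations integrate in space first, then in time. *)
Lemma Rintegral_fubini f : m12.-integrable setT (EFin \o f) ->
  m2.-integrable setT (EFin \o (fun t => \int[m1]_x f (x, t))) /\
  \int[m2]_t \int[m1]_x f (x, t) = \int[m12]_z f z.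
Proof.
move=> fi.
have mG := measurable_fubini_G fi.
have mR : measurable_fun setT (fun t => \int[m1]_x f (x, t)).
  exact: measurableT_comp mG.
have mf := measurable_int _ fi.
split.
  apply/integrableP; split; first exact/measurable_EFinP.
  apply: (le_lt_trans _ ((integrable21ltyP _ _ mf).1 fi)).
  have mG' : measurable_fun setT (fun t => \int[m1]_x `|(EFin \o f) (x, t)|)%E.
    exact: (measurable_fubini_G (integrable_abse fi)).
  apply: ae_ge0_le_integral => //.
  - by apply: measurableT_comp => //; exact/measurable_EFinP.
  - by move=> x _; apply: integral_ge0.
  - have := ae_integrable2 fi; apply: filterS => t /= it _.
    rewrite -abse_EFin /Rintegral fineK; last exact: integrable_fin_num.
    by apply: le_abse_integral => //; apply: (measurableT_comp mf).
rewrite /Rintegral -(integral21_prod_meas1 fi).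
congr fine; apply: ae_eq_integral => //.
- exact/measurable_EFinP.
- have := ae_integrable2 fi; apply: filterS => t /= it _.
  by rewrite /Rintegral fineK//; exact: integrable_fin_num.
Qed.

Lemma Rintegral_fubini1 f : m12.-integrable setT (EFin \o f) ->
  m1.-integrable setT (EFin \o (fun x => \int[m2]_t f (x, t))) /\
  \int[m1]_x \int[m2]_t f (x, t) = \int[m12]_z f z.
Proof.
move=> fi.
have mG := measurable_fubini_F fi.
have mR : measurable_fun setT (fun x => \int[m2]_t f (x, t)).
  exact: measurableT_comp mG.
have mf := measurable_int _ fi.
split.
  apply/integrableP; split; first exact/measurable_EFinP.
  apply: (le_lt_trans _ ((integrable12ltyP _ _ mf).1 fi)).
  have mG' : measurable_fun setT (fun x => \int[m2]_t `|(EFin \o f) (x, t)|)%E.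
    exact: (measurable_fubini_F (integrable_abse fi)).
  apply: ae_ge0_le_integral => //.
  - by apply: measurableT_comp => //; exact/measurable_EFinP.
  - by move=> x _; apply: integral_ge0.
  - have := ae_integrable1 fi; apply: filterS => t /= it _.
    rewrite -abse_EFin /Rintegral fineK; last exact: integrable_fin_num.
    by apply: le_abse_integral => //; apply: (measurableT_comp mf).
rewrite /Rintegral -(integral12_prod_meas1 fi).
congr fine; apply: ae_eq_integral => //.
- exact/measurable_EFinP.
- have := ae_integrable1 fi; apply: filterS => t /= it _.
  by rewrite /Rintegral fineK//; exact: integrable_fin_num.
Qed.

End fubini.

(** * Monotonicity of Lipschitz functions *)

Section lipschitz_mono.
Context {R : realType}.
Local Notation mu := (@lebesgue_measure R).

Lemma lipschitz_cont (F : R -> R) (C : R) :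
  (forall x y, `|F x - F y| <= C * `|x - y|) -> continuous F.
Proof.
move=> FL x; apply/cvgrPdist_lt => e e0.
have C1 : 0 < `|C| + 1 by rewrite ltr_wpDl.
near=> y.
apply: (le_lt_trans (FL x y)).
have : `|x - y| < e / (`|C| + 1).
  by near: y; apply: (@cvgr_dist_lt _ _ _ _ _ id x) => //; apply: divr_gt0.
rewrite ltr_pdivlMr// mulrC; apply: le_lt_trans.
by apply: ler_wpM2r => //; rewrite (le_trans (ler_norm C))// lerDl.
Unshelve. all: by end_near. Qed.

Lemma stieltjes_ocitv (G : cumulative R R) x y : x <= y ->
  lebesgue_stieltjes_measure G `]x, y]%classic = (G y - G x)%:E.
Proof.
move=> xy; rewrite /lebesgue_stieltjes_measure /measure_extension.
rewrite measurable_mu_extE/=; last exact: is_ocitv.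
by rewrite wlength_itv_bnd.
Qed.

Lemma ocitv_ind (P : set R -> Prop) : P set0 ->
  (forall x y, x <= y -> P `]x, y]%classic) -> forall X, ocitv X -> P X.
Proof.
move=> P0 Pxy _ [[x y] _ <-] /=.
have [xy|yx] := leP x y; first exact: Pxy.
rewrite set_itv_ge//.
by rewrite bnd_simp -leNgt; exact: ltW.
Qed.

(** The Stieltjes measures of [G] and [H] add up to that of [C * x], which is
    [C] times the Lebesgue measure. *)
Lemma stieltjes_dominated (G H : cumulative R R) (C : R) : 0 <= C ->
  (forall x, G x + H x = C * x) ->
  forall A, measurable A ->
   (lebesgue_stieltjes_measure G A <= C%:E * mu A)%E.
Proof.
move=> C0 GH A mA.
pose nu := mscale (NngNum C0) mu.
pose GpH := measure_add (lebesgue_stieltjes_measure G)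
                                 (lebesgue_stieltjes_measure H).
have id_nd : {homo (fun x : R => C * x) : x y / x <= y}.
  by move=> x y xy; apply: ler_wpM2l.
have id_rc : right_continuous (fun x : R => C * x).
  apply/right_continuousW => x; apply: cvgMl_tmp; exact: cvg_id.
pose CI := isCumulative.Build R _ R (fun x : R => C * x) id_nd id_rc.
pose Cc : cumulative R R := HB.pack (fun x : R => C * x) CI.
have E1 : forall X, ocitv X -> lebesgue_stieltjes_measure Cc X = nu X.
  apply: ocitv_ind => [|x y xy]; first by rewrite !measure0.
  rewrite /nu/= /mscale/= lebesgue_measure_itv/=.
  rewrite [LHS]stieltjes_ocitv//= lte_fin lt_neqAle xy andbT.
  by have [->|_] := eqVneq x y; rewrite /= ?subrr ?mule0// -EFinB -EFinM mulrBr.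
have E2 : forall X, ocitv X -> lebesgue_stieltjes_measure Cc X = GpH X.
  apply: ocitv_ind => [|x y xy]; first by rewrite !measure0.
  rewrite /GpH [RHS]measure_addE [LHS]stieltjes_ocitv//=.
  transitivity ((G y - G x)%:E + (H y - H x)%:E)%E.
    by rewrite -EFinD -!GH; congr EFin; ring.
  by congr (_ + _)%E; symmetry; exact: stieltjes_ocitv.
have e1 : lebesgue_stieltjes_measure Cc A = (C%:E * mu A)%E.
  exact: lebesgue_stieltjes_measure_unique E1 _ mA.
rewrite -e1 (lebesgue_stieltjes_measure_unique E2 mA) [leRHS]measure_addE.
by rewrite leeDl.
Qed.

(** The sign of the derivative is only known where the derivative exists.  The
    function [F + C x] is nondecreasing and its Stieltjes measure is absolutely
    continuous, so it is the integral of a density, which by Lebesgue's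
    differentiation theorem is almost everywhere the derivative of [F] plus
    [C], hence at least [C]. *)
Lemma lipschitz_derive_ge0_homo (F : R -> R) (C : R) :
  (forall x y, `|F x - F y| <= C * `|x - y|) ->
  (forall x, derivable F x 1 -> 0 <= derive1 F x) ->
  {homo F : x y / x <= y}.
Proof.
move=> FL dF a b; rewrite le_eqVlt => /predU1P[->//|ab].
have C0 : 0 <= C.
  have := FL 1 0; rewrite subr0 normr1 mulr1; exact: le_trans.
have FL2 x y : x <= y -> - (C * (y - x)) <= F y - F x <= C * (y - x).
  by move=> xy; rewrite -ler_norml (le_trans (FL _ _))// ger0_norm// subr_ge0.
have cF := lipschitz_cont FL.
have cC : continuous (fun x : R => C * x).
  by move=> x; apply: cvgMl_tmp; exact: cvg_id.
pose G0 x := F x + C * x; pose H0 x := C * x - F x.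
have Gnd : {homo G0 : x y / x <= y}.
  by move=> x y xy; rewrite /G0; have := FL2 _ _ xy; lra.
have Hnd : {homo H0 : x y / x <= y}.
  by move=> x y xy; rewrite /H0; have := FL2 _ _ xy; lra.
have Grc : right_continuous G0.
  by apply/right_continuousW => x; apply: cvgD; [exact: cF|exact: cC].
have Hrc : right_continuous H0.
  by apply/right_continuousW => x; apply: cvgB; [exact: cC|exact: cF].
pose GI := isCumulative.Build R _ R G0 Gnd Grc.
pose HI := isCumulative.Build R _ R H0 Hnd Hrc.
pose G : cumulative R R := HB.pack G0 GI.
pose H : cumulative R R := HB.pack H0 HI.
have C20 : 0 <= C * 2 by rewrite mulr_ge0.
have Gdom : forall A, measurable A ->
    (lebesgue_stieltjes_measure G A <= (C * 2)%:E * mu A)%E.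
  apply: (stieltjes_dominated C20 (H := H)) => x /=.
  by rewrite /G0 /H0; ring.
pose I := `]a, b]%classic : set (measurableTypeR R).
have mI : measurable I by exact: measurable_itv.
have Ioo : (lebesgue_stieltjes_measure G I < +oo)%E.
  by rewrite stieltjes_ocitv ?ltry// ltW.
pose nu : {finite_measure set (measurableTypeR R) -> \bar R} := mfrestr mI Ioo.
have numu : nu `<< mu.
  apply/null_content_dominatesP => A mA A0; apply/eqP; rewrite eq_le measure_ge0 andbT.
  rewrite /nu/= /mfrestr /mrestr.
  apply: (@le_trans _ _ (lebesgue_stieltjes_measure G A)).
    by apply: le_measure; rewrite ?inE//; exact: measurableI.
  by rewrite (le_trans (Gdom _ mA))// A0 mule0.
have [f [f0 ffin fint fE]] := radon_nikodym_sigma_finite numu.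
pose fr : R -> R := fine \o f.
have frE : EFin \o fr = f by apply/funext => x /=; rewrite /fr/= fineK.
have GE x : a <= x <= b -> G0 x - G0 a = \int[mu]_(t in `]a, x]) fr t.
  move=> /andP[ax xb]; rewrite /Rintegral.
  rewrite -[X in integral _ _ X]/(EFin \o fr) frE -fE//.
  rewrite /nu/= /mfrestr /mrestr (_ : _ `&` _ = `]a, x]%classic) ?stieltjes_ocitv//.
  rewrite setIidl// => z; rewrite /I /= !in_itv/= => /andP[-> /=] /le_trans; exact.
have ifr : mu.-integrable [set: R] (EFin \o fr) by rewrite frE.
have := @FTC1 R fr (BRight a) _ (open_integrable_locally openT ifr).
case=> [y|N [mN N0 sN]]; first exact: integrableS ifr.
(* the right end point is discarded: there the primitive is only known on the left *)
have Cf : {ae mu, forall x, I x -> (C%:E <= f x)%E}.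
  exists (N `|` [set b]); split => //.
  - by apply: measurableU.
  - by rewrite measureU0//= ?lebesgue_measure_set1.
  - move=> x /= /not_implyP[]; rewrite /I/= in_itv/= => /andP[ax]; rewrite le_eqVlt => /predU1P[->|xb] Cfx.
      by right.
    left; apply: sN => /= /(_ ax)[dI DI]; apply: Cfx.
    have nG : {near x, (fun y => \int[mu]_(t in `]a, y]) fr t) =1 (fun y => G0 y - G0 a)}.
      near=> y; rewrite GE//; apply/andP; split; apply/ltW; near: y.
        exact: lt_nbhsr.
      exact: lt_nbhsl.
    have dG : derivable (fun y => G0 y - G0 a) x 1 by exact: near_eq_derivable dI.
    have DG : 'D_1 (fun y => G0 y - G0 a) x = fr x.
      by rewrite -(near_eq_derive _ nG) -DI derive1E.
    have isG : is_derive x 1 (fun y => G0 y - G0 a) (fr x) by split.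
    have FE : F = (fun y => (G0 y - G0 a) - (C * y - G0 a)).
      by apply/funext => y; rewrite /G0; ring.
    have isF : is_derive x 1 F (fr x - C).
      rewrite FE; apply: is_deriveB; rewrite -[X in is_derive _ _ _ X]subr0.
      apply: is_deriveB; rewrite -[X in is_derive _ _ _ X]mulr1.
      exact: is_deriveZ.
    have := dF x (@ex_derive _ _ _ _ _ _ _ isF); rewrite derive1E derive_val subr_ge0.
    by rewrite -(fineK (ffin x)) lee_fin.
have mf := measurable_funS measurableT (@subsetT _ I) (measurable_int _ fint).
have : ((C * (b - a))%:E <= \int[mu]_(x in I) f x)%E.
  rewrite [X in (X <= _)%E](_ : _ = \int[mu]_(x in I) (cst C%:E) x)%E; last first.
    transitivity (C%:E * mu I)%E; last by symmetry; exact: integral_cst.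
    by rewrite /I lebesgue_measure_itv/= lte_fin ab -EFinB -EFinM.
  by apply: ae_ge0_le_integral.
have nuI : nu I = (G0 b - G0 a)%:E.
  by rewrite /nu/= /mfrestr /mrestr setIid /I stieltjes_ocitv// ltW.
by rewrite -(fE _ mI) nuI lee_fin /G0; lra.
Unshelve. all: by end_near. Qed.
End lipschitz_mono.

(** * Sums and variation over the integers *)

Section integer_sums.
Context {R : realType}.
Implicit Types (f h u : int -> R) (j : int).

Definition zsum f : \bar R := \esum_(j in [set: int]) (f j)%:E.

Definition zvar u := zsum (fun j => `|u (j + 1) - u j|).

Definition znorm u := zsum (fun j => `|u j|).

Lemma zsum_ge0 f : (forall j, 0 <= f j) -> (0 <= zsum f)%E.
Proof. by move=> f0; apply: esum_ge0 => j _; rewrite lee_fin. Qed.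

Lemma le_zsum f h : (forall j, f j <= h j) -> (zsum f <= zsum h)%E.
Proof. by move=> fh; apply: le_esum => j _; rewrite lee_fin. Qed.

Lemma eq_zsum f h : f =1 h -> zsum f = zsum h.
Proof. by move=> fh; congr zsum; exact/funext. Qed.

Lemma zsumD f h : (forall j, 0 <= f j) -> (forall j, 0 <= h j) ->
  zsum (fun j => f j + h j) = (zsum f + zsum h)%E.
Proof.
by move=> f0 h0; rewrite -esumD => // *; rewrite lee_fin.
Qed.

Lemma zsum_sum (I : choiceType) (s : seq I) (F : I -> int -> R) :
  (forall i j, 0 <= F i j) ->
  zsum (fun j => \sum_(i <- s) F i j) = (\sum_(i <- s) zsum (F i))%E.
Proof.
move=> F0; rewrite /zsum -esum_sum; last by move=> *; rewrite lee_fin.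
by apply: eq_esum => j _; rewrite sumEFin.
Qed.

Lemma zsum_shift f (c : int) : zsum (fun j => f (j + c)) = zsum f.
Proof.
rewrite /zsum [RHS](@reindex_esum _ _ _ [set: int] _ (fun j => j + c))//.
split => //; first by move=> x y _ _; exact: addIr.
by move=> y _; exists (y - c) => //; rewrite subrK.
Qed.

Lemma sum_le_zsum f (s : seq int) : uniq s -> (forall j, 0 <= f j) ->
  ((\sum_(j <- s) f j)%:E <= zsum f)%E.
Proof.
move=> us f0; apply: esum_ge; exists [set` s].
  by split => //; exact: finite_seq.
by rewrite -fsbig_seq// sumEFin.
Qed.

(** A finite set of integers is contained in a symmetric interval. *)
Lemma zsum_le f (B : R) : (forall j, 0 <= f j) ->
  (forall n : nat, \sum_(0 <= i < n.*2) f (i%:Z - n%:Z) <= B) ->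
  (zsum f <= B%:E)%E.
Proof.
move=> f0 fB; apply: ge_ereal_sup => _ [X [fX _] <-].
have [n nX] : exists n : nat, forall x, X x -> (- n%:Z <= x < n%:Z)%R.
  have /finite_seqP[s Xs] := fX.
  exists (\max_(x <- s) (absz x).+1)%N => x; rewrite Xs /= => xs.
  have : ((absz x).+1 <= \max_(x <- s) (absz x).+1)%N by exact: leq_bigmax_seq.
  by move: (\max_(_ <- _) _)%N => m; lia.
pose s := [seq (i%:Z - n%:Z)%R | i <- index_iota 0 n.*2].
apply: (@le_trans _ _ (\sum_(x \in [set` s]) (f x)%:E)%E).
  apply: lee_fsum_nneg_subset => //; last by move=> x _; rewrite lee_fin.
  - exact: finite_seq.
  - move=> x /set_mem /nX xn; apply: mem_set => /=; rewrite /s; apply/mapP.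
    exists (absz (x + n%:Z)); last by lia.
    by rewrite mem_index_iota; lia.
rewrite -fsbig_seq; last first.
  by rewrite map_inj_uniq ?iota_uniq// => x y; lia.
by rewrite sumEFin lee_fin /s big_map.
Qed.

Lemma zsum_scale f (c B : R) : 0 <= c -> (forall j, 0 <= f j) ->
  (zsum f <= B%:E)%E -> (zsum (fun j => (c * f j)%R) <= (c * B)%:E)%E.
Proof.
move=> c0 f0 fB; apply: zsum_le => [j|n]; first exact: mulr_ge0.
rewrite -mulr_sumr ler_wpM2l// -lee_fin (le_trans _ fB)//.
rewrite -(big_map (fun i : nat => (i%:Z - n%:Z)%R) xpredT f).
by apply: sum_le_zsum => //; rewrite map_inj_uniq ?iota_uniq// => x y; lia.
Qed.

Lemma zsum_fin f (B : R) : (forall j, 0 <= f j) ->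
  (zsum f <= B%:E)%E -> zsum f \is a fin_num.
Proof.
by move=> f0 fB; rewrite ge0_fin_numE ?zsum_ge0// (le_lt_trans fB)// ltry.
Qed.

(** The partial sums telescope. *)
Lemma zsum_telescope (M : int -> R) (V : R) :
  (forall j, M j <= M (j + 1)) -> (forall j, 0 <= M j <= V) ->
  (zsum (fun j => (M (j + 1) - M j)%R) <= V%:E)%E.
Proof.
move=> Mnd MV; apply: zsum_le => [j|n]; first by rewrite subr_ge0.
have -> : \sum_(0 <= i < n.*2) (M (i%:Z - n%:Z + 1) - M (i%:Z - n%:Z)) =
   M (n.*2%:Z - n%:Z) - M (0%N%:Z - n%:Z).
  rewrite -(telescope_sumr (fun i : nat => M (i%:Z - n%:Z)))//.
  apply: eq_bigr => i _; congr (M _ - _); lia.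
have /andP[_ h1] := MV (n.*2%:Z - n%:Z); have /andP[h2 _] := MV (0%N%:Z - n%:Z).
lra.
Qed.

(** [M j] is the variation of [u] to the left of [j].  Increments of a monotone
    function are additive, which makes this form convenient for shifts that
    are not multiples of the grid size. *)
Lemma zvar_majorant u (V : R) :
  (zvar u <= V%:E)%E ->
  exists M : int -> R, [/\ forall j, 0 <= M j <= V,
    (forall i j, i <= j -> M i <= M j) &
    forall i j, i <= j -> `|u j - u i| <= M j - M i].
Proof.
move=> uV; pose d j := `|u (j + 1) - u j|.
pose c (j l : int) : R := if l < j then d l else 0.
have c0 j l : 0 <= c j l by rewrite /c; case: ifP => // _; exact: normr_ge0.
have cd j l : c j l <= d l by rewrite /c; case: ifP => _ //; rewrite /d.
have cV j : (zsum (c j) <= V%:E)%E by apply: le_trans uV; apply: le_zsum => l.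
have cf j : zsum (c j) \is a fin_num by apply: zsum_fin (cV j).
pose M j := fine (zsum (c j)).
have ME j : (M j)%:E = zsum (c j) by rewrite fineK.
have Mstep j : M j + d j <= M (j + 1).
  rewrite -lee_fin EFinD !ME.
  pose dl l : R := if l == j then d l else 0.
  have dl0 l : 0 <= dl l by rewrite /dl; case: ifP => // _; exact: normr_ge0.
  apply: (@le_trans _ _ (zsum (c j) + zsum dl)%E).
    apply: leeD => //; have := @sum_le_zsum dl [:: j] erefl dl0.
    by rewrite big_seq1 /dl eqxx.
  rewrite -zsumD//; apply: le_zsum => l; rewrite /c /dl.
  have [->|lj] := eqVneq l j; first by rewrite ltxx add0r ifT//; lia.
  by rewrite addr0; case: ifPn; case: ifPn => //; lia.
have key i (n : nat) : `|u (i + n%:Z) - u i| <= M (i + n%:Z) - M i.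
  elim: n => [|n IH]; first by rewrite addr0 !subrr normr0.
  have -> : i + n.+1%:Z = i + n%:Z + 1 by lia.
  have := Mstep (i + n%:Z); rewrite /d.
  have := ler_distD (u (i + n%:Z)) (u (i + n%:Z + 1)) (u i).
  by move: IH; lra.
have key' i j : i <= j -> `|u j - u i| <= M j - M i.
  by move=> ij; have := key i (absz (j - i)); rewrite (_ : i + _ = j)//; lia.
exists M; split => //.
- by move=> j; rewrite -!lee_fin ME cV zsum_ge0.
- by move=> i j /key' h; rewrite -subr_ge0 (le_trans _ h).
Qed.

(** A jump over [n] cells is a sum of [n] jumps over one cell. *)
Lemma zsum_jump u (V : R) (n : nat) :
  (zvar u <= V%:E)%E ->
  (zsum (fun j => `|u (j + n%:Z) - u j|)%R <= (n%:R * V)%:E)%E.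
Proof.
move=> uV; elim: n => [|n IH].
  rewrite mul0r; apply: zsum_le => // n; rewrite big1// => i _.
  by rewrite addr0 subrr normr0.
apply: (@le_trans _ _ (zsum (fun j => `|u (j + n%:Z + 1) - u (j + n%:Z)| + `|u (j + n%:Z) - u j|)%R)).
  apply: le_zsum => j; rewrite (_ : j + n.+1%:Z = j + n%:Z + 1); last by lia.
  exact: ler_distD.
rewrite zsumD// (zsum_shift (fun j => `|u (j + 1) - u j|)%R n%:Z).
by rewrite -(natr1 n) mulrDl mul1r addrC EFinD leeD.
Qed.

(** A summable sequence is small somewhere, and it varies by at most [V] from
    there.  If one value exceeded [V] by [e], all values to its right would
    be at least [e]. *)
Lemma norm_le_zvar u (V B : R) :
  (zvar u <= V%:E)%E ->
  (znorm u <= B%:E)%E ->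
  forall j, `|u j| <= V.
Proof.
move=> uV uB j; rewrite leNgt; apply/negP => Vu.
have e0 : 0 < `|u j| - V by rewrite subr_gt0.
set e := `|u j| - V in e0.
have [M [MV Mnd uM]] := zvar_majorant uV.
have ue (n : nat) : e <= `|u (j + n%:Z)|.
  have h : j <= j + n%:Z by lia.
  have := uM _ _ h; have /andP[_ h1] := MV (j + n%:Z); have /andP[h2 _] := MV j.
  have := lerB_normD (u j) (u (j + n%:Z) - u j); rewrite addrCA subrr addr0 /e; lra.
have [N NB] : exists N : nat, B < N%:R * e.
  exists (Num.trunc (B / e)).+1; rewrite -ltr_pdivrMr//; exact: Num.Theory.truncnS_gt.
have := @sum_le_zsum (fun j => `|u j|) [seq (j + i%:Z)%R | i <- index_iota 0 N].
rewrite map_inj_uniq ?iota_uniq; last by move=> x y; lia.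
move=> /(_ isT (fun _ => normr_ge0 _)) /le_trans /(_ uB).
rewrite lee_fin big_map; apply/negP; rewrite -ltNge (lt_le_trans NB)//.
rewrite -[X in X <= _](_ : \sum_(0 <= i < N) e = _); last first.
  by rewrite sumr_const_nat subn0 mulr_natl.
by apply: ler_sum => i _; exact: ue.
Qed.

End integer_sums.

(** * Total variation of one step of the scheme *)

Section tvd.
Context {R : realType}.
Implicit Types (u : int -> R) (j : int) (k : nat).

(** The incremental form of Harten: the increment of the numerical flux [G] is
    that of [u] with a nonnegative coefficient minus that of the translate of
    [u] by [s] with a nonnegative coefficient. *)
Definition incremental (C : R) (s : int) (p n G u : int -> R) :=
  [/\ forall j, 0 <= p j <= C, forall j, 0 <= n j <= C &
    forall j, G (j + 1) - G j =
      p j * (u (j + 1) - u j) - n (j + s) * (u (j + s + 1) - u (j + s))].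

Lemma incremental_zvar C s p n G u (V : R) : 0 <= C -> incremental C s p n G u ->
  (zvar u <= V%:E)%E -> (zvar G <= (C * V + C * V)%:E)%E.
Proof.
move=> C0 [pC nC GE] uV.
apply: (@le_trans _ _ (zsum (fun j => C * `|u (j + 1) - u j| + C * `|u (j + s + 1) - u (j + s)|)%R)).
  apply: le_zsum => j; rewrite GE (le_trans (ler_normB _ _))// !normrM.
  have /andP[p0 pc] := pC j; have /andP[n0 nc] := nC (j + s).
  by rewrite !(ger0_norm p0) !(ger0_norm n0) lerD// ler_wpM2r.
rewrite zsumD; [|by move=> j; rewrite mulr_ge0..].
rewrite (zsum_shift (fun j => C * `|u (j + 1) - u j|)%R s) EFinD.
by apply: leeD; apply: zsum_scale.
Qed.

Context (r : nat) (a : nat -> R) (s : nat -> nat) (C : R) (p n G : nat -> int -> R).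
Context (u u' : int -> R) (V : R).
Hypotheses (a0 : forall k, 0 <= a k) (C0 : 0 <= C).
Hypothesis Ginc : forall k, incremental C (s k)%:Z (p k) (n k) (G k) u.
Hypothesis u'E : forall j,
  u' j = u j - \sum_(0 <= k < r) a k * (G k j - G k (j - (s k)%:Z)).
Hypothesis uV : (zvar u <= V%:E)%E.

(** Each increment of [u] loses the fraction [c j] of its size, and what it
    loses is found again at other places.  Summed over the integers, the losses
    [A] and the gains [B] are equal by translation invariance; the remaining
    coefficient [1 - c j] is nonnegative when the [a k] are small. *)
Lemma step_zvar : C * 2 * (\sum_(0 <= k < r) a k) <= 1 -> (zvar u' <= V%:E)%E.
Proof.
move=> aC; pose D j := u (j + 1) - u j.
pose A j := \sum_(0 <= k < r) (a k * n k j * `|D j| + a k * p k j * `|D j|).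
pose B j := \sum_(0 <= k < r)
  (a k * n k (j + (s k)%:Z) * `|D (j + (s k)%:Z)| +
   a k * p k (j - (s k)%:Z) * `|D (j - (s k)%:Z)|).
have p0 k j : 0 <= p k j by have [/(_ j)/andP[]] := Ginc k.
have n0 k j : 0 <= n k j by have [_ /(_ j)/andP[]] := Ginc k.
have pC k j : p k j <= C by have [/(_ j)/andP[]] := Ginc k.
have nC k j : n k j <= C by have [_ /(_ j)/andP[]] := Ginc k.
have AB0 k (f : nat -> int -> R) i j : (forall k j, 0 <= f k j) ->
    0 <= a k * f k i * `|D j|.
  by move=> f0; rewrite !mulr_ge0.
have A0 j : 0 <= A j by apply: sumr_ge0 => k _; rewrite addr_ge0// AB0.
have B0 j : 0 <= B j by apply: sumr_ge0 => k _; rewrite addr_ge0// AB0.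
have AE : zsum B = zsum A.
  rewrite /A /B !zsum_sum; [|by move=> *; rewrite addr_ge0// AB0..].
  apply: eq_bigr => k _; rewrite !zsumD; [|by move=> *; rewrite AB0..].
  rewrite (zsum_shift (fun j => a k * n k j * `|D j|) (s k)%:Z).
  by rewrite (zsum_shift (fun j => a k * p k j * `|D j|) (- (s k)%:Z)).
pose c j := \sum_(0 <= k < r) (a k * n k j + a k * p k j).
have AcD j : A j = c j * `|D j|.
  by rewrite /A /c mulr_suml; apply: eq_bigr => k _; rewrite mulrDl.
have c1 j : c j <= 1.
  apply: le_trans aC; rewrite /c mulr_sumr; apply: ler_sum => k _.
  have := ler_wpM2l (a0 k) (pC k j); have := ler_wpM2l (a0 k) (nC k j); lra.
have D'E j : u' (j + 1) - u' j = (1 - c j) * D j + \sum_(0 <= k < r)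
  (a k * n k (j + (s k)%:Z) * D (j + (s k)%:Z) +
   a k * p k (j - (s k)%:Z) * D (j - (s k)%:Z)).
  rewrite !u'E mulrBl mul1r /c mulr_suml.
  transitivity (D j - (\sum_(0 <= k < r) a k * (G k (j + 1) - G k (j + 1 - (s k)%:Z)) -
     \sum_(0 <= k < r) a k * (G k j - G k (j - (s k)%:Z)))).
    by rewrite /D; ring.
  rewrite -!sumrB -[RHS]addrA; congr (_ + _); rewrite [RHS]addrC -sumrB -sumrN.
  apply: eq_bigr => k _; have [_ _ GE] := Ginc k.
  have e1 := GE j; have e2 := GE (j - (s k)%:Z).
  have h1 : j - (s k)%:Z + 1 = j + 1 - (s k)%:Z by ring.
  rewrite subrK h1 in e2.
  have -> : a k * (G k (j + 1) - G k (j + 1 - (s k)%:Z)) - a k * (G k j - G k (j - (s k)%:Z)) =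
    a k * ((G k (j + 1) - G k j) - (G k (j + 1 - (s k)%:Z) - G k (j - (s k)%:Z))) by ring.
  by rewrite e1 e2 /D h1; ring.
have main j : `|u' (j + 1) - u' j| + A j <= `|D j| + B j.
  rewrite D'E AcD.
  have := ler_normD ((1 - c j) * D j) (\sum_(0 <= k < r)
    (a k * n k (j + (s k)%:Z) * D (j + (s k)%:Z) +
     a k * p k (j - (s k)%:Z) * D (j - (s k)%:Z))).
  rewrite normrM (@ger0_norm _ (1 - c j)) ?subr_ge0//.
  suff : `|\sum_(0 <= k < r) (a k * n k (j + (s k)%:Z) * D (j + (s k)%:Z) +
     a k * p k (j - (s k)%:Z) * D (j - (s k)%:Z))| <= B j by lra.
  rewrite (le_trans (ler_norm_sum _ _ _))// ler_sum// => k _.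
  rewrite (le_trans (ler_normD _ _))// !normrM.
  by rewrite !(ger0_norm (a0 _)) !(ger0_norm (p0 _ _)) !(ger0_norm (n0 _ _)).
have AD : (zsum A <= zsum (fun j => `|D j|)%R)%E.
  by apply: le_zsum => j; rewrite AcD ler_piMl.
have Af : zsum A \is a fin_num by apply: (zsum_fin (B := V)) => //; apply: le_trans uV.
rewrite -(leeD2rE _ _ Af) -[X in (_ <= _ + X)%E]AE.
apply: (@le_trans _ _ (zvar u + zsum B)%E); last exact: leeD.
rewrite /zvar -!zsumD//; exact: le_zsum.
Qed.

Lemma step_znorm :
  (zsum (fun j => `|u' j - u j|)%R <=
   (2 * C * V * \sum_(0 <= k < r) a k * (s k)%:R)%:E)%E.
Proof.
apply: (@le_trans _ _ (zsum (fun j => \sum_(0 <= k < r) a k * `|G k j - G k (j - (s k)%:Z)|)%R)).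
  apply: le_zsum => j; rewrite u'E addrAC subrr add0r normrN.
  rewrite (le_trans (ler_norm_sum _ _ _))// ler_sum// => k _.
  by rewrite normrM (ger0_norm (a0 _)).
rewrite zsum_sum; last by move=> *; rewrite mulr_ge0.
rewrite mulr_sumr -sumEFin; apply: lee_sum => k _.
rewrite [X in (_ <= X%:E)%E](_ : _ = a k * ((s k)%:R * (C * V + C * V))); last by ring.
apply: zsum_scale => //.
rewrite -(zsum_shift _ (s k)%:Z) (eq_zsum (h := fun j => `|G k (j + (s k)%:Z) - G k j|)).
  by apply: zsum_jump; exact: incremental_zvar (Ginc k) uV.
by move=> j /=; rewrite addrK.
Qed.

End tvd.

Section scheme.
Context {R : realType}.
Variables (g : R -> R -> R) (C : R).
Hypothesis C0 : 0 <= C.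
Hypothesis gL : forall u1 u2 v1 v2, `|g u1 v1 - g u2 v2| <= C * (`|u1 - u2| + `|v1 - v2|).
Hypothesis gnd : forall v, {homo g ^~ v : x y / x <= y}.
Hypothesis gni : forall v x y, x <= y -> g v y <= g v x.

(** A difference quotient of a monotone Lipschitz function lies in [[0, C]]. *)
Lemma flux_incr1 v x y : exists2 th, 0 <= th <= C & g x v - g y v = th * (x - y).
Proof.
have [->|xy] := eqVneq x y; first by exists 0; rewrite ?lexx// !subrr mul0r.
have xy0 : x - y != 0 by rewrite subr_eq0.
exists ((g x v - g y v) / (x - y)); last by rewrite divfK.
apply/andP; split.
  have [h|h] := leP x y.
    by rewrite mulr_le0// ?invr_le0 subr_le0//; exact: gnd.
  by apply: divr_ge0; rewrite subr_ge0; [apply: gnd|]; exact: ltW.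
rewrite (le_trans (ler_norm _))// normrM normfV ler_pdivrMr ?normr_gt0//.
by rewrite (le_trans (gL _ _ _ _))// subrr normr0 addr0.
Qed.

Lemma flux_incr2 v x y : exists2 th, 0 <= th <= C & g v x - g v y = - (th * (x - y)).
Proof.
have [->|xy] := eqVneq x y; first by exists 0; rewrite ?lexx// !subrr mul0r oppr0.
have xy0 : x - y != 0 by rewrite subr_eq0.
exists ((g v y - g v x) / (x - y)); last by rewrite divfK// opprB.
apply/andP; split.
  have [h|h] := leP x y.
    by rewrite mulr_le0// ?invr_le0 subr_le0//; exact: gni.
  by apply: divr_ge0; rewrite subr_ge0; [apply: gni|]; exact: ltW.
rewrite (le_trans (ler_norm _))// normrM normfV ler_pdivrMr ?normr_gt0//.
by rewrite (le_trans (gL _ _ _ _))// subrr normr0 add0r distrC.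
Qed.

(** The term [k = 0] of the scheme couples a cell with its neighbours. *)
Definition stride (k : nat) : nat := if k is 0%N then 1%N else k.

Definition scheme_flux (s u : int -> R) (k : nat) (j : int) : R :=
  if k is 0 then g (recp u s j) (recm u s (j + 1)) else g (u j) (u (j + k%:Z)).

(** The bounds on the slopes say exactly that the reconstructed values move in
    the same direction as [u], at most twice as fast. *)
Lemma slope_ratio (s u : int -> R) : admissible_slopes u s ->
  forall j, exists2 th, 0 <= th <= 2 &
    recp u s (j + 1) - recp u s j = th * (u (j + 1) - u j) /\
    recm u s (j + 1) - recm u s j = (2 - th) * (u (j + 1) - u j).
Proof.
move=> us j; have := us j.
set d := u (j + 1) - u j; set e := s (j + 1) - s j => de.
have [d0|d0] := eqVneq d 0.
  exists 0; rewrite ?lexx ?ler0n//.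
  move: de; rewrite d0 normr0 mulr0 normr_le0 => /eqP; rewrite /recp /recm.
  by move: d0; rewrite /d /e; lra.
exists (1 + 2^-1 * (e / d)).
  have : `|e / d| <= 2 by rewrite normrM normfV ler_pdivrMr ?normr_gt0.
  by rewrite ler_norml; lra.
have ed : (2^-1 * (e / d)) * d = 2^-1 * e by rewrite -mulrA divfK.
move: ed; set t := 2^-1 * (e / d) => ed.
have -> : (1 + t) * d = d + t * d by ring.
have -> : (2 - (1 + t)) * d = d - t * d by ring.
by rewrite ed /recp /recm /d /e; split; field.
Qed.

Lemma scheme_flux_incremental (s u : int -> R) : admissible_slopes u s ->
  forall k, exists pn : (int -> R) * (int -> R),
   incremental (2 * C) (stride k)%:Z pn.1 pn.2 (scheme_flux s u k) u.
Proof.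
move=> us k.
suff H j : exists pn : R * R, [/\ 0 <= pn.1 <= 2 * C, 0 <= pn.2 <= 2 * C &
    scheme_flux s u k (j + 1) - scheme_flux s u k j =
      pn.1 * (u (j + 1) - u j) -
      pn.2 * (u (j + (stride k)%:Z + 1) - u (j + (stride k)%:Z))].
  have [pn pnP] := choice H.
  exists (fun j => (pn j).1, fun j => (pn (j - (stride k)%:Z)).2) => /=; split => j.
  - by have [] := pnP j.
  - by have [] := pnP (j - (stride k)%:Z).
  - by have [_ _ ->] := pnP j; rewrite addrK.
case: k => [|k] /=.
  have [t1 t1b [e1 _]] := slope_ratio us j.
  have [t2 t2b [_ e2]] := slope_ratio us (j + 1).
  have [h1 h1b g1] := flux_incr1 (recm u s (j + 1 + 1)) (recp u s (j + 1)) (recp u s j).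
  have [h2 h2b g2] := flux_incr2 (recp u s j) (recm u s (j + 1 + 1)) (recm u s (j + 1)).
  exists (t1 * h1, (2 - t2) * h2); split => /=.
  - case/andP: t1b => ? ?; case/andP: h1b => ? ?.
    by rewrite mulr_ge0//= ler_pM.
  - case/andP: t2b => ? ?; case/andP: h2b => ? ?.
    by rewrite mulr_ge0//= ?subr_ge0// ler_pM// ?subr_ge0//; lra.
  - move: g1 g2; rewrite e1 e2; lra.
have [h1 h1b g1] := flux_incr1 (u (j + 1 + k.+1%:Z)) (u (j + 1)) (u j).
have [h2 h2b g2] := flux_incr2 (u j) (u (j + 1 + k.+1%:Z)) (u (j + k.+1%:Z)).
exists (h1, h2) => /=; split; [by move: h1b C0; lra|by move: h2b C0; lra|].
have e : j + k.+1%:Z + 1 = j + 1 + k.+1%:Z by ring.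
rewrite e; move: g1 g2; lra.
Qed.

Lemma dt_scheme_op (delta dx dt : R) (w : R -> R) (s u : int -> R) j :
  dt * scheme_op delta w g dx s u j =
  \sum_(0 <= k < (Num.truncn (delta / dx)).+2)
    (dt * weight w dx k / ((stride k)%:R * dx)) *
    (scheme_flux s u k j - scheme_flux s u k (j - (stride k)%:Z)).
Proof.
rewrite /scheme_op [RHS]big_nat_recl// [LHS]mulrDr; congr (_ + _).
  rewrite /= mul1r subrK; ring.
rewrite big_add1 mulr_sumr; apply: eq_bigr => k _ /=.
by rewrite subrK; ring.
Qed.

End scheme.

(** * Quadrature weights *)

Section weights.
Context {R : realType}.
Local Notation mu := (@lebesgue_measure R).
Local Notation TR := (measurableTypeR R).
Variables (delta : R) (w : R -> R).
Hypothesis delta0 : 0 < delta.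
Hypothesis wK : nonlocal_kernel delta w.
Local Notation D := (`[0, delta]%classic : set TR).

Let mD : measurable D.
Proof. exact: measurable_itv. Qed.

Let wi : mu.-integrable setT (EFin \o w).
Proof. by case: wK. Qed.

Lemma kernel_ge0 h : 0 <= w h.
Proof. by case: wK. Qed.

Lemma kernel_integrable : mu.-integrable D (EFin \o w).
Proof. exact: integrableS wi. Qed.

Lemma kernel_out h : ~ D h -> w h = 0.
Proof.
move=> nD; apply/eqP; apply: contra_notT nD => wh.
by case: wK => _ _ + _; apply; apply: subset_closure.
Qed.

Lemma kernel_mass : \int[mu]_(h in D) w h = 1.
Proof. by case: wK. Qed.

Lemma kernel_mul_integrable (f : R -> R) (M : R) : measurable_fun D (f : TR -> R) ->
  (forall h, D h -> `|f h| <= M) -> mu.-integrable D (EFin \o (fun h => f h * w h)).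
Proof. by move=> mf fM; apply: integrable_mulM fM _ => //; exact: kernel_integrable. Qed.

Lemma measurable_hat dx k : measurable_fun [set: TR] (hat dx k : TR -> R).
Proof.
apply: measurable_maxr => //; apply: measurable_funB => //.
by apply: measurable_funM => //; apply: measurableT_comp => //; exact: measurable_funB.
Qed.

Lemma hat_ge0 dx k h : 0 <= hat dx k h :> R.
Proof. by rewrite /hat le_max lexx. Qed.

Lemma hat_le1 dx k h : 0 < dx -> hat dx k h <= 1 :> R.
Proof. by move=> dx0; rewrite /hat ge_max ler01/= gerBl divr_ge0// ltW. Qed.

Lemma hat_neq0 dx k h : 0 < dx -> hat dx k h != 0 :> R -> `|h - k%:R * dx| < dx.
Proof.
move=> dx0; rewrite /hat; apply: contraR; rewrite -leNgt => h1.
apply/eqP/max_idPl; rewrite subr_le0 ler_pdivlMr//; lra.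
Qed.

(** The cells of the definition of [weight] cover the support of the hat
    function up to grid points, a null set. *)
Lemma weightE dx k : 0 < dx -> weight w dx k = \int[mu]_(h in D) (hat dx k h * w h).
Proof.
move=> dx0; rewrite /weight Rintegral_mkcond [RHS]Rintegral_mkcond.
set E := if _ then _ else _.
have mE : measurable (E : set TR).
  by rewrite /E; case: ifP => _; [|apply: measurableU]; exact: measurable_itv.
have mhw : measurable_fun setT ((fun h => hat dx k h * w h) : TR -> R).
  apply: measurable_funM; first exact: measurable_hat.
  by apply/measurable_EFinP; exact: measurable_int wi.
apply: ae_eq_Rintegral => //.
- by apply/(measurable_restrictT _ mE); exact: measurable_funTS.
- by apply/(measurable_restrictT _ mD); exact: measurable_funTS.
exists ([set 0] `|` [set (k%:R - 1) * dx] `|` [set k%:R * dx] `|` [set (k%:R + 1) * dx]).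
split; first by do 3?apply: measurableU.
  by rewrite !measureU0//=; try (exact: lebesgue_measure_set1); do ?apply: measurableU.
move=> h /= /not_implyP[_]; rewrite !patchE; apply: contra_notP.
move=> /not_orP[/not_orP[/not_orP[h0 h1] h2] h3].
have [hE|hE] := boolP (h \in E); have [hD|hD] := boolP (h \in D) => //.
- by rewrite [w h]kernel_out ?mulr0//; move/negP: hD; rewrite inE.
- apply/esym; have [->|] := eqVneq (hat dx k h) 0; first by rewrite mul0r.
  move=> /(hat_neq0 dx0); rewrite ltr_norml => hk.
  exfalso; move/negP : hE; apply; apply/mem_set.
  move: hD; rewrite inE/= in_itv/= => /andP[hD _].
  have {}h0 : 0 < h by rewrite lt_neqAle hD andbT eq_sym; apply/eqP.
  have {}h2 : h != k%:R * dx by apply/eqP.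
  rewrite /E; case: ifPn => [/eqP k0|k0].
    by move: hk; rewrite k0 /I_/= in_itv/=; lra.
  have [hlt|hge] := ltP h (k%:R * dx); [left|right]; rewrite /I_/= in_itv/=.
    by move: hk; lra.
  have : k%:R * dx < h by rewrite lt_neqAle hge andbT eq_sym.
  by rewrite -(natr1 k); move: hk; lra.
Qed.

(** The hat functions form a partition of unity; the truncation keeps the two
    hats that do not vanish at [h], by the choice of the number of weights. *)
Lemma hat_sum dx h : 0 < dx -> D h ->
  \sum_(0 <= k < (Num.truncn (delta / dx)).+2) hat dx k h = 1.
Proof.
move=> dx0; rewrite /= in_itv/= => /andP[h0 hd].
pose i := Num.truncn (h / dx).
have hi : i%:R * dx <= h < i.+1%:R * dx.
  have := @Num.Theory.truncn_itv _ (h / dx); rewrite -/i (divr_ge0 h0 (ltW dx0)) => /(_ isT).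
  by rewrite ler_pdivlMr// ltr_pdivrMr.
have ir : (i <= Num.truncn (delta / dx))%N.
  rewrite Num.Theory.truncn_ge_nat; last by rewrite divr_ge0// ltW.
  by rewrite ler_pdivlMr// (le_trans _ hd)//; case/andP: hi.
have Z k : k != i -> k != i.+1 -> hat dx k h = 0.
  move=> ki ki1; apply/eqP; apply: contraTT isT => /(hat_neq0 dx0).
  rewrite ltr_norml => hk.
  have : (k < i)%N \/ (i.+1 < k)%N by move: ki ki1; lia.
  case=> [kk|kk].
    have : k.+1%:R <= i%:R :> R by rewrite ler_nat.
    by rewrite -(natr1 k) -(ler_pM2r dx0); move: hi hk; lra.
  have : i.+2%:R <= k%:R :> R by rewrite ler_nat.
  by rewrite -(natr1 i.+1) -(ler_pM2r dx0); move: hi hk; lra.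
move: ir; set N := Num.truncn (delta / dx) => ir.
have m1 : i \in index_iota 0 N.+2 by rewrite mem_index_iota/= ltnS leqW.
have m2 : i.+1 \in index_iota 0 N.+2 by rewrite mem_index_iota/= !ltnS.
have u1 : uniq (index_iota 0 N.+2) by rewrite iota_uniq.
move: (index_iota 0 N.+2) m1 m2 u1 => s m1 m2 u1.
rewrite (bigD1_seq i m1 u1)/= -big_filter.
have u2 : uniq [seq k <- s | k != i] by rewrite filter_uniq.
have m3 : i.+1 \in [seq k <- s | k != i].
  by rewrite mem_filter m2 andbT -addn1 -[X in _ != X]addn0 eqn_add2l.
rewrite (bigD1_seq i.+1 m3 u2)/= [X in _ + (_ + X)]big1_seq ?addr0; last first.
  by move=> k /andP[k1]; rewrite mem_filter => /andP[k2 _]; exact: Z.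
rewrite /hat ger0_norm ?subr_ge0; last by case/andP: hi.
rewrite ler0_norm; last by rewrite subr_le0 ltW//; case/andP: hi.
have -> : 1 - (h - i%:R * dx) / dx = i.+1%:R - h / dx.
  by rewrite -(natr1 i); field; rewrite gt_eqF.
have -> : 1 - - (h - i.+1%:R * dx) / dx = h / dx - i%:R.
  by rewrite -(natr1 i); field; rewrite gt_eqF.
rewrite !max_r ?subr_ge0; [rewrite -(natr1 i); ring| |].
  by rewrite ler_pdivlMr//; case/andP: hi.
by rewrite ler_pdivrMr//; case/andP: hi => _ /ltW.
Qed.

(** The values at [h <= 2 dx] are 1 so that [cutoff] also controls the terms with
    [k = 0] and [k = 1]. *)
Definition cutoff (dx h : R) : R := if h <= 2 * dx then 1 else 2 * dx / h.

Lemma cutoff_ge0 dx h : 0 < dx -> 0 <= h -> 0 <= cutoff dx h.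
Proof.
by move=> dx0 h0; rewrite /cutoff; case: ifP => // _; rewrite divr_ge0// mulr_ge0// ltW.
Qed.

Lemma cutoff_le1 dx h : 0 < dx -> cutoff dx h <= 1.
Proof.
move=> dx0; rewrite /cutoff; case: ifPn => //; rewrite -ltNge => h0.
by rewrite ler_pdivrMr ?mul1r ?ltW// (le_lt_trans _ h0)// mulr_ge0// ltW.
Qed.

Lemma le_cutoff dx h x : 0 < dx -> 0 <= x -> x <= 1 -> x * h <= 2 * dx ->
  x <= cutoff dx h.
Proof.
move=> dx0 x0 x1 xh; rewrite /cutoff; case: ifPn => //; rewrite -ltNge => h0.
by rewrite ler_pdivlMr// (le_lt_trans _ h0)// mulr_ge0// ltW.
Qed.

Lemma measurable_cutoff dx : measurable_fun D (cutoff dx : TR -> R).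
Proof.
apply: measurable_funTS; apply: measurable_fun_ifT => //=.
  exact: measurable_fun_ler.
by apply: measurable_funM => //; exact: measurable_inv.
Qed.

(** The size of the part of the kernel that the grid does not resolve. *)
Definition kmass (dx : R) : R := \int[mu]_(h in D) (cutoff dx h * w h).

Lemma kmass_arg dx h : 0 < dx -> D h -> 0 <= cutoff dx h <= 1.
Proof.
move=> dx0; rewrite /= in_itv/= => /andP[h0 _].
by rewrite cutoff_ge0// cutoff_le1.
Qed.

Lemma kmass_integrable dx : 0 < dx ->
  mu.-integrable D (EFin \o (fun h => cutoff dx h * w h)).
Proof.
move=> dx0; apply: (kernel_mul_integrable (M := 1)) => [|h Dh]; first exact: measurable_cutoff.
by have /andP[? ?] := kmass_arg dx0 Dh; rewrite ger0_norm.
Qed.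

(** By dominated convergence: [cutoff (dx m) h] tends to 0 except at [h = 0]. *)
Lemma kmass_cvg0 (dx : nat -> R) : (forall m, 0 < dx m) ->
  dx m @[m --> \oo] --> 0 -> kmass (dx m) @[m --> \oo] --> 0.
Proof.
move=> dx0 dxc.
have [|||||_] := @Rintegral_dominated_cvg _ _ _ mu D
  (fun m h => cutoff (dx m) h * w h) (cst 0) w _ _ _ kernel_integrable.
- exact: mD.
- move=> m; apply/measurable_EFinP; exact: measurable_int (kmass_integrable (dx0 m)).
- exact: measurable_cst.
- exists [set 0]; split => //; first exact: lebesgue_measure_set1.
  move=> h /= /not_implyP[]; rewrite in_itv/= => /andP[h0 hd]; apply: contra_notP => hn0.
  have {}h0 : 0 < h by rewrite lt_neqAle h0 andbT eq_sym; apply/eqP.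
  rewrite -[X in _ --> X](mul0r (w h)); apply: cvgM; last exact: cvg_cst.
  apply: (@squeeze_cvgr _ _ _ _ (cst 0) (fun m => 2 / h * dx m)).
  + apply: nearW => m; rewrite (cutoff_ge0 (dx0 m) (ltW h0))/= /cutoff; case: ifPn => hm.
      by rewrite mulrAC ler_pdivlMr// mul1r.
    by rewrite mulrAC.
  + exact: cvg_cst.
  + rewrite -[X in _ --> X](mulr0 (2 / h)); apply: cvgM => //; exact: cvg_cst.
- move=> m h Dh; have /andP[? ?] := kmass_arg (dx0 m) Dh.
  by rewrite normrM ger0_norm// (ger0_norm (kernel_ge0 h)) ler_piMl// kernel_ge0.
- rewrite Rintegral_cst//= mul0r; exact.
Qed.

Lemma weight_ge0 dx k : 0 < dx -> 0 <= weight w dx k.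
Proof.
move=> dx0; rewrite weightE//; apply: Rintegral_ge0 => h _.
by rewrite mulr_ge0 ?hat_ge0 ?kernel_ge0.
Qed.

Lemma hatw_integrable dx k : 0 < dx ->
  mu.-integrable D (EFin \o (fun h => hat dx k h * w h)).
Proof.
move=> dx0; apply: (kernel_mul_integrable (M := 1)).
  by apply: measurable_funTS; exact: measurable_hat.
by move=> h _; rewrite ger0_norm ?hat_ge0 ?hat_le1.
Qed.

Lemma weighted_sumE dx (J : nat -> R) n : 0 < dx ->
  mu.-integrable D (EFin \o (fun h => (\sum_(0 <= k < n) J k * hat dx k h) * w h)) /\
  \sum_(0 <= k < n) J k * weight w dx k =
  \int[mu]_(h in D) ((\sum_(0 <= k < n) J k * hat dx k h) * w h).
Proof.
move=> dx0.
have iJ k : mu.-integrable D (EFin \o (fun h => J k * (hat dx k h * w h))).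
  have := integrableZl mD (J k) (hatw_integrable k dx0).
  by apply: eq_integrable => // h _.
have E : (fun h => (\sum_(0 <= k < n) J k * hat dx k h) * w h) =
         (fun h => \sum_(0 <= k < n) J k * (hat dx k h * w h)).
  by apply/funext => h; rewrite mulr_suml; apply: eq_bigr => k _; rewrite mulrA.
split.
  rewrite E.
  have := integrable_sum mD (index_iota 0 n) (P := xpredT) (fun i _ => iJ i).
  by apply: eq_integrable => // x _ /=; rewrite sumEFin.
rewrite E Rintegral_sum//; apply: eq_bigr => k _.
by rewrite weightE// RintegralZl//; exact: hatw_integrable.
Qed.

(** The weights integrate the piecewise linear interpolation of the values [J],
    so only the differences between [Jf] and [J] at neighbouring points matter;
    they may be of order [dx / h]. *)
Lemma quadrature_error dx (J : nat -> R) (Jf : R -> R) (c e : R) : 0 < dx ->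
  0 <= c -> 0 <= e -> measurable_fun D (Jf : TR -> R) ->
  (forall k h, D h -> `|h - k%:R * dx| < dx ->
     `|J k - Jf h| <= c * cutoff dx h + e) ->
  mu.-integrable D (EFin \o (fun h => Jf h * w h)) ->
  `|\sum_(0 <= k < (Num.truncn (delta / dx)).+2) J k * weight w dx k -
    \int[mu]_(h in D) (Jf h * w h)| <= c * kmass dx + e.
Proof.
move=> dx0 c0 e0 mJ JJ iJ.
set n := _.+2.
have [iS ->] := weighted_sumE J n dx0.
have i1 := kmass_integrable dx0.
have ic : mu.-integrable D (EFin \o (fun h => c * (cutoff dx h * w h))).
  have := integrableZl mD c i1.
  by apply: eq_integrable => // h _.
have ie : mu.-integrable D (EFin \o (fun h => e * w h)).
  have := integrableZl mD e kernel_integrable.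
  by apply: eq_integrable => // h _.
have ice : mu.-integrable D (EFin \o (fun h => c * (cutoff dx h * w h) + e * w h)).
  have := integrableD mD ic ie.
  by apply: eq_integrable => // h _.
rewrite -RintegralB//.
have -> : c * kmass dx + e = \int[mu]_(h in D) (c * (cutoff dx h * w h) + e * w h).
  by rewrite RintegralD// !RintegralZl// ?kernel_mass ?mulr1//; exact: kernel_integrable.
apply: le_norm_Rintegral => //.
  by apply: measurable_funB; apply/measurable_EFinP; [exact: measurable_int iS|exact: measurable_int iJ].
move=> h Dh.
rewrite -mulrBl normrM (ger0_norm (kernel_ge0 h)) mulrA -mulrDl ler_wpM2r ?kernel_ge0//.
rewrite -[Jf h]mulr1 -(hat_sum dx0 Dh) mulr_sumr -sumrB.
rewrite (le_trans (ler_norm_sum _ _ _))//.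
apply: (@le_trans _ _ (\sum_(0 <= k < n) (c * cutoff dx h + e) * hat dx k h)).
  apply: ler_sum => k _; rewrite -mulrBl normrM (ger0_norm (hat_ge0 _ _ _)).
  have [->|h0] := eqVneq (hat dx k h) 0; first by rewrite !mulr0.
  by rewrite ler_wpM2r ?hat_ge0// JJ//; exact: hat_neq0.
by rewrite -mulr_sumr hat_sum// mulr1.
Qed.

Lemma weight_sum dx : 0 < dx ->
  \sum_(0 <= k < (Num.truncn (delta / dx)).+2) weight w dx k = 1.
Proof.
move=> dx0; under eq_bigr do rewrite -[weight _ _ _]mul1r.
have [_ ->] := weighted_sumE (fun=> 1) (Num.truncn (delta / dx)).+2 dx0.
rewrite -[RHS]kernel_mass; apply: eq_Rintegral => h /set_mem Dh.
by rewrite -[RHS]mul1r -[in RHS](hat_sum dx0 Dh); congr (_ * _); apply: eq_bigr => k _; rewrite mul1r.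
Qed.

Lemma stride_gt0 k : 0 < (stride k)%:R :> R.
Proof. by case: k. Qed.

(** The quadrature estimate with [J k = 1 / k] and [Jf = 0], since [1 / k] is of
    order [dx / h] on the support of the hat function. *)
Lemma weight_stride_sum dx : 0 < dx ->
  \sum_(0 <= k < (Num.truncn (delta / dx)).+2) weight w dx k / (stride k)%:R <= kmass dx.
Proof.
move=> dx0; have := @quadrature_error dx (fun k => (stride k)%:R^-1) (cst 0) 1 0 dx0 ler01 (lexx 0).
rewrite mul1r addr0 (_ : (fun h => cst 0 h * w h) = cst 0); last first.
  by apply/funext => h; rewrite /= mul0r.
rewrite Rintegral_cst//= mul0r subr0 => H.
rewrite (le_trans _ (H _ _ _))//.
- rewrite (le_trans _ (ler_norm _))// le_eqVlt; apply/orP; left; apply/eqP.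
  by apply: eq_bigr => k _; rewrite mulrC.
- move=> k h; rewrite in_itv/= => /andP[h0 _]; rewrite ltr_norml subr0 mul1r addr0 => hk.
  rewrite ger0_norm ?invr_ge0//; apply: le_cutoff => //.
    by rewrite invf_le1 ?stride_gt0// ler1n; case: (k).
  rewrite mulrC ler_pdivrMr ?stride_gt0//.
  case: k hk => [|k] /= hk; first by rewrite mulr1; lra.
  have : 1 <= k.+1%:R :> R by rewrite ler1n.
  rewrite -(ler_pM2r dx0); lra.
- exact: integrable0.
Qed.

End weights.

(** * Step functions on a grid *)

Section countable_range.
Lemma measurable_countable_range d d' (T : measurableType d) (T' : measurableType d')
  (I : countType) (i : T -> I) (F : I -> T') :
  (forall c, measurable (i @^-1` [set c])) -> measurable_fun setT (F \o i).
Proof.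
move=> mi _ Y mY; rewrite setTI.
pose A n := if unpickle n is Some c then
  (if asbool (Y (F c)) then i @^-1` [set c] else set0) else set0.
rewrite (_ : _ @^-1` _ = \bigcup_n A n).
  apply: bigcup_measurable => n _; rewrite /A; case: unpickle => // c.
  by case: ifP.
apply/seteqP; split => [x /= Yx|x [n _]]; rewrite /A.
  exists (pickle (i x)) => //=; rewrite pickleK ifT//; exact/asboolP.
by case: unpickle => // c; case: ifPn => // /asboolP Yc /= ic; rewrite /preimage/= ic.
Qed.
End countable_range.

Section cells.
Context {R : realType}.
Local Notation mu := (@lebesgue_measure R).
Local Notation TR := (measurableTypeR R).
Implicit Types (dx dt x : R) (j : int).

(** The index of the cell that contains [x]. *)
Definition idx dx x : int := Num.floor (x / dx + 2^-1).
Definition cell_lo dx j : R := (j%:~R - 2^-1) * dx.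

Lemma cell_loS dx j : cell_lo dx (j + 1) = cell_lo dx j + dx.
Proof. by rewrite /cell_lo intrD; ring. Qed.

Lemma idxP dx x j : 0 < dx -> (idx dx x == j) = (cell_lo dx j <= x < cell_lo dx (j + 1)).
Proof.
move=> dx0; rewrite /idx /cell_lo floor_eq -lerBlDr -ltrBrDr.
by rewrite ler_pdivlMr// ltr_pdivrMr// intrD.
Qed.

Lemma idx_itv dx x : 0 < dx -> cell_lo dx (idx dx x) <= x < cell_lo dx (idx dx x) + dx.
Proof. by move=> dx0; rewrite -cell_loS -idxP. Qed.

Lemma idx_shift dx x (k : int) : 0 < dx -> idx dx (x + k%:~R * dx) = idx dx x + k.
Proof.
move=> dx0; apply/eqP; rewrite idxP// !cell_loS.
have := idx_itv x dx0; rewrite /cell_lo intrD; lra.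
Qed.

Lemma idx_le dx : 0 < dx -> {homo idx dx : x y / x <= y >-> (x <= y)%R}.
Proof.
by move=> dx0 x y xy; apply: le_floor; rewrite lerD2r ler_pM2r// invr_gt0.
Qed.

Lemma preimage_idx dx j : 0 < dx ->
  idx dx @^-1` [set j] = `[cell_lo dx j, cell_lo dx j + dx[%classic.
Proof.
move=> dx0; apply/seteqP; split => x /=; rewrite in_itv/=.
  by move=> <-; exact: idx_itv.
by rewrite -cell_loS -idxP// => /eqP.
Qed.

Lemma measurable_idx dx j : 0 < dx -> measurable (idx dx @^-1` [set j] : set TR).
Proof. by move=> dx0; rewrite preimage_idx//; exact: measurable_itv. Qed.

Lemma measurable_step d (T : measurableType d) dx (F : int -> T) : 0 < dx ->
  measurable_fun [set: TR] (fun x : TR => F (idx dx x)).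
Proof.
by move=> dx0; apply: (measurable_countable_range (i := idx dx)) => j; exact: measurable_idx.
Qed.

Definition tidx dt (t : R) : nat := Num.truncn (t / dt).

Lemma tidx_itv dt t : 0 < dt -> 0 <= t -> (tidx dt t)%:R * dt <= t < (tidx dt t).+1%:R * dt.
Proof.
move=> dt0 t0; have := Num.Theory.truncn_itv (divr_ge0 t0 (ltW dt0)).
by rewrite -/(tidx dt t) ler_pdivlMr// ltr_pdivrMr.
Qed.

Lemma tidx_shift dt t : 0 < dt -> 0 <= t -> tidx dt (t + dt) = (tidx dt t).+1.
Proof.
move=> dt0 t0; apply/eqP; rewrite /tidx Num.Theory.truncn_eq; last first.
  by rewrite divr_ge0 ?addr_ge0// ltW.
have := tidx_itv dt0 t0; rewrite ler_pdivlMr// ltr_pdivrMr//.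
by rewrite -!(natr1 (tidx dt t).+1) -(natr1 (tidx dt t)) !mulrDl !mul1r lerD2r ltrD2r.
Qed.

Lemma tidx0 dt t : 0 < dt -> t < dt -> tidx dt t = 0%N.
Proof.
move=> dt0 t1; have [t0|t0] := leP 0 t.
  have h0 := divr_ge0 t0 (ltW dt0).
  by apply/eqP; rewrite /tidx Num.Theory.truncn_eq// h0/= ltr_pdivrMr// mul1r.
by rewrite /tidx; apply/Num.Theory.truncn0Pn; rewrite -ltNge (lt_trans _ ltr01)// pmulr_llt0 ?invr_gt0.
Qed.

Lemma tidx_diff dt s t : 0 < dt -> 0 <= s <= t ->
  (tidx dt s <= tidx dt t)%N /\ ((tidx dt t)%:R - (tidx dt s)%:R) * dt <= t - s + dt.
Proof.
move=> dt0 /andP[s0 st]; have t0 := le_trans s0 st.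
split.
  by rewrite /tidx Num.Theory.truncn_ge_nat ?divr_ge0 ?(ltW dt0)// ler_pdivlMr// (le_trans _ st)//; case/andP: (tidx_itv dt0 s0).
have := tidx_itv dt0 s0; have := tidx_itv dt0 t0; rewrite -natr1 -(natr1 (tidx dt s)); lra.
Qed.

Lemma measurable_tidx dt n : 0 < dt -> measurable (tidx dt @^-1` [set n] : set TR).
Proof.
move=> dt0; case: n => [|n].
  rewrite (_ : _ @^-1` _ = `]-oo, dt[%classic); first exact: measurable_itv.
  apply/seteqP; split => t /=; rewrite in_itv/=; last exact: tidx0.
  have [t0|t0] := leP 0 t; last by move=> _; exact: lt_trans t0 dt0.
  by have := tidx_itv dt0 t0 => /[swap] ->; rewrite mul1r => /andP[].
rewrite (_ : _ @^-1` _ = `[n.+1%:R * dt, n.+2%:R * dt[%classic); first exact: measurable_itv.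
apply/seteqP; split => t /=; rewrite in_itv/=.
  have [t0|t0] := leP 0 t; last by rewrite tidx0// (lt_trans t0).
  by move=> <-; exact: tidx_itv.
move=> h; apply/eqP; rewrite /tidx Num.Theory.truncn_eq; last first.
  by rewrite divr_ge0 ?(ltW dt0)//; case/andP: h => h _; rewrite (le_trans _ h)// mulr_ge0// ltW.
by rewrite ler_pdivlMr// ltr_pdivrMr.
Qed.

Lemma piecewise_constantE dx dt (U : nat -> int -> R) x t :
  piecewise_constant dx dt U x t = U (tidx dt t) (idx dx x).
Proof. by []. Qed.

Lemma measurable_piecewise_constant dx dt (U : nat -> int -> R) : 0 < dx -> 0 < dt ->
  measurable_fun [set: TR * TR] (fun z : TR * TR => piecewise_constant dx dt U z.1 z.2 : R).
Proof.
move=> dx0 dt0.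
pose i (z : TR * TR) : nat * int := (tidx dt z.2, idx dx z.1).
apply: (measurable_countable_range (fun c => U c.1 c.2 : R) (i := i)) => -[n j].
rewrite (_ : _ @^-1` _ = (idx dx @^-1` [set j]) `*` (tidx dt @^-1` [set n])).
  by apply: measurableX; [exact: measurable_idx|exact: measurable_tidx].
by apply/seteqP; split => -[x t] /=; rewrite /i/=; [case=> -> ->|case=> -> ->].
Qed.

Definition nat_int (n : nat) : int := if odd n then Negz n./2 else Posz n./2.

Lemma nat_int_bij : set_bij [set: nat] [set: int] nat_int.
Proof.
split => //.
  move=> m n _ _; rewrite /nat_int.
  have := odd_double_half m; have := odd_double_half n.
  by case: ifP => om; case: ifP => on // en em [h]; move: em; rewrite h => em; exact: etrans (esym em) en.
move=> [n|n] _ /=; rewrite /nat_int.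
  by exists n.*2 => //; rewrite odd_double doubleK.
by exists n.*2.+1 => //=; rewrite odd_double/= uphalf_double.
Qed.

(** The cells are numbered by the bijection [nat_int] to apply countable
    additivity. *)
Lemma integral_step dx (F : int -> R) : 0 < dx -> (forall j, 0 <= F j) ->
  (\int[mu]_x (F (idx dx x))%:E = dx%:E * zsum F)%E.
Proof.
move=> dx0 F0.
pose A n : set TR := idx dx @^-1` [set nat_int n].
have UA : \bigcup_n A n = setT.
  apply/seteqP; split => // x _.
  have [_ _ /(_ (idx dx x) I)[n _ h]] := nat_int_bij.
  by exists n.
have tA : trivIset setT A.
  apply/trivIsetP => m n _ _ mn; apply/seteqP; split => // x [/= e1 e2].
  have [_ inj _] := nat_int_bij.
  by move/eqP: mn; apply; apply: inj; rewrite ?inE// -e1.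
have mA n : measurable (A n) by exact: measurable_idx.
have mF : measurable_fun [set: TR] (fun x : TR => (F (idx dx x))%:E).
  exact: (measurable_step (fun j => (F j)%:E) dx0).
rewrite -UA ge0_integral_bigcup//; last 2 first.
  by rewrite UA.
  by move=> x _; rewrite lee_fin.
rewrite (eq_eseriesr (g := fun n => (dx%:E * (F (nat_int n))%:E)%E)); last first.
  move=> n _; rewrite (eq_integral (cst (F (nat_int n))%:E)); last first.
    by move=> x; rewrite inE/= => ->.
  rewrite integral_cst// muleC; congr (_ * _)%E.
  transitivity (mu `[cell_lo dx (nat_int n), cell_lo dx (nat_int n) + dx[%classic).
    by congr (_ _); rewrite /A preimage_idx.
  rewrite lebesgue_measure_itv/= lte_fin ltrDl dx0 -EFinB; congr EFin; ring.
rewrite nneseriesZl//; last by move=> n _; rewrite lee_fin.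
congr (_ * _)%E; rewrite nneseries_esumT; last by move=> n; rewrite lee_fin.
by rewrite /zsum [RHS](@reindex_esum _ _ _ [set: nat] _ nat_int)//; exact: nat_int_bij.
Qed.

End cells.

(** * Bounded variation on the line *)

Section majorants.
Context {R : realType}.
Local Notation mu := (@lebesgue_measure R).
Local Notation TR := (measurableTypeR R).

(** Bounded variation in a form that survives translations and passes to
    pointwise limits without a supremum over partitions. *)
Definition majorant (V : R) (p v : R -> R) :=
  [/\ {homo v : x y / x <= y}, forall x, 0 <= v x <= V &
      forall x y, x <= y -> `|p y - p x| <= v y - v x].

Lemma majorant_step dx (u : int -> R) (V : R) : 0 < dx -> (zvar u <= V%:E)%E ->
  exists v, majorant V (fun x => u (idx dx x)) v.
Proof.
move=> dx0 /zvar_majorant[M [MV Mnd uM]].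
exists (fun x => M (idx dx x)); split => [x y xy|x|x y xy].
- by apply: Mnd; exact: idx_le.
- exact: MV.
- by apply: uM; exact: idx_le.
Qed.

(** On the grid of size [h] the points [x - h] and [x + h] lie at most one cell
    away from the cell of [x], so that three telescoping sums bound the
    integral. *)
Lemma majorant_integral (v : R -> R) (V h : R) (f : TR -> R) : 0 < h ->
  {homo v : x y / x <= y} -> (forall x, 0 <= v x <= V) ->
  measurable_fun [set: TR] f -> (forall x, `|f x| <= v (x + h) - v (x - h)) ->
  (\int[mu]_x `|f x|%:E <= (h * (3 * V))%:E)%E.
Proof.
move=> h0 vnd vV mf fv.
pose M j := v (cell_lo h j).
have Mnd j : M j <= M (j + 1) by apply: vnd; rewrite cell_loS lerDl ltW.
pose F j := (M (j + 1) - M j) + ((M (j - 1 + 1) - M (j - 1)) + (M (j + 1 + 1) - M (j + 1))).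
have F0 j : 0 <= F j by rewrite /F; apply: addr_ge0; [|apply: addr_ge0]; rewrite subr_ge0.
apply: (@le_trans _ _ (\int[mu]_x (F (idx h x))%:E)%E).
  apply: ge0_le_integral => //.
  - by apply/measurable_EFinP; exact: measurableT_comp.
  - exact: (measurable_step (fun j => (F j)%:E) h0).
  - move=> x _; rewrite lee_fin (le_trans (fv x))//.
    have /andP[x1 x2] := idx_itv x h0.
    have : v (x + h) <= M (idx h x + 1 + 1).
      by apply: vnd; rewrite !cell_loS lerD2r ltW.
    have : M (idx h x - 1) <= v (x - h).
      apply: vnd; rewrite lerBrDr -cell_loS subrK//.
    by rewrite /F subrK; lra.
rewrite integral_step//.
have Z c : (zsum (fun j => M (j + c + 1) - M (j + c))%R <= V%:E)%E.
  rewrite (zsum_shift (fun j => M (j + 1) - M j) c).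
  by apply: zsum_telescope => // j; exact: vV.
rewrite EFinM lee_pmul2l//.
rewrite /F zsumD; [|by move=> j; rewrite subr_ge0|by move=> j; apply: addr_ge0; rewrite subr_ge0].
rewrite [X in (_ + X)%E]zsumD; [|by move=> j; rewrite subr_ge0..].
have -> : 3 * V = V + (V + V) by ring.
rewrite !EFinD; apply: leeD; first by have := Z 0; under eq_zsum do rewrite addr0.
by apply: leeD; [exact: Z|exact: Z].
Qed.

Lemma majorant_shift (V h : R) (p v : R -> R) x y : majorant V p v ->
  `|y - x| <= h -> `|p y - p x| <= v (x + h) - v (x - h).
Proof.
move=> [vnd vV pv]; rewrite ler_norml => /andP[h1 h2].
have [xy|yx] := leP x y.
  rewrite (le_trans (pv _ _ xy))//; apply: lerB; apply: vnd; lra.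
rewrite distrC (le_trans (pv _ _ (ltW yx)))//; apply: lerB; apply: vnd; lra.
Qed.

End majorants.

(** * Initial data *)

Section initial_data.
Context {R : realType}.
Local Notation mu := (@lebesgue_measure R).
Local Notation TR := (measurableTypeR R).
Variable u0 : R -> R.

(** The majorant at [x] is the variation on the half-line up to [x]. *)
Lemma TV_line_majorant (v : R -> R) : (TV_line v < +oo)%E ->
  exists2 V : R, 0 <= V & exists m, majorant V v m.
Proof.
move=> vV.
have TV0 : (0 <= TV_line v)%E.
  apply: ereal_sup_ubound; exists (0, 0); first by rewrite /= lexx.
  by rewrite /= total_variationxx.
have TVf : TV_line v \is a fin_num by rewrite ge0_fin_numE.
have le_TV a b : a <= b -> (total_variation a b v <= TV_line v)%E.
  by move=> ab; apply: ereal_sup_ubound; exists (a, b).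
pose me x := ereal_sup [set total_variation a x v | a in [set a | a <= x]].
have me0 x : (0 <= me x)%E.
  by apply: ereal_sup_ubound; exists x; rewrite /= ?lexx// total_variationxx.
have meV x : (me x <= TV_line v)%E.
  by apply: ge_ereal_sup => _ [a ax <-]; exact: le_TV.
have mef x : me x \is a fin_num by rewrite ge0_fin_numE// (le_lt_trans (meV x)).
have mD x y : x <= y -> (me x + `|v y - v x|%:E <= me y)%E.
  move=> xy; rewrite -leeBrDr//; apply: ge_ereal_sup => _ [a ax <-].
  rewrite leeBrDr//; apply: (@le_trans _ _ (total_variation a y v)).
    by rewrite (total_variationD v ax xy) leeD2l// total_variation_ge.
  by apply: ereal_sup_ubound; exists a => //=; exact: le_trans xy.
have mD' x y : x <= y -> `|v y - v x| <= fine (me y) - fine (me x).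
  by move=> xy; rewrite lerBrDl -lee_fin EFinD !fineK// mD.
exists (fine (TV_line v)); first by rewrite fine_ge0.
exists (fun x => fine (me x)); split => // [x y xy|x].
- by rewrite -subr_ge0 (le_trans _ (mD' _ _ xy)).
- by rewrite fine_ge0//= fine_le.
Qed.

Definition cell_avg (dx : R) (j : int) : R := dx^-1 * \int[mu]_(x in cell dx j) u0 x.

(** On a cell, [u0] and its average differ from the value of the representative
    of bounded variation at the left end of the cell by at most the increment
    of the majorant over the cell; these increments telescope. *)
Lemma cell_avg_bounds : L1_BV u0 -> exists2 V : R, 0 <= V &
  forall dx, 0 < dx -> [/\ (zvar (cell_avg dx) <= V%:E)%E,
    (\int[mu]_x `|cell_avg dx (idx dx x) - u0 x|%:E <= (dx * V)%:E)%E &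
    exists B : R, (znorm (cell_avg dx) <= B%:E)%E].
Proof.
case=> iu0 [v u0v /TV_line_majorant[V V0 [m [mnd mV vm]]]].
exists (V + (V + V)); first by rewrite !addr_ge0.
move=> dx dx0.
have mu0 : measurable_fun [set: TR] (u0 : TR -> R).
  by apply/measurable_EFinP; exact: measurable_int iu0.
pose M j := m (cell_lo dx j).
have Mnd j : M j <= M (j + 1) by apply: mnd; rewrite cell_loS lerDl ltW.
have celE j : cell dx j = `]cell_lo dx j, cell_lo dx (j + 1)[%classic.
  rewrite /cell /cell_lo intrD (_ : j%:~R + 1%:~R - 2^-1 = j%:~R + 2^-1 :> R)//.
    by rewrite -[1%:~R]/(1 : R); field.
have vcell j x : cell_lo dx j <= x <= cell_lo dx (j + 1) ->
    `|v x - v (cell_lo dx j)| <= M (j + 1) - M j.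
  move=> /andP[x1 x2]; rewrite (le_trans (vm _ _ x1))// lerB//.
  exact: mnd.
have mcell j : measurable (cell dx j : set TR) by exact: measurable_itv.
have mucell j : mu (cell dx j) = dx%:E.
  by rewrite celE cell_loS lebesgue_measure_itv/= lte_fin ltrDl dx0 -EFinB; congr EFin; ring.
have fcell j : (mu (cell dx j) < +oo)%E by rewrite mucell ltry.
have icst j (c : R) : mu.-integrable (cell dx j) (EFin \o cst c).
  exact: (integrable_bounded (mcell j) (fcell j) (measurable_cst c) (fun x _ => lexx `|c|)).
have avgE j (c : R) : \int[mu]_(x in cell dx j) c = c * dx.
  rewrite (Rintegral_cst mu (mcell j)).
  by rewrite -[in RHS](_ : fine (mu (cell dx j)) = dx)// mucell.
have iuc j (c : R) : mu.-integrable (cell dx j) (EFin \o (fun x => u0 x - c)).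
  have := integrableB (mcell j) (integrableS measurableT (mcell j) (@subsetT _ _) iu0) (icst j c).
  by apply: eq_integrable => // x _.
(* averaging the oscillation of [u0] around one value *)
have avg j : `|cell_avg dx j - v (cell_lo dx j)| <= M (j + 1) - M j.
  have -> : cell_avg dx j - v (cell_lo dx j) =
     dx^-1 * \int[mu]_(x in cell dx j) (u0 x - v (cell_lo dx j)).
    rewrite RintegralB//; last 2 first.
      exact: integrableS iu0.
      exact: icst.
    by rewrite avgE /cell_avg mulrBr; congr (_ - _); field; rewrite gt_eqF.
  rewrite normrM ger0_norm ?invr_ge0 ?(ltW dx0)// ler_pdivrMl//.
  rewrite -lee_fin (EFin_normr_Rintegral (mcell j) (iuc j _)).
  apply: (le_trans (le_abse_integral mu (mcell j) (measurable_int _ (iuc j _)))).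
  rewrite EFinM muleC [X in (_ <= _ * X)%E](_ : _ = mu (cell dx j)); last by rewrite mucell.
  apply: integral_le_bound => //.
  - exact: measurable_int (iuc j _).
  - by rewrite lee_fin subr_ge0.
  - have := u0v; apply: (@filterS _ _ (ae_filter_ringOfSetsType mu)) => x /= -> /=.
    rewrite celE/= in_itv/= => /andP[x1 x2].
    by rewrite lee_fin vcell// !ltW.
have Z c : (zsum (fun j => M (j + c + 1) - M (j + c))%R <= V%:E)%E.
  rewrite (zsum_shift (fun j => M (j + 1) - M j) c).
  by apply: zsum_telescope => // j; exact: mV.
have Z0 : (zsum (fun j => M (j + 1) - M j)%R <= V%:E)%E.
  by apply: zsum_telescope => // j; exact: mV.
have I : (\int[mu]_x `|cell_avg dx (idx dx x) - u0 x|%:E <= (dx * (V + (V + V)))%:E)%E.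
  pose F j := (M (j + 1) - M j) + (M (j + 1) - M j).
  have F0 j : 0 <= F j by rewrite /F addr_ge0// subr_ge0.
  apply: (@le_trans _ _ (\int[mu]_x (F (idx dx x))%:E)%E).
    apply: ae_ge0_le_integral => //.
    - apply/measurable_EFinP; apply: measurableT_comp => //.
      by apply: measurable_funB => //; exact: measurable_step.
    - by move=> x _; rewrite lee_fin.
    - exact: (measurable_step (fun j => (F j)%:E) dx0).
    - have := u0v; apply: (@filterS _ _ (ae_filter_ringOfSetsType mu)) => x /= -> _; rewrite lee_fin.
      have /andP[x1 x2] := idx_itv x dx0.
      rewrite (le_trans (ler_distD (v (cell_lo dx (idx dx x))) _ _))// lerD//.
      by rewrite distrC vcell// x1/= cell_loS ltW.
  rewrite integral_step// EFinM lee_pmul2l// /F zsumD; [|by move=> j; rewrite subr_ge0..].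
  by rewrite !EFinD -[leLHS]adde0 addeC; apply: leeD; [rewrite lee_fin|exact: leeD].
split => //.
- apply: (@le_trans _ _ (zsum (fun j => (M (j + 1 + 1) - M (j + 1)) +
     ((M (j + 1) - M j) + (M (j + 1) - M j)))%R)).
    apply: le_zsum => j.
    rewrite (le_trans (ler_distD (v (cell_lo dx (j + 1))) _ _))// lerD//.
    rewrite (le_trans (ler_distD (v (cell_lo dx j)) _ _))// lerD//; last by rewrite distrC.
    by rewrite vcell// lexx/= cell_loS lerDl ltW.
  rewrite zsumD; [|by move=> j; rewrite subr_ge0|by move=> j; apply: addr_ge0; rewrite subr_ge0].
  rewrite [X in (_ + X)%E]zsumD; [|by move=> j; rewrite subr_ge0..].
  by rewrite !EFinD; apply: leeD; [exact: Z|exact: leeD].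
- have J : (dx%:E * znorm (cell_avg dx) < +oo)%E.
    rewrite -(integral_step dx0)//.
    apply: (@le_lt_trans _ _ (\int[mu]_x (`|cell_avg dx (idx dx x) - u0 x|%:E + `|u0 x|%:E))%E).
      apply: ge0_le_integral => //.
      - exact: (measurable_step (fun j => (`|cell_avg dx j|)%:E) dx0).
      - apply: emeasurable_funD; apply/measurable_EFinP; apply: measurableT_comp => //.
        by apply: measurable_funB => //; exact: measurable_step.
      - move=> x _; rewrite -EFinD lee_fin.
        by rewrite -[X in `|X| <= _](subrK (u0 x)) ler_normD.
    rewrite ge0_integralD//.
    - by apply: lte_add_pinfty; [apply: le_lt_trans I (ltry _)|case/integrableP: iu0].
    - apply/measurable_EFinP; apply: measurableT_comp => //.
      by apply: measurable_funB => //; exact: measurable_step.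
    - by apply/measurable_EFinP; apply: measurableT_comp.
  have z0 : (0 <= znorm (cell_avg dx))%E by exact: zsum_ge0.
  exists (fine (znorm (cell_avg dx))); rewrite fineK// ge0_fin_numE//.
  by move: J z0; case: (znorm _) => [y| |] //; rewrite ?ltry// mulry gtr0_sg// mul1e.
Qed.

End initial_data.

(** * Uniform bounds on the scheme *)

Section scheme_bounds.
Context {R : realType}.
Local Notation mu := (@lebesgue_measure R).
Local Notation TR := (measurableTypeR R).
Variables (delta : R) (w : R -> R) (g : R -> R -> R) (C : R) (u0 : R -> R).
Variables (lambda dx dt : R) (sigma : nat -> int -> R).
Hypotheses (delta0 : 0 < delta) (wK : nonlocal_kernel delta w) (C0 : 0 <= C).
Hypothesis gL : forall u1 u2 v1 v2, `|g u1 v1 - g u2 v2| <= C * (`|u1 - u2| + `|v1 - v2|).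
Hypothesis gnd : forall v, {homo g ^~ v : x y / x <= y}.
Hypothesis gni : forall v x y, x <= y -> g v y <= g v x.
Hypotheses (dx0 : 0 < dx) (dt0 : 0 < dt) (lam0 : 0 < lambda) (dtE : dt = lambda * dx).
Local Notation U := (forward_euler delta w g u0 dx dt sigma).
Hypothesis Us : forall n, admissible_slopes (U n) (sigma n).
Hypothesis small : 4 * C * lambda * kmass delta w dx <= 1.
Variable V : R.
Hypothesis U0V : (zvar (cell_avg u0 dx) <= V%:E)%E.
Hypothesis U0B : exists B : R, (znorm (cell_avg u0 dx) <= B%:E)%E.

Local Notation r := (Num.truncn (delta / dx)).+2.

Definition step_weight k : R := lambda * weight w dx k / (stride k)%:R.

Lemma step_weight_ge0 k : 0 <= step_weight k.
Proof. by rewrite divr_ge0// mulr_ge0 ?(ltW lam0)// (weight_ge0 wK). Qed.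

Lemma forward_eulerS n j : U n.+1 j = U n j - \sum_(0 <= k < r)
  step_weight k * (scheme_flux g (sigma n) (U n) k j -
                   scheme_flux g (sigma n) (U n) k (j - (stride k)%:Z)).
Proof.
rewrite /= (dt_scheme_op g delta dx dt w (sigma n) (U n) j); congr (_ - _).
apply: eq_bigr => k _; congr (_ * _); rewrite /step_weight dtE.
by field; rewrite (gt_eqF dx0)/= pnatr_eq0; case: (k).
Qed.

Lemma step_weight_sum : \sum_(0 <= k < r) step_weight k <= lambda * kmass delta w dx.
Proof.
have := weight_stride_sum delta0 wK dx0; rewrite -(ler_pM2l lam0) mulr_sumr; apply: le_trans.
by rewrite le_eqVlt; apply/orP; left; apply/eqP/eq_bigr => k _; rewrite mulrA.
Qed.

Lemma step_weight_stride_sum : \sum_(0 <= k < r) step_weight k * (stride k)%:R = lambda.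
Proof.
rewrite -[RHS]mulr1 -[in RHS](weight_sum delta0 wK dx0) mulr_sumr; apply: eq_bigr => k _.
by rewrite /step_weight divfK// pnatr_eq0; case: (k).
Qed.

(** The factor 2 C, twice the Lipschitz constant, comes from the slopes. *)
Lemma scheme_step n : (zvar (U n) <= V%:E)%E ->
  (zvar (U n.+1) <= V%:E)%E /\
  (zsum (fun j => `|U n.+1 j - U n j|)%R <= (4 * C * V * lambda)%:E)%E.
Proof.
move=> UV.
have [pn pnP] := choice (scheme_flux_incremental C0 gL gnd gni (Us n)).
have C20 : 0 <= 2 * C by rewrite mulr_ge0.
split.
  apply: (@step_zvar _ r step_weight stride (2 * C) (fun k => (pn k).1)
    (fun k => (pn k).2) (scheme_flux g (sigma n) (U n)) (U n)) => //.
  - exact: step_weight_ge0.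
  - exact: forward_eulerS.
  - apply: le_trans small; rewrite (_ : 2 * C * 2 = 4 * C); last by ring.
    by rewrite -[leRHS]mulrA ler_wpM2l ?mulr_ge0//; exact: step_weight_sum.
have := @step_znorm _ r step_weight stride (2 * C) (fun k => (pn k).1)
    (fun k => (pn k).2) (scheme_flux g (sigma n) (U n)) (U n) (U n.+1) V
    step_weight_ge0 C20 pnP (forward_eulerS n) UV.
by rewrite step_weight_stride_sum (_ : 2 * (2 * C) = 4 * C)//; ring.
Qed.

Lemma scheme_zvar n : (zvar (U n) <= V%:E)%E.
Proof. by elim: n => [|n IH]; [exact: U0V|exact: (scheme_step IH).1]. Qed.

Lemma scheme_diff m n : (m <= n)%N ->
  (zsum (fun j => `|U n j - U m j|)%R <= ((n%:R - m%:R) * (4 * C * V * lambda))%:E)%E.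
Proof.
elim: n => [|n IH].
  rewrite leqn0 => /eqP ->; rewrite subrr mul0r; apply: zsum_le => // k.
  by rewrite big1// => i _; rewrite subrr normr0.
rewrite leq_eqVlt => /predU1P[->|].
  rewrite subrr mul0r; apply: zsum_le => // k.
  by rewrite big1// => i _; rewrite subrr normr0.
rewrite ltnS => /IH {}IH.
apply: (@le_trans _ _ (zsum (fun j => `|U n.+1 j - U n j| + `|U n j - U m j|)%R)).
  by apply: le_zsum => j; exact: ler_distD.
rewrite zsumD// (_ : (n.+1%:R - m%:R) * (4 * C * V * lambda) =
  4 * C * V * lambda + (n%:R - m%:R) * (4 * C * V * lambda)); last by rewrite -natr1; ring.
by rewrite EFinD leeD// (scheme_step (scheme_zvar n)).2.
Qed.

(** The values of the scheme remain summable, with a bound that grows in [n], so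
    that the variation bounds them uniformly. *)
Lemma scheme_sup n j : `|U n j| <= V.
Proof.
have [B UB] := U0B.
apply: (norm_le_zvar (scheme_zvar n) (B := B + (n%:R - 0%:R) * (4 * C * V * lambda))).
apply: (@le_trans _ _ (zsum (fun j => `|U 0 j| + `|U n j - U 0 j|)%R)).
  by apply: le_zsum => i; rewrite -[X in `|X| <= _](subrKC (U 0 i)) ler_normD.
by rewrite zsumD// EFinD leeD// scheme_diff.
Qed.

Lemma V_ge0 : 0 <= V.
Proof. by rewrite -lee_fin (le_trans _ U0V)// zsum_ge0. Qed.

Local Notation p := (piecewise_constant dx dt U).

Lemma pc_sup x t : `|p x t| <= V.
Proof. exact: scheme_sup. Qed.

Lemma pc_majorant t : exists v, majorant V (p ^~ t) v.
Proof. exact: majorant_step (scheme_zvar _). Qed.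

Lemma pc_time s t : 0 <= s <= t ->
  (\int[mu]_x `|p x t - p x s|%:E <= (4 * C * V * (t - s + dt))%:E)%E.
Proof.
move=> st; have [nst hst] := tidx_diff dt0 st.
rewrite (integral_step (F := fun j => `|U (tidx dt t) j - U (tidx dt s) j|))//.
apply: (@le_trans _ _ (dx%:E * (((tidx dt t)%:R - (tidx dt s)%:R) * (4 * C * V * lambda))%:E)%E).
  by rewrite lee_pmul2l// scheme_diff.
rewrite -EFinM lee_fin.
rewrite (_ : dx * _ = 4 * C * V * (((tidx dt t)%:R - (tidx dt s)%:R) * dt)); last by rewrite dtE; ring.
by rewrite ler_wpM2l// !mulr_ge0// V_ge0.
Qed.

(** The only term in which the slopes enter.  It is treated as an error: its
    coefficient is at most [lambda * kmass]. *)
Definition recon_error n j : R := step_weight 0 *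
  (scheme_flux g (sigma n) (U n) 0 j - scheme_flux g (sigma n) (U n) 0 (j - 1)).

Lemma recon_error_sum n :
  (zsum (fun j => `|recon_error n j|)%R <= (4 * C * V * lambda * kmass delta w dx)%:E)%E.
Proof.
have [pn pnP] := scheme_flux_incremental C0 gL gnd gni (Us n) 0.
have C20 : 0 <= 2 * C by rewrite mulr_ge0.
have h := incremental_zvar C20 pnP (scheme_zvar n).
apply: (@le_trans _ _ (step_weight 0 * (2 * C * V + 2 * C * V))%:E); last first.
  rewrite lee_fin (_ : 4 * C * V * lambda * _ = lambda * kmass delta w dx * (2 * C * V + 2 * C * V)); last by ring.
  rewrite ler_wpM2r ?addr_ge0 ?mulr_ge0 ?V_ge0// (le_trans _ step_weight_sum)//.
  by rewrite big_nat_recl// lerDl sumr_ge0// => k _; exact: step_weight_ge0.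
rewrite (eq_zsum (h := fun j => step_weight 0 *
  `|scheme_flux g (sigma n) (U n) 0 j - scheme_flux g (sigma n) (U n) 0 (j - 1)|)); last first.
  by move=> j; rewrite /recon_error normrM (ger0_norm (step_weight_ge0 0)).
apply: zsum_scale => //; first exact: step_weight_ge0.
rewrite -(zsum_shift _ 1); apply: le_trans h; rewrite /zvar.
by apply: le_zsum => j; rewrite addrK.
Qed.

(** The scheme as an identity between functions on the line: the grid
    translations become translations by multiples of [dx]. *)
Lemma pc_step x t : 0 <= t -> p x (t + dt) = p x t
  - \sum_(0 <= k < r.-1) step_weight k.+1 *
      (g (p x t) (p (x + k.+1%:R * dx) t) - g (p (x - k.+1%:R * dx) t) (p x t))
  - recon_error (tidx dt t) (idx dx x).
Proof.
move=> t0; rewrite !piecewise_constantE tidx_shift// forward_eulerS big_nat_recl//.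
rewrite opprD addrA -/(recon_error _ _) addrAC; congr (_ - _ - _).
apply: eq_bigr => k _ /=; congr (_ * (g _ _ - g _ _)).
- by rewrite !piecewise_constantE -[k.+1%:R]/(k.+1%:Z%:~R) idx_shift.
- by rewrite !piecewise_constantE -mulNr -[- k.+1%:R](intrN _ k.+1%:Z) idx_shift.
- by rewrite subrK.
Qed.

End scheme_bounds.

(** * Compactness *)

Section l1_distance.
Context {R : realType}.
Local Notation mu := (@lebesgue_measure R).
Local Notation TR := (measurableTypeR R).

Definition L1dist (A : set TR) (f g : R -> R) : \bar R :=
  (\int[mu]_(x in A) `|f x - g x|%:E)%E.

Lemma measurable_absB (A : set TR) (f g : TR -> R) : measurable_fun A f -> measurable_fun A g ->
  measurable_fun A (fun x => `|f x - g x|%:E).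
Proof.
move=> mf mg; apply/measurable_EFinP; apply: measurableT_comp => //.
exact: measurable_funB.
Qed.

Lemma L1dist_ge0 A f g : (0 <= L1dist A f g)%E.
Proof. by apply: integral_ge0 => x _; rewrite lee_fin. Qed.

Lemma L1distC A f g : L1dist A f g = L1dist A g f.
Proof. by apply: eq_integral => x _; rewrite distrC. Qed.

Lemma L1dist_triangle (A : set TR) (f g h : TR -> R) : measurable A ->
  measurable_fun A f -> measurable_fun A g -> measurable_fun A h ->
  (L1dist A f h <= L1dist A f g + L1dist A g h)%E.
Proof.
move=> mA mf mg mh; rewrite /L1dist -ge0_integralD//; first last.
- exact: measurable_absB.
- exact: measurable_absB.
apply: ge0_le_integral => //.
- exact: measurable_absB.
- by apply: emeasurable_funD; exact: measurable_absB.
- by move=> x _; rewrite -EFinD lee_fin ler_distD.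
Qed.

Lemma L1dist_subset (A B : set TR) (f g : TR -> R) : measurable A -> measurable B ->
  measurable_fun B f -> measurable_fun B g -> A `<=` B ->
  (L1dist A f g <= L1dist B f g)%E.
Proof.
move=> mA mB mf mg AB; apply: ge0_subset_integral => //; exact: measurable_absB.
Qed.

Definition window (N : R) : set TR := `[- N, N]%classic.

Lemma measurable_window N : measurable (window N).
Proof. exact: measurable_itv. Qed.

Lemma window_measure N : 0 <= N -> mu (window N) = (2 * N)%:E.
Proof.
move=> N0; rewrite /window lebesgue_measure_itv/= lte_fin.
case: ltP => [_|h]; first by rewrite -EFinB; congr EFin; ring.
by congr EFin; lra.
Qed.

(** By monotone convergence. *)
Lemma integral_le_windows (f : TR -> R) (B : \bar R) : measurable_fun setT f ->
  (forall n : nat, (\int[mu]_(x in window n%:R) `|f x|%:E <= B)%E) ->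
  (\int[mu]_x `|f x|%:E <= B)%E.
Proof.
move=> mf fB.
have UT : \bigcup_n (window n%:R) = setT.
  apply/seteqP; split => // x _; exists (Num.truncn `|x|).+1 => //.
  by rewrite /window/= in_itv/= -ler_norml ltW// Num.Theory.truncnS_gt.
have := @ge0_nondecreasing_set_cvg_integral _ _ _ (fun n => window n%:R) (fun x => `|f x|%:E) mu.
rewrite UT => /(_ _ _ _ _)/cvg_lim <- //; first last.
- move=> n; apply: measurable_funTS; apply/measurable_EFinP; exact: measurableT_comp.
- by move=> n; exact: measurable_window.
- apply/nondecreasing_seqP => n; apply/subsetPset => x; rewrite /window/= !in_itv/= => /andP[h1 h2].
  have : n%:R <= n.+1%:R :> R by rewrite ler_nat.
  by move: h1 h2; lra.
apply: lime_le; last exact: nearW.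
apply: ereal_nondecreasing_is_cvgn; apply: ge0_nondecreasing_set_nondecreasing_integral.
- apply/nondecreasing_seqP => n; apply/subsetPset => x; rewrite /window/= !in_itv/= => /andP[h1 h2].
  have : n%:R <= n.+1%:R :> R by rewrite ler_nat.
  by move: h1 h2; lra.
- by move=> n; exact: measurable_window.
- move=> n; apply: measurable_funTS; apply/measurable_EFinP; exact: measurableT_comp.
- by move=> n x _; rewrite lee_fin.
Qed.

Lemma compact_window (K : set R) : compact K -> exists N : nat, K `<=` window N%:R.
Proof.
move=> /compact_bounded[M [_ KM]].
exists (Num.truncn (`|M| + 1)).+1 => x Kx.
rewrite /window/= in_itv/= -ler_norml.
rewrite (le_trans (KM (`|M| + 1) _ x Kx))//; last exact: ltW (Num.Theory.truncnS_gt _).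
by rewrite (le_lt_trans (ler_norm M))// ltrDl.
Qed.

End l1_distance.

Section diagonal.
Context {R : realType}.

(** A cluster point of the sequence in the product topology, in terms of finite
    sets of indices. *)
Lemma tychonoff_cluster (I : eqType) (P : nat -> I -> R) (V : R) :
  (forall m i, `|P m i| <= V) ->
  exists L : I -> R, forall (s : seq I) (e : R) (N : nat), 0 < e ->
    exists2 m, (N <= m)%N & forall i, i \in s -> `|P m i - L i| < e.
Proof.
move=> PV.
have := @tychonoff I (fun _ => R) (fun _ => `[- V, V]%classic) (fun _ => @segment_compact R (- V) V).
set A := [set f | _] => cA.
have PA : ((fun n => (P n : prod_topology (fun _ : I => R))) @ \oo) A.
  by exists 0%N => // n _ i /=; rewrite in_itv/= -ler_norml.
have [L [_ clL]] := cA _ _ PA.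
exists L => s e N e0.
have nP i : nbhs L [set f : I -> R | `|f i - L i| < e].
  have : nbhs (L i) [set y | `|y - L i| < e].
    by apply/nbhs_ballP; exists e => //= y; rewrite /ball/= distrC.
  exact: (@proj_continuous I (fun _ => R) i L).
have FL : Filter (nbhs L) by exact: nbhs_filter.
have nL : nbhs L [set f : I -> R | forall i, i \in s -> `|f i - L i| < e].
  elim: s => [|i s IH]; first by apply: (@filterE _ _ FL).
  apply: (@filterS2 _ _ FL _ _ _ _ IH (nP i)) => f h2 h3 j.
  by rewrite inE => /orP[/eqP->//|]; exact: h2.
have nN : ((fun n => (P n : prod_topology (fun _ : I => R))) @ \oo) (P @` [set n | (N <= n)%N]).
  by exists N => // n Nn; exists n.
by have [_ [[m Nm <-] h]] := clL _ _ nN nL; exists m.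
Qed.

End diagonal.

Section compactness.
Context {R : realType}.
Local Notation mu := (@lebesgue_measure R).
Local Notation TR := (measurableTypeR R).
Variables (T V K : R) (P : nat -> R -> R -> R) (tau : nat -> R).
Hypothesis K0 : 0 <= K.
Hypothesis mP : forall m, measurable_fun [set: TR * TR] (fun z : TR * TR => P m z.1 z.2 : R).
Hypothesis PV : forall m x t, `|P m x t| <= V.
Hypothesis Pmaj : forall m t, exists v, majorant V (P m ^~ t) v.
Hypothesis Ptime : forall m s t, 0 <= s <= t ->
  (\int[mu]_x `|P m x t - P m x s|%:E <= (K * (t - s + tau m))%:E)%E.
Hypothesis tauc : tau m @[m --> \oo] --> 0.

Let V0 : 0 <= V.
Proof. exact: le_trans (PV 0 0 0). Qed.

Lemma measurable_slice m t : measurable_fun [set: TR] (P m ^~ t : TR -> R).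
Proof.
exact: measurable_comp (mP m) (measurable_pair2 t).
Qed.

Definition mesh (n : nat) : R := (4 ^+ n)^-1.

Lemma mesh_gt0 n : 0 < mesh n.
Proof. by rewrite invr_gt0 exprn_gt0. Qed.

Lemma mesh_decr n : mesh n.+1 <= mesh n.
Proof. by rewrite lef_pV2 ?posrE ?exprn_gt0// ler_eXn2l// ltr1n. Qed.

(** Rounding to the mesh, in space and in time. *)
Definition xround n x : R := (idx (mesh n) x)%:~R * mesh n.
Definition tround n t : R := (tidx (mesh n) t)%:R * mesh n.

Lemma xround_near n x : `|x - xround n x| <= mesh n.
Proof.
have := idx_itv x (mesh_gt0 n); rewrite /cell_lo -/(xround n x) => h.
have h0 := mesh_gt0 n.
by rewrite ler_norml; move: h; rewrite /xround; lra.
Qed.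

Lemma tround_near n t : 0 <= t -> 0 <= tround n t <= t /\ t - tround n t <= mesh n.
Proof.
move=> t0; have := tidx_itv (mesh_gt0 n) t0; rewrite -natr1 => h.
have h0 : 0 <= tround n t by rewrite mulr_ge0// ltW// mesh_gt0.
by move: h h0; rewrite /tround; lra.
Qed.

(** All mesh points that arise by rounding points of [[- n, n] x [0, T]]. *)
Definition mesh_points (n : nat) : seq (R * R) :=
  [seq ((i%:Z - (n * 4 ^ n).+1%:Z)%:~R * mesh n, j%:R * mesh n) |
    i <- iota 0 ((n * 4 ^ n).+1.*2).+1, j <- iota 0 (tidx (mesh n) T).+1].

Lemma mesh_pointsP n x t : window n%:R x -> 0 <= t <= T ->
  (xround n x, tround n t) \in mesh_points n.
Proof.
rewrite /window/= in_itv/= => /andP[x1 x2] /andP[t0 tT].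
have h0 := mesh_gt0 n.
have hn : n%:R = (n * 4 ^ n)%:R * mesh n.
  by rewrite natrM natrX mulfK// expf_neq0.
set N := (n * 4 ^ n)%N in hn *.
have h : - N.+1%:Z <= idx (mesh n) x <= N.+1%:Z.
  have := idx_itv x h0; rewrite /cell_lo => /andP[i1 i2].
  have a1 : (idx (mesh n) x)%:~R - 2^-1 <= N%:R :> R.
    by rewrite -(ler_pM2r h0) -hn; lra.
  have a2 : - N%:R < (idx (mesh n) x)%:~R - 2^-1 + 1 :> R.
    by rewrite -(ltr_pM2r h0) mulNr -hn mulrDl mul1r; lra.
  have b1 : (idx (mesh n) x)%:~R < N.+1%:Z%:~R :> R.
    by rewrite -[N.+1%:Z%:~R]/(N.+1%:R) -natr1; lra.
  have b2 : (- N.+1%:Z)%:~R < (idx (mesh n) x)%:~R :> R.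
    by rewrite intrN -[N.+1%:Z%:~R]/(N.+1%:R) -natr1; lra.
  by move: b1 b2; rewrite !ltr_int => /ltW -> /ltW ->.
apply/allpairsP; exists (absz (idx (mesh n) x + N.+1%:Z), tidx (mesh n) t); split.
- by rewrite [_.1]/= mem_iota; move: h; clear; lia.
- rewrite [_.2]/= mem_iota add0n ltnS; apply: (tidx_diff h0 _).1.
  by rewrite t0.
- by rewrite [_.1]/= [_.2]/=; congr (_, _); rewrite /xround; congr (_%:~R * _); move: h; clear; lia.
Qed.

Lemma slice_dist m s t : 0 <= s <= t ->
  (L1dist setT (P m ^~ t) (P m ^~ s) <= (K * (t - s + tau m))%:E)%E.
Proof. exact: Ptime. Qed.

Lemma slice_round_dist m n t :
  (L1dist setT (P m ^~ t) (fun x => P m (xround n x) t) <= (mesh n * (3 * V))%:E)%E.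
Proof.
have [v vP] := Pmaj m t; have [vnd vV _] := vP.
apply: (majorant_integral (mesh_gt0 n) vnd vV).
  apply: measurable_funB; first exact: measurable_slice.
  exact: (measurable_step (fun j => P m (j%:~R * mesh n) t) (mesh_gt0 n)).
move=> x; rewrite distrC; apply: majorant_shift vP _.
by rewrite distrC xround_near.
Qed.

Lemma L1dist_sub (A : set TR) (f g : TR -> R) B : measurable A ->
  measurable_fun setT f -> measurable_fun setT g ->
  (L1dist setT f g <= B)%E -> (L1dist A f g <= B)%E.
Proof.
move=> mA mf mg; apply: le_trans; apply: L1dist_subset => //.
Qed.

(** Two members of the family that agree up to [mesh n] at the mesh points are
    close in L^1: move to the mesh point in time, then in space, compare, and
    move back.  The bounds are uniform in [t]. *)
Lemma slices_close n k l t (L : R * R -> R) : 0 <= t <= T ->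
  tau k <= mesh n -> tau l <= mesh n ->
  (forall z, z \in mesh_points n -> `|P k z.1 z.2 - L z| <= mesh n) ->
  (forall z, z \in mesh_points n -> `|P l z.1 z.2 - L z| <= mesh n) ->
  (L1dist (window n%:R) (P k ^~ t) (P l ^~ t) <=
    (mesh n * (4 * K + 6 * V + 4 * n%:R))%:E)%E.
Proof.
move=> tT tk tl kL lL.
have /andP[t0 _] := tT.
have [ts tm] := tround_near n t0.
have mW : measurable (window n%:R : set TR) by exact: measurable_window.
have mround m s : measurable_fun [set: TR] (fun x : TR => P m (xround n x) s : R).
  exact: (measurable_step (fun j => P m (j%:~R * mesh n) s) (mesh_gt0 n)).
set s := tround n t in ts tm.
have h0 := ltW (mesh_gt0 n).
have time m : tau m <= mesh n ->
    (L1dist (window n%:R) (P m ^~ t) (P m ^~ s) <= (mesh n * (2 * K))%:E)%E.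
  move=> tm'; apply: L1dist_sub => //; [exact: measurable_slice|exact: measurable_slice|].
  apply: le_trans (slice_dist m ts) _; rewrite lee_fin.
  have -> : mesh n * (2 * K) = K * (mesh n + mesh n) by ring.
  by rewrite ler_wpM2l// lerD.
have space m : (L1dist (window n%:R) (P m ^~ s) (fun x => P m (xround n x) s) <= (mesh n * (3 * V))%:E)%E.
  by apply: L1dist_sub => //; [exact: measurable_slice|exact: slice_round_dist].
have mid : (L1dist (window n%:R) (fun x => P k (xround n x) s) (fun x => P l (xround n x) s) <=
    (mesh n * (4 * n%:R))%:E)%E.
  have -> : mesh n * (4 * n%:R) = (mesh n + mesh n) * (2 * n%:R) by ring.
  rewrite EFinM -window_measure// /L1dist.
  apply: (integral_le_bound (mu := mu) (f := fun x => (P k (xround n x) s - P l (xround n x) s)%:E)) => //.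
  - by apply/measurable_EFinP; apply: measurable_funTS; exact: measurable_funB.
  - by rewrite lee_fin addr_ge0.
  - apply: aeW => x Wx; rewrite /= lee_fin.
    have zM := mesh_pointsP Wx tT.
    rewrite (le_trans (ler_distD (L (xround n x, s)) _ _))// lerD//.
      exact: (kL _ zM).
    by rewrite distrC; exact: (lL _ zM).
have -> : mesh n * (4 * K + 6 * V + 4 * n%:R) = mesh n * (2 * K) + (mesh n * (3 * V)
   + (mesh n * (4 * n%:R) + (mesh n * (3 * V) + mesh n * (2 * K)))) by ring.
have mS m s' : measurable_fun (window n%:R) (P m ^~ s' : TR -> R).
  by apply: measurable_funTS; exact: measurable_slice.
have mS' m s' : measurable_fun (window n%:R) (fun x : TR => P m (xround n x) s' : R).
  by apply: measurable_funTS; exact: mround.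
rewrite !EFinD.
apply: (le_trans (L1dist_triangle mW (mS k t) (mS k s) (mS l t))); apply: leeD; first exact: time.
apply: (le_trans (L1dist_triangle mW (mS k s) (mS' k s) (mS l t))); apply: leeD; first exact: space.
apply: (le_trans (L1dist_triangle mW (mS' k s) (mS' l s) (mS l t))); apply: leeD; first exact: mid.
apply: (le_trans (L1dist_triangle mW (mS' l s) (mS l s) (mS l t))); apply: leeD.
  by rewrite L1distC; exact: space.
by rewrite L1distC; exact: time.
Qed.

(** The mesh size [4^-n] beats the length of the window, which leaves a
    summable bound [2^-n]. *)
Lemma fast_subsequence : exists2 s : nat -> nat, {homo s : m n / (m < n)%N} &
  forall n t, 0 <= t <= T ->
    (L1dist (window n%:R) (P (s n) ^~ t) (P (s n.+1) ^~ t) <=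
     ((4 * K + 6 * V + 4) * 2 ^- n)%:E)%E.
Proof.
have [L LP] := @tychonoff_cluster R (R * R)%type (fun m z => P m z.1 z.2) V
  (fun m z => PV m z.1 z.2).
(* [s n] is good on two meshes, for the comparisons with [s n.-1] and [s n.+1] *)
have step n N : exists m, [/\ (N <= m)%N, tau m <= mesh n &
   forall z, z \in mesh_points n ++ mesh_points n.-1 -> `|P m z.1 z.2 - L z| <= mesh n].
  have [N1 _ N1P] : \forall m \near \oo, tau m <= mesh n.
    have /cvgrPdist_le/(_ _ (mesh_gt0 n)) := tauc.
    by apply: filterS => m; rewrite sub0r normrN; apply: le_trans; exact: ler_norm.
  have [m mN h] := LP (mesh_points n ++ mesh_points n.-1) (mesh n) (maxn N N1) (mesh_gt0 n).
  exists m; split.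
  - exact: leq_trans (leq_maxl _ _) mN.
  - by apply: N1P => /=; exact: leq_trans (leq_maxr _ _) mN.
  - by move=> z /h/ltW.
have /choice[c cP] : forall nN : nat * nat, exists m, [/\ (nN.2 <= m)%N, tau m <= mesh nN.1 &
   forall z, z \in mesh_points nN.1 ++ mesh_points nN.1.-1 -> `|P m z.1 z.2 - L z| <= mesh nN.1].
  by move=> [n N]; exact: step.
pose s := fix s n := if n is m.+1 then c (n, (s m).+1) else c (0, 0)%N.
have sP n : tau (s n) <= mesh n /\
  (forall z, z \in mesh_points n ++ mesh_points n.-1 -> `|P (s n) z.1 z.2 - L z| <= mesh n).
  by case: n => [|n] /=; [have [] := cP (0, 0)%N|have [] := cP (n.+1, (s n).+1)].
exists s.
  by apply: homo_ltn; [exact: ltn_trans|move=> n /=; have [] := cP (n.+1, (s n).+1)].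
move=> n t tT.
apply: (@le_trans _ _ (mesh n * (4 * K + 6 * V + 4 * n%:R))%:E).
  apply: (slices_close (L := L)) => //.
  - exact: (sP n).1.
  - exact: le_trans (sP n.+1).1 (mesh_decr n).
  - by move=> z zn; apply: (sP n).2; rewrite mem_cat zn.
  - move=> z zn; apply: le_trans (mesh_decr n); apply: (sP n.+1).2.
    by rewrite mem_cat zn orbT.
have -> : mesh n = 2 ^- n * 2 ^- n.
  by rewrite /mesh -invfM -exprMn; congr ((_ ^+ _)^-1); ring.
rewrite lee_fin -mulrA mulrC ler_pM2r ?invr_gt0 ?exprn_gt0//.
have n2 : n%:R <= 2 ^+ n :> R by rewrite -natrX ler_nat ltnW// ltn_expl.
have p1 : 1 <= 2 ^+ n :> R by rewrite exprn_ege1// ler1n.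
rewrite mulrC ler_pdivrMr ?exprn_gt0//.
rewrite [leRHS]mulrDl; apply: lerD.
  by rewrite ler_peMr// addr_ge0 ?mulr_ge0.
by rewrite ler_wpM2l.
Qed.

End compactness.

Section fast_convergence.
Context {R : realType}.
Local Notation mu := (@lebesgue_measure R).
Local Notation TR := (measurableTypeR R).

Lemma nneseries_geometric (B : R) : 0 <= B ->
  (\sum_(0 <= n <oo) (B * 2 ^- n)%:E <= (2 * B)%:E)%E.
Proof.
move=> B0; apply: lime_le.
  by apply: is_cvg_nneseries => n _ _; rewrite lee_fin mulr_ge0// invr_ge0 exprn_ge0.
apply: nearW => n; rewrite sumEFin lee_fin -mulr_sumr mulrC ler_wpM2r//.
have -> : \sum_(0 <= i < n) 2 ^- i = 2 - 2 * 2 ^- n :> R.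
  elim: n => [|n IH]; first by rewrite big_nil expr0 invr1; ring.
  by rewrite big_nat_recr//= IH exprS invfM; field; rewrite expf_neq0.
by rewrite gerBl mulr_ge0// invr_ge0 exprn_ge0.
Qed.

(** The sum of the increments is integrable, hence finite almost everywhere. *)
Lemma fast_cauchy_ae (A : set TR) (f : nat -> TR -> R) (B : R) : 0 <= B -> measurable A ->
  (forall n, measurable_fun A (f n)) ->
  (forall n, (L1dist A (f n) (f n.+1) <= (B * 2 ^- n)%:E)%E) ->
  {ae mu, forall x, A x -> cvgn (fun n => f n x)}.
Proof.
move=> B0 mA mf fB.
pose S x := (\sum_(0 <= n <oo) `|f n x - f n.+1 x|%:E)%E.
have mS n : measurable_fun A (fun x => `|f n x - f n.+1 x|%:E) by exact: measurable_absB.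
have S0 x : (0 <= S x)%E by apply: nneseries_ge0 => n _ _; rewrite lee_fin.
have mS' : measurable_fun A S.
  by apply: ge0_emeasurable_sum => // n x _ _; rewrite lee_fin.
have iS : mu.-integrable A S.
  apply/integrableP; split => //.
  under eq_integral do rewrite gee0_abs//.
  rewrite /S integral_nneseries//.
  apply: (@le_lt_trans _ _ (\sum_(0 <= n <oo) (B * 2 ^- n)%:E)%E).
    apply: lee_nneseries => [n _ _|n _]; first exact: L1dist_ge0.
    exact: fB.
  by apply: le_lt_trans (nneseries_geometric B0) _; exact: ltry.
have := integrable_ae mA iS.
apply: (@filterS _ _ (ae_filter_ringOfSetsType mu)) => x h Ax.
have {}h := h Ax.
have cT : cvgn [normed series (telescope (fun n => f n x))].
  apply: nondecreasing_is_cvgn.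
    by apply: nondecreasing_series => n _ _; exact: normr_ge0.
  exists (fine (S x)) => _ [n _ <-]; rewrite -lee_fin fineK//.
  rewrite /series/= -sumEFin.
  under eq_bigr do rewrite /telescope distrC.
  by apply: nneseries_lim_ge => k _ _; rewrite lee_fin.
have := normed_cvg cT.
rewrite telescopeK => /cvg_ex[l lP].
apply/cvg_ex; exists (l + f 0%N x).
have -> : (fun n => f n x) = (fun n => (f n x - f 0%N x) + f 0%N x).
  by apply/funext => n; rewrite subrK.
by apply: cvgD => //; exact: cvg_cst.
Qed.

End fast_convergence.

Section limit.
Context {R : realType}.
Local Notation mu := (@lebesgue_measure R).
Local Notation TR := (measurableTypeR R).
Variables (T V K : R) (P : nat -> R -> R -> R) (tau : nat -> R).
Hypothesis K0 : 0 <= K.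
Hypothesis mP : forall m, measurable_fun [set: TR * TR] (fun z : TR * TR => P m z.1 z.2 : R).
Hypothesis PV : forall m x t, `|P m x t| <= V.
Hypothesis Pmaj : forall m t, exists v, majorant V (P m ^~ t) v.
Hypothesis Ptime : forall m s t, 0 <= s <= t ->
  (\int[mu]_x `|P m x t - P m x s|%:E <= (K * (t - s + tau m))%:E)%E.
Hypothesis tauc : tau m @[m --> \oo] --> 0.

Let V0 : 0 <= V.
Proof. exact: le_trans (PV 0 0 0). Qed.

(** An upper limit is jointly measurable whether or not the sequence converges;
    the truncation keeps the function bounded at every point. *)
Definition limit_fun (s : nat -> nat) (x t : R) : R :=
  Num.max (- V) (Num.min V (fine (limn_esup (fun n => (P (s n) x t)%:E)))).

Lemma limit_funE s x t (l : R) : P (s n) x t @[n --> \oo] --> l -> limit_fun s x t = l.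
Proof.
move=> Pl.
have Pl' : (P (s n) x t)%:E @[n --> \oo] --> l%:E by apply: cvg_EFin; [exact: nearW|exact: Pl].
rewrite /limit_fun is_cvg_limn_esupE; last by apply/cvg_ex; exists l%:E.
rewrite (cvg_lim _ Pl')//=.
have lV : `|l| <= V.
  have h : `|P (s n) x t| @[n --> \oo] --> `|l| by exact: cvg_norm Pl.
  rewrite -(cvg_lim _ h)//; apply: limr_le; last exact: nearW.
  by apply/cvg_ex; exists `|l|.
move: lV; rewrite ler_norml => /andP[h1 h2].
by rewrite (min_idPr _)// (max_idPr _).
Qed.

Lemma limit_fun_bound s x t : `|limit_fun s x t| <= V.
Proof.
rewrite ler_norml /limit_fun le_max lexx/= ge_max ge_min lexx/= andbT.
by rewrite (le_trans _ V0)// oppr_le0.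
Qed.

Lemma measurable_limit_fun s :
  measurable_fun [set: TR * TR] (fun z : TR * TR => limit_fun s z.1 z.2 : R).
Proof.
apply: measurable_maxr; first exact: measurable_cst.
apply: measurable_minr; first exact: measurable_cst.
apply: measurableT_comp => //.
apply: (measurable_fun_limn_esup (f := fun n (z : TR * TR) => (P (s n) z.1 z.2)%:E)) => n.
apply/measurable_EFinP; exact: mP.
Qed.

Lemma increasing_ge (s : nat -> nat) : {homo s : m n / (m < n)%N} ->
  forall n, (n <= s n)%N.
Proof. by move=> sh; elim=> // n IH; apply: leq_ltn_trans IH _; exact: sh. Qed.

Lemma increasing_cvg (s : nat -> nat) : {homo s : m n / (m < n)%N} -> s @ \oo --> \oo.
Proof.
move=> sh A [N _ NA]; exists N => // n /= Nn; apply: NA => /=.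
exact: leq_trans Nn (increasing_ge sh n).
Qed.

Lemma slice_L1_cvg (s : nat -> nat) (u : R -> R -> R) t (A : set TR) :
  measurable A -> (mu A < +oo)%E ->
  measurable_fun [set: TR] (u ^~ t : TR -> R) -> (forall x t, `|u x t| <= V) ->
  {ae mu, forall x, P (s n) x t @[n --> \oo] --> u x t} ->
  L1dist A (P (s n) ^~ t) (u ^~ t) @[n --> \oo] --> 0%E.
Proof.
move=> mA Aoo mu_ uV Pu.
have mf n : measurable_fun A (fun x => (P (s n) x t)%:E).
  by apply/measurable_EFinP; apply: measurable_funTS; exact: measurable_slice.
have ml : measurable_fun A (fun x => (u x t)%:E).
  by apply/measurable_EFinP; exact: measurable_funTS.
have Pu' : {ae mu, forall x, A x -> (P (s n) x t)%:E @[n --> \oo] --> (u x t)%:E}.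
  move: Pu; apply: (@filterS _ _ (ae_filter_ringOfSetsType mu)) => x Px _.
  by apply: cvg_EFin; [exact: nearW|exact: Px].
have iV : mu.-integrable A (fun=> V%:E).
  apply: (integrable_bounded (f := fun=> V) (M := V)) => // x _.
  by rewrite ger0_norm.
have PV' : {ae mu, forall x n, A x -> (`|(P (s n) x t)%:E| <= V%:E)%E}.
  by apply: aeW => x n _; rewrite lee_fin.
by have [] := dominated_convergence mA mf ml Pu' iV PV'.
Qed.

(** Along the fast subsequence the slices at a fixed time converge almost
    everywhere on each window, and the modulus of continuity in time passes to
    the limit. *)
Lemma compactness : exists s : nat -> nat, {homo s : m n / (m < n)%N} /\
  exists u : R -> R -> R,
  [/\ measurable_fun [set: TR * TR] (fun z : TR * TR => u z.1 z.2 : R),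
      forall x t, `|u x t| <= V,
      forall t, 0 <= t <= T -> {ae mu, forall x, P (s n) x t @[n --> \oo] --> u x t} &
      forall a b, 0 <= a <= b -> b <= T ->
        (\int[mu]_x `|u x b - u x a|%:E <= (K * (b - a))%:E)%E].
Proof.
have [s sh sP] := fast_subsequence T K0 mP PV Pmaj Ptime tauc.
have mu_ t : measurable_fun [set: TR] (limit_fun s ^~ t : TR -> R).
  exact: measurable_comp (measurable_limit_fun s) (measurable_pair2 t).
have cae t : 0 <= t <= T -> {ae mu, forall x, P (s n) x t @[n --> \oo] --> limit_fun s x t}.
  move=> tT.
  have : {ae mu, forall x (N : nat), window N%:R x -> cvgn (fun n => P (s (n + N)%N) x t)}.
    apply: ae_foralln => N.
    apply: (fast_cauchy_ae (B := 4 * K + 6 * V + 4)) => //.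
    - by rewrite addr_ge0// addr_ge0// mulr_ge0.
    - exact: measurable_window.
    - by move=> n; apply: measurable_funTS; exact: measurable_slice.
    move=> n; apply: (@le_trans _ _ ((4 * K + 6 * V + 4) * 2 ^- (n + N))%:E).
      apply: le_trans (sP (n + N)%N t tT); rewrite addSn.
      apply: L1dist_subset; [exact: measurable_window|exact: measurable_window| | |].
      - by apply: measurable_funTS; exact: measurable_slice.
      - by apply: measurable_funTS; exact: measurable_slice.
      move=> x; rewrite /window/= !in_itv/= => /andP[h1 h2].
      have : N%:R <= (n + N)%:R :> R by rewrite ler_nat leq_addl.
      by move: h1 h2; lra.
    rewrite lee_fin ler_wpM2l//; first by rewrite addr_ge0// addr_ge0// mulr_ge0.
    by rewrite lef_pV2 ?posrE ?exprn_gt0// ler_eXn2l ?ltr1n// leq_addr.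
  apply: (@filterS _ _ (ae_filter_ringOfSetsType mu)) => x xc.
  have xW : window (Num.truncn `|x|).+1%:R x.
    by rewrite /window/= in_itv/= -ler_norml ltW// Num.Theory.truncnS_gt.
  have /cvg_ex[l lP] := xc _ xW.
  have Pl : P (s n) x t @[n --> \oo] --> l.
    by rewrite -(cvg_shiftn (Num.truncn `|x|).+1).
  by rewrite (limit_funE Pl).
exists s; split => //; exists (limit_fun s); split => //.
- exact: measurable_limit_fun.
- exact: limit_fun_bound.
- move=> a b ab bT.
  have /andP[a0 ab'] := ab.
  apply: integral_le_windows => [|N]; first exact: measurable_funB.
  have mW : measurable (window N%:R : set TR) by exact: measurable_window.
  have Woo : (mu (window N%:R) < +oo)%E by rewrite window_measure// ltry.
  have ca : L1dist (window N%:R) (P (s n) ^~ a) (limit_fun s ^~ a) @[n --> \oo] --> 0%E.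
    apply: slice_L1_cvg => //; [exact: limit_fun_bound|apply: cae].
    by rewrite a0 (le_trans ab').
  have cb : L1dist (window N%:R) (P (s n) ^~ b) (limit_fun s ^~ b) @[n --> \oo] --> 0%E.
    apply: slice_L1_cvg => //; [exact: limit_fun_bound|apply: cae].
    by rewrite bT (le_trans a0).
  have ct : (K * (b - a + tau (s n)))%:E @[n --> \oo] --> (K * (b - a))%:E.
    apply: cvg_EFin; first exact: nearW.
    have tausc : tau (s n) @[n --> \oo] --> 0 by exact: cvg_comp (increasing_cvg sh) tauc.
    rewrite -[in X in _ --> X](addr0 (b - a)).
    by apply: cvgM; [exact: cvg_cst|apply: cvgD => //; exact: cvg_cst].
  have := cvgeD _ (cvgeD _ cb ct) ca; rewrite add0e adde0 => /(_ _ isT _ isT) h.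
  apply: (cvge_to_ge h); apply: nearW => n.
  have mS m r : measurable_fun (window N%:R) (P m ^~ r : TR -> R).
    by apply: measurable_funTS; exact: measurable_slice.
  have mL r : measurable_fun (window N%:R) (limit_fun s ^~ r : TR -> R).
    exact: measurable_funTS.
  have h1 := L1dist_triangle mW (mL b) (mS (s n) b) (mL a).
  have h2 := L1dist_triangle mW (mS (s n) b) (mS (s n) a) (mL a).
  apply: le_trans h1 _; rewrite -[leRHS]addeA; apply: leeD.
    by rewrite L1distC lexx.
  apply: le_trans h2 _; apply: leeD => //.
  by apply: L1dist_sub => //; [exact: measurable_slice|exact: measurable_slice|exact: Ptime].
Qed.

End limit.

(** * The nonlocal flux of a bounded profile *)

Lemma Rintegral_eq0 d (T : measurableType d) (R : realType) (m : {measure set T -> \bar R})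
  (D : set T) (f : T -> R) : (forall x, D x -> f x = 0) -> \int[m]_(x in D) f x = 0.
Proof.
move=> f0; rewrite /Rintegral (eq_integral (cst 0%E)); first by rewrite integral0.
by move=> x /set_mem Dx; rewrite f0.
Qed.

Section box_fubini.
Context d1 d2 (T1 : measurableType d1) (T2 : measurableType d2) (R : realType).
Variables (m1 : {sigma_finite_measure set T1 -> \bar R})
          (m2 : {sigma_finite_measure set T2 -> \bar R}).

(** The form of Fubini's theorem for the nonlocal flux: integrability in the
    second variable comes from the weight. *)
Lemma Rintegral_fubini_box (A : set T1) (B : set T2) (F : T1 * T2 -> R) (w : T2 -> R) (M : R) :
  measurable A -> (m1 A < +oo)%E -> measurable B -> measurable_fun setT F ->
  m2.-integrable B (EFin \o w) -> 0 <= M -> (forall x y, A x -> B y -> `|F (x, y)| <= M) ->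
  [/\ m2.-integrable B (EFin \o (fun y => (\int[m1]_(x in A) F (x, y)) * w y)),
      m1.-integrable A (EFin \o (fun x => \int[m2]_(y in B) (F (x, y) * w y))) &
      \int[m1]_(x in A) \int[m2]_(y in B) (F (x, y) * w y) =
      \int[m2]_(y in B) ((\int[m1]_(x in A) F (x, y)) * w y)].
Proof.
move=> mA Aoo mB mF iw M0 FM.
pose wB : T2 -> R := w \_ B.
have iwB : m2.-integrable setT (EFin \o wB).
  by rewrite -restrict_EFin; apply/(integrable_mkcond _ mB).
have mwB : measurable_fun setT wB by apply/measurable_EFinP; exact: measurable_int iwB.
pose G (z : T1 * T2) : R := F z * \1_A z.1 * wB z.2.
have mG : measurable_fun setT G.
  apply: measurable_funM; last exact: measurableT_comp mwB measurable_snd.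
  by apply: measurable_funM => //; apply: (measurableT_comp (measurable_indic _)).
have wBN y : ~ B y -> wB y = 0 by move=> By; rewrite /wB patchN// notin_setE.
have wBI y : B y -> wB y = w y by move=> By; rewrite /wB patchT// inE.
have GM z : `|G z| <= M * \1_A z.1 * `|wB z.2|.
  rewrite /G !normrM; case: z => x y /=.
  have [By|By] := pselect (B y); last by rewrite wBN// normr0 !mulr0.
  rewrite ler_wpM2r// indicE; case: (boolP (x \in A)) => [|_]; last by rewrite normr0 !mulr0.
  by rewrite inE => Ax; rewrite normr1 !mulr1 FM.
have iG : (m1 \x m2)%E.-integrable setT (EFin \o G).
  apply: (integrable_dominated (g := fun z => M * \1_A z.1 * `|wB z.2|)) => //.
  apply/integrable12ltyP.
    apply/measurable_EFinP; apply: measurable_funM.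
      by apply: measurable_funM => //; apply: (measurableT_comp (measurable_indic _)).
    by apply: measurableT_comp => //; exact: measurableT_comp mwB measurable_snd.
  have [_ wBoo] := integrableP _ _ _ iwB.
  have inner x : (\int[m2]_y `|(EFin \o (fun z : T1 * T2 => M * \1_A z.1 * `|wB z.2|)%R) (x, y)| =
      (M * \1_A x)%:E * \int[m2]_y `|(EFin \o wB) y|)%E.
    rewrite -ge0_integralZl//; first last.
    - by rewrite lee_fin mulr_ge0.
    - by apply: measurableT_comp => //; exact/measurable_EFinP.
    by apply: eq_integral => y _; rewrite /= normrM normr_id -EFinM ger0_norm// mulr_ge0.
  under eq_integral do rewrite inner.
  rewrite ge0_integralZr//; first last.
  - exact: integral_ge0.
  - by move=> x _; rewrite lee_fin mulr_ge0.
  - by apply/measurable_EFinP; apply: measurable_funM => //; exact: measurable_indic.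
  under eq_integral do rewrite EFinM.
  rewrite ge0_integralZl//; first last.
  - by apply/measurable_EFinP; exact: measurable_indic.
  rewrite integral_indic// setIT.
  have f1 : m1 A \is a fin_num by rewrite ge0_fin_numE.
  apply: lte_mul_pinfty => //; first exact: mule_ge0.
  by apply: fin_numM.
have [i1 e1] := Rintegral_fubini iG.
have [i2 e2] := Rintegral_fubini1 iG.
have E1 y : \int[m1]_x G (x, y) = (\int[m1]_(x in A) F (x, y)) * wB y.
  have [By|By] := pselect (B y); last first.
    rewrite wBN// mulr0; by apply: Rintegral_eq0 => x _; rewrite /G/= wBN// mulr0.
  have mFy : measurable_fun setT (fun x => F (x, y)).
    exact: measurable_comp mF (measurable_pair2 y).
  rewrite -RintegralZr//; last first.
    apply: (integrable_bounded (M := M)) => //; first exact: measurable_funTS.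
    by move=> x Ax; exact: FM.
  rewrite [RHS]Rintegral_mkcond; apply: eq_Rintegral => x _.
  by rewrite /G/= patchE indicE; case: ifPn; rewrite ?mulr1// mulr0 mul0r.
have E2 x : \int[m2]_y G (x, y) = ((fun x => \int[m2]_(y in B) (F (x, y) * w y)) \_ A) x.
  rewrite patchE; case: ifPn => Ax.
    rewrite [RHS]Rintegral_mkcond; apply: eq_Rintegral => y _.
    rewrite /G/= indicE Ax mulr1 /wB !patchE; case: ifPn => //; by rewrite mulr0.
  by apply: Rintegral_eq0 => y _; rewrite /G/= indicE (negbTE Ax) mulr0 mul0r.
have E1' : (fun y => \int[m1]_x G (x, y)) = (fun y => (\int[m1]_(x in A) F (x, y)) * w y) \_ B.
  by apply/funext => y; rewrite E1 /wB !patchE; case: ifPn => //; rewrite mulr0.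
have E2' : (fun x => \int[m2]_y G (x, y)) = (fun x => \int[m2]_(y in B) (F (x, y) * w y)) \_ A.
  by apply/funext => x; rewrite E2.
split.
- by apply/(integrable_mkcond _ mB); rewrite restrict_EFin -E1'.
- by apply/(integrable_mkcond _ mA); rewrite restrict_EFin -E2'.
- by rewrite [LHS]Rintegral_mkcond [RHS]Rintegral_mkcond -E1' -E2' e1 e2.
Qed.

End box_fubini.

Section two_variables.
Context {R : realType}.
Local Notation mu := (@lebesgue_measure R).
Local Notation TR := (measurableTypeR R).

(** As a limit of step functions on finer and finer grids. *)
Lemma continuous_measurable2 (f : R -> R -> R) : continuous (fun z : R * R => f z.1 z.2) ->
  measurable_fun [set: TR * TR] (fun z : TR * TR => f z.1 z.2 : R).
Proof.
move=> cf.
pose i n (z : TR * TR) : int * int := (idx (mesh n : R) z.1, idx (mesh n : R) z.2).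
pose F n (z : TR * TR) : R := f (xround n z.1) (xround n z.2).
apply: (measurable_fun_cvg (h := F)) => [n|[x y] _].
  apply: (measurable_countable_range (fun c => f (c.1%:~R * mesh n) (c.2%:~R * mesh n) : R) (i := i n)) => -[a b].
  rewrite (_ : _ @^-1` _ = (idx (mesh n) @^-1` [set a]) `*` (idx (mesh n) @^-1` [set b])).
    by apply: measurableX; apply: measurable_idx; exact: mesh_gt0.
  by apply/seteqP; split => -[u v]/=; rewrite /i/= => -[-> ->].
have c1 (u : R) : xround n u @[n --> \oo] --> u.
  apply/cvgrPdist_le => e e0.
  have m0 : mesh n @[n --> \oo] --> (0 : R).
    have -> : (fun n => mesh n : R) = geometric 1 4^-1.
      by apply/funext => n; rewrite /mesh/geometric/= mul1r exprVn.
    by apply: cvg_geometric; rewrite ger0_norm ?invr_ge0// invf_lt1// ltr1n.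
  have /cvgrPdist_le/(_ e e0) := m0.
  apply: filterS => n; rewrite sub0r normrN => h.
  apply: (le_trans (xround_near n u)); apply: le_trans h; exact: ler_norm.
apply: (cvg_comp (fun n => (xround n x, xround n y) : R * R) (fun z => f z.1 z.2)).
  apply: (@cvg_pair _ _ _ _ (nbhs x) (nbhs y)); exact: c1.
exact: cf.
Qed.

Lemma ae_shift (a : R) (P : R -> Prop) : {ae mu, forall x, P x} -> {ae mu, forall x, P (x + a)}.
Proof.
move=> [N [mN N0 PN]]; exists ((fun x : TR => x + a : TR) @^-1` N); split.
- by rewrite -[_ @^-1` _]setTI; exact: measurable_shift.
- by rewrite -N0; exact: (lebesgue_pushforward_shift a mN).
- by move=> x /= nP; apply: PN.
Qed.

End two_variables.

(** Space integral of the nonlocal flux tested against [psi], at a fixed time,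
    and its discretization on a grid. *)
Section flux_limit.
Context {R : realType}.
Local Notation mu := (@lebesgue_measure R).
Local Notation TR := (measurableTypeR R).
Variables (delta : R) (w : R -> R).
Hypotheses (delta0 : 0 < delta) (wK : nonlocal_kernel delta w).
Local Notation D := (`[0, delta]%classic : set TR).
Variables (Q : R -> R -> R) (LQ V QM : R).
Hypotheses (LQ0 : 0 <= LQ).
Hypothesis QL : forall a b a' b', `|Q a b - Q a' b'| <= LQ * (`|a - a'| + `|b - b'|).
Hypothesis QB : forall a b, `|a| <= V -> `|b| <= V -> `|Q a b| <= QM.
Variables (psi : R -> R) (N B : R).
Hypotheses (N0 : 0 <= N) (B0 : 0 <= B).
Hypothesis mpsi : measurable_fun [set: TR] (psi : TR -> R).
Hypothesis psi0 : forall x, N < `|x| -> psi x = 0.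
Hypothesis psiL : forall x y, `|psi x - psi y| <= B * `|x - y|.

(** At [h = 0] its value is 0, by the convention on division. *)
Definition dquot h x : R := (psi (x + h) - psi x) / h.

Lemma dquot_bound h x : `|dquot h x| <= B.
Proof.
rewrite /dquot normrM normfV; have [->|h0] := eqVneq h 0.
  by rewrite normr0 invr0 mulr0.
rewrite ler_pdivrMr ?normr_gt0//; apply: le_trans (psiL _ _) _.
by rewrite (_ : x + h - x = h)//; ring.
Qed.

Lemma dquot_support h x : `|h| <= delta + 1 -> N + (delta + 1) < `|x| -> dquot h x = 0.
Proof.
move=> h1 x1; have x2 := ler_normB (x + h) h; rewrite addrK in x2.
have d0 := delta0.
by rewrite /dquot (@psi0 x) 1?(@psi0 (x + h)) ?subrr ?mul0r//; move: h1 x1 x2 d0; lra.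
Qed.

Lemma dquot_diff h k x : 0 <= h -> 0 < k -> `|dquot k x - dquot h x| <= 2 * B * (`|h - k| / k).
Proof.
move=> h0 k0; have [->|hn] := eqVneq h 0.
  rewrite sub0r normrN (gtr0_norm k0) divff ?gt_eqF// mulr1.
  by rewrite (le_trans (ler_normB _ _))// mulr_natl mulr2n lerD// dquot_bound.
have hp : 0 < h by rewrite lt_def hn.
have -> : dquot k x - dquot h x =
    (psi (x + k) - psi (x + h)) / k + dquot h x * ((h - k) / k).
  by rewrite /dquot; field; rewrite hn gt_eqF.
rewrite (le_trans (ler_normD _ _))//.
rewrite [X in X + _]normrM [X in _ + X]normrM (normrM (h - k)) normfV (gtr0_norm k0).
have -> : 2 * B * (`|h - k| / k) = B / k * `|h - k| + B * (`|h - k| / k) by ring.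
apply: lerD; last first.
  by rewrite ler_wpM2r ?dquot_bound// divr_ge0// ltW.
rewrite mulrAC ler_wpM2r ?invr_ge0 ?(ltW k0)//; apply: le_trans (psiL _ _) _.
by rewrite (_ : x + k - (x + h) = k - h) 1?distrC//; ring.
Qed.

Local Notation W := (window (N + (delta + 1)) : set TR).

(** The window contains the support of [dquot h] for all [h] that occur, also
    for those slightly larger than [delta] of the last grid point. *)
Definition flux_integral (p : R -> R) (h : R) : R :=
  \int[mu]_(x in W) (dquot h x * Q (p x) (p (x + h))).

Let mW : measurable W.
Proof. exact: measurable_window. Qed.

Let Nd : 0 <= N + (delta + 1).
Proof. by rewrite addr_ge0// addr_ge0// ltW. Qed.

Let Woo : (mu W < +oo)%E.
Proof. by rewrite window_measure// ltry. Qed.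

Let mD : measurable D.
Proof. exact: measurable_itv. Qed.

Lemma lipschitz2_cvg (I : Type) (F : set_system I) {FF : Filter F} (a b : I -> R) (x y : R) :
  a i @[i --> F] --> x -> b i @[i --> F] --> y -> Q (a i) (b i) @[i --> F] --> Q x y.
Proof.
move=> c1 c2; apply/cvgrPdist_le => e e0.
have e1 : 0 < e / (2 * (LQ + 1)) by rewrite divr_gt0// mulr_gt0// ltr_pwDr.
move/cvgrPdist_le : c1 => /(_ _ e1); move/cvgrPdist_le : c2 => /(_ _ e1).
apply: filterS2 => i h1 h2; apply: le_trans (QL _ _ _ _) _.
apply: (@le_trans _ _ ((LQ + 1) * (2 * (e / (2 * (LQ + 1)))))).
  apply: ler_pM => //; first by rewrite lerDl.
  by rewrite mulr_natl mulr2n lerD.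
rewrite le_eqVlt; apply/orP; left; apply/eqP; field.
by rewrite gt_eqF// ltr_pwDr.
Qed.

Lemma Q_measurable d (T : measurableType d) (a b : T -> R) :
  measurable_fun setT a -> measurable_fun setT b -> measurable_fun setT (fun x => Q (a x) (b x)).
Proof.
move=> ma mb.
have mQ : measurable_fun [set: TR * TR] (fun z : TR * TR => Q z.1 z.2 : R).
  by apply: continuous_measurable2 => z; apply: lipschitz2_cvg; [exact: cvg_fst|exact: cvg_snd].
have mab : measurable_fun setT (fun x => (a x, b x) : TR * TR) by exact: measurable_fun_pair ma mb.
exact: (@measurableT_comp _ _ _ _ _ _ (fun z : TR * TR => Q z.1 z.2 : R) setT (fun x => (a x, b x) : TR * TR) mQ mab).
Qed.

Let Doo : (mu D < +oo)%E.
Proof. by rewrite lebesgue_measure_itv/= lte_fin delta0 -EFinB ltry. Qed.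

Section bounded_profile.
Variable p : R -> R.
Hypothesis mp : measurable_fun [set: TR] (p : TR -> R).
Hypothesis pV : forall x, `|p x| <= V.

Let QM0 : 0 <= QM.
Proof. exact: le_trans (QB (pV 0) (pV 0)). Qed.

Definition flux_integrand (z : TR * TR) : R := dquot z.2 z.1 * Q (p z.1) (p (z.1 + z.2)).

Lemma measurable_flux_integrand : measurable_fun setT flux_integrand.
Proof.
have ma : measurable_fun [set: TR * TR] (fun z : TR * TR => z.1 + z.2 : TR).
  by apply: measurable_funD; [exact: measurable_fst|exact: measurable_snd].
have mc (q : TR -> R) : measurable_fun [set: TR] q ->
    measurable_fun [set: TR * TR] (fun z : TR * TR => q (z.1 + z.2)).
  by move=> mq; exact: measurableT_comp mq ma.
have m1 (q : TR -> R) : measurable_fun [set: TR] q ->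
    measurable_fun [set: TR * TR] (fun z : TR * TR => q z.1).
  by move=> mq; exact: measurableT_comp mq measurable_fst.
apply: measurable_funM; last by apply: Q_measurable; [exact: m1|exact: mc].
apply: measurable_funM; first by apply: measurable_funB; [exact: mc|exact: m1].
exact: measurableT_comp (@measurable_inv R) measurable_snd.
Qed.

Lemma flux_integrand_bound z : `|flux_integrand z| <= B * QM.
Proof. by rewrite normrM ler_pM// ?dquot_bound// QB. Qed.

Lemma flux_slice h : measurable_fun [set: TR] (fun x : TR => dquot h x * Q (p x) (p (x + h)) : R).
Proof. exact: measurable_comp measurable_flux_integrand (measurable_pair2 h). Qed.

Lemma flux_fubini : [/\
  mu.-integrable D (EFin \o (fun h => flux_integral p h * w h)),
  mu.-integrable W (EFin \o (fun x => \int[mu]_(h in D) (dquot h x * Q (p x) (p (x + h)) * w h))) &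
  \int[mu]_x \int[mu]_(h in D) (dquot h x * Q (p x) (p (x + h)) * w h) =
  \int[mu]_(h in D) (flux_integral p h * w h)].
Proof.
have [i1 i2 e] := Rintegral_fubini_box (m1 := mu) (m2 := mu) mW Woo mD
   measurable_flux_integrand (kernel_integrable wK) (mulr_ge0 B0 QM0)
   (fun x y _ _ => flux_integrand_bound (x, y)).
split => //.
rewrite -[RHS]e [RHS]Rintegral_mkcond; apply: eq_Rintegral => x _.
rewrite patchE; case: ifPn => // /negP xW.
apply: Rintegral_eq0 => h; rewrite /= in_itv/= => /andP[h0 h1].
rewrite dquot_support ?mul0r//; first by rewrite ger0_norm// (le_trans h1)// lerDl.
by rewrite ltNge; apply/negP => h2; apply: xW; rewrite inE /window/= in_itv/= -ler_norml.
Qed.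

Lemma measurable_flux_integral : measurable_fun D (flux_integral p : TR -> R).
Proof.
have c1 : mu.-integrable D (EFin \o (fun=> 1 : R)).
  by apply: (integrable_bounded (M := 1)) => //; move=> x _; rewrite normr1.
have [i1 _ _] := Rintegral_fubini_box (m1 := mu) (m2 := mu) mW Woo mD
   measurable_flux_integrand c1 (mulr_ge0 B0 QM0)
   (fun x y _ _ => flux_integrand_bound (x, y)).
have /measurable_EFinP := measurable_int _ i1.
by apply: eq_measurable_fun => h _; rewrite mulr1.
Qed.

Lemma flux_integrable h : mu.-integrable W (EFin \o (fun x => dquot h x * Q (p x) (p (x + h)))).
Proof.
apply: (integrable_bounded (M := B * QM)) => //; first by apply: measurable_funTS; exact: flux_slice.
by move=> x _; exact: (flux_integrand_bound (x, h)).
Qed.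

Lemma flux_integral_bound h : `|flux_integral p h| <= B * QM * fine (mu W).
Proof.
rewrite -(Rintegral_cst mu mW); apply: le_norm_Rintegral => //.
- by apply: measurable_funTS; exact: flux_slice.
- apply: (integrable_bounded (M := B * QM)) => // x _.
  by rewrite ger0_norm// mulr_ge0.
- by move=> x _; exact: (flux_integrand_bound (x, h)).
Qed.

Lemma le_Rintegral_norm (A : set TR) (f : TR -> R) (c : R) : measurable A -> measurable_fun setT f ->
  (\int[mu]_x `|f x|%:E <= c%:E)%E ->
  mu.-integrable A (EFin \o (fun x => `|f x|)) /\ \int[mu]_(x in A) `|f x| <= c.
Proof.
move=> mA mf fc.
have mf' : measurable_fun setT (fun x => `|f x|%:E).
  by apply/measurable_EFinP; exact: measurableT_comp.
have fA : (\int[mu]_(x in A) `|f x|%:E <= c%:E)%E.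
  by apply: le_trans fc; apply: ge0_subset_integral => //.
have fi : mu.-integrable A (EFin \o (fun x => `|f x|)).
  apply/integrableP; split; first exact: measurable_funTS.
  under eq_integral do rewrite /= normr_id.
  exact: le_lt_trans fA (ltry _).
split => //; rewrite -lee_fin /Rintegral fineK//; exact: integrable_fin_num.
Qed.

(** The factor [|h - k| / k] is the error of the difference quotient of the test
    function; the shift of the profile costs its variation times [dx]. *)
Lemma flux_integral_near dx k h (v : R -> R) : 0 < dx -> majorant V p v ->
  0 <= h -> 0 < k -> `|h - k| <= dx ->
  `|flux_integral p k - flux_integral p h| <=
    2 * B * QM * fine (mu W) * (`|h - k| / k) + B * LQ * (3 * V) * dx.
Proof.
move=> dx0 [vnd vV pv] h0 k0 hk.
have mpa a : measurable_fun [set: TR] (fun x => p (x + a) : R).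
  exact: measurableT_comp mp (measurable_shift a).
have md : measurable_fun [set: TR] (fun x => p (x + k) - p (x + h) : R) by exact: measurable_funB.
have [id dc] : mu.-integrable W (EFin \o (fun x => `|p (x + k) - p (x + h)|)) /\
    \int[mu]_(x in W) `|p (x + k) - p (x + h)| <= dx * (3 * V).
  apply: le_Rintegral_norm => //.
  apply: (@majorant_integral _ (fun x => v (x + h))) => //.
  - by move=> x y xy; apply: vnd; rewrite lerD2r.
  move=> x; have := @majorant_shift _ V dx p v (x + h) (x + k) (And3 vnd vV pv).
  rewrite (_ : x + k - (x + h) = k - h); last by ring.
  by rewrite distrC => /(_ hk); rewrite [x + h + dx]addrAC [x + h - dx]addrAC.
rewrite /flux_integral -RintegralB//; [|exact: flux_integrable..].
pose c := 2 * B * (`|h - k| / k) * QM.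
have c0 : 0 <= c by rewrite mulr_ge0// mulr_ge0 ?mulr_ge0// invr_ge0 ltW.
have ic : mu.-integrable W (EFin \o (fun=> c)).
  by apply: (integrable_bounded (M := c)) => // x _; rewrite ger0_norm.
have iz : mu.-integrable W (EFin \o (fun x => B * LQ * `|p (x + k) - p (x + h)|)).
  by have := integrableZl mW (B * LQ) id; apply: eq_integrable.
apply: (@le_trans _ _ (\int[mu]_(x in W) (c + B * LQ * `|p (x + k) - p (x + h)|))).
  apply: le_norm_Rintegral => //.
  - by apply: measurable_funB; apply: measurable_funTS; exact: flux_slice.
  - by have := integrableD mW ic iz; apply: eq_integrable.
  move=> x _.
  have -> : dquot k x * Q (p x) (p (x + k)) - dquot h x * Q (p x) (p (x + h)) =
    (dquot k x - dquot h x) * Q (p x) (p (x + k)) +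
    dquot h x * (Q (p x) (p (x + k)) - Q (p x) (p (x + h))) by ring.
  rewrite (le_trans (ler_normD _ _))// [X in X + _]normrM [X in _ + X]normrM lerD//.
    by rewrite ler_pM// ?QB// dquot_diff.
  rewrite -mulrA ler_pM// ?dquot_bound//.
  by apply: le_trans (QL _ _ _ _) _; rewrite subrr normr0 add0r.
rewrite RintegralD// Rintegral_cst// RintegralZl//.
apply: lerD; first by rewrite /c le_eqVlt; apply/orP; left; apply/eqP; ring.
by rewrite -[leRHS]mulrA ler_wpM2l ?mulr_ge0// mulrC.
Qed.

(** The value at [k = 0] is free, as [weight 0] is small; the reconstructed term
    has its own treatment. *)
Definition grid_flux dx (k : nat) : R := if k is 0%N then 0 else flux_integral p (k%:R * dx).

Lemma flux_quadrature dx (v : R -> R) : 0 < dx -> majorant V p v ->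
  `|\sum_(0 <= k < (Num.truncn (delta / dx)).+2) grid_flux dx k * weight w dx k -
    \int[mu]_(h in D) (flux_integral p h * w h)| <=
  2 * B * QM * fine (mu W) * kmass delta w dx + B * LQ * (3 * V) * dx.
Proof.
move=> dx0 pv.
have V0 : 0 <= V by exact: le_trans (pV 0).
have m0 : 0 <= fine (mu W) by exact: fine_ge0.
have c0 : 0 <= 2 * B * QM * fine (mu W) by rewrite !mulr_ge0.
have e0 : 0 <= B * LQ * (3 * V) * dx by rewrite !mulr_ge0// ltW.
have [i _ _] := flux_fubini.
apply: (quadrature_error delta0 wK dx0 c0 e0 measurable_flux_integral) => // k h.
rewrite /= in_itv/= => /andP[h0 hd] hk; case: k hk => [|k] hk.
  rewrite mul0r subr0 in hk; rewrite /grid_flux sub0r normrN.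
  rewrite /cutoff ifT; last first.
    by move: hk; rewrite (ger0_norm h0); move: dx0; lra.
  rewrite mulr1 (le_trans (flux_integral_bound _))// (le_trans _ (_ : 2 * B * QM * fine (mu W) <= _))//.
    by rewrite ler_wpM2r// ler_wpM2r// ler_peMl// ler1n.
  by rewrite lerDl.
have k0 : 0 < k.+1%:R * dx by rewrite mulr_gt0.
rewrite /grid_flux (le_trans (flux_integral_near dx0 pv h0 k0 (ltW hk)))// lerD2r.
rewrite ler_wpM2l// (@le_trans _ _ (k.+1%:R^-1))//.
  rewrite ler_pdivrMr// mulKf ?pnatr_eq0//; exact: ltW.
apply: le_cutoff => //; rewrite ?invr_ge0// ?invf_le1 ?ler1n//.
rewrite ler_pdivrMl//.
move: hk; rewrite ltr_norml => /andP[_ hk].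
have : (1 : R) <= k.+1%:R by rewrite ler1n.
rewrite -(ler_pM2r dx0); move: hk; lra.
Qed.

End bounded_profile.

Lemma flux_integral_cvg (p : nat -> R -> R) (u : R -> R) h :
  (forall m, measurable_fun [set: TR] (p m : TR -> R)) -> (forall m x, `|p m x| <= V) ->
  measurable_fun [set: TR] (u : TR -> R) -> (forall x, `|u x| <= V) ->
  {ae mu, forall x, p m x @[m --> \oo] --> u x} ->
  flux_integral (p m) h @[m --> \oo] --> flux_integral u h.
Proof.
move=> mp pV mu_ uV pu.
have QM0 : 0 <= QM by exact: le_trans (QB (uV 0) (uV 0)).
have icst : mu.-integrable W (EFin \o (fun=> B * QM)).
  by apply: (integrable_bounded (M := B * QM)) => // x _; rewrite ger0_norm// mulr_ge0.
have cae : {ae mu, forall x, W x ->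
    dquot h x * Q (p m x) (p m (x + h)) @[m --> \oo] --> dquot h x * Q (u x) (u (x + h))}.
  have := ae_shift h pu; apply: (@filterS2 _ _ (ae_filter_ringOfSetsType mu) _ _ _ _ pu) => x c1 c2 _.
  by apply: cvgM; [exact: cvg_cst|exact: lipschitz2_cvg].
apply: (Rintegral_dominated_cvg mW _ _ icst cae _).2.
- by move=> m; apply: measurable_funTS; exact: flux_slice.
- by apply: measurable_funTS; exact: flux_slice.
- by move=> m x _; exact: (flux_integrand_bound (pV m) (x, h)).
Qed.

(** The quadrature error tends to 0, and the integral in [h] converges by
    dominated convergence. *)
Lemma grid_flux_cvg (dx : nat -> R) (p : nat -> R -> R) (u : R -> R) :
  (forall m, 0 < dx m) -> dx m @[m --> \oo] --> 0 ->
  (forall m, measurable_fun [set: TR] (p m : TR -> R)) -> (forall m x, `|p m x| <= V) ->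
  (forall m, exists v, majorant V (p m) v) ->
  measurable_fun [set: TR] (u : TR -> R) -> (forall x, `|u x| <= V) ->
  {ae mu, forall x, p m x @[m --> \oo] --> u x} ->
  \sum_(0 <= k < (Num.truncn (delta / dx m)).+2) grid_flux (p m) (dx m) k * weight w (dx m) k
    @[m --> \oo] -->
  \int[mu]_x \int[mu]_(h in D) (dquot h x * Q (u x) (u (x + h)) * w h).
Proof.
move=> dx0 dxc mp pV pmaj mu_ uV pu.
have QM0 : 0 <= QM by exact: le_trans (QB (uV 0) (uV 0)).
have [_ _ ->] := flux_fubini mu_ uV.
have cI : \int[mu]_(h in D) (flux_integral (p m) h * w h) @[m --> \oo] -->
    \int[mu]_(h in D) (flux_integral u h * w h).
  pose c := B * QM * fine (mu W).
  have ic : mu.-integrable D (EFin \o (fun h => c * w h)).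
    by have := integrableZl mD c (kernel_integrable wK); apply: eq_integrable.
  have mw : measurable_fun D (w : TR -> R).
    by apply/measurable_EFinP; exact: measurable_int (kernel_integrable wK).
  apply: (Rintegral_dominated_cvg mD _ _ ic _ _).2.
  - by move=> m; apply: measurable_funM => //; exact: measurable_flux_integral.
  - by apply: measurable_funM => //; exact: measurable_flux_integral.
  - apply: aeW => h _; apply: cvgM; [exact: flux_integral_cvg|exact: cvg_cst].
  - move=> m h _; rewrite normrM (ger0_norm (kernel_ge0 wK h)) ler_wpM2r ?(kernel_ge0 wK)//.
    exact: flux_integral_bound.
set S := fun m => \sum_(0 <= k < _) _.
set I := fun m => \int[mu]_(h in D) (flux_integral (p m) h * w h) in cI.
rewrite -[X in _ --> X](add0r _).
have -> : S = (fun m => (S m - I m) + I m) by apply/funext => m; rewrite subrK.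
apply: cvgD => //.
apply/norm_cvg0P.
apply: (@squeeze_cvgr _ _ _ _ (cst 0) (fun m => 2 * B * QM * fine (mu W) * kmass delta w (dx m) + B * LQ * (3 * V) * dx m)).
- apply: nearW => m; rewrite normr_ge0/=; have [v vP] := pmaj m.
  exact: flux_quadrature vP.
- exact: cvg_cst.
- rewrite -[X in _ --> X]addr0; apply: cvgD.
    rewrite -[X in _ --> X](mulr0 (2 * B * QM * fine (mu W))).
    by apply: cvgM; [exact: cvg_cst|exact: kmass_cvg0].
  rewrite -[X in _ --> X](mulr0 (B * LQ * (3 * V))).
  by apply: cvgM; [exact: cvg_cst|].
Qed.

End flux_limit.

(** * Test functions *)

Section tame_functions.
Context {R : realType}.
Local Notation TR := (measurableTypeR R).

(** The properties of a test function on which the passage to the limit rests.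
    The bound [T'] leaves room for one time step before [T]. *)
Record tame (N B T' : R) (phi : R -> R -> R) : Prop := Tame {
  tame_measurable : measurable_fun [set: TR * TR] (fun z : TR * TR => phi z.1 z.2 : R);
  tame_support : forall x t, N < `|x| -> phi x t = 0;
  tame_late : forall x t, T' <= t -> phi x t = 0;
  tame_bound : forall x t, `|phi x t| <= B;
  tame_lipx : forall x y t, `|phi x t - phi y t| <= B * `|x - y|;
  tame_lipt : forall x s t, `|phi x s - phi x t| <= B * `|s - t|;
  tame_derivable : forall x t, derivable (phi x) t 1 }.

Lemma compact_norm_bound (K : set (R * R)) (f : R * R -> R) : compact K -> continuous f ->
  exists2 B, 0 <= B & forall z, K z -> `|f z| <= B.
Proof.
move=> cK cf; have [->|/set0P K0] := eqVneq K set0; first by exists 0.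
have cf' : {within K, continuous (fun z => `|f z|)}.
  apply: continuous_subspaceT => z; apply: continuous_comp; first exact: cf.
  exact: norm_continuous.
have [c _ cmax] := compact_EVT_max K0 cK cf'.
by exists `|f c| => // z Kz; apply: cmax; rewrite inE.
Qed.

Lemma derive_bound_lipschitz (f : R -> R) (B : R) : (forall x, derivable f x 1) ->
  (forall x, `|derive1 f x| <= B) -> forall x y, `|f x - f y| <= B * `|x - y|.
Proof.
move=> df fB.
have H a b : a <= b -> `|f b - f a| <= B * `|b - a|.
  move=> ab.
  have [||c _ ->] := @MVT_segment R f (fun x => derive1 f x) a b ab.
  - by move=> x _; rewrite derive1E; apply: DeriveDef => //; exact: df.
  - apply: continuous_subspaceT => x.
    by apply: differentiable_continuous; apply/derivable1_diffP; exact: df.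
  by rewrite normrM ler_wpM2r.
move=> x y; have [xy|/ltW yx] := leP x y; last exact: H.
by rewrite distrC [X in _ * X]distrC H.
Qed.

Lemma test_function_tame (T : R) (phi : R -> R -> R) : test_function T phi ->
  exists N B T', [/\ 0 <= N, 0 <= B, T' < T & tame N B T' phi].
Proof.
case=> phiC; set K := closure _ => cK KT.
have [c0 [dx dt [cx _] [ct _]]] := phiC 1%N.
have out x t : ~ K (x, t) -> phi x t = 0.
  by move=> nK; apply/eqP; apply: contra_notT nK => h; apply: subset_closure.
have nout x t : ~ K (x, t) -> \forall z \near (x, t), phi z.1 z.2 = 0.
  move=> nK.
  have oK : open (~` K) by apply: closed_openC; exact: closed_closure.
  have := open_nbhs_nbhs (conj oK nK : open_nbhs (x, t) (~` K)).
  by apply: filterS => -[a b] /out.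
have xout x t : ~ K (x, t) -> partial_x phi x t = 0.
  move=> /nout n0; rewrite /partial_x derive1E.
  rewrite (near_eq_derive (g := cst 0)) ?derive_cst//.
  have c : (y, t) @[y --> x] --> (x, t)
    by apply: (@cvg_pair _ _ _ _ (nbhs x) (nbhs t)); [exact: cvg_id|exact: cvg_cst].
  exact: c _ n0.
have tout x t : ~ K (x, t) -> partial_t phi x t = 0.
  move=> /nout n0; rewrite /partial_t derive1E.
  rewrite (near_eq_derive (g := cst 0)) ?derive_cst//.
  have c : (x, y) @[y --> t] --> (x, t)
    by apply: (@cvg_pair _ _ _ _ (nbhs x) (nbhs t)); [exact: cvg_cst|exact: cvg_id].
  exact: c _ n0.
have cfst : continuous (fst : R * R -> R) by move=> z; exact: cvg_fst.
have csnd : continuous (snd : R * R -> R) by move=> z; exact: cvg_snd.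
have [N N0 NP] := compact_norm_bound cK cfst.
have [B1 B10 B1P] := compact_norm_bound cK c0.
have [B2 B20 B2P] := compact_norm_bound cK cx.
have [B3 B30 B3P] := compact_norm_bound cK ct.
have [T' T'T T'P] : exists2 T', T' < T & forall z, K z -> z.2 < T'.
  have [K0|/set0P K0] := eqVneq K set0; first by exists (T - 1); [lra|rewrite K0].
  have [c /set_mem Kc cmax] := @compact_EVT_max _ R snd K K0 cK
    (continuous_subspaceT csnd).
  exists ((c.2 + T) / 2); first by have := KT _ Kc; rewrite /=; lra.
  move=> z Kz; have := cmax z (mem_set Kz); have := KT _ Kc; rewrite /=; lra.
exists N, (B1 + B2 + B3), T'; split => //; first by rewrite !addr_ge0.
have bd (f : R -> R -> R) b : (forall x t, ~ K (x, t) -> f x t = 0) -> 0 <= b ->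
    (forall z, K z -> `|f z.1 z.2| <= b) -> b <= B1 + B2 + B3 ->
    forall x t, `|f x t| <= B1 + B2 + B3.
  move=> f0 b0 fb bB x t; have [Kz|nK] := pselect (K (x, t)).
    exact: le_trans (fb _ Kz) bB.
  by rewrite f0// normr0 !addr_ge0.
split => //.
- exact: continuous_measurable2.
- move=> x t Nx; apply: out => Kz; have := NP _ Kz; rewrite /= leNgt Nx//.
- by move=> x t tT; apply: out => Kz; have := T'P _ Kz; rewrite /= ltNge tT.
- by apply: bd B1P _ => //; rewrite -addrA lerDl addr_ge0.
- move=> x y t; apply: (derive_bound_lipschitz (f := phi^~ t)) => // z.
  by apply: (bd (partial_x phi)) B2P _ z t => //; rewrite addrAC lerDr addr_ge0.
- move=> x s t; apply: (derive_bound_lipschitz (f := phi x)) => // z.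
  by apply: (bd (partial_t phi)) B3P _ x z => //; rewrite lerDr addr_ge0.
Qed.

Lemma partial_t_support N B T' phi x t : tame N B T' phi -> N < `|x| -> partial_t phi x t = 0.
Proof.
move=> tm Nx; rewrite /partial_t (_ : phi x = cst 0) ?derive1_cst//.
by apply/funext => s; rewrite (tame_support tm).
Qed.

Lemma left_quotient_cvg (f : R -> R) t (e : nat -> R) : derivable f t 1 ->
  (forall m, 0 < e m) -> e m @[m --> \oo] --> 0 ->
  (f t - f (t - e m)) / e m @[m --> \oo] --> derive1 f t.
Proof.
move=> d e0 ec.
have {}d : (h^-1 *: (f (h *: 1 + t) - f t)) @[h --> 0^'] --> derive1 f t.
  by rewrite derive1E; exact: d.
have ne : - e m @[m --> \oo] --> 0^'.
  move=> A hA; have {}hA : nbhs (0 : R) (fun y => y != 0 -> A y) by exact: hA.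
  have : - e m @[m --> \oo] --> (0 : R) by rewrite -oppr0; exact: cvgN.
  move=> /(_ _ hA)[M _ MP]; exists M => // m Mm; apply: (MP m Mm).
  by rewrite oppr_eq0 gt_eqF.
have := cvg_comp _ _ ne d; apply: cvg_trans; apply: near_eq_cvg; apply: nearW => m /=.
rewrite /GRing.scale/= mulr1 invrN mulNr -mulrN opprB.
by rewrite mulrC [- e m + t]addrC.
Qed.

Lemma partial_t_cvg N B T' phi x t (e : nat -> R) : tame N B T' phi ->
  (forall m, 0 < e m) -> e m @[m --> \oo] --> 0 ->
  (phi x t - phi x (t - e m)) / e m @[m --> \oo] --> partial_t phi x t.
Proof. by move=> tm; apply: left_quotient_cvg; exact: tame_derivable tm _ _. Qed.

End tame_functions.

(** * Consistency *)

Section slices.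
Context {R : realType}.
Local Notation mu := (@lebesgue_measure R).
Local Notation TR := (measurableTypeR R).
Variables (N c : R) (F : TR * TR -> R).
Hypotheses (N0 : 0 <= N) (mF : measurable_fun setT F) (Fc : forall z, `|F z| <= c).
Hypothesis F0 : forall x t, N < `|x| -> F (x, t) = 0.

Let Woo : (mu (window N : set TR) < +oo)%E.
Proof. by rewrite window_measure// ltry. Qed.

Let mW : measurable (window N : set TR).
Proof. exact: measurable_window. Qed.

Let c0 : 0 <= c.
Proof. exact: le_trans (Fc (0, 0)). Qed.

Let icst : mu.-integrable (window N : set TR) (EFin \o (fun=> c)).
Proof. by apply: (integrable_bounded (M := c)) => // x _; rewrite ger0_norm. Qed.

Let patchF t : (fun x => F (x, t)) \_ (window N) = (fun x => F (x, t)).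
Proof.
apply/funext => x; rewrite patchE; case: ifPn => // /negP xW; rewrite F0//.
by rewrite ltNge; apply/negP => h; apply: xW; rewrite inE /window/= in_itv/= -ler_norml.
Qed.

Lemma slice_window t : \int[mu]_x F (x, t) = \int[mu]_(x in window N) F (x, t).
Proof. by rewrite [RHS]Rintegral_mkcond patchF. Qed.

Let mFt t : measurable_fun [set: TR] (fun x => F (x, t)).
Proof. exact: measurable_fun_pair1. Qed.

Lemma slice_integrable t : mu.-integrable setT (EFin \o (fun x => F (x, t))).
Proof.
have : mu.-integrable (window N : set TR) (EFin \o (fun x => F (x, t))).
  by apply: (integrable_bounded (M := c)) => //; exact: measurable_funTS.
by move/(integrable_mkcond _ mW); rewrite restrict_EFin patchF.
Qed.

Lemma slice_integral_bound t : `|\int[mu]_x F (x, t)| <= c * fine (mu (window N)).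
Proof.
rewrite slice_window -(Rintegral_cst mu mW); apply: le_norm_Rintegral => //.
exact: measurable_funTS.
Qed.

(** Fubini's theorem with the weight 1. *)
Lemma measurable_slice_integral (E : set TR) : measurable E -> (mu E < +oo)%E ->
  measurable_fun E (fun t => \int[mu]_x F (x, t) : R).
Proof.
move=> mE Eoo.
have c1 : mu.-integrable E (EFin \o (fun=> 1 : R)).
  by apply: (integrable_bounded (M := 1)) => // x _; rewrite normr1.
have [i1 _ _] := Rintegral_fubini_box (m1 := mu) (m2 := mu) mW Woo mE mF c1 c0
   (fun x y _ _ => Fc (x, y)).
have /measurable_EFinP := measurable_int _ i1.
by apply: eq_measurable_fun => h _; rewrite slice_window mulr1.
Qed.

Lemma slice_integral_integrable (E : set TR) : measurable E -> (mu E < +oo)%E ->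
  mu.-integrable E (EFin \o (fun t => \int[mu]_x F (x, t) : R)).
Proof.
move=> mE Eoo; apply: (integrable_bounded (M := c * fine (mu (window N)))) => //.
  exact: measurable_slice_integral.
by move=> t _; exact: slice_integral_bound.
Qed.

End slices.

(** One time step, tested against [phi]: summation by parts in space and time
    moves the differences onto the test function. *)
Section tested_step.
Context {R : realType}.
Local Notation mu := (@lebesgue_measure R).
Local Notation TR := (measurableTypeR R).
Variables (T delta lambda : R) (w : R -> R).
Hypotheses (T0 : 0 < T) (delta0 : 0 < delta) (wK : nonlocal_kernel delta w).
Variables (Q : R -> R -> R) (eta : R -> R) (L V : R).
Hypotheses (L0 : 0 <= L).
Hypothesis QL : forall a b a' b', `|Q a b - Q a' b'| <= L * (`|a - a'| + `|b - b'|).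
Hypothesis etaL : forall a b, `|eta a - eta b| <= L * `|a - b|.
Variables (phi : R -> R -> R) (N B T' : R).
Hypotheses (N0 : 0 <= N) (B0 : 0 <= B) (phiT : tame N B T' phi) (T'T : T' < T).

Definition sup_bound : R := `|Q 0 0| + `|eta 0| + L * (V + V).

Lemma Q_sup a b : `|a| <= V -> `|b| <= V -> `|Q a b| <= sup_bound.
Proof.
move=> aV bV; rewrite -[Q a b](subrK (Q 0 0)) (le_trans (ler_normD _ _))//.
rewrite addrC /sup_bound -addrA lerD2l; apply: le_trans (QL _ _ _ _) _; rewrite !subr0.
by rewrite (le_trans (ler_wpM2l L0 (lerD aV bV)))// lerDr.
Qed.

Lemma eta_sup a : `|a| <= V -> `|eta a| <= sup_bound.
Proof.
move=> aV; have V0 : 0 <= V by exact: le_trans aV.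
rewrite -[eta a](subrK (eta 0)) (le_trans (ler_normD _ _))//.
rewrite addrC /sup_bound [`|Q 0 0| + _]addrC -addrA lerD2l; apply: le_trans (etaL _ _) _; rewrite subr0.
rewrite (le_trans (ler_wpM2l L0 aV))// mulrDr addrCA lerDl.
by rewrite addr_ge0// mulr_ge0.
Qed.

Lemma eta_cvg (I : Type) (F : set_system I) {FF : Filter F} (a : I -> R) (x : R) :
  a i @[i --> F] --> x -> eta (a i) @[i --> F] --> eta x.
Proof.
move=> c1; apply/cvgrPdist_le => e e0.
have e1 : 0 < e / (L + 1) by rewrite divr_gt0// ltr_pwDr.
move/cvgrPdist_le : c1 => /(_ _ e1).
apply: filterS => i h1; apply: le_trans (etaL _ _) _.
rewrite (le_trans (ler_wpM2l L0 h1))// mulrCA -[leRHS]mulr1 ler_wpM2l ?(ltW e0)//.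
by rewrite ler_pdivrMr ?ltr_pwDr// mul1r lerDl.
Qed.

Lemma eta_measurable d (X : measurableType d) (a : X -> R) : measurable_fun setT a ->
  measurable_fun setT (fun x => eta (a x)).
Proof.
move=> ma; apply: (@measurableT_comp _ _ _ _ _ _ (eta : TR -> R)) => //.
by apply: continuous_measurable_fun => x; apply: eta_cvg; exact: cvg_id.
Qed.

Section step.
Variables (dx dt : R) (p : R -> R -> R).
Hypotheses (dx0 : 0 < dx) (dx1 : dx <= 1) (lam0 : 0 < lambda) (dtE : dt = lambda * dx).
Hypothesis mp : measurable_fun [set: TR * TR] (fun z : TR * TR => p z.1 z.2 : R).
Hypothesis pV : forall x t, `|p x t| <= V.

Local Notation r := (Num.truncn (delta / dx)).+1.

(** The residual of one step for the pair of an entropy [eta] and an entropy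
    flux [Q]; the identity and [g] give the scheme itself. *)
Definition defect x t : R := eta (p x (t + dt)) - eta (p x t) +
  \sum_(0 <= k < r) step_weight w lambda dx k.+1 *
   (Q (p x t) (p (x + k.+1%:R * dx) t) - Q (p (x - k.+1%:R * dx) t) (p x t)).

Definition tested s t : R := \int[mu]_x (phi x s * eta (p x t)).

Definition tested_flux t : R := \sum_(0 <= k < r.+1)
  grid_flux delta Q (phi ^~ t) N (p ^~ t) dx k * weight w dx k.

Let SB := sup_bound.

Let V0 : 0 <= V.
Proof. exact: le_trans (pV 0 0). Qed.

Let SB0 : 0 <= SB.
Proof. exact: le_trans (eta_sup (pV 0 0)). Qed.

Let dt0 : 0 < dt.
Proof. by rewrite dtE mulr_gt0. Qed.

Let mshift (a b : R) (f : R -> R -> R) :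
  measurable_fun [set: TR * TR] (fun z : TR * TR => f z.1 z.2 : R) ->
  measurable_fun [set: TR * TR] (fun z : TR * TR => f (z.1 + a) (z.2 + b) : R).
Proof.
move=> mf.
have ms : measurable_fun [set: TR * TR] (fun z : TR * TR => ((z.1 + a : TR), (z.2 + b : TR))).
  apply: measurable_fun_pair.
    exact: measurableT_comp (measurable_shift a) measurable_fst.
  exact: measurableT_comp (measurable_shift b) measurable_snd.
exact: (@measurableT_comp _ _ _ _ _ _ (fun z : TR * TR => f z.1 z.2 : R) setT _ mf ms).
Qed.

Let mtested s t : measurable_fun [set: TR * TR]
  (fun z : TR * TR => phi z.1 (z.2 + s) * eta (p z.1 (z.2 + t)) : R).
Proof.
apply: measurable_funM.
  have := mshift 0 s (tame_measurable phiT); apply: eq_measurable_fun => z _ /=.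
  by rewrite addr0.
apply: eta_measurable; have := mshift 0 t mp; apply: eq_measurable_fun => z _ /=.
by rewrite addr0.
Qed.

Let btested s t z : `|phi z.1 (z.2 + s) * eta (p z.1 (z.2 + t))| <= B * SB.
Proof. by rewrite normrM ler_pM// ?(tame_bound phiT)// eta_sup. Qed.

Let ztested s t x y : N < `|x| -> phi x (y + s) * eta (p x (y + t)) = 0.
Proof. by move=> Nx; rewrite (tame_support phiT)// mul0r. Qed.

Lemma tested_shift_integrable s t (E : set TR) : measurable E -> (mu E < +oo)%E ->
  mu.-integrable E (EFin \o (fun y => tested (y + s) (y + t))).
Proof.
exact: (slice_integral_integrable N0 (mtested s t) (btested s t) (@ztested s t)).
Qed.

(** A translation of the integration variable in the terms with index [j - k]
    moves the difference onto [phi]. *)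
Lemma space_defect t :
  mu.-integrable setT (EFin \o (fun x => phi x t * defect x t)) /\
  \int[mu]_x (phi x t * defect x t) =
  tested t (t + dt) - tested t t - dt * tested_flux t.
Proof.
have I1 s : mu.-integrable setT (EFin \o (fun x => phi x t * eta (p x (t + s)))).
  have := slice_integrable N0 (mtested 0 s) (btested 0 s) (@ztested 0 s) t.
  by apply: eq_integrable => // x _ /=; rewrite addr0.
pose h k : R := k.+1%:R * dx.
have h0 k : 0 < h k by rewrite mulr_gt0.
have mpt a : measurable_fun [set: TR] (fun x => p (x + a) t : R).
  have := measurable_fun_pair1 t (mshift a 0 mp).
  by apply: eq_measurable_fun => x _ /=; rewrite addr0.
have mphit a : measurable_fun [set: TR] (fun x => phi (x + a) t : R).
  have := measurable_fun_pair1 t (mshift a 0 (tame_measurable phiT)).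
  by apply: eq_measurable_fun => x _ /=; rewrite addr0.
have Qm a b : measurable_fun [set: TR] (fun x => Q (p (x + a) t) (p (x + b) t)).
  by apply: (Q_measurable L0 QL).
have I2 a b c : mu.-integrable setT (EFin \o (fun x => phi (x + a) t * Q (p (x + b) t) (p (x + c) t))).
  have mF : measurable_fun [set: TR * TR]
      (fun z : TR * TR => phi (z.1 + a) t * Q (p (z.1 + b) t) (p (z.1 + c) t) : R).
    apply: measurable_funM; first exact: measurableT_comp (mphit a) measurable_fst.
    exact: measurableT_comp (Qm b c) measurable_fst.
  apply: (@slice_integrable _ (N + `|a|) (B * SB) _ _ mF _ _ 0).
  - by rewrite addr_ge0.
  - by move=> z; rewrite normrM ler_pM// ?(tame_bound phiT)// Q_sup.
  - move=> x _ /= Nx; rewrite (tame_support phiT) ?mul0r//.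
    by have := ler_normB (x + a) a; rewrite addrK; move: Nx; lra.
pose A k x := phi x t * Q (p x t) (p (x + h k) t).
pose A' k x := phi (x + h k) t * Q (p x t) (p (x + h k) t).
pose A'' k x := phi x t * Q (p (x - h k) t) (p x t).
have IA k : mu.-integrable setT (EFin \o A k).
  by have := I2 0 0 (h k); apply: eq_integrable => // x _; rewrite /A/= !addr0.
have IA' k : mu.-integrable setT (EFin \o A' k).
  by have := I2 (h k) 0 (h k); apply: eq_integrable => // x _; rewrite /A'/= !addr0.
have IA'' k : mu.-integrable setT (EFin \o A'' k).
  by have := I2 0 (- h k) 0; apply: eq_integrable => // x _; rewrite /A''/= !addr0.
have IAA k : mu.-integrable setT (EFin \o (fun x => A k x - A'' k x)).
  by have := integrableB measurableT (IA k) (IA'' k); apply: eq_integrable.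
pose a k := step_weight w lambda dx k.+1.
have IaAA k : mu.-integrable setT (EFin \o (fun x => a k * (A k x - A'' k x))).
  by have := integrableZl measurableT (a k) (IAA k); apply: eq_integrable.
have IS : mu.-integrable setT (EFin \o (fun x => \sum_(0 <= k < r) a k * (A k x - A'' k x))).
  have := @integrable_sum _ _ _ mu _ measurableT _ (index_iota 0 r) predT _ (fun k _ => IaAA k).
  by apply: eq_integrable => // x _; rewrite /= sumEFin.
have flux k : (k < r)%N -> \int[mu]_x (a k * (A k x - A'' k x)) =
    - (dt * (grid_flux delta Q (phi ^~ t) N (p ^~ t) dx k.+1 * weight w dx k.+1)).
  move=> kr; rewrite RintegralZl// RintegralB//.
  have -> : \int[mu]_x A'' k x = \int[mu]_x A' k x.
    have mA : measurable_fun [set: TR] (A'' k : TR -> R).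
      by apply/measurable_EFinP; exact: measurable_int (IA'' k).
    rewrite -(Rintegral_shift (h k) mA).
    by apply: eq_Rintegral => x _; rewrite /A'' /A' addrK.
  rewrite -RintegralB//.
  pose F (z : TR * TR) := dquot (phi ^~ t) (h k) z.1 * Q (p z.1 t) (p (z.1 + h k) t).
  have mp' : measurable_fun [set: TR] (p ^~ t : TR -> R) by exact: measurable_fun_pair1 mp.
  have hk1 : `|h k| <= delta + 1.
    rewrite ger0_norm ?(ltW (h0 k))// /h.
    have : k%:R * dx <= delta.
      rewrite -ler_pdivlMr// -Num.Theory.truncn_ge_nat ?divr_ge0 ?(ltW delta0) ?(ltW dx0)//.
    by rewrite -natr1 mulrDl mul1r; move: dx1; lra.
  have dq x : `|dquot (phi ^~ t) (h k) x| <= B.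
    by apply: dquot_bound => // u v; exact: tame_lipx phiT _ _ _.
  have mF : measurable_fun setT F.
    apply: measurable_funM; last first.
      have := Qm 0 (h k) => m; have := measurableT_comp m (@measurable_fst _ _ TR TR).
      by apply: eq_measurable_fun => z _ /=; rewrite addr0.
    apply: measurable_funM => //; apply: measurable_funB.
      exact: measurableT_comp (mphit (h k)) measurable_fst.
    have := measurableT_comp (mphit 0) (@measurable_fst _ _ TR TR).
    by apply: eq_measurable_fun => z _ /=; rewrite addr0.
  have Fb z : `|F z| <= B * SB by rewrite normrM ler_pM// Q_sup.
  have F0 x y : N + (delta + 1) < `|x| -> F (x, y) = 0.
    move=> Nx; rewrite /F/= (dquot_support delta0 (N := N)) ?mul0r//.
    by move=> u; exact: (@tame_support _ _ _ _ _ phiT u t).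
  have Nd : 0 <= N + (delta + 1) by rewrite !addr_ge0// ltW.
  have iF := slice_integrable Nd mF Fb F0 0.
  rewrite (_ : \int[mu]_x (A k x - A' k x) = - h k * flux_integral delta Q (phi ^~ t) N (p ^~ t) (h k)).
    rewrite /a /step_weight /= dtE /h.
    have : k.+1%:R != 0 :> R by rewrite pnatr_eq0.
    move: (k.+1%:R : R) (flux_integral _ _ _ _ _ _) => n i n0.
    by field.
  rewrite /flux_integral -(slice_window F0 0) -RintegralZl//.
  apply: eq_Rintegral => x _; rewrite /A /A' /F /dquot /=.
  by field; rewrite gt_eqF.
have ID : mu.-integrable setT (EFin \o (fun x => phi x t * eta (p x (t + dt)) - phi x t * eta (p x t))).
  have J0 := I1 0; rewrite addr0 in J0.
  by have := integrableB measurableT (I1 dt) J0; apply: eq_integrable.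
have -> : (fun x => phi x t * defect x t) = (fun x =>
    (phi x t * eta (p x (t + dt)) - phi x t * eta (p x t)) +
    \sum_(0 <= k < r) a k * (A k x - A'' k x)).
  apply/funext => x; rewrite /defect mulrDr mulrBr; congr (_ + _).
  by rewrite mulr_sumr; apply: eq_bigr => k _; rewrite mulrCA mulrBr.
split; first by have := integrableD measurableT ID IS; apply: eq_integrable.
rewrite RintegralD// RintegralB//; last by have := I1 0; rewrite addr0.
congr (_ + _); rewrite Rintegral_sum//.
rewrite /tested_flux [in RHS]big_nat_recl// [X in _ = - (_ * (X * _ + _))](_ : _ = 0)//.
rewrite mul0r add0r mulr_sumr -sumrN.
by rewrite big_nat_cond [RHS]big_nat_cond; apply: eq_bigr => k /andP[/andP[_ kr] _]; rewrite flux.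
Qed.

Lemma measurable_flux_time h (E : set TR) : measurable E -> (mu E < +oo)%E ->
  measurable_fun E (fun t => flux_integral delta Q (phi ^~ t) N (p ^~ t) h : R).
Proof.
move=> mE Eoo; have Nd : 0 <= N + (delta + 1) by rewrite !addr_ge0// ltW.
have c1 : mu.-integrable E (EFin \o (fun=> 1 : R)).
  by apply: (integrable_bounded (M := 1)) => // x _; rewrite normr1.
pose F (z : TR * TR) := dquot (phi ^~ z.2) h z.1 * Q (p z.1 z.2) (p (z.1 + h) z.2).
have sh f : measurable_fun [set: TR * TR] (fun z : TR * TR => f z.1 z.2 : R) ->
    measurable_fun [set: TR * TR] (fun z : TR * TR => f (z.1 + h) z.2 : R).
  by move=> mf; have := mshift h 0 mf; apply: eq_measurable_fun => z _ /=; rewrite addr0.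
have mF : measurable_fun setT F.
  apply: measurable_funM.
    apply: measurable_funM => //; apply: measurable_funB; last exact: tame_measurable phiT.
    exact: sh (tame_measurable phiT).
  by apply: (Q_measurable L0 QL) => //; exact: sh.
have Fb x t : `|F (x, t)| <= B * SB.
  rewrite normrM ler_pM// ?Q_sup//; apply: dquot_bound => // u v.
  exact: tame_lipx phiT _ _ _.
have mW : measurable (window (N + (delta + 1)) : set TR) by exact: measurable_window.
have Woo : (mu (window (N + (delta + 1)) : set TR) < +oo)%E by rewrite window_measure// ltry.
have [i1 _ _] := Rintegral_fubini_box (m1 := mu) (m2 := mu) mW Woo mE mF c1 (mulr_ge0 B0 SB0)
   (fun x y _ _ => Fb x y).
have /measurable_EFinP := measurable_int _ i1.
by apply: eq_measurable_fun => t _; rewrite mulr1.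
Qed.

Lemma measurable_tested_flux (E : set TR) : measurable E -> (mu E < +oo)%E ->
  measurable_fun E (tested_flux : TR -> R).
Proof.
move=> mE Eoo; apply: measurable_sum => -[|k]; apply: measurable_funM => //.
exact: measurable_flux_time.
Qed.

Lemma tested_flux_bound t : `|tested_flux t| <= B * SB * fine (mu (window (N + (delta + 1)))).
Proof.
set c := _ * fine _.
have c0 : 0 <= c by rewrite !mulr_ge0// fine_ge0.
rewrite /tested_flux (le_trans (ler_norm_sum _ _ _))//.
rewrite -[leRHS]mulr1 -(weight_sum delta0 wK dx0) mulr_sumr; apply: ler_sum => k _.
rewrite normrM (ger0_norm (weight_ge0 wK _ dx0)) ler_wpM2r ?(weight_ge0 wK)//.
case: k => [|k]; first by rewrite /grid_flux normr0.
have mp' : measurable_fun [set: TR] (p ^~ t : TR -> R) by exact: measurable_fun_pair1 mp.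
have mphi' : measurable_fun [set: TR] (phi ^~ t : TR -> R).
  exact: measurable_fun_pair1 (tame_measurable phiT).
apply: (flux_integral_bound delta0 L0 QL (V := V)) => //; first exact: Q_sup.
by move=> x y; exact: tame_lipx phiT _ _ _.
Qed.

Lemma tested_flux_integrable (E : set TR) : measurable E -> (mu E < +oo)%E ->
  mu.-integrable E (EFin \o tested_flux).
Proof.
move=> mE Eoo; apply: (integrable_bounded (M := B * SB * fine (mu (window (N + (delta + 1)))))) => //.
  exact: measurable_tested_flux.
by move=> t _; exact: tested_flux_bound.
Qed.

(** Summation by parts in time leaves a layer of width [dt] at the initial time,
    and no layer at [T] because [phi] vanishes there. *)
Lemma time_defect : dt <= T - T' -> dt <= T ->
  mu.-integrable (`[0, T[%classic : set TR) (EFin \o (fun t => \int[mu]_x (phi x t * defect x t))) /\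
  \int[mu]_(t in `[0, T[) \int[mu]_x (phi x t * defect x t) =
  - (dt * (\int[mu]_(t in `[0, T[) ((tested t t - tested (t - dt) t) / dt) +
     dt^-1 * \int[mu]_(t in `[0, dt[) tested (t - dt) t +
     \int[mu]_(t in `[0, T[) tested_flux t)).
Proof.
move=> dtT' dtT.
have mI (b c : itv_bound R) : measurable ([set` Interval b c] : set TR) by exact: measurable_itv.
have Ioo (c : R) : 0 < c -> (mu (`[0%R, c[%classic : set TR) < +oo)%E.
  by move=> c0; rewrite lebesgue_measure_itv/= lte_fin c0 -EFinB ltry.
have i2 : mu.-integrable (`[0, T[ : set TR) (EFin \o (fun t => tested t t)).
  have := tested_shift_integrable 0 0 (mI _ _) (Ioo _ T0).
  by apply: eq_integrable => // t _; rewrite /= addr0.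
have i1 : mu.-integrable (`[0, T[ : set TR) (EFin \o (fun t => tested t (t + dt))).
  have := tested_shift_integrable 0 dt (mI _ _) (Ioo _ T0).
  by apply: eq_integrable => // t _; rewrite /= addr0.
have i3 c : 0 < c -> mu.-integrable (`[0, c[ : set TR) (EFin \o (fun t => tested (t - dt) t)).
  move=> c0; have := tested_shift_integrable (- dt) 0 (mI _ _) (Ioo _ c0).
  by apply: eq_integrable => // t _; rewrite /= addr0.
have iS : mu.-integrable (`[0, T[ : set TR) (EFin \o tested_flux).
  by apply: tested_flux_integrable => //; exact: Ioo.
have -> : (fun t => \int[mu]_x (phi x t * defect x t)) =
    (fun t => tested t (t + dt) - tested t t - dt * tested_flux t).
  by apply/funext => t; exact: (space_defect t).2.
have i12 : mu.-integrable (`[0, T[ : set TR) (EFin \o (fun t => tested t (t + dt) - tested t t)).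
  by have := integrableB (mI _ _) i1 i2; apply: eq_integrable.
have iS' : mu.-integrable (`[0, T[ : set TR) (EFin \o (fun t => dt * tested_flux t)).
  by have := integrableZl (mI _ _) dt iS; apply: eq_integrable.
split; first by have := integrableB (mI _ _) i12 iS'; apply: eq_integrable.
rewrite RintegralB// RintegralB// RintegralZl//.
have shiftE : \int[mu]_(t in `[0, T[) tested t (t + dt) = \int[mu]_(t in `[dt, T[) tested (t - dt) t.
  rewrite [LHS]Rintegral_mkcond [RHS]Rintegral_mkcond.
  rewrite -[RHS](Rintegral_shift dt).
    apply: eq_Rintegral => t _; rewrite !patchE addrK !mem_setE !in_itv/=.
    rewrite -[X in X <= t + dt]add0r lerD2r; case: (leP 0 t) => //= t0.
    case: (ltP (t + dt) T) => h1; case: (ltP t T) => // h2.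
      by exfalso; have := dt0; move: h1 h2; lra.
    apply: Rintegral_eq0 => x _; rewrite (tame_late phiT) ?mul0r//.
    by move: h1 dtT'; lra.
  apply/(measurable_restrict _ _ _) => //; rewrite setTI.
  have := i3 _ T0 => /measurable_int/measurable_EFinP; apply: measurable_funS => //.
  move=> t /=; rewrite !in_itv/= => /andP[h1 ->]; rewrite andbT.
  exact: le_trans (ltW dt0) h1.
have i23 : mu.-integrable (`[0, T[ : set TR) (EFin \o (fun t => tested t t - tested (t - dt) t)).
  by have := integrableB (mI _ _) i2 (i3 _ T0); apply: eq_integrable.
have splitE : \int[mu]_(t in `[0, T[) tested (t - dt) t =
    \int[mu]_(t in `[0, dt[) tested (t - dt) t + \int[mu]_(t in `[dt, T[) tested (t - dt) t.
  have E : (`[0, T[%classic : set TR) = `[0, dt[%classic `|` `[dt, T[%classic.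
    apply/seteqP; split => t /=; rewrite !in_itv/=.
      by move=> /andP[h1 h2]; case: (ltP t dt) => h3; [left|right]; rewrite ?h1 ?h2.
    move=> [/andP[h1 h2]|/andP[h1 h2]].
      by rewrite h1 (lt_le_trans h2).
    by rewrite h2 andbT (le_trans (ltW dt0)).
  rewrite [in LHS]E Rintegral_setU//; first by rewrite -E; exact: i3.
  apply/disj_setPS => t /=; rewrite !in_itv/= => -[/andP[_ h1] /andP[h2 _]].
  by move: h1; rewrite ltNge h2.
rewrite shiftE RintegralZr// RintegralB//; last exact: i3.
rewrite splitE.
move: (\int[mu]_(t in `[dt, T[) _) (\int[mu]_(t in `[0, dt[) _) (\int[mu]_(t in `[0, T[) tested t t)
  (\int[mu]_(t in `[0, T[) tested_flux t) => i j k l.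
by field; rewrite gt_eqF.
Qed.

End step.

End tested_step.

Section consistency.
Context {R : realType}.
Local Notation mu := (@lebesgue_measure R).
Local Notation TR := (measurableTypeR R).
Variables (T delta lambda : R) (w : R -> R).
Hypotheses (T0 : 0 < T) (delta0 : 0 < delta) (wK : nonlocal_kernel delta w).
Variables (Q : R -> R -> R) (eta : R -> R) (L V : R).
Hypotheses (L0 : 0 <= L).
Hypothesis QL : forall a b a' b', `|Q a b - Q a' b'| <= L * (`|a - a'| + `|b - b'|).
Hypothesis etaL : forall a b, `|eta a - eta b| <= L * `|a - b|.
Variables (phi : R -> R -> R) (N B T' : R).
Hypotheses (N0 : 0 <= N) (B0 : 0 <= B) (phiT : tame N B T' phi) (T'T : T' < T).
Variables (dx dt : nat -> R) (P : nat -> R -> R -> R) (u : R -> R -> R) (u0 : R -> R) (V' : R).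
Hypotheses (dx0 : forall m, 0 < dx m) (dxc : dx m @[m --> \oo] --> 0).
Hypotheses (lam0 : 0 < lambda) (dtE : forall m, dt m = lambda * dx m).
Hypothesis mP : forall m, measurable_fun [set: TR * TR] (fun z : TR * TR => P m z.1 z.2 : R).
Hypothesis PV : forall m x t, `|P m x t| <= V.
Hypothesis Pmaj : forall m t, exists v, majorant V (P m ^~ t) v.
Hypothesis Pinit : forall m x t, t < dt m -> P m x t = P m x 0.
Hypothesis iu0 : mu.-integrable setT (EFin \o u0).
Hypothesis Pu0 : forall m, (\int[mu]_x `|P m x 0 - u0 x|%:E <= (dx m * V')%:E)%E.
Hypothesis mu_ : measurable_fun [set: TR * TR] (fun z : TR * TR => u z.1 z.2 : R).
Hypothesis uV : forall x t, `|u x t| <= V.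
Hypothesis Pu : forall t, 0 <= t <= T -> {ae mu, forall x, P m x t @[m --> \oo] --> u x t}.

Let SB := sup_bound Q eta L V.
Local Notation W := (window N : set TR).
Local Notation I := (`[0, T[%classic : set TR).

Let V0 : 0 <= V.
Proof. exact: le_trans (PV 0 0 0). Qed.

Let SB0 : 0 <= SB.
Proof. exact: le_trans (eta_sup Q L0 etaL (PV 0 0 0)). Qed.

Let dt0 m : 0 < dt m.
Proof. by rewrite dtE mulr_gt0. Qed.

Let dtc : dt m @[m --> \oo] --> 0.
Proof.
rewrite -[X in _ --> X](mulr0 lambda) (_ : dt = fun m => lambda * dx m).
  by apply: cvgM => //; exact: cvg_cst.
by apply/funext.
Qed.

Let mW : measurable W.
Proof. exact: measurable_window. Qed.

Let Woo : (mu W < +oo)%E.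
Proof. by rewrite window_measure// ltry. Qed.

Let mI : measurable I.
Proof. exact: measurable_itv. Qed.

Let Ioo : (mu I < +oo)%E.
Proof. by rewrite lebesgue_measure_itv/= lte_fin T0 -EFinB ltry. Qed.

Let outW x : ~ W x -> N < `|x|.
Proof.
by move=> xW; rewrite ltNge; apply/negP => h; apply: xW; rewrite /window/= in_itv/= -ler_norml.
Qed.

Let restrictW (f : R -> R) : (forall x, N < `|x| -> f x = 0) -> \int[mu]_x f x = \int[mu]_(x in W) f x.
Proof.
move=> f0; rewrite [RHS]Rintegral_mkcond; congr Rintegral; apply/funext => x.
by rewrite patchE; case: ifPn => // /negP xW; rewrite f0//; apply: outW; rewrite inE in xW.
Qed.

Let icst (c : R) : mu.-integrable W (EFin \o (fun=> c)).
Proof. by apply: (integrable_bounded (M := `|c|)). Qed.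

Let icstI (c : R) : mu.-integrable I (EFin \o (fun=> c)).
Proof. by apply: (integrable_bounded (M := `|c|)). Qed.

Let mphi t : measurable_fun [set: TR] (phi ^~ t : TR -> R).
Proof. exact: measurable_fun_pair1 (tame_measurable phiT). Qed.

Let metaP m t : measurable_fun [set: TR] (fun x => eta (P m x t)).
Proof. by apply: (eta_measurable L0 etaL); exact: measurable_fun_pair1 (mP m). Qed.

Lemma tested_quotientE m t : (tested eta phi (P m) t t - tested eta phi (P m) (t - dt m) t) / dt m =
  \int[mu]_(x in W) ((phi x t - phi x (t - dt m)) / dt m * eta (P m x t)).
Proof.
have It s : mu.-integrable W (EFin \o (fun x => phi x s * eta (P m x t))).
  apply: (integrable_bounded (M := B * SB)) => //.
    by apply: measurable_funTS; exact: measurable_funM.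
  by move=> x _; rewrite normrM ler_pM// ?(tame_bound phiT)// (eta_sup Q L0 etaL).
rewrite /tested !restrictW; [|by move=> x /(tame_support phiT) ->; rewrite mul0r..].
rewrite -RintegralB// -RintegralZr//.
  by apply: eq_Rintegral => x _; ring.
by have := integrableB mW (It t) (It (t - dt m)); apply: eq_integrable.
Qed.

Lemma tested_quotient_bound m t :
  `|(tested eta phi (P m) t t - tested eta phi (P m) (t - dt m) t) / dt m| <= B * SB * fine (mu W).
Proof.
rewrite tested_quotientE -(Rintegral_cst mu mW); apply: le_norm_Rintegral => //.
  apply: measurable_funTS; apply: measurable_funM => //; apply: measurable_funM => //.
  exact: measurable_funB.
move=> x _; rewrite normrM ler_pM// ?(eta_sup Q L0 etaL)//.
rewrite normrM normfV (gtr0_norm (dt0 m)) ler_pdivrMr//.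
apply: le_trans (tame_lipt phiT _ _ _) _.
by rewrite (_ : t - (t - dt m) = dt m) ?gtr0_norm//; ring.
Qed.

Let openI (a : nat -> R) (f : TR -> R) :
  mu.-integrable I (EFin \o f) /\ a m @[m --> \oo] --> \int[mu]_(t in I) f t ->
  a m @[m --> \oo] --> \int[mu]_(t in `]0, T[) f t.
Proof.
move=> [fi h]; rewrite Rintegral_itv_obnd_cbnd//.
apply: integrableS fi => // t /=; rewrite !in_itv/= => /andP[/ltW -> ->] //.
Qed.

Lemma time_term_cvg :
  \int[mu]_(t in I) ((tested eta phi (P m) t t - tested eta phi (P m) (t - dt m) t) / dt m)
    @[m --> \oo] -->
  \int[mu]_(t in `]0, T[) \int[mu]_x (eta (u x t) * partial_t phi x t).
Proof.
have mq m : measurable_fun I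
    (fun t => (tested eta phi (P m) t t - tested eta phi (P m) (t - dt m) t) / dt m : R).
  have h c := tested_shift_integrable Q L0 etaL N0 phiT (mP m) (PV m) c 0 mI Ioo.
  apply: measurable_funM => //; apply: measurable_funB.
    have /measurable_int/measurable_EFinP := h 0.
    by apply: eq_measurable_fun => t _; rewrite !addr0.
  have /measurable_int/measurable_EFinP := h (- dt m).
  by apply: eq_measurable_fun => t _; rewrite !addr0.
have qc t : I t ->
    (tested eta phi (P m) t t - tested eta phi (P m) (t - dt m) t) / dt m @[m --> \oo] -->
    \int[mu]_x (eta (u x t) * partial_t phi x t).
  rewrite /= in_itv/= => /andP[t0 tT].
  rewrite restrictW; last by move=> x /(partial_t_support _ phiT) ->; rewrite mulr0.
  under eq_fun do rewrite tested_quotientE.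
  have mu_t : measurable_fun [set: TR] (fun x => eta (u x t)).
    by apply: (eta_measurable L0 etaL); exact: measurable_fun_pair1 mu_.
  apply: (Rintegral_dominated_cvg mW _ _ (icst (B * SB)) _ _).2.
  - move=> m; apply: measurable_funTS; apply: measurable_funM => //; apply: measurable_funM => //.
    exact: measurable_funB.
  - apply: measurable_funTS; apply: measurable_funM => //.
    apply: (@measurable_fun_cvg _ TR R setT (fun m x => (phi x t - phi x (t - dt m)) / dt m)).
      by move=> m; apply: measurable_funM => //; exact: measurable_funB.
    by move=> x _; exact: partial_t_cvg phiT dt0 dtc.
  - have tT' : 0 <= t <= T by rewrite t0 ltW.
    have := Pu tT'; apply: (@filterS _ _ (ae_filter_ringOfSetsType mu)) => x Px _.
    rewrite [X in _ --> X]mulrC; apply: cvgM; first exact: partial_t_cvg phiT dt0 dtc.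
    exact: (eta_cvg L0 etaL).
  - move=> m x _; rewrite normrM ler_pM// ?(eta_sup Q L0 etaL)//.
    rewrite normrM normfV (gtr0_norm (dt0 m)) ler_pdivrMr//.
    apply: le_trans (tame_lipt phiT _ _ _) _.
    by rewrite (_ : t - (t - dt m) = dt m) ?gtr0_norm//; ring.
apply: openI; apply: (Rintegral_dominated_cvg mI mq _ (icstI (B * SB * fine (mu W)))).
- exact: measurable_fun_cvg mq qc.
- exact: aeW.
- by move=> m t _; exact: tested_quotient_bound.
Qed.

Lemma flux_term_cvg :
  \int[mu]_(t in I) tested_flux delta w Q phi N (dx m) (P m) t @[m --> \oo] -->
  \int[mu]_(t in `]0, T[) \int[mu]_x \int[mu]_(h in `[0, delta])
     ((phi (x + h) t - phi x t) / h * Q (u x t) (u (x + h) t) * w h).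
Proof.
have mS m : measurable_fun I (tested_flux delta w Q phi N (dx m) (P m) : TR -> R).
  exact: (measurable_tested_flux w delta0 L0 QL etaL N0 B0 phiT (dx m) (mP m) (PV m) mI Ioo).
have Sc t : I t -> tested_flux delta w Q phi N (dx m) (P m) t @[m --> \oo] -->
    \int[mu]_x \int[mu]_(h in `[0, delta])
     ((phi (x + h) t - phi x t) / h * Q (u x t) (u (x + h) t) * w h).
  rewrite /= in_itv/= => /andP[t0 tT].
  apply: (grid_flux_cvg delta0 wK L0 QL (Q_sup eta L0 QL) N0 B0 (mphi t) _ _ dx0 dxc) => //.
  - by move=> x; exact: tame_support phiT _ _.
  - by move=> x y; exact: tame_lipx phiT _ _ _.
  - by move=> m; exact: measurable_fun_pair1 (mP m).
  - exact: measurable_fun_pair1 mu_.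
  - by apply: Pu; rewrite t0 ltW.
apply: openI; apply: (Rintegral_dominated_cvg mI mS _ (icstI (B * SB * fine (mu (window (N + (delta + 1))))))).
- exact: measurable_fun_cvg mS Sc.
- exact: aeW.
- by move=> m t _; exact: (tested_flux_bound delta0 wK L0 QL etaL N0 B0 phiT (dx0 m) (mP m) (PV m)).
Qed.

(** On the first time step the approximation is constant in time, and close to
    [u0] in L^1. *)
Lemma initial_term_cvg :
  (dt m)^-1 * \int[mu]_(t in `[0, dt m[) tested eta phi (P m) (t - dt m) t @[m --> \oo] -->
  \int[mu]_x (eta (u0 x) * phi x 0).
Proof.
set I0 := \int[mu]_x _.
pose e m := B * SB * fine (mu W) * dt m + B * L * V' * dx m.
have mu0 : measurable_fun [set: TR] (u0 : TR -> R).
  by apply/measurable_EFinP; exact: measurable_int iu0.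
have meu0 : measurable_fun [set: TR] (fun x => eta (u0 x)) by exact: (eta_measurable L0 etaL).
have ieu0 : mu.-integrable W (EFin \o (fun x => eta (u0 x) * phi x 0)).
  have iu0' : mu.-integrable W (EFin \o (fun x => `|u0 x|)).
    exact: integrableS (integrable_norm iu0).
  have ig : mu.-integrable W (EFin \o (fun x => (`|eta 0| + L * `|u0 x|) * B)).
    have := integrableZr mW B (integrableD mW (icst `|eta 0|) (integrableZl mW L iu0')).
    by apply: eq_integrable.
  apply: (integrable_dominated mW _ ig).
    by apply: measurable_funTS; exact: measurable_funM.
  move=> x _; rewrite normrM ler_pM// ?(tame_bound phiT)//.
  rewrite -[X in `|X| <= _](subrKC (eta 0)) (le_trans (ler_normD _ _))// lerD2l.
  by rewrite (le_trans (etaL _ _))// subr0.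
have near m t : 0 <= t < dt m -> `|tested eta phi (P m) (t - dt m) t - I0| <= e m.
  move=> /andP[t0 tdt].
  rewrite /tested /I0 !restrictW; first last.
  - by move=> x /(tame_support phiT) ->; rewrite mul0r.
  - by move=> x /(tame_support phiT) ->; rewrite mulr0.
  have iP : mu.-integrable W (EFin \o (fun x => phi x (t - dt m) * eta (P m x t))).
    apply: (integrable_bounded (M := B * SB)) => //.
      by apply: measurable_funTS; exact: measurable_funM.
    by move=> x _; rewrite normrM ler_pM// ?(tame_bound phiT)// (eta_sup Q L0 etaL).
  rewrite -RintegralB//.
  have mPt : measurable_fun [set: TR] (P m ^~ 0 : TR -> R) by exact: measurable_fun_pair1 (mP m).
  have [id1 dc] := le_Rintegral_norm mW (measurable_funB mPt mu0) (Pu0 m).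
  have iz : mu.-integrable W (EFin \o (fun x => B * L * `|P m x 0 - u0 x|)).
    by have := integrableZl mW (B * L) id1; apply: eq_integrable.
  apply: (@le_trans _ _ (\int[mu]_(x in W) (B * SB * dt m + B * L * `|P m x 0 - u0 x|))).
    apply: le_norm_Rintegral => //.
    - by apply: measurable_funTS; apply: measurable_funB; exact: measurable_funM.
    - by have := integrableD mW (icst (B * SB * dt m)) iz; apply: eq_integrable.
    move=> x _; rewrite (Pinit _ tdt).
    have -> : phi x (t - dt m) * eta (P m x 0) - eta (u0 x) * phi x 0 =
      (phi x (t - dt m) - phi x 0) * eta (P m x 0) + phi x 0 * (eta (P m x 0) - eta (u0 x)) by ring.
    rewrite (le_trans (ler_normD _ _))// [X in X + _]normrM [X in _ + X]normrM lerD//.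
      rewrite mulrAC ler_pM// ?(eta_sup Q L0 etaL)//.
      apply: le_trans (tame_lipt phiT _ _ _) _; rewrite ler_wpM2l// subr0 ler_norml.
      by move: t0 tdt; lra.
    by rewrite -mulrA ler_pM// ?(tame_bound phiT).
  rewrite RintegralD// Rintegral_cst// RintegralZl// /e.
  apply: lerD; first by rewrite le_eqVlt; apply/orP; left; apply/eqP; ring.
  by rewrite -[leRHS]mulrA ler_wpM2l ?mulr_ge0// mulrC.
have ec : e m @[m --> \oo] --> 0.
  rewrite -[X in _ --> X]addr0; apply: cvgD.
    rewrite -[X in _ --> X](mulr0 (B * SB * fine (mu W))).
    by apply: cvgM => //; exact: cvg_cst.
  rewrite -[X in _ --> X](mulr0 (B * L * V')).
  by apply: cvgM => //; exact: cvg_cst.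
suff H m : `|(dt m)^-1 * \int[mu]_(t in `[0, dt m[) tested eta phi (P m) (t - dt m) t - I0| <= e m.
  apply/subr_cvg0/norm_cvg0P.
  apply: (@squeeze_cvgr _ _ _ _ (cst 0) e) => //; last exact: cvg_cst.
  by apply: nearW => m; rewrite normr_ge0/=.
pose D : set TR := `[0, dt m[%classic.
rewrite -/D.
have mD : measurable D by exact: measurable_itv.
have muD : mu D = (dt m)%:E.
  by rewrite lebesgue_measure_itv/= lte_fin dt0 sube0.
have Doo : (mu D < +oo)%E by rewrite muD ltry.
have it : mu.-integrable D (EFin \o (fun t => tested eta phi (P m) (t - dt m) t)).
  have := tested_shift_integrable Q L0 etaL N0 phiT (mP m) (PV m) (- dt m) 0 mD Doo.
  by apply: eq_integrable => // t _; rewrite /= addr0.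
have ic c : mu.-integrable D (EFin \o (fun=> c)).
  by apply: (integrable_bounded (M := `|c|)).
have cstE c : \int[mu]_(t in D) c = c * dt m.
  by rewrite (Rintegral_cst mu mD) -[in RHS](_ : fine (mu D) = dt m)// muD.
have -> : (dt m)^-1 * \int[mu]_(t in D) tested eta phi (P m) (t - dt m) t - I0 =
    (dt m)^-1 * \int[mu]_(t in D) (tested eta phi (P m) (t - dt m) t - I0).
  by rewrite RintegralB// cstE; field; rewrite gt_eqF.
rewrite normrM gtr0_norm ?invr_gt0// ler_pdivrMl//.
rewrite [leRHS](_ : _ = \int[mu]_(t in D) e m); last first.
  by rewrite cstE mulrC.
apply: le_norm_Rintegral => //.
  apply/measurable_EFinP; apply: (measurable_int mu).
  by have := integrableB mD it (ic I0); apply: eq_integrable.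
by move=> t; rewrite /D/= in_itv/= => h; exact: near.
Qed.

(** Division by [dt] is what makes the defect comparable to the weak formulation;
    the sign comes from the two summations by parts. *)
Lemma defect_cvg : (forall m, dx m <= 1) -> (forall m, dt m <= T - T') -> (forall m, dt m <= T) ->
  - ((dt m)^-1 * \int[mu]_(t in I) \int[mu]_x (phi x t * defect delta lambda w Q eta (dx m) (dt m) (P m) x t))
  @[m --> \oo] -->
  \int[mu]_(t in `]0, T[) \int[mu]_x (eta (u x t) * partial_t phi x t) +
  \int[mu]_x (eta (u0 x) * phi x 0) +
  \int[mu]_(t in `]0, T[) \int[mu]_x \int[mu]_(h in `[0, delta])
     ((phi (x + h) t - phi x t) / h * Q (u x t) (u (x + h) t) * w h).
Proof.
move=> dx1 dtT' dtT.
rewrite (_ : (fun m => _) = (fun m =>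
  \int[mu]_(t in I) ((tested eta phi (P m) t t - tested eta phi (P m) (t - dt m) t) / dt m) +
  (dt m)^-1 * \int[mu]_(t in `[0, dt m[) tested eta phi (P m) (t - dt m) t +
  \int[mu]_(t in I) tested_flux delta w Q phi N (dx m) (P m) t)); last first.
  apply/funext => m.
  rewrite (time_defect T0 delta0 wK L0 QL etaL N0 B0 phiT (dx0 m) (dx1 m) lam0 (dtE m) (mP m) (PV m) (dtT' m) (dtT m)).2.
  by rewrite mulrN opprK mulKf// gt_eqF.
exact: cvgD (cvgD time_term_cvg initial_term_cvg) flux_term_cvg.
Qed.

End consistency.

(** * Discrete entropy inequality *)

Section discrete_entropy.
Context {R : realType}.
Local Notation mu := (@lebesgue_measure R).
Local Notation TR := (measurableTypeR R).
Variables (g : R -> R -> R) (C : R).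
Hypotheses (C0 : 0 <= C).
Hypothesis gL : forall u1 u2 v1 v2, `|g u1 v1 - g u2 v2| <= C * (`|u1 - u2| + `|v1 - v2|).
Hypothesis gnd : forall v, {homo g ^~ v : x y / x <= y}.
Hypothesis gni : forall v x y, x <= y -> g v y <= g v x.

(** The update of one cell as a function of its own value and of the values of
    its right and left neighbours. *)
Definition cell_update (n : nat) (a : nat -> R) (x : R) (y z : nat -> R) : R :=
  x - \sum_(0 <= k < n) a k * (g x (y k) - g (z k) x).

(** The dependence on the neighbours is monotone by the monotonicity of [g]; in
    the own value it is so because the total weight is small. *)
Lemma cell_update_homo n a x x' y y' z z' : (forall k, 0 <= a k) ->
  2 * C * (\sum_(0 <= k < n) a k) <= 1 -> x <= x' ->
  (forall k, y k <= y' k) -> (forall k, z k <= z' k) ->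
  cell_update n a x y z <= cell_update n a x' y' z'.
Proof.
move=> a0 aC xx yy zz; rewrite /cell_update -subr_ge0.
rewrite (_ : _ - _ = (x' - x) - \sum_(0 <= k < n) a k *
  ((g x' (y' k) - g x (y k)) - (g (z' k) x' - g (z k) x))); last first.
  rewrite [X in x' - X](_ : _ = \sum_(0 <= k < n) a k * (g x (y k) - g (z k) x) +
    \sum_(0 <= k < n) a k * ((g x' (y' k) - g x (y k)) - (g (z' k) x' - g (z k) x))).
    by move: (\sum_(0 <= k < n) _) (\sum_(0 <= k < n) _) => S1 S2; ring.
  by rewrite -big_split/=; apply: eq_bigr => k _; ring.
rewrite subr_ge0; apply: (@le_trans _ _ (\sum_(0 <= k < n) a k * (2 * C * (x' - x)))).
  apply: ler_sum => k _; rewrite ler_wpM2l//.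
  have h1 : g x' (y' k) - g x (y k) <= C * (x' - x).
    have : g x' (y' k) <= g x' (y k) by exact: gni.
    have := le_trans (ler_norm _) (gL x' x (y k) (y k)).
    rewrite subrr normr0 addr0 ger0_norm ?subr_ge0//; lra.
  have h2 : - (C * (x' - x)) <= g (z' k) x' - g (z k) x.
    have : g (z k) x' <= g (z' k) x' by exact: gnd.
    have := le_trans (ler_norm _) (gL (z k) (z k) x x').
    rewrite subrr normr0 add0r distrC ger0_norm ?subr_ge0//; lra.
  by move: h1 h2; lra.
rewrite -mulr_suml mulrA -[leRHS]mul1r ler_wpM2r ?subr_ge0//.
by rewrite mulrC.
Qed.

Lemma max_sub_min (a c : R) : Num.max a c - Num.min a c = `|a - c|.
Proof. by case: (leP a c) => h; [rewrite distrC ger0_norm ?subr_ge0|rewrite gtr0_norm ?subr_gt0]. Qed.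

Lemma cell_update_const n a c : cell_update n a c (fun=> c) (fun=> c) = c.
Proof. by rewrite /cell_update big1 ?subr0// => k _; rewrite subrr mulr0. Qed.

(** The argument of Crandall and Majda: the update of the maximum with [c] is
    above both the update and [c], that of the minimum is below both, and the
    right-hand side is the difference of the two. *)
Lemma cell_update_entropy n a x y z c : (forall k, 0 <= a k) ->
  2 * C * (\sum_(0 <= k < n) a k) <= 1 ->
  `|cell_update n a x y z - c| <= `|x - c| -
    \sum_(0 <= k < n) a k * (entropy_flux g x (y k) c - entropy_flux g (z k) x c).
Proof.
move=> a0 aC.
pose Hi := cell_update n a (Num.max x c) (fun k => Num.max (y k) c) (fun k => Num.max (z k) c).
pose Lo := cell_update n a (Num.min x c) (fun k => Num.min (y k) c) (fun k => Num.min (z k) c).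
have hi1 : cell_update n a x y z <= Hi by apply: cell_update_homo => //= *; rewrite le_max lexx.
have lo1 : Lo <= cell_update n a x y z by apply: cell_update_homo => //= *; rewrite ge_min lexx.
have hi2 : c <= Hi.
  by rewrite -[leLHS](cell_update_const n a); apply: cell_update_homo => //= *; rewrite le_max lexx orbT.
have lo2 : Lo <= c.
  by rewrite -[leRHS](cell_update_const n a); apply: cell_update_homo => //= *; rewrite ge_min lexx orbT.
have -> : `|x - c| - \sum_(0 <= k < n) a k * (entropy_flux g x (y k) c - entropy_flux g (z k) x c)
   = Hi - Lo.
  rewrite /Hi /Lo /cell_update -max_sub_min opprD addrACA opprK; congr (_ + _).
  rewrite addrC -sumrB -sumrN; apply: eq_bigr => k _; rewrite /entropy_flux; ring.
by rewrite ler_norml; move: hi1 hi2 lo1 lo2; lra.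
Qed.

Lemma max_lipschitz (a b c : R) : `|Num.max a c - Num.max b c| <= `|a - b|.
Proof.
rewrite !maxEle; case: (leP a c) => h1; case: (leP b c) => h2; rewrite ?subrr ?normr0//.
  by rewrite !ler0_norm; move: h1 h2; lra.
by rewrite !ger0_norm; move: h1 h2; lra.
Qed.

Lemma min_lipschitz (a b c : R) : `|Num.min a c - Num.min b c| <= `|a - b|.
Proof.
rewrite !minEle; case: (leP a c) => h1; case: (leP b c) => h2; rewrite ?subrr ?normr0//.
  by rewrite !ler0_norm; move: h1 h2; lra.
by rewrite !ger0_norm; move: h1 h2; lra.
Qed.

Lemma entropy_flux_lipschitz c a b a' b' :
  `|entropy_flux g a b c - entropy_flux g a' b' c| <= (2 * C) * (`|a - a'| + `|b - b'|).
Proof.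
rewrite /entropy_flux.
rewrite (_ : _ - _ - (_ - _) = (g (Num.max a c) (Num.max b c) - g (Num.max a' c) (Num.max b' c)) -
   (g (Num.min a c) (Num.min b c) - g (Num.min a' c) (Num.min b' c))); last by ring.
rewrite (le_trans (ler_normB _ _))// -mulrA mulr_natl mulr2n lerD//.
  by rewrite (le_trans (gL _ _ _ _))// ler_wpM2l// lerD// max_lipschitz.
by rewrite (le_trans (gL _ _ _ _))// ler_wpM2l// lerD// min_lipschitz.
Qed.

Lemma kruzhkov_lipschitz (c a b : R) : `| `|a - c| - `|b - c| | <= `|a - b|.
Proof. by rewrite (le_trans (ler_dist_dist _ _))// (_ : a - c - (b - c) = a - b)//; ring. Qed.

End discrete_entropy.

Section scheme_defect.
Context {R : realType}.
Local Notation mu := (@lebesgue_measure R).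
Local Notation TR := (measurableTypeR R).
Variables (delta : R) (w : R -> R) (g : R -> R -> R) (C : R) (u0 : R -> R).
Variables (lambda dx dt : R) (sigma : nat -> int -> R).
Hypotheses (delta0 : 0 < delta) (wK : nonlocal_kernel delta w) (C0 : 0 <= C).
Hypothesis gL : forall u1 u2 v1 v2, `|g u1 v1 - g u2 v2| <= C * (`|u1 - u2| + `|v1 - v2|).
Hypothesis gnd : forall v, {homo g ^~ v : x y / x <= y}.
Hypothesis gni : forall v x y, x <= y -> g v y <= g v x.
Hypotheses (dx0 : 0 < dx) (dt0 : 0 < dt) (lam0 : 0 < lambda) (dtE : dt = lambda * dx).
Local Notation U := (forward_euler delta w g u0 dx dt sigma).
Hypothesis Us : forall n, admissible_slopes (U n) (sigma n).
Hypothesis small : 4 * C * lambda * kmass delta w dx <= 1.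
Variable V : R.
Hypothesis U0V : (zvar (cell_avg u0 dx) <= V%:E)%E.
Hypothesis U0B : exists B : R, (znorm (cell_avg u0 dx) <= B%:E)%E.
Local Notation p := (piecewise_constant dx dt U).
Let err t x := recon_error delta w g u0 lambda dx dt sigma (tidx dt t) (idx dx x).

(** The scheme holds exactly, except for the reconstructed term. *)
Lemma defect_weak x t : 0 <= t -> defect delta lambda w g id dx dt p x t = - err t x.
Proof.
move=> t0; rewrite /defect (pc_step delta w g u0 sigma dx0 dt0 dtE x t0) -/(err t x) /=.
by set S := \sum_(0 <= k < _) _; ring.
Qed.

Lemma defect_entropy c x t : 0 <= t ->
  defect delta lambda w (fun a b => entropy_flux g a b c) (fun a => `|a - c|) dx dt p x t <= `|err t x|.
Proof.
move=> t0; rewrite /defect (pc_step delta w g u0 sigma dx0 dt0 dtE x t0) -/(err t x) /=.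
have a0 k : 0 <= step_weight w lambda dx k.+1 by exact: step_weight_ge0 wK dx0 lam0 _.
have aC : 2 * C * (\sum_(0 <= k < (Num.truncn (delta / dx)).+1) step_weight w lambda dx k.+1) <= 1.
  apply: le_trans small; rewrite (_ : 4 * C * lambda * _ = 2 * C * (2 * (lambda * kmass delta w dx))); last by ring.
  rewrite ler_wpM2l ?mulr_ge0//; have := step_weight_sum delta0 wK dx0 lam0.
  rewrite big_nat_recl//; have := step_weight_ge0 wK dx0 lam0 0.
  have : 0 <= \sum_(0 <= i < (Num.truncn (delta / dx)).+1) step_weight w lambda dx i.+1.
    by apply: sumr_ge0.
  lra.
have := cell_update_entropy gL gnd gni (p x t) (fun k => p (x + k.+1%:R * dx) t)
  (fun k => p (x - k.+1%:R * dx) t) c a0 aC.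
rewrite /cell_update.
set S1 := \sum_(0 <= k < _) _; set S2 := \sum_(0 <= k < _) _ => h.
have := ler_normB (p x t - S1 - c) (err t x).
rewrite (_ : p x t - S1 - c - err t x = p x t - S1 - err t x - c); last by ring.
by move: h; lra.
Qed.

Variables (phi : R -> R -> R) (N B T' : R).
Hypotheses (N0 : 0 <= N) (B0 : 0 <= B) (phiT : tame N B T' phi) (dx1 : dx <= 1).

Let e : R := dt * (4 * C * V * B * kmass delta w dx).

Lemma tested_error t : mu.-integrable setT (EFin \o (fun x => B * `|err t x|)) /\
  \int[mu]_x (B * `|err t x|) <= e.
Proof.
have me : measurable_fun [set: TR] (err t : TR -> R).
  exact: (measurable_step (fun j => recon_error delta w g u0 lambda dx dt sigma (tidx dt t) j) dx0).
have h : (\int[mu]_x `|err t x|%:E <= (dx * (4 * C * V * lambda * kmass delta w dx))%:E)%E.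
  rewrite (integral_step (F := fun j => `|recon_error delta w g u0 lambda dx dt sigma (tidx dt t) j|))//.
  rewrite EFinM lee_pmul2l//.
  exact: (recon_error_sum delta0 wK C0 gL gnd gni dx0 lam0 dtE Us small U0V).
have [ie le] := le_Rintegral_norm measurableT me h.
split; first by have := integrableZl measurableT B ie; apply: eq_integrable.
rewrite RintegralZl// (le_trans (ler_wpM2l B0 le))// /e dtE.
by rewrite le_eqVlt; apply/orP; left; apply/eqP; ring.
Qed.

Lemma weak_defect_small t : 0 <= t ->
  `|\int[mu]_x (phi x t * defect delta lambda w g id dx dt p x t)| <= e.
Proof.
move=> t0; have [i h] := tested_error t; apply: le_trans h; apply: le_norm_Rintegral => //.
  have me : measurable_fun [set: TR] (err t : TR -> R).
    exact: (measurable_step (fun j => recon_error delta w g u0 lambda dx dt sigma (tidx dt t) j) dx0).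
  have : measurable_fun [set: TR] (fun x => phi x t * - err t x).
    apply: measurable_funM; first exact: measurable_fun_pair1 (tame_measurable phiT).
    exact: measurableT_comp me.
  by apply: eq_measurable_fun => x _; rewrite defect_weak.
by move=> x _; rewrite defect_weak// normrM normrN ler_wpM2r// (tame_bound phiT).
Qed.

Lemma entropy_defect_small c t : 0 <= t -> (forall x, 0 <= phi x t) ->
  \int[mu]_x (phi x t * defect delta lambda w (fun a b => entropy_flux g a b c)
    (fun a => `|a - c|) dx dt p x t) <= e.
Proof.
move=> t0 phi0; have [i h] := tested_error t; apply: le_trans h.
have C20 : 0 <= 2 * C + 1 by rewrite addr_ge0// mulr_ge0.
have qL a b a' b' : `|entropy_flux g a b c - entropy_flux g a' b' c| <= (2 * C + 1) * (`|a - a'| + `|b - b'|).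
  by rewrite (le_trans (entropy_flux_lipschitz C0 gL _ _ _ _ _))// ler_wpM2r ?addr_ge0// lerDl.
have eL a b : `| `|a - c| - `|b - c| | <= (2 * C + 1) * `|a - b|.
  by rewrite (le_trans (kruzhkov_lipschitz _ _ _))// ler_peMl// lerDr mulr_ge0.
have pV := pc_sup delta0 wK C0 gL gnd gni dx0 lam0 dtE Us small U0V U0B.
have mp : measurable_fun [set: TR * TR] (fun z : TR * TR => p z.1 z.2 : R).
  exact: measurable_piecewise_constant.
have [i' _] := space_defect w delta0 C20 qL eL N0 B0 phiT dx0 dx1 dtE mp pV t.
apply: le_Rintegral => // x _.
rewrite (le_trans (ler_wpM2l (phi0 x) (defect_entropy c x t0)))// ler_wpM2r//.
by rewrite (le_trans (ler_norm _))// (tame_bound phiT).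
Qed.

End scheme_defect.

(** * Limits of the scheme *)

Section limit_solution.
Context {R : realType}.
Local Notation mu := (@lebesgue_measure R).
Local Notation TR := (measurableTypeR R).
Variables (T delta lambda : R) (w : R -> R) (g : R -> R -> R) (C V : R) (u0 : R -> R).
Variables (sigma : R -> nat -> int -> R).
Hypotheses (T0 : 0 < T) (delta0 : 0 < delta) (lam0 : 0 < lambda) (wK : nonlocal_kernel delta w).
Hypotheses (C0 : 0 <= C).
Hypothesis gL : forall u1 u2 v1 v2, `|g u1 v1 - g u2 v2| <= C * (`|u1 - u2| + `|v1 - v2|).
Hypothesis gnd : forall v, {homo g ^~ v : x y / x <= y}.
Hypothesis gni : forall v x y, x <= y -> g v y <= g v x.
Local Notation U dt := (forward_euler delta w g u0 (dt / lambda) dt (sigma dt)).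
Local Notation udt dt := (piecewise_constant (dt / lambda) dt (U dt)).
Hypothesis Us : forall dt, 0 < dt -> forall n, admissible_slopes (U dt n) (sigma dt n).
Hypothesis iu0 : mu.-integrable setT (EFin \o u0).
Hypothesis u0V : forall dx, 0 < dx -> [/\ (zvar (cell_avg u0 dx) <= V%:E)%E,
    (\int[mu]_x `|cell_avg u0 dx (idx dx x) - u0 x|%:E <= (dx * V)%:E)%E &
    exists B : R, (znorm (cell_avg u0 dx) <= B%:E)%E].

(** The last condition makes the scheme total variation diminishing and the
    unreconstructed part of it monotone. *)
Definition small_step (dt : R) : Prop := [/\ 0 < dt, dt <= T, dt / lambda <= 1 &
  4 * C * lambda * kmass delta w (dt / lambda) <= 1].

Lemma small_step_near (dt : nat -> R) : (forall m, 0 < dt m) -> dt m @[m --> \oo] --> 0 ->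
  \forall m \near \oo, small_step (dt m).
Proof.
move=> dt0 dtc.
have dx0 m : 0 < dt m / lambda by rewrite divr_gt0.
have dxc : dt m / lambda @[m --> \oo] --> 0.
  by rewrite -[X in _ --> X](mul0r lambda^-1); apply: cvgM => //; exact: cvg_cst.
have kc : 4 * C * lambda * kmass delta w (dt m / lambda) @[m --> \oo] --> 0.
  rewrite -[X in _ --> X](mulr0 (4 * C * lambda)).
  by apply: cvgM; [exact: cvg_cst|exact: kmass_cvg0 dx0 dxc].
near=> m; split => //.
- by apply: ltW; near: m; exact: cvgr_lt dtc _ T0.
- by apply: ltW; near: m; exact: cvgr_lt dxc _ ltr01.
- by apply: ltW; near: m; exact: cvgr_lt kc _ ltr01.
Unshelve. all: by end_near. Qed.

Section sequence.
Variables (dt : nat -> R) (u : R -> R -> R).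
Hypotheses (dts : forall m, small_step (dt m)) (dtc : dt m @[m --> \oo] --> 0).
Hypothesis mu_ : measurable_fun [set: TR * TR] (fun z : TR * TR => u z.1 z.2 : R).
Hypothesis uV : forall x t, `|u x t| <= V.
Hypothesis Pu : forall t, 0 <= t <= T -> {ae mu, forall x, udt (dt m) x t @[m --> \oo] --> u x t}.

Let dt0 m : 0 < dt m.
Proof. by have [] := dts m. Qed.

Let dx0 m : 0 < dt m / lambda.
Proof. by rewrite divr_gt0. Qed.

Let dtE m : dt m = lambda * (dt m / lambda).
Proof. by rewrite mulrC divfK// gt_eqF. Qed.

Let dxc : dt m / lambda @[m --> \oo] --> 0.
Proof. by rewrite -[X in _ --> X](mul0r lambda^-1); apply: cvgM => //; exact: cvg_cst. Qed.

Lemma udt_sup m x t : `|udt (dt m) x t| <= V.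
Proof.
have [_ _ _ h] := dts m; have [z _ b] := u0V (dx0 m).
exact: (pc_sup delta0 wK C0 gL gnd gni (dx0 m) lam0 (dtE m) (Us (dt0 m)) h z b).
Qed.

Lemma udt_majorant m t : exists v, majorant V (udt (dt m) ^~ t) v.
Proof.
have [_ _ _ h] := dts m; have [z _ b] := u0V (dx0 m).
exact: (pc_majorant delta0 wK C0 gL gnd gni (dx0 m) lam0 (dtE m) (Us (dt0 m)) h z).
Qed.

Lemma udt_time m s t : 0 <= s <= t ->
  (\int[mu]_x `|udt (dt m) x t - udt (dt m) x s|%:E <= (4 * C * V * (t - s + dt m))%:E)%E.
Proof.
have [_ _ _ h] := dts m; have [z _ b] := u0V (dx0 m).
exact: (pc_time delta0 wK C0 gL gnd gni (dx0 m) (dt0 m) lam0 (dtE m) (Us (dt0 m)) h z).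
Qed.

Lemma measurable_udt m : measurable_fun [set: TR * TR] (fun z : TR * TR => udt (dt m) z.1 z.2 : R).
Proof. exact: measurable_piecewise_constant. Qed.

Lemma udt_initial m x t : t < dt m -> udt (dt m) x t = udt (dt m) x 0.
Proof. by move=> h; rewrite !piecewise_constantE !tidx0. Qed.

Lemma udt_initial_error m : (\int[mu]_x `|udt (dt m) x 0 - u0 x|%:E <= ((dt m / lambda) * V)%:E)%E.
Proof. by have [_ h _] := u0V (dx0 m); move: h; rewrite /piecewise_constant -/(tidx _ _) tidx0. Qed.

Section passage.
Variables (Q : R -> R -> R) (eta : R -> R) (L : R).
Hypotheses (L0 : 0 <= L).
Hypothesis QL : forall a b a' b', `|Q a b - Q a' b'| <= L * (`|a - a'| + `|b - b'|).
Hypothesis etaL : forall a b, `|eta a - eta b| <= L * `|a - b|.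
Variables (phi : R -> R -> R) (N B T' : R).
Hypotheses (N0 : 0 <= N) (B0 : 0 <= B) (phiT : tame N B T' phi) (T'T : T' < T).

Let d m t := \int[mu]_x (phi x t *
  defect delta lambda w Q eta (dt m / lambda) (dt m) (udt (dt m)) x t).
Let c m := 4 * C * V * B * kmass delta w (dt m / lambda).
Local Notation functional := (
  \int[mu]_(t in `]0, T[) \int[mu]_x (eta (u x t) * partial_t phi x t) +
  \int[mu]_x (eta (u0 x) * phi x 0) +
  \int[mu]_(t in `]0, T[) \int[mu]_x \int[mu]_(h in `[0, delta])
     ((phi (x + h) t - phi x t) / h * Q (u x t) (u (x + h) t) * w h)).
Local Notation I := (`[0, T[%classic : set TR).

Let X m := - ((dt m)^-1 * \int[mu]_(t in I) d m t).

Let V0 : 0 <= V.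
Proof. exact: le_trans (uV 0 0). Qed.

(** A shift of the sequence makes the time step smaller than [T - T']. *)
Lemma passage_cvg : [/\ X m @[m --> \oo] --> functional,
  (\forall m \near \oo, mu.-integrable I (EFin \o d m)) & T * c m @[m --> \oo] --> 0].
Proof.
have [M _ MP] : \forall m \near \oo, dt m <= T - T'.
  have h : 0 < T - T' by rewrite subr_gt0.
  near=> m; apply: ltW; near: m; exact: cvgr_lt dtc _ h.
have small m : dt (m + M)%N <= T - T' by apply: MP; exact: leq_addl.
have dxT m : dt (m + M)%N <= T by have [] := dts (m + M)%N.
have dx1 m : dt (m + M)%N / lambda <= 1 by have [] := dts (m + M)%N.
have Pu' t : 0 <= t <= T -> {ae mu, forall x, udt (dt (m + M)%N) x t @[m --> \oo] --> u x t}.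
  move=> /Pu; apply: (@filterS _ _ (ae_filter_ringOfSetsType mu)) => x h.
  exact: (cvg_comp (fun m => (m + M)%N) _ (cvg_addnr M) h).
have dxc' : dt (m + M)%N / lambda @[m --> \oo] --> 0.
  exact: (cvg_comp (fun m => (m + M)%N) _ (cvg_addnr M) dxc).
split.
- rewrite -(cvg_shiftn M).
  exact: (defect_cvg T0 delta0 wK L0 QL etaL N0 B0 phiT
    (dx := fun m => dt (m + M)%N / lambda) (dt := fun m => dt (m + M)%N)
    (P := fun m => udt (dt (m + M)%N)) (fun m => dx0 _) dxc' lam0 (fun m => dtE _)
    (fun m => measurable_udt _) (fun m => @udt_sup _) (fun m => udt_majorant _)
    (fun m => @udt_initial _) iu0 (fun m => udt_initial_error _) mu_ uV Pu').
- exists M => // m /= Mm; have h := MP m Mm; have [_ h1 h2 _] := dts m.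
  exact: (time_defect T0 delta0 wK L0 QL etaL N0 B0 phiT (dx0 m) h2 lam0 (dtE m)
    (measurable_udt m) (udt_sup m) h h1).1.
- rewrite -[X in _ --> X](mulr0 T); apply: cvgM; first exact: cvg_cst.
  rewrite -[X in _ --> X](mulr0 (4 * C * V * B)).
  by apply: cvgM; [exact: cvg_cst|exact: kmass_cvg0 dx0 dxc].
Unshelve. all: by end_near. Qed.

Let mI : measurable I.
Proof. exact: measurable_itv. Qed.

Let icst (a : R) : mu.-integrable I (EFin \o (fun=> a)).
Proof.
have Ioo : (mu I < +oo)%E by rewrite lebesgue_measure_itv/= lte_fin T0 -EFinB ltry.
by apply: (integrable_bounded (M := `|a|)).
Qed.

Let cstE a : \int[mu]_(t in I) a = a * T.
Proof.
rewrite (Rintegral_cst mu mI) -[in RHS](_ : fine (mu I) = T)//.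
by rewrite lebesgue_measure_itv/= lte_fin T0 sube0.
Qed.

Lemma passage_ge0 : (forall m t, 0 <= t -> d m t <= dt m * c m) -> 0 <= functional.
Proof.
move=> dc; have [Xc [M _ MP] cc] := passage_cvg.
have h := cvgD Xc cc; rewrite addr0 in h.
apply: (cvgr_to_ge (h _)); exists M => // m Mm.
rewrite /X addrC subr_ge0 ler_pdivrMl//.
rewrite (@le_trans _ _ (\int[mu]_(t in I) (dt m * c m)))//; last first.
  by rewrite cstE le_eqVlt; apply/orP; left; apply/eqP; ring.
apply: le_Rintegral => //; first exact: MP.
by move=> t; rewrite /= in_itv/= => /andP[t0 _]; exact: dc.
Qed.

Lemma passage_eq0 : (forall m t, 0 <= t -> `|d m t| <= dt m * c m) -> functional = 0.
Proof.
move=> dc; have [Xc [M _ MP] cc] := passage_cvg.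
apply: (cvg_unique _ Xc); first exact: norm_hausdorff.
apply/norm_cvg0P.
apply: (@squeeze_cvgr _ _ _ _ (cst 0) (fun m => T * c m)) => //; last exact: cvg_cst.
exists M => // m Mm; rewrite normr_ge0/= normrN normrM gtr0_norm ?invr_gt0//.
rewrite ler_pdivrMl// (@le_trans _ _ (\int[mu]_(t in I) (dt m * c m)))//; last first.
  by rewrite cstE le_eqVlt; apply/orP; left; apply/eqP; ring.
apply: le_norm_Rintegral => //.
  by apply/measurable_EFinP; exact: measurable_int (MP m Mm).
by move=> t; rewrite /= in_itv/= => /andP[t0 _]; exact: dc.
Qed.

End passage.

Lemma limit_Linfty : Linfty_strip T u.
Proof.
split; first exact: measurable_funTS.
by exists V; apply: aeW => z _.
Qed.

Lemma limit_weak_solution : weak_solution T delta w g u0 u.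
Proof.
split; first exact: limit_Linfty.
move=> phi /test_function_tame[N [B [T' [N0 B0 T'T phiT]]]].
have C10 : 0 <= C + 1 by rewrite addr_ge0.
apply: (passage_eq0 (L := C + 1) C10 (eta := id) _ _ N0 B0 phiT T'T).
- by move=> a b a' b'; rewrite (le_trans (gL _ _ _ _))// ler_wpM2r ?addr_ge0// lerDl.
- by move=> a b; rewrite /= ler_peMl// lerDr.
move=> m t t0; have [_ _ d1 h] := dts m; have [z _ b] := u0V (dx0 m).
exact: (weak_defect_small delta0 wK C0 gL gnd gni (dx0 m) (dt0 m) lam0 (dtE m) (Us (dt0 m)) h z B0 phiT t0).
Qed.

Lemma limit_entropy_solution : entropy_solution T delta w g u0 u.
Proof.
split; first exact: limit_Linfty.
move=> k phi /test_function_tame[N [B [T' [N0 B0 T'T phiT]]]] phi0.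
have C10 : 0 <= 2 * C + 1 by rewrite addr_ge0// mulr_ge0.
apply: (passage_ge0 (L := 2 * C + 1) C10 (eta := fun a => `|a - k|)
  (Q := fun a b => entropy_flux g a b k) _ _ N0 B0 phiT T'T).
- move=> a b a' b'; rewrite (le_trans (entropy_flux_lipschitz C0 gL _ _ _ _ _))//.
  by rewrite ler_wpM2r ?addr_ge0// lerDl.
- by move=> a b; rewrite (le_trans (kruzhkov_lipschitz _ _ _))// ler_peMl// lerDr mulr_ge0.
move=> m t t0; have [_ _ d1 h] := dts m; have [z _ b] := u0V (dx0 m).
exact: (entropy_defect_small delta0 wK C0 gL gnd gni (dx0 m) (dt0 m) lam0 (dtE m) (Us (dt0 m)) h z b
  N0 B0 phiT d1 k t0 (fun x => phi0 x t t0)).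
Qed.

(** Integrability at a given time follows from the distance to [u0], which is
    bounded on windows along the sequence. *)
Lemma limit_C_L1 :
  (forall a b, 0 <= a <= b -> b <= T ->
    (\int[mu]_x `|u x b - u x a|%:E <= (4 * C * V * (b - a))%:E)%E) -> C_L1 T u.
Proof.
move=> ut.
have mut t : measurable_fun [set: TR] (u ^~ t : TR -> R) by exact: measurable_fun_pair1 mu_.
have mu0 : measurable_fun [set: TR] (u0 : TR -> R).
  by apply/measurable_EFinP; exact: measurable_int iu0.
have V0 : 0 <= V by exact: le_trans (uV 0 0).
split => t; rewrite in_itv/= => tT; have /andP[t0 tT'] := tT.
- pose c := 4 * C * V * (T + T) + V.
  have c0 : 0 <= c by rewrite addr_ge0// !mulr_ge0// addr_ge0// ltW.
  have h : (\int[mu]_x `|u x t - u0 x|%:E <= c%:E)%E.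
    apply: integral_le_windows => [|n]; first exact: measurable_funB.
    have mW : measurable (window n%:R : set TR) by exact: measurable_window.
    have Woo : (mu (window n%:R : set TR) < +oo)%E by rewrite window_measure// ltry.
    have cv := @slice_L1_cvg R V (fun m => udt (dt m)) measurable_udt udt_sup id u t _ mW Woo (mut t) uV (Pu tT).
    have cc : cst c%:E m @[m --> \oo] --> c%:E by exact: cvg_cst.
    have := cvgeD _ cv cc; rewrite add0e => /(_ _ isT) h.
    apply: (cvge_to_ge h); apply: nearW => m /=.
    have mS r : measurable_fun (window n%:R) (udt (dt m) ^~ r : TR -> R).
      by apply: measurable_funTS; exact: measurable_fun_pair1 (measurable_udt m).
    have mu1 : measurable_fun (window n%:R) (u ^~ t : TR -> R) by exact: measurable_funTS.
    have mu2 : measurable_fun (window n%:R) (u0 : TR -> R) by exact: measurable_funTS.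
    apply: (le_trans (L1dist_triangle mW mu1 (mS t) mu2)); apply: leeD.
      by rewrite L1distC lexx.
    apply: (le_trans (L1dist_triangle mW (mS t) (mS 0) mu2)).
    rewrite /c EFinD; apply: leeD.
      apply: L1dist_sub => //; [exact: measurable_fun_pair1 (measurable_udt m)..|].
      apply: (@le_trans _ _ (4 * C * V * (t - 0 + dt m))%:E).
        by apply: udt_time; rewrite lexx.
      rewrite lee_fin ler_wpM2l ?mulr_ge0// subr0 lerD//.
      by have [] := dts m.
    apply: L1dist_sub => //; first exact: measurable_fun_pair1 (measurable_udt m).
    apply: (le_trans (udt_initial_error m)); rewrite lee_fin ler_piMl//.
    by have [] := dts m.
  have id : mu.-integrable setT (EFin \o (fun x => u x t - u0 x)).
    apply/integrableP; split; first by apply/measurable_EFinP; exact: measurable_funB.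
    exact: le_lt_trans h (ltry _).
  have := integrableD measurableT id iu0; apply: eq_integrable => // x _ /=.
  by rewrite -EFinD subrK.
- pose K := 4 * C * V.
  have bnd s : `[0, T]%classic s -> (\int[mu]_x `|u x s - u x t|%:E <= (K * `|s - t|)%:E)%E.
    rewrite /= in_itv/= => /andP[s0 sT]; have [st|/ltW ts] := leP s t.
      rewrite distrC ger0_norm ?subr_ge0//.
      under eq_integral do rewrite distrC.
      by apply: ut => //; rewrite s0.
    by rewrite ger0_norm ?subr_ge0//; apply: ut => //; rewrite t0.
  have cK : (K * `|s - t|)%:E @[s --> within `[0, T]%classic (nbhs t)] --> 0%E.
    apply: cvg_within_filter.
    apply: cvg_EFin; first exact: nearW.
    rewrite -[X in _ --> X](mulr0 K); apply: cvgM; first exact: cvg_cst.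
    rewrite -[X in _ --> X](normr0 R) -[X in `|X|](subrr t).
    by apply: cvg_norm; apply: cvgB; [exact: cvg_id|exact: cvg_cst].
  apply: (squeeze_cvge _ (cvg_cst 0%E) cK).
  rewrite near_withinE; apply: nearW => s sI; apply/andP; split; last exact: bnd.
  by apply: integral_ge0 => x _; rewrite lee_fin.
Qed.

End sequence.

(** Small steps start at some index [M]; the bounds are applied to the shifted
    sequence. *)
Lemma scheme_compactness (dt : nat -> R) : (forall m, 0 < dt m) -> dt m @[m --> \oo] --> 0 ->
  exists s : nat -> nat, {homo s : m n / (m < n)%N} /\
  exists u : R -> R -> R, [/\ C_L1 T u, weak_solution T delta w g u0 u,
    entropy_solution T delta w g u0 u,
    measurable_fun [set: TR * TR] (fun z : TR * TR => u z.1 z.2 : R) /\ (forall x t, `|u x t| <= V) &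
    forall t : R, t \in `[0, T] -> cvg_L1loc \oo (fun k => udt (dt (s k)) ^~ t) (u ^~ t)].
Proof.
move=> dt0 dtc.
have [M _ MP] := small_step_near dt0 dtc.
pose dt' m := dt (m + M)%N.
have dts m : small_step (dt' m) by apply: MP; exact: leq_addl.
have dtc' : dt' m @[m --> \oo] --> 0 by exact: (cvg_comp (fun m => (m + M)%N) _ (cvg_addnr M) dtc).
have V0 : 0 <= V by exact: le_trans (udt_sup dts 0 0 0).
have K0 : 0 <= 4 * C * V by rewrite !mulr_ge0.
have [s [sh [u [mu_ uV Pu ut]]]] := compactness T K0 (fun m => measurable_udt dts m)
  (udt_sup dts) (udt_majorant dts) (@udt_time _ dts) dtc'.
exists (fun k => (s k + M)%N); split; first by move=> m n mn; rewrite ltn_add2r; exact: sh.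
have dtss m : small_step (dt' (s m)) by exact: dts.
have dtsc : dt' (s m) @[m --> \oo] --> 0 by exact: cvg_comp (increasing_cvg sh) dtc'.
exists u; split => //.
- exact: (limit_C_L1 dtss mu_ uV Pu ut).
- exact: (limit_weak_solution dtss dtsc mu_ uV Pu).
- exact: (limit_entropy_solution dtss dtsc mu_ uV Pu).
move=> t; rewrite in_itv/= => tT K cK.
have mK : measurable (K : set TR).
  by apply: closed_measurable; apply: compact_closed => //; exact: norm_hausdorff.
have [N KN] := compact_window cK.
have Koo : (mu K < +oo)%E.
  apply: (@le_lt_trans _ _ (mu (window N%:R : set TR))).
    by apply: le_measure; rewrite ?inE//; exact: measurable_window.
  by rewrite window_measure// ltry.
exact: (@slice_L1_cvg R V (fun m => udt (dt' m)) (fun m => measurable_udt dts m) (udt_sup dts) s u t _ mK Koo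
  (measurable_fun_pair1 t mu_) uV (Pu t tT)).
Qed.

End limit_solution.

(** * Smooth approximations of indicator functions *)

Section smooth_functions.
Context {R : realType}.

(** The one-variable analogue of [Ck]. *)
Fixpoint smooth (n : nat) (f : R -> R) : Prop :=
  continuous f /\ if n is m.+1 then (forall x, derivable f x 1) /\ smooth m (derive1 f) else True.

Lemma derivable_is_derive (f : R -> R) x : derivable f x 1 -> is_derive x (1 : R) f (derive1 f x).
Proof. by move=> df; rewrite derive1E; apply: DeriveDef. Qed.

Lemma is_derive_derive1 (f : R -> R) x df : is_derive x (1 : R) f df -> derivable f x 1 /\ derive1 f x = df.
Proof. by move=> h; rewrite derive1E; split; [exact: ex_derive|exact: derive_val]. Qed.

Lemma smooth_of_is_derive n (f df : R -> R) : (forall x, is_derive x (1 : R) f (df x)) -> smooth n df -> smooth n.+1 f.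
Proof.
move=> fdf sdf.
have dE : derive1 f = df by apply/funext => x; exact: (is_derive_derive1 (fdf x)).2.
have df' x : derivable f x 1 by exact: (is_derive_derive1 (fdf x)).1.
split; last by rewrite dE.
by move=> x; apply: differentiable_continuous; apply/derivable1_diffP; exact: df'.
Qed.

Lemma smoothS n (f : R -> R) : smooth n.+1 f -> smooth n f.
Proof.
elim: n f => [|n IH] f; first by case.
by move=> [cf [df sf]]; split => //; split => //; exact: IH.
Qed.

Lemma smooth_is_derive n (f : R -> R) x : smooth n.+1 f -> is_derive x (1 : R) f (derive1 f x).
Proof. by move=> [_ [df _]]; exact: derivable_is_derive. Qed.

Lemma smooth_cst n (c : R) : smooth n (fun=> c).
Proof.
elim: n c => [|n IH] c; first by split => // x; exact: cvg_cst.
by apply: smooth_of_is_derive (IH 0) => x; exact: is_derive_cst.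
Qed.

Lemma smooth_id n : smooth n (@id R).
Proof.
case: n => [|n]; first by split => // x; exact: cvg_id.
by apply: smooth_of_is_derive (smooth_cst n 1) => x; exact: is_derive_id.
Qed.

Lemma smoothD n (f h : R -> R) : smooth n f -> smooth n h -> smooth n (fun x => f x + h x).
Proof.
elim: n f h => [|n IH] f h sf sh.
  by split => // x; apply: cvgD; [exact: sf.1|exact: sh.1].
apply: (smooth_of_is_derive (df := fun x => derive1 f x + derive1 h x)).
  by move=> x; apply: is_deriveD; [exact: smooth_is_derive sf|exact: smooth_is_derive sh].
by apply: IH; [exact: sf.2.2|exact: sh.2.2].
Qed.

Lemma smoothM n (f h : R -> R) : smooth n f -> smooth n h -> smooth n (fun x => f x * h x).
Proof.
elim: n f h => [|n IH] f h sf sh.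
  by split => // x; apply: cvgM; [exact: sf.1|exact: sh.1].
apply: (smooth_of_is_derive (df := fun x => f x * derive1 h x + h x * derive1 f x)).
  move=> x; have := is_deriveM (smooth_is_derive x sf) (smooth_is_derive x sh).
  exact.
by apply: smoothD; apply: IH; [exact: smoothS|exact: sh.2.2|exact: smoothS|exact: sf.2.2].
Qed.

Lemma is_derive_affine (c e x : R) : is_derive x (1 : R) (fun x => c * x + e) c.
Proof.
have h := is_deriveD (is_deriveZ c (is_derive_id x (1 : R))) (is_derive_cst e x (1 : R)).
by apply: (is_derive_eq h); rewrite addr0 /GRing.scale/= mulr1.
Qed.

Lemma smooth_affine n (f : R -> R) (c e : R) : smooth n f -> smooth n (fun x => f (c * x + e)).
Proof.
elim: n f => [|n IH] f sf.
  split => // x; apply: (continuous_comp (f := fun x => c * x + e)); last exact: sf.1.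
  by apply: cvgD; [apply: cvgM; [exact: cvg_cst|exact: cvg_id]|exact: cvg_cst].
apply: (smooth_of_is_derive (df := fun x => c * derive1 f (c * x + e))).
  move=> x; have h := @is_derive1_comp _ f (fun x => c * x + e) x _ _ (smooth_is_derive _ sf) (is_derive_affine c e x).
  by apply: (is_derive_eq h); rewrite mulrC.
by apply: smoothM; [exact: smooth_cst|apply: IH; exact: sf.2.2].
Qed.

(** A partial derivative of a product acts on one of the two factors. *)
Lemma smooth_tensor n (a b : R -> R) : smooth n a -> smooth n b -> Ck n (fun x t => a x * b t).
Proof.
elim: n a b => [|n IH] a b sa sb.
  split => // z; apply: cvgM.
    by apply: continuous_comp; [exact: cvg_fst|exact: sa.1].
  by apply: continuous_comp; [exact: cvg_snd|exact: sb.1].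
have dx x t : is_derive x (1 : R) (fun x => a x * b t) (derive1 a x * b t).
  have h := is_deriveM (smooth_is_derive x sa) (is_derive_cst (b t) x (1 : R)).
  by apply: (is_derive_eq h); rewrite scaler0 add0r /GRing.scale/= mulrC.
have dt x t : is_derive t (1 : R) (fun t => a x * b t) (a x * derive1 b t).
  have h := is_deriveM (is_derive_cst (a x) t (1 : R)) (smooth_is_derive t sb).
  by apply: (is_derive_eq h); rewrite scaler0 addr0 /GRing.scale/=.
split.
  move=> z; apply: cvgM.
    by apply: continuous_comp; [exact: cvg_fst|exact: sa.1].
  by apply: continuous_comp; [exact: cvg_snd|exact: sb.1].
split.
- by move=> x t; exact: (is_derive_derive1 (dx x t)).1.
- by move=> x t; exact: (is_derive_derive1 (dt x t)).1.
- rewrite (_ : partial_x _ = fun x t => derive1 a x * b t).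
    by apply: IH; [exact: sa.2.2|exact: smoothS].
  by apply/funext => x; apply/funext => t; exact: (is_derive_derive1 (dx x t)).2.
- rewrite (_ : partial_t _ = fun x t => a x * derive1 b t).
    by apply: IH; [exact: smoothS|exact: sb.2.2].
  by apply/funext => x; apply/funext => t; exact: (is_derive_derive1 (dt x t)).2.
Qed.

End smooth_functions.

Section flat_exp.
Context {R : realType}.

(** The derivatives of [exp (- 1 / y)], extended by zero to [y <= 0], are
    combinations of these functions. *)
Definition flat_exp (k : nat) (y : R) : R := if 0 < y then y ^- k * expR (- y^-1) else 0.

Lemma flat_exp_ge0 k y : 0 <= flat_exp k y.
Proof. by rewrite /flat_exp; case: ifP => // y0; rewrite mulr_ge0 ?expR_ge0// invr_ge0 exprn_ge0// ltW. Qed.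

(** Lipschitz at 0, from [exp z >= (z / (k + 1))^(k + 1)] with [z = 1 / y]. *)
Lemma flat_exp_near0 k y : flat_exp k y <= k.+1%:R ^+ k.+1 * `|y|.
Proof.
rewrite /flat_exp; case: ifPn => [y0|_]; last by rewrite mulr_ge0 ?exprn_ge0.
rewrite gtr0_norm// expRN ler_pdivrMr ?expR_gt0//.
set z := y^-1; have z0 : 0 < z by rewrite invr_gt0.
have h : (z / k.+1%:R) ^+ k.+1 <= expR z.
  rewrite [X in expR X](_ : z = k.+1%:R * (z / k.+1%:R)); last by rewrite mulrC divfK// pnatr_eq0.
  rewrite expRM_natl lerXn2r ?nnegrE ?expR_ge0 ?divr_ge0 ?(ltW z0)//.
  by rewrite (le_trans _ (expR_ge1Dx _))// lerDr.
rewrite -exprVn -/z -[y]invrK -/z.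
have n0 : 0 < k.+1%:R ^+ k.+1 :> R by rewrite exprn_gt0// ltr0n.
have {}h : z ^+ k.+1 <= k.+1%:R ^+ k.+1 * expR z.
  by rewrite mulrC -ler_pdivrMr// -exprVn -exprMn.
rewrite -(ler_pM2r z0) -exprSr (le_trans h)//.
by rewrite [leRHS](_ : _ = k.+1%:R ^+ k.+1 * expR z)//; field; rewrite gt_eqF.
Qed.

Lemma flat_exp_neg k y : y <= 0 -> flat_exp k y = 0.
Proof. by rewrite /flat_exp leNgt => /negbTE ->. Qed.

Lemma flat_exp_divr k y : flat_exp k y / y = flat_exp k.+1 y.
Proof.
rewrite /flat_exp; case: ifPn => [y0|]; last by rewrite mul0r.
by rewrite exprSr invfM; ring.
Qed.

(** At 0 the difference quotient is [flat_exp k.+1], which tends to 0. *)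
Lemma flat_exp_is_derive k y : is_derive y (1 : R) (flat_exp k) (- k%:R * flat_exp k.+1 y + flat_exp k.+2 y).
Proof.
have [y0|y0|<-] := ltgtP 0 y.
- have dV : is_derive y (1 : R) (fun x : R => x^-1) (- y ^- 2).
    have h := is_deriveV (lt0r_neq0 y0 : id y != 0) (is_derive_id y (1 : R)).
    by apply: (is_derive_eq h); rewrite /GRing.scale/= mulr1.
  pose G (z : R) := z ^+ k * expR (- z).
  have dG z : is_derive z (1 : R) G ((k%:R * z ^+ k.-1 - z ^+ k) * expR (- z)).
    have dN : is_derive z (1 : R) (fun z : R => - z) (- 1) by exact: is_deriveN (is_derive_id z (1 : R)).
    have dE := is_derive1_comp (is_derive_expR (- z)) dN.
    have dX := is_deriveX k (is_derive_id z (1 : R)).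
    have h := is_deriveM dX dE.
    have -> : G = (@id R) ^+ k * (expR \o -%R) by apply/funext => x; rewrite /G !fctE.
    by apply: (is_derive_eq h); rewrite /GRing.scale/= mulr1 fctE; ring.
  have h := is_derive1_comp (dG y^-1) dV.
  apply: (@near_eq_is_derive _ _ _ (G \o (fun x : R => x^-1))).
    near=> x; have x0 : 0 < x by near: x; exact: lt_nbhsr.
    by rewrite /G/= /flat_exp x0 exprVn.
  apply: (is_derive_eq h); rewrite /flat_exp y0; case: k {G dG h} => [|k]/=.
    by rewrite !mul0r expr0 oppr0 mul0r; ring.
  rewrite !exprVn; have : y ^+ k != 0 by rewrite expf_neq0// gt_eqF.
  rewrite !exprS; move: (y ^+ k) (expR _) => Y e Y0; field.
  by rewrite Y0 gt_eqF.
- apply: (@near_eq_is_derive _ _ _ (cst 0)).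
    near=> x; have x0 : x < 0 by near: x; exact: lt_nbhsl.
    by rewrite flat_exp_neg// ltW.
  by apply: (is_derive_eq (is_derive_cst 0 y (1 : R))); rewrite !flat_exp_neg ?(ltW y0)// mulr0 addr0.
- have c : h^-1 *: (flat_exp k (h *: 1 + 0) - flat_exp k 0) @[h --> 0^'] --> (0 : R).
    rewrite (_ : (fun h => _) = flat_exp k.+1); last first.
      apply/funext => h; rewrite /GRing.scale/= mulr1 addr0 (flat_exp_neg k (lexx 0)) subr0.
      by rewrite mulrC flat_exp_divr.
    apply: cvg_within_filter; apply/norm_cvg0P.
    apply: (@squeeze_cvgr _ _ _ _ (cst 0) (fun x => k.+2%:R ^+ k.+2 * `|x|)).
    - by apply: nearW => x; rewrite normr_ge0/= ger0_norm ?flat_exp_ge0// flat_exp_near0.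
    - exact: cvg_cst.
    - rewrite -[X in _ --> X](mulr0 (k.+2%:R ^+ k.+2)); apply: cvgM; first exact: cvg_cst.
      by rewrite -[X in _ --> X](normr0 R); apply: cvg_norm; exact: cvg_id.
  rewrite !(flat_exp_neg _ (lexx 0)) mulr0 addr0.
  apply: DeriveDef; first by apply/cvg_ex; exists 0.
  exact: cvg_lim c.
Unshelve. all: by end_near. Qed.

Lemma smooth_flat_exp n k : smooth n (flat_exp k).
Proof.
elim: n k => [|n IH] k.
  split => // y; apply: differentiable_continuous; apply/derivable1_diffP.
  exact: (is_derive_derive1 (flat_exp_is_derive k y)).1.
apply: (smooth_of_is_derive (flat_exp_is_derive k)).
by apply: smoothD => //; apply: smoothM => //; exact: smooth_cst.
Qed.

Lemma flat_exp_mulr k y : y * flat_exp k.+1 y = flat_exp k y.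
Proof.
rewrite /flat_exp; case: ifPn => [y0|]; last by rewrite mulr0.
by rewrite exprSr invfM; field; rewrite ?expf_neq0 ?gt_eqF.
Qed.

(** The ramp [y * flat_exp 0 y] is a smooth version of the positive part; [ramp'] is
    its derivative. *)
Definition ramp (y : R) : R := y * flat_exp 0 y.
Definition ramp' (y : R) : R := flat_exp 0 y + flat_exp 1 y.

Lemma ramp_is_derive y : is_derive y (1 : R) ramp (ramp' y).
Proof.
have h := is_deriveM (is_derive_id y (1 : R)) (flat_exp_is_derive 0 y).
apply: (is_derive_eq h); rewrite /GRing.scale/= oppr0 mul0r add0r mulr1 flat_exp_mulr /ramp'.
exact: addrC.
Qed.

Lemma ramp'_itv y : 0 <= ramp' y <= 1.
Proof.
rewrite addr_ge0 ?flat_exp_ge0//= /ramp' /flat_exp; case: ifPn => [y0|]; last by rewrite addr0.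
rewrite expr0 invr1 mul1r expr1 -[X in X + _]mul1r -mulrDl expRN ler_pdivrMr ?expR_gt0//.
by rewrite mul1r expR_ge1Dx.
Qed.

Lemma flat_exp0_le1 y : flat_exp 0 y <= 1.
Proof. by have /andP[_] := ramp'_itv y; apply: le_trans; rewrite /ramp' lerDl flat_exp_ge0. Qed.

Lemma flat_exp2_le y : 0 < y -> flat_exp 2 y <= y ^- 2.
Proof.
move=> y0; have := flat_exp0_le1 y; rewrite /flat_exp y0 expr0 invr1 mul1r => h.
by rewrite ler_piMr// invr_ge0 exprn_ge0// ltW.
Qed.

Lemma flat_exp0_near1 y : 0 < y -> 1 - y^-1 <= flat_exp 0 y.
Proof. by move=> y0; rewrite /flat_exp y0 expr0 invr1 mul1r (le_trans _ (expR_ge1Dx _)). Qed.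

(** Scaled up, [flat_exp 0] and [ramp'] are approximations of the Heaviside function. *)
Lemma heaviside_cvg (f : R -> R) y : (forall z, flat_exp 0 z <= f z <= 1) -> (forall z, z <= 0 -> f z = 0) ->
  f (n.+1%:R * y) @[n --> \oo] --> ((0 < y)%R%:R : R).
Proof.
move=> fb f0; case: (ltP 0 y) => y0 /=; last first.
  rewrite (_ : (fun n => _) = cst 0); first exact: cvg_cst.
  by apply/funext => n; rewrite f0// mulr_ge0_le0.
have c1 : 1 - (n.+1%:R * y)^-1 @[n --> \oo] --> (1 : R).
  rewrite -[X in _ --> X]subr0; apply: cvgB; first exact: cvg_cst.
  rewrite (_ : (fun n => _) = (fun n => harmonic n * y^-1)); last first.
    by apply/funext => n; rewrite invfM.
  by rewrite -[X in _ --> X](mul0r y^-1); apply: cvgM; [exact: cvg_harmonic|exact: cvg_cst].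
apply: (@squeeze_cvgr _ _ _ _ (fun n => 1 - (n.+1%:R * y)^-1) (cst 1)) => //; last exact: cvg_cst.
apply: nearW => n; have /andP[h1 ->] := fb (n.+1%:R * y).
by rewrite andbT (le_trans _ h1)// flat_exp0_near1// mulr_gt0.
Qed.

Lemma flat_exp0_cvg y : flat_exp 0 (n.+1%:R * y) @[n --> \oo] --> ((0 < y)%R%:R : R).
Proof.
by apply: heaviside_cvg => z; [rewrite lexx flat_exp0_le1|exact: flat_exp_neg].
Qed.

Lemma ramp'_cvg y : ramp' (n.+1%:R * y) @[n --> \oo] --> ((0 < y)%R%:R : R).
Proof.
apply: heaviside_cvg => z; last by move=> z0; rewrite /ramp' !flat_exp_neg// addr0.
by have /andP[_ ->] := ramp'_itv z; rewrite /ramp' lerDl flat_exp_ge0.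
Qed.

Lemma ramp_homo : {homo ramp : x y / x <= y}.
Proof.
move=> x y xy.
have d z := is_derive_derive1 (ramp_is_derive z).
have [||c _ E] := @MVT_segment R ramp ramp' x y xy.
- by move=> z _; exact: ramp_is_derive.
- apply: continuous_subspaceT => z.
  by apply: differentiable_continuous; apply/derivable1_diffP; exact: (d z).1.
by rewrite -subr_ge0 E mulr_ge0 ?subr_ge0//; case/andP: (ramp'_itv c).
Qed.

Lemma ramp_lipschitz x y : `|ramp x - ramp y| <= `|x - y|.
Proof.
rewrite -[leRHS]mul1r; apply: derive_bound_lipschitz => z.
  exact: (is_derive_derive1 (ramp_is_derive z)).1.
by rewrite (is_derive_derive1 (ramp_is_derive z)).2 ger0_norm; case/andP: (ramp'_itv z).
Qed.

Lemma smooth_ramp n : smooth n ramp.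
Proof. by apply: smoothM; [exact: smooth_id|exact: smooth_flat_exp]. Qed.

End flat_exp.

Section approximate_identities.
Context {R : realType}.
Variables (al be s1 s2 : R) (n : nat).
Hypothesis s12 : s1 <= s2.
Local Notation N := (n.+1%:R : R).

(** Approximation of the indicator of [al, be]. *)
Definition box_fun (x : R) : R := flat_exp 0 (N * (x - al)) * flat_exp 0 (N * (be - x)).

(** Approximation of a function of time with slope -1 on [s1, s2] and 0
    elsewhere, cut off for negative times. *)
Definition slope_fun (t : R) : R :=
  N^-1 * (ramp (N * (s2 - t)) - ramp (N * (s1 - t))) * flat_exp 0 (N * (t + 1)).

Let N0 : 0 < N.
Proof. by rewrite ltr0n. Qed.

Lemma box_fun_ge0 x : 0 <= box_fun x.
Proof. by rewrite mulr_ge0 ?flat_exp_ge0. Qed.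

Lemma box_fun_le1 x : box_fun x <= 1.
Proof. by rewrite -[leRHS]mulr1 ler_pM ?flat_exp_ge0 ?flat_exp0_le1. Qed.

Lemma box_fun_out x : ~~ (al < x < be) -> box_fun x = 0.
Proof.
rewrite negb_and -!leNgt /box_fun => /orP[h|h].
  by rewrite (flat_exp_neg 0 (_ : N * (x - al) <= 0)) ?mul0r// pmulr_rle0// subr_le0.
by rewrite (flat_exp_neg 0 (_ : N * (be - x) <= 0)) ?mulr0// pmulr_rle0// subr_le0.
Qed.

Lemma smooth_box_fun m : smooth m box_fun.
Proof.
apply: smoothM.
  rewrite (_ : (fun x => _) = (fun x => flat_exp 0 (N * x + - (N * al)))).
    by apply: smooth_affine; exact: smooth_flat_exp.
  by apply/funext => x; rewrite mulrBr.
rewrite (_ : (fun x => _) = (fun x => flat_exp 0 (- N * x + N * be))).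
  by apply: smooth_affine; exact: smooth_flat_exp.
by apply/funext => x; congr flat_exp; ring.
Qed.

Lemma smooth_slope_fun m : smooth m slope_fun.
Proof.
have sr s : smooth m (fun t => ramp (N * (s - t))).
  rewrite (_ : (fun x => _) = (fun x => ramp (- N * x + N * s))).
    by apply: smooth_affine; exact: smooth_ramp.
  by apply/funext => x; congr ramp; ring.
apply: smoothM; last first.
  rewrite (_ : (fun x => _) = (fun x => flat_exp 0 (N * x + N))).
    by apply: smooth_affine; exact: smooth_flat_exp.
  by apply/funext => x; rewrite mulrDr mulr1.
apply: smoothM; first exact: smooth_cst.
apply: smoothD => //.
rewrite (_ : (fun x => _) = (fun x => (-1) * ramp (N * (s1 - x)))).
  by apply: smoothM => //; exact: smooth_cst.
by apply/funext => x; rewrite mulN1r.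
Qed.

Lemma slope_fun_ge0 t : 0 <= slope_fun t.
Proof.
rewrite !mulr_ge0 ?flat_exp_ge0 ?invr_ge0 ?(ltW N0)// subr_ge0; apply: ramp_homo.
by rewrite ler_pM2l// lerD2r.
Qed.

Lemma slope_diff_bound t : `|N^-1 * (ramp (N * (s2 - t)) - ramp (N * (s1 - t)))| <= s2 - s1.
Proof.
rewrite normrM gtr0_norm ?invr_gt0// ler_pdivrMl// (le_trans (ramp_lipschitz _ _))//.
rewrite -mulrBr (_ : s2 - t - (s1 - t) = s2 - s1); last by ring.
by rewrite ger0_norm// mulr_ge0 ?subr_ge0// ltW.
Qed.

Lemma slope_fun_bound t : slope_fun t <= s2 - s1.
Proof.
rewrite -[leRHS]mulr1 /slope_fun; apply: le_trans (ler_norm _) _.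
rewrite normrM ler_pM// ?slope_diff_bound//.
by rewrite ger0_norm ?flat_exp_ge0// flat_exp0_le1.
Qed.

Lemma slope_fun_late t : s2 <= t -> slope_fun t = 0.
Proof.
move=> st; rewrite /slope_fun /ramp (flat_exp_neg 0 (_ : N * (s2 - t) <= 0)) ?pmulr_rle0 ?subr_le0//.
rewrite (flat_exp_neg 0 (_ : N * (s1 - t) <= 0)) ?pmulr_rle0 ?subr_le0 ?(le_trans s12)//.
by rewrite !mulr0 subrr mulr0 mul0r.
Qed.

Lemma slope_fun_early t : t <= - 1 -> slope_fun t = 0.
Proof.
by move=> t1; rewrite /slope_fun (flat_exp_neg 0) ?mulr0// pmulr_rle0//; move: t1; lra.
Qed.

Definition slope_fun' (t : R) : R :=
  - (ramp' (N * (s2 - t)) - ramp' (N * (s1 - t))) * flat_exp 0 (N * (t + 1)) +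
  N^-1 * (ramp (N * (s2 - t)) - ramp (N * (s1 - t))) * (N * flat_exp 2 (N * (t + 1))).

Lemma slope_fun_is_derive t : is_derive t (1 : R) slope_fun (slope_fun' t).
Proof.
have dr s : is_derive t (1 : R) (fun t => ramp (N * (s - t))) (- N * ramp' (N * (s - t))).
  have h := @is_derive1_comp _ ramp (fun t => - N * t + N * s) t _ _ (ramp_is_derive _)
    (is_derive_affine (- N) (N * s) t).
  rewrite (_ : (fun t => _) = ramp \o (fun t => - N * t + N * s)); last first.
    by apply/funext => x /=; congr ramp; ring.
  by apply: (is_derive_eq h); rewrite mulrC; congr (_ * ramp' _); ring.
have de : is_derive t (1 : R) (fun t => flat_exp 0 (N * (t + 1))) (N * flat_exp 2 (N * (t + 1))).
  have h := @is_derive1_comp _ (flat_exp 0) (fun t => N * t + N) t _ _ (flat_exp_is_derive 0 _)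
    (is_derive_affine N N t).
  rewrite (_ : (fun t => _) = flat_exp 0 \o (fun t => N * t + N)); last first.
    by apply/funext => x /=; congr flat_exp; ring.
  apply: (is_derive_eq h); rewrite oppr0 mul0r add0r mulrC; congr (_ * flat_exp _ _); ring.
have h := is_deriveM (is_deriveZ N^-1 (is_deriveB (dr s2) (dr s1))) de.
apply: (is_derive_eq h); rewrite /slope_fun' /GRing.scale/= !fctE.
move: (ramp _) (ramp _) (ramp' _) (ramp' _) (flat_exp _ _) (flat_exp _ _) => a b c e f k.
by rewrite /GRing.scale/=; field; rewrite gt_eqF.
Qed.

Lemma slope_cutoff_bound t : 0 <= t ->
  `|N^-1 * (ramp (N * (s2 - t)) - ramp (N * (s1 - t))) * (N * flat_exp 2 (N * (t + 1)))| <=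
  (s2 - s1) * N^-1.
Proof.
move=> t0; rewrite normrM ler_pM ?slope_diff_bound//.
rewrite normrM ger0_norm ?(ltW N0)// ger0_norm ?flat_exp_ge0//.
have t1 : 0 < t + 1 by rewrite ltr_wpDl.
rewrite (le_trans (ler_wpM2l (ltW N0) (flat_exp2_le (mulr_gt0 N0 t1))))//.
rewrite -[X in _ <= X](_ : N / N ^+ 2 = N^-1); last by field; rewrite gt_eqF.
rewrite ler_wpM2l ?(ltW N0)// lef_pV2 ?posrE ?exprn_gt0// ?mulr_gt0//.
by rewrite lerXn2r ?nnegrE ?mulr_ge0 ?(ltW N0) ?(ltW t1)// ler_peMr ?(ltW N0)// lerDr.
Qed.

Lemma slope_fun'_bound t : 0 <= t -> `|slope_fun' t| <= 1 + (s2 - s1).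
Proof.
move=> t0; rewrite (le_trans (ler_normD _ _))// lerD//.
  rewrite normrM -[leRHS]mulr1 ler_pM//; last by rewrite ger0_norm ?flat_exp_ge0 ?flat_exp0_le1.
  have := ramp'_itv (N * (s2 - t)); have := ramp'_itv (N * (s1 - t)).
  by rewrite normrN ler_norml; lra.
rewrite (le_trans (slope_cutoff_bound t0))// ler_piMr ?subr_ge0//.
by rewrite invf_le1// ler1n.
Qed.

Lemma tensor_test_function (T : R) : s2 < T -> test_function T (fun x t => box_fun x * slope_fun t).
Proof.
move=> s2T.
have sub : closure [set z : R * R | box_fun z.1 * slope_fun z.2 != 0] `<=` `[al, be]%classic `*` `[-1, s2]%classic.
  have cl : closed (`[al, be]%classic `*` `[-1, s2]%classic : set (R * R)).
    by apply: compact_closed; [exact: norm_hausdorff|apply: compact_setX; exact: segment_compact].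
  rewrite [X in _ `<=` X](proj1 (closure_id _) cl); apply: closure_subset => -[x t] /=.
  rewrite mulf_eq0 negb_or !in_itv/= => /andP[a0 b0]; split.
    have : al < x < be by apply: contraNT a0 => h; rewrite box_fun_out.
    by move=> /andP[/ltW -> /ltW ->].
  apply/andP; split.
    by rewrite leNgt; apply: contra b0 => /ltW h; rewrite slope_fun_early.
  by rewrite leNgt; apply: contra b0 => /ltW h; rewrite slope_fun_late.
split.
- by move=> m; apply: smooth_tensor; [exact: smooth_box_fun|exact: smooth_slope_fun].
- apply: (subclosed_compact _ _ sub); first exact: closed_closure.
  by apply: compact_setX; exact: segment_compact.
- move=> z /sub[_]; rewrite /= in_itv/= => /andP[_ h]; exact: le_lt_trans h s2T.
Qed.

End approximate_identities.

Section approximation_limits.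
Context {R : realType}.
Variables (al be s1 s2 : R).
Hypothesis s12 : s1 <= s2.

Lemma box_fun_cvg x : box_fun al be n x @[n --> \oo] --> ((al < x < be)%R%:R : R).
Proof.
rewrite (_ : ((al < x < be)%R%:R : R) = (0 < x - al)%R%:R * (0 < be - x)%R%:R); last first.
  by rewrite !subr_gt0 -natrM mulnb.
by apply: cvgM; exact: flat_exp0_cvg.
Qed.

Lemma slope_fun'_cvg t : 0 <= t ->
  slope_fun' s1 s2 n t @[n --> \oo] --> - ((s1 <= t < s2)%R%:R : R).
Proof.
move=> t0; rewrite (_ : - _ = - ((0 < s2 - t)%R%:R - (0 < s1 - t)%R%:R) * 1 + 0); last first.
  rewrite addr0 mulr1 !subr_gt0; congr (- _).
  case: (ltP t s1) => /= h; last by rewrite subr0.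
  by rewrite (lt_le_trans h s12) subrr.
apply: cvgD.
  apply: cvgM; first by apply: cvgN; apply: cvgB; exact: ramp'_cvg.
  have := @flat_exp0_cvg R (t + 1); rewrite (_ : 0 < t + 1)//.
  by rewrite ltr_wpDl.
apply/norm_cvg0P.
apply: (@squeeze_cvgr _ _ _ _ (cst 0) (fun n => (s2 - s1) * harmonic n)).
- by apply: nearW => n; rewrite normr_ge0/=; exact: slope_cutoff_bound.
- exact: cvg_cst.
- rewrite -[X in _ --> X](mulr0 (s2 - s1)); apply: cvgM; first exact: cvg_cst.
  exact: cvg_harmonic.
Qed.

End approximation_limits.

(** * Null sets of products and means over intervals *)

Section product_null_sets.
Context d1 d2 (T1 : measurableType d1) (T2 : measurableType d2) (R : realType).
Variables (m1 : {sigma_finite_measure set T1 -> \bar R})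
          (m2 : {sigma_finite_measure set T2 -> \bar R}).

(** Positive and negative parts are treated separately by Tonelli's theorem, so
    that no integrability is required. *)
Lemma measurable_Rintegral_param (f : T1 * T2 -> R) : measurable_fun setT f ->
  measurable_fun setT (fun x => \int[m2]_y f (x, y)).
Proof.
move=> mf.
have mE : measurable_fun setT (EFin \o f) by exact/measurable_EFinP.
have h := emeasurable_funB
  (measurable_fun_fubini_tonelli_F (m2 := m2) _ (measurable_funepos mE) (fun z => funepos_ge0 _ z))
  (measurable_fun_fubini_tonelli_F (m2 := m2) _ (measurable_funeneg mE) (fun z => funeneg_ge0 _ z)).
have h' : measurable_fun setT
    (fun x => fine ((fubini_F m2 (EFin \o f)^\+ \- fubini_F m2 (EFin \o f)^\-) x)%E).
  exact: measurableT_comp h.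
apply: (eq_measurable_fun _ _ h') => x _.
rewrite /Rintegral (integralE m2 setT (fun y => (f (x, y))%:E)).
rewrite /fubini_F.
congr (fine (_ - _)%E).
  apply: eq_integral.
  move=> y _.
  by rewrite !funeposE.
by apply: eq_integral => y _; rewrite !funenegE.
Qed.

Lemma product_measure_sections (A : set (T1 * T2)) : measurable A ->
  ((m1 \x m2) A = \int[m2]_y m1 (ysection A y))%E.
Proof.
move=> mA; have := integral_indic (m1 \x m2)%E measurableT mA.
rewrite setIT => <-; rewrite indic_fubini_tonelli1// indic_fubini_tonelli//.
by rewrite indic_fubini_tonelli_GE.
Qed.

Let measurable_sections (A : set (T1 * T2)) : measurable A ->
  measurable_fun setT (fun y => m1 (ysection A y)).
Proof.
move=> mA; have := indic_measurable_fun_fubini_tonelli_G m1 mA.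
by rewrite indic_fubini_tonelli_GE.
Qed.

Lemma ae_sections (P : T1 -> T2 -> Prop) : {ae (m1 \x m2)%E, forall z, P z.1 z.2} ->
  {ae m2, forall y, {ae m1, forall x, P x y}}.
Proof.
move=> [A [mA A0 PA]].
have mS := measurable_sections mA.
have : ae_eq m2 setT (fun y => m1 (ysection A y)) (cst 0%E).
  apply/(ae_eq_integral_abs m2 measurableT mS).
  by under eq_integral do rewrite gee0_abs//; rewrite -product_measure_sections.
apply: (@filterS _ _ (ae_filter_ringOfSetsType m2)) => y /(_ I) y0.
exists (ysection A y); split => //; first exact: measurable_ysection.
by move=> x nP; rewrite ysectionE/=; apply: PA.
Qed.

Lemma sections_ae (A : set (T1 * T2)) : measurable A ->
  {ae m2, forall y, {ae m1, forall x, ~ A (x, y)}} ->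
  {ae (m1 \x m2)%E, forall z, ~ A z}.
Proof.
move=> mA A0; exists A; split => //; last by move=> z /= /contrapT.
have mS := measurable_sections mA.
rewrite product_measure_sections//.
transitivity (\int[m2]_y `|m1 (ysection A y)|)%E.
  by apply: eq_integral => y _; rewrite gee0_abs.
apply/(ae_eq_integral_abs m2 measurableT mS).
apply: (@filterS _ _ (ae_filter_ringOfSetsType m2) _ _ _ A0) => y [B [mB B0 BP]] _ /=.
apply/eqP; rewrite eq_le measure_ge0 andbT -B0; apply: le_measure.
- by rewrite inE; exact: measurable_ysection.
- by rewrite inE.
- by move=> x; rewrite ysectionE/= => Ax; apply: BP => /=; apply.
Qed.

End product_null_sets.

Section bound_from_intervals.
Context {R : realType}.
Local Notation mu := (@lebesgue_measure R).
Local Notation TR := (measurableTypeR R).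

(** Lebesgue's differentiation theorem, with intervals to the left of a point so
    that the bound is evaluated at the point itself. *)
Lemma ae_bound_of_means (f : TR -> R) (M : R) (K : R -> R) (a0 b0 : R) :
  measurable_fun setT f -> (forall x, `|f x| <= M) ->
  (forall a b, a0 < a < b -> b < b0 -> `|\int[mu]_(x in `[a, b]) f x| <= K b * (b - a)) ->
  {ae mu, forall x, a0 < x < b0 -> `|f x| <= K x}.
Proof.
move=> mf fM fK.
have M0 : 0 <= M by exact: le_trans (fM 0).
have fi a b : mu.-integrable (`[a, b]%classic : set TR) (EFin \o f).
  have abo : (mu (`[a, b]%classic : set TR) < +oo)%E.
    by rewrite lebesgue_measure_itv/=; case: ifP => // _; rewrite -EFinB ltry.
  by apply: (integrable_bounded (M := M)) => //; exact: measurable_funTS.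
have li : locally_integrable [set: R] f.
  split => //; first exact: openT.
  move=> A _ cA; have [N AN] := compact_window cA.
  have mA : measurable (A : set TR).
    by apply: closed_measurable; apply: compact_closed => //; exact: norm_hausdorff.
  have mW : measurable (window N%:R : set TR) by exact: measurable_window.
  apply: (@le_lt_trans _ _ (\int[mu]_(x in window N%:R) `|f x|%:E)%E).
    apply: ge0_subset_integral => //; apply/measurable_EFinP.
    by apply: measurableT_comp => //; exact: measurable_funTS.
  by have /integrableP[] := fi (- N%:R) N%:R.
have := @FTC1 R f (BLeft a0) (fun y => fi a0 y) li.
apply: (@filterS _ _ (ae_filter_ringOfSetsType mu)) => x /= h /andP[a0x xb0].
have [|dF <-] := h; first by rewrite lte_fin.
set F := fun x => _ in dF *.
have FB h' : 0 < h' -> a0 < x - h' -> `|F x - F (x - h')| <= K x * h'.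
  move=> h0 ax.
  have hx : x - h' < x by rewrite gtrBl.
  have a0x' := ltW ax.
  rewrite /F Rintegral_itvB//; last by rewrite bnd_simp ltW.
  rewrite Rintegral_itv_obnd_cbnd; last first.
    by apply: integrableS (fi (x - h') x) => // t /=; rewrite !in_itv/= => /andP[/ltW -> ->].
  have := fK (x - h') x; rewrite ax hx => /(_ isT xb0).
  by rewrite (_ : x - (x - h') = h')//; ring.
pose e m := (x - a0) / 2 * harmonic m.
have e0 m : 0 < e m by rewrite mulr_gt0 ?divr_gt0 ?subr_gt0 ?harmonic_gt0.
have ec : e m @[m --> \oo] --> 0.
  rewrite -[X in _ --> X](mulr0 ((x - a0) / 2)); apply: cvgM; first exact: cvg_cst.
  exact: cvg_harmonic.
have h' := cvg_norm (left_quotient_cvg dF e0 ec).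
apply: (cvgr_to_le (h' _)); apply: nearW => m.
rewrite normrM normfV (gtr0_norm (e0 m)) ler_pdivrMr//; apply: FB => //.
have h1 : harmonic m <= 1 :> R by rewrite invf_le1// ler1n.
have : e m <= (x - a0) / 2 by rewrite ler_piMr// divr_ge0// subr_ge0 ltW.
by move: a0x; lra.
Qed.

End bound_from_intervals.

(** * Entropy solutions tested with tensor products *)

Section bounded_representative.
Context {R : realType}.
Local Notation mu := (@lebesgue_measure R).
Local Notation TR := (measurableTypeR R).
Variables (T M : R) (v : R -> R -> R).
Hypotheses (M0 : 0 <= M).
Hypothesis mv : measurable_fun (strip T) (fun z : TR * TR => v z.1 z.2 : R).
Hypothesis vM : {ae (mu \x mu)%E, forall z, strip T z -> `|v z.1 z.2| <= M}.

(** Entropy solutions are measurable and essentially bounded on the strip only;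
    the representative has these properties everywhere. *)
Definition on_strip (x t : R) : R := if 0 < t < T then v x t else 0.
Definition representative (x t : R) : R := Num.max (- M) (Num.min M (on_strip x t)).

Lemma measurable_strip : measurable (strip T : set (TR * TR)).
Proof.
have -> : strip T = snd @^-1` (`]0, T[%classic : set TR) :> set (TR * TR).
  by apply/seteqP; split => z /=; rewrite in_itv.
rewrite -[X in measurable X]setTI; apply: measurable_snd => //; exact: measurable_itv.
Qed.

Lemma measurable_on_strip : measurable_fun [set: TR * TR] (fun z : TR * TR => on_strip z.1 z.2 : R).
Proof.
have -> : (fun z : TR * TR => on_strip z.1 z.2 : R) = (fun z => v z.1 z.2) \_ (strip T).
  apply/funext => z; rewrite patchE /on_strip; case: ifPn => h; case: ifPn => //.
    by rewrite notin_setE => /(_ h).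
  by rewrite inE => h'; rewrite h' in h.
apply/(measurable_restrict _ measurable_strip measurableT).
by rewrite setTI.
Qed.

Lemma measurable_representative :
  measurable_fun [set: TR * TR] (fun z : TR * TR => representative z.1 z.2 : R).
Proof.
apply: measurable_maxr; first exact: measurable_cst.
apply: measurable_minr; first exact: measurable_cst.
exact: measurable_on_strip.
Qed.

Lemma representative_bound x t : `|representative x t| <= M.
Proof.
rewrite ler_norml /representative le_max lexx/= ge_max ge_min lexx/= andbT.
by rewrite (le_trans _ M0)// oppr_le0.
Qed.

Lemma representative_eq x t : `|on_strip x t| <= M -> representative x t = on_strip x t.
Proof.
rewrite ler_norml => /andP[h1 h2].
by rewrite /representative (min_idPr _)// (max_idPr _).
Qed.

(** For almost every time the bound holds on the slice, by Fubini's theorem. *)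
Lemma ae_representative : {ae mu, forall t, 0 < t < T -> {ae mu, forall x, v x t = representative x t}}.
Proof.
have := ae_sections (P := fun x t => strip T (x, t) -> `|v x t| <= M) vM.
apply: (@filterS _ _ (ae_filter_ringOfSetsType mu)) => t h tT.
move: h; apply: (@filterS _ _ (ae_filter_ringOfSetsType mu)) => x h.
have vx : v x t = on_strip x t by rewrite /on_strip tT.
by rewrite representative_eq -vx//; apply: h.
Qed.

End bounded_representative.

Section linear_combinations.
Context d (X : measurableType d) (R : realType) (mu : {measure set X -> \bar R}).
Variables (D : set X) (f : X -> R).
Hypotheses (mD : measurable D) (fi : mu.-integrable D (EFin \o f)).

Lemma integrable_scale (c : R) : mu.-integrable D (EFin \o (fun x => c * f x)).
Proof. by have := integrableZl mD c fi; apply: eq_integrable. Qed.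

End linear_combinations.

Lemma Rintegral_lincomb d (X : measurableType d) (R : realType) (mu : {measure set X -> \bar R})
    (D : set X) (f g : X -> R) (a b : R) : measurable D ->
  mu.-integrable D (EFin \o f) -> mu.-integrable D (EFin \o g) ->
  \int[mu]_(x in D) (a * f x + b * g x) = a * \int[mu]_(x in D) f x + b * \int[mu]_(x in D) g x.
Proof.
move=> mD fi gi; rewrite RintegralD//; [|exact: integrable_scale..].
by rewrite !RintegralZl.
Qed.

Lemma continuous_segment_bound (R : realType) (T : R) (f : R -> R) : 0 <= T -> continuous f ->
  exists2 B, 0 <= B & forall t, 0 <= t <= T -> `|f t| <= B.
Proof.
move=> T0 cf; have [|c _ cmax] := @EVT_max R (fun t => `|f t|) _ _ T0.
  by apply: continuous_subspaceT => z; apply: continuous_comp; [exact: cf|exact: norm_continuous].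
by exists `|f c| => // t tT; apply: cmax; rewrite in_itv.
Qed.

Section nonlocal_measurability.
Context {R : realType}.
Local Notation mu := (@lebesgue_measure R).
Local Notation TR := (measurableTypeR R).

Lemma measurable_Rintegral_param1 (f : TR * TR -> R) : measurable_fun setT f ->
  measurable_fun [set: TR] (fun y : TR => \int[mu]_x f (x, y) : R).
Proof.
move=> mf; apply: (measurable_Rintegral_param mu (f := fun z : TR * TR => f (z.2, z.1))).
exact: measurableT_comp mf (measurable_fun_pair measurable_snd measurable_fst).
Qed.

(** The inner integral depends on the parameters [x] and [t]; the kernel is
    extended by zero to integrate over the whole line. *)
Lemma measurable_nonlocal_density (delta : R) (w : R -> R) (Q : R -> R -> R) (LQ : R)
    (psi v : R -> R -> R) : nonlocal_kernel delta w -> 0 <= LQ ->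
  (forall a b a' b', `|Q a b - Q a' b'| <= LQ * (`|a - a'| + `|b - b'|)) ->
  measurable_fun [set: TR * TR] (fun z : TR * TR => psi z.1 z.2 : R) ->
  measurable_fun [set: TR * TR] (fun z : TR * TR => v z.1 z.2 : R) ->
  measurable_fun [set: TR * TR] (fun z : TR * TR => \int[mu]_(h in `[0, delta])
    ((psi (z.1 + h) z.2 - psi z.1 z.2) / h * Q (v z.1 z.2) (v (z.1 + h) z.2) * w h) : R).
Proof.
move=> wK LQ0 QL mpsi mv; set D := `[0, delta]%classic : set TR.
have mD : measurable D by exact: measurable_itv.
have mw : measurable_fun setT (w \_ D : TR -> R).
  apply/(measurable_restrict _ mD measurableT); apply: measurable_funTS.
  by case: wK => /measurable_int/measurable_EFinP.
pose f (y : (TR * TR) * TR) : R := (psi (y.1.1 + y.2) y.1.2 - psi y.1.1 y.1.2) / y.2 *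
  Q (v y.1.1 y.1.2) (v (y.1.1 + y.2) y.1.2) * (w \_ D) y.2.
have m11 : measurable_fun setT (fun y : (TR * TR) * TR => y.1.1 : TR).
  exact: measurableT_comp measurable_fst measurable_fst.
have m12 : measurable_fun setT (fun y : (TR * TR) * TR => y.1.2 : TR).
  exact: measurableT_comp measurable_snd measurable_fst.
have m2 : measurable_fun setT (fun y : (TR * TR) * TR => y.2 : TR) by exact: measurable_snd.
have m1s : measurable_fun setT (fun y : (TR * TR) * TR => y.1.1 + y.2 : TR).
  exact: measurable_funD m11 m2.
have sh q : measurable_fun [set: TR * TR] (fun z : TR * TR => q z.1 z.2 : R) ->
    measurable_fun setT (fun y : (TR * TR) * TR => q (y.1.1 + y.2) y.1.2 : R).
  move=> mq; have mp := measurable_fun_pair m1s m12.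
  exact: (@measurableT_comp _ _ _ _ _ _ (fun z : TR * TR => q z.1 z.2 : R) setT _ mq mp).
have un q : measurable_fun [set: TR * TR] (fun z : TR * TR => q z.1 z.2 : R) ->
    measurable_fun setT (fun y : (TR * TR) * TR => q y.1.1 y.1.2 : R).
  by move=> mq; exact: measurableT_comp mq measurable_fst.
have mf : measurable_fun setT f.
  apply: measurable_funM; last exact: measurableT_comp mw m2.
  apply: measurable_funM; last by apply: (Q_measurable LQ0 QL); [exact: un|exact: sh].
  apply: measurable_funM; first by apply: measurable_funB; [exact: sh|exact: un].
  exact: measurableT_comp (@measurable_inv R) m2.
apply: (eq_measurable_fun _ _ (measurable_Rintegral_param mu mf)) => z _.
rewrite [RHS]Rintegral_mkcond; apply: eq_Rintegral => h _.
by rewrite /f/= !patchE; case: ifP => // _; rewrite mulr0.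
Qed.

End nonlocal_measurability.

Section tensor_test.
Context {R : realType}.
Local Notation mu := (@lebesgue_measure R).
Local Notation TR := (measurableTypeR R).
Variables (T delta : R) (w : R -> R) (g : R -> R -> R) (C : R) (u0 : R -> R).
Hypotheses (T0 : 0 < T) (delta0 : 0 < delta) (wK : nonlocal_kernel delta w) (C0 : 0 <= C).
Hypothesis gL : forall u1 u2 v1 v2, `|g u1 v1 - g u2 v2| <= C * (`|u1 - u2| + `|v1 - v2|).
Hypothesis iu0 : mu.-integrable setT (EFin \o u0).
Local Notation D := (`[0, delta]%classic : set TR).
Variables (a b b' : R -> R) (N A : R).
Hypotheses (N0 : 0 <= N) (A0 : 0 <= A).
Hypothesis a01 : forall x, 0 <= a x <= 1.
Hypothesis aN : forall x, N < `|x| -> a x = 0.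
Hypothesis aL : forall x y, `|a x - a y| <= A * `|x - y|.
Hypothesis ma : measurable_fun [set: TR] (a : TR -> R).
Hypothesis bD : forall t, is_derive t (1 : R) b (b' t).
Hypothesis b'c : continuous b'.
Hypothesis bT : b T = 0.
Variables (M : R) (v : R -> R -> R).
Hypothesis mv : measurable_fun [set: TR * TR] (fun z : TR * TR => v z.1 z.2 : R).
Hypothesis vM : forall x t, `|v x t| <= M.
Hypothesis u0M : {ae mu, forall x, `|u0 x| <= M}.

Local Notation I := (`]0, T[%classic : set TR).

Definition space_mean (t : R) : R := \int[mu]_x (v x t * a x).

Definition space_flux (Q : R -> R -> R) (t : R) : R :=
  \int[mu]_x \int[mu]_(h in D) (dquot a h x * Q (v x t) (v (x + h) t) * w h).

(** The weak formulation for the test function [a x * b t]. *)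
Definition tensor_functional : R :=
  \int[mu]_(t in I) (b' t * space_mean t) + b 0 * \int[mu]_x (u0 x * a x) +
  \int[mu]_(t in I) (b t * space_flux g t).

Let mI : measurable I.
Proof. exact: measurable_itv. Qed.

Let Ioo : (mu I < +oo)%E.
Proof. by rewrite lebesgue_measure_itv/= lte_fin T0 -EFinB ltry. Qed.

Lemma partial_t_tensor x t : partial_t (fun x t => a x * b t) x t = a x * b' t.
Proof.
rewrite /partial_t; have h := is_deriveM (is_derive_cst (a x) t (1 : R)) (bD t).
have -> : (fun t => a x * b t) = cst (a x) * b by apply/funext.
by rewrite (is_derive_derive1 h).2 scaler0 addr0.
Qed.

Let w1 : \int[mu]_(h in D) w h = 1.
Proof. by case: wK. Qed.

Let gL' p q p' q' : `|g p q - g p' q'| <= C * (`|p - p'| + `|q - q'|).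
Proof. exact: gL. Qed.

Let mD : measurable D.
Proof. exact: measurable_itv. Qed.

Let GM : R := `|g 0 0| + C * (M + M).

Let gB p q : `|p| <= M -> `|q| <= M -> `|g p q| <= GM.
Proof.
move=> pM qM; rewrite -[g p q](subrK (g 0 0)) (le_trans (ler_normD _ _))//.
rewrite addrC /GM lerD2l; apply: le_trans (gL _ _ _ _) _; rewrite !subr0.
by rewrite ler_wpM2l// lerD.
Qed.

Let mvt t : measurable_fun [set: TR] (v ^~ t : TR -> R).
Proof. exact: (measurable_fun_pair1 t mv). Qed.

Let mean_fun (z : TR * TR) : R := v z.1 z.2 * a z.1.

Let mmean_fun : measurable_fun setT mean_fun.
Proof. by apply: measurable_funM => //; exact: measurableT_comp ma measurable_fst. Qed.

Let bmean_fun z : `|mean_fun z| <= M.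
Proof.
rewrite normrM -[leRHS]mulr1 ler_pM//; have /andP[a0 a1] := a01 z.1.
by rewrite ger0_norm.
Qed.

Let zmean_fun x t : N < `|x| -> mean_fun (x, t) = 0.
Proof. by move=> Nx; rewrite /mean_fun/= aN// mulr0. Qed.

Lemma space_mean_integrable (E : set TR) : measurable E -> (mu E < +oo)%E ->
  mu.-integrable E (EFin \o space_mean).
Proof. exact: (slice_integral_integrable N0 mmean_fun bmean_fun zmean_fun). Qed.

Lemma profile_integrable t : mu.-integrable setT (EFin \o (fun x => v x t * a x)).
Proof. exact: (slice_integrable N0 mmean_fun bmean_fun zmean_fun t). Qed.

Lemma cutoff_integrable : mu.-integrable setT (EFin \o a).
Proof.
apply: (slice_integrable (c := 1) (F := fun z : TR * TR => a z.1) N0 _ _ _ 0).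
- exact: measurableT_comp ma measurable_fst.
- by move=> z; have /andP[a0 a1] := a01 z.1; rewrite ger0_norm.
- by move=> x t; exact: aN.
Qed.

Lemma space_fluxE t : space_flux g t =
  \int[mu]_(h in D) (flux_integral delta g a N (v ^~ t) h * w h).
Proof. by have [_ _ <-] := flux_fubini delta0 wK C0 gL' gB N0 A0 ma aN aL (mvt t) (vM ^~ t). Qed.

Lemma space_flux_bound t : `|space_flux g t| <= A * GM * fine (mu (window (N + (delta + 1)))).
Proof.
have GM0 : 0 <= GM by apply: le_trans (gB (vM 0 0) (vM 0 0)).
have mw : measurable_fun D w.
  by apply: measurable_funTS; case: wK => /measurable_int/measurable_EFinP.
have iw : mu.-integrable D (EFin \o w) := kernel_integrable wK.
rewrite space_fluxE; have -> : A * GM * fine (mu (window (N + (delta + 1)))) =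
    \int[mu]_(h in D) (A * GM * fine (mu (window (N + (delta + 1)))) * w h).
  by rewrite RintegralZl// w1 mulr1.
have [i1 _ _] := flux_fubini delta0 wK C0 gL' gB N0 A0 ma aN aL (mvt t) (vM ^~ t).
apply: le_norm_Rintegral.
- exact: measurable_itv.
- by apply/measurable_EFinP; exact: measurable_int i1.
- exact: integrable_scale.
- move=> h _; rewrite normrM [`|w h|]ger0_norm; last by case: wK.
  rewrite ler_wpM2r//; first by case: wK.
  exact: (flux_integral_bound delta0 C0 gL' gB N0 A0 ma aL (mvt t) (vM ^~ t)).
Qed.

Lemma measurable_space_flux : measurable_fun [set: TR] (space_flux g : TR -> R).
Proof.
have ma1 : measurable_fun [set: TR * TR] (fun z : TR * TR => a z.1 : R).
  exact: measurableT_comp ma measurable_fst.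
exact: (measurable_Rintegral_param1
  (measurable_nonlocal_density (psi := fun x _ => a x) wK C0 gL' ma1 mv)).
Qed.

Lemma mean_dquot h : `|h| <= delta + 1 ->
  \int[mu]_(x in window (N + (delta + 1))) dquot a h x = 0.
Proof.
move=> hd; rewrite Rintegral_mkcond (_ : _ \_ _ = dquot a h); last first.
  apply/funext => x; rewrite patchE; case: ifPn => // /negP xW.
  apply/esym/(dquot_support delta0 aN hd).
  by rewrite ltNge; apply/negP => h2; apply: xW; rewrite inE /window/= in_itv/= -ler_norml.
have mah : measurable_fun [set: TR] (fun x : TR => a (x + h)).
  exact: measurableT_comp ma (measurable_shift h).
have iah : mu.-integrable setT (EFin \o (fun x => a (x + h))).
  have Nd : 0 <= N + (delta + 1) by rewrite !addr_ge0// ltW.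
  apply: (slice_integrable (c := 1) (F := fun z : TR * TR => a (z.1 + h)) Nd _ _ _ 0).
  - exact: measurableT_comp mah measurable_fst.
  - by move=> z; have /andP[a0 a1] := a01 (z.1 + h); rewrite ger0_norm.
  - move=> x _ Nx /=; apply: aN; have := ler_normB (x + h) h; rewrite addrK.
    by move: hd Nx; lra.
transitivity (\int[mu]_x (h^-1 * a (x + h) + (- h^-1) * a x)).
  by apply: eq_Rintegral => x _; rewrite /dquot; ring.
rewrite (Rintegral_lincomb _ _ measurableT iah cutoff_integrable) Rintegral_shift//.
by rewrite mulNr subrr.
Qed.

(** Constants drop out, since difference quotients of a compactly supported
    function have mean zero. *)
Lemma space_flux_affine (Q : R -> R -> R) (LQ eps kap k : R) t : 0 <= LQ ->
  (forall a b a' b', `|Q a b - Q a' b'| <= LQ * (`|a - a'| + `|b - b'|)) ->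
  (forall p q, `|p| <= M -> `|q| <= M -> Q p q = eps * g p q + kap) ->
  \int[mu]_x \int[mu]_(h in D)
    ((a (x + h) * k - a x * k) / h * Q (v x t) (v (x + h) t) * w h) =
  eps * (k * space_flux g t).
Proof.
move=> LQ0 QL Qg.
have QB p q : `|p| <= M -> `|q| <= M -> `|Q p q| <= `|eps| * GM + `|kap|.
  move=> pM qM; rewrite Qg// (le_trans (ler_normD _ _))// lerD2r normrM.
  by rewrite ler_wpM2l// gB.
pose ak x := a x * k.
have mak : measurable_fun [set: TR] (ak : TR -> R) by exact: measurable_funM.
have akN x : N < `|x| -> ak x = 0 by move=> Nx; rewrite /ak aN// mul0r.
have akL x y : `|ak x - ak y| <= A * `|k| * `|x - y|.
  by rewrite -mulrBl normrM mulrAC ler_wpM2r.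
have Ak0 : 0 <= A * `|k| by rewrite mulr_ge0.
have [_ _ e1] := flux_fubini delta0 wK LQ0 QL QB N0 Ak0 mak akN akL (mvt t) (vM ^~ t).
have [i1 _ e2] := flux_fubini delta0 wK C0 gL' gB N0 A0 ma aN aL (mvt t) (vM ^~ t).
rewrite [LHS]e1 mulrA [X in _ * X]e2 -RintegralZl//.
apply: eq_Rintegral => h; rewrite inE/= in_itv/= => /andP[h0 hd].
rewrite mulrA; congr (_ * _).
have mW : measurable (window (N + (delta + 1)) : set TR) by exact: measurable_window.
have Woo : (mu (window (N + (delta + 1)) : set TR) < +oo)%E by rewrite window_measure ?ltry// !addr_ge0// ltW.
have iq : mu.-integrable (window (N + (delta + 1))) (EFin \o dquot a h).
  apply: (integrable_bounded (M := A)) => //; last by move=> x _; exact: dquot_bound.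
  apply: measurable_funTS; apply: measurable_funM => //; apply: measurable_funB => //.
  exact: measurableT_comp ma (measurable_shift h).
have ig := flux_integrable delta0 C0 gL' gB N0 A0 ma aL (mvt t) (vM ^~ t) h.
transitivity (\int[mu]_(x in window (N + (delta + 1)))
    (eps * k * (dquot a h x * g (v x t) (v (x + h) t)) + kap * k * dquot a h x)).
  by apply: eq_Rintegral => x _; rewrite Qg// /dquot /ak; ring.
rewrite Rintegral_lincomb// mean_dquot ?mulr0 ?addr0//.
by rewrite ger0_norm// (le_trans hd)// lerDl.
Qed.

Lemma slope_integrable : mu.-integrable (`[0, T]%classic : set TR) (EFin \o b').
Proof.
by apply: continuous_compact_integrable; [exact: segment_compact|exact: continuous_subspaceT].
Qed.

Lemma slope_integral : \int[mu]_(t in I) b' t = - b 0.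
Proof.
have ib := slope_integrable.
have sub : (`[0, T[%classic : set TR) `<=` `[0, T]%classic.
  by move=> x /=; rewrite !in_itv/= => /andP[-> /ltW].
rewrite Rintegral_itv_obnd_cbnd; last first.
  by apply: integrableS ib => //; move=> x /=; rewrite !in_itv/= => /andP[/ltW -> /ltW].
rewrite Rintegral_itv_bndo_bndc//; last exact: integrableS ib.
have db x : derivable b x 1 by exact: (is_derive_derive1 (bD x)).1.
have bc x : b y @[y --> x] --> b x.
  by apply: differentiable_continuous; apply/derivable1_diffP; exact: db.
rewrite /Rintegral (@continuous_FTC2 _ b' b)//.
- by rewrite bT sub0e.
- exact: continuous_subspaceT.
- split => [x _||]; first exact: db.
  + exact: cvg_at_right_filter.
  + exact: cvg_at_left_filter.
- by move=> x _; rewrite (is_derive_derive1 (bD x)).2.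
Qed.

(** When the values of [v] are on one side of [c], the entropy pair is affine
    in the identity and [g].  The additive constants contribute
    [kap * int a * (int b' + b 0)], which is 0, and a multiple of the mean of
    difference quotients. *)
Lemma tensor_entropy (eps kap kap' c : R) :
  (forall p, `|p| <= M -> `|p - c| = eps * p + kap) ->
  (forall p q, `|p| <= M -> `|q| <= M -> entropy_flux g p q c = eps * g p q + kap') ->
  \int[mu]_(t in I) \int[mu]_x (`|v x t - c| * partial_t (fun x t => a x * b t) x t)
    + \int[mu]_x (`|u0 x - c| * (a x * b 0))
    + \int[mu]_(t in I) \int[mu]_x \int[mu]_(h in D)
        ((a (x + h) * b t - a x * b t) / h
         * entropy_flux g (v x t) (v (x + h) t) c * w h) = eps * tensor_functional.
Proof.
move=> He Hq.
have e1 t : \int[mu]_x (`|v x t - c| * partial_t (fun x t => a x * b t) x t) =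
    eps * (b' t * space_mean t) + kap * \int[mu]_x a x * b' t.
  transitivity (\int[mu]_x (eps * b' t * (v x t * a x) + kap * b' t * a x)).
    by apply: eq_Rintegral => x _; rewrite partial_t_tensor He//; ring.
  have i1 := profile_integrable t; have i2 := cutoff_integrable.
  by rewrite Rintegral_lincomb//; rewrite /space_mean; move: (\int[mu]_x _) (\int[mu]_x _) => p q; ring.
have e2 : \int[mu]_x (`|u0 x - c| * (a x * b 0)) =
    eps * (b 0 * \int[mu]_x (u0 x * a x)) + kap * \int[mu]_x a x * b 0.
  have mu0 : measurable_fun [set: TR] (u0 : TR -> R).
    by apply/measurable_EFinP; exact: measurable_int iu0.
  have i1 : mu.-integrable setT (EFin \o (fun x => u0 x * a x)).
    have i1 : mu.-integrable setT (EFin \o (fun x => a x * u0 x)).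
      apply: (integrable_mulM (M := 1)) => // x _.
      by have /andP[a0 a1] := a01 x; rewrite ger0_norm.
    by apply: eq_integrable i1 => // x _ /=; rewrite mulrC.
  have i2 := cutoff_integrable.
  transitivity (\int[mu]_x (eps * b 0 * (u0 x * a x) + kap * b 0 * a x)).
    apply: ae_eq_Rintegral => //.
    - by apply: measurable_funM; [apply: measurableT_comp => //; exact: measurable_funB|exact: measurable_funM].
    - by apply: measurable_funD; apply: measurable_funM => //; exact: measurable_funM.
    - apply: (@filterS _ _ (ae_filter_ringOfSetsType mu) _ _ _ u0M) => x ux _.
      by rewrite He//; ring.
  by rewrite Rintegral_lincomb//; move: (\int[mu]_x _) (\int[mu]_x _) => p q; ring.
have e3 t : \int[mu]_x \int[mu]_(h in D)
        ((a (x + h) * b t - a x * b t) / h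
         * entropy_flux g (v x t) (v (x + h) t) c * w h) = eps * (b t * space_flux g t).
  have C20 : 0 <= 2 * C by rewrite mulr_ge0.
  exact: (space_flux_affine (b t) t C20 (entropy_flux_lipschitz C0 gL c) Hq).
have sub : I `<=` `[0, T]%classic by move=> x /=; rewrite !in_itv/= => /andP[/ltW -> /ltW].
have ib' : mu.-integrable I (EFin \o b') by apply: integrableS slope_integrable.
have I0 t : I t -> 0 <= t <= T by rewrite /= in_itv/= => /andP[/ltW -> /ltW].
have bc : continuous b.
  move=> x; apply: differentiable_continuous; apply/derivable1_diffP.
  exact: (is_derive_derive1 (bD x)).1.
have [B' B'0 bB] := continuous_segment_bound (ltW T0) b'c.
have [B1 B10 bB1] := continuous_segment_bound (ltW T0) bc.
have mb : measurable_fun I b by apply: measurable_funTS; exact: continuous_measurable_fun.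
have j1 : mu.-integrable I (EFin \o (fun t => b' t * space_mean t)).
  apply: (integrable_mulM (M := B')) => //; last first; [exact: space_mean_integrable|by move=> t /I0; exact: bB|by apply/measurable_EFinP; exact: measurable_int ib'].
have j3 : mu.-integrable I (EFin \o (fun t => b t * space_flux g t)).
  apply: (integrable_mulM (M := B1)) => //; first by move=> t /I0; exact: bB1.
  apply: (integrable_bounded (M := A * GM * fine (mu (window (N + (delta + 1)))))) => //.
  - by apply: measurable_funTS; exact: measurable_space_flux.
  - by move=> t _; exact: space_flux_bound.
under eq_Rintegral do rewrite e1.
rewrite e2.
under [X in _ + _ + X]eq_Rintegral do rewrite e3.
rewrite (Rintegral_lincomb _ _ mI j1 ib') RintegralZl// slope_integral /tensor_functional.
move: (Rintegral _ _ _) (Rintegral _ _ _) (Rintegral _ _ _) (Rintegral _ _ _) => p q r s.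
ring.
Qed.

End tensor_test.

Section almost_everywhere_equal.
Context {R : realType}.
Local Notation mu := (@lebesgue_measure R).
Local Notation TR := (measurableTypeR R).
Variables (T : R) (p q : R -> R -> R).
Hypothesis mp : measurable_fun [set: TR * TR] (fun z : TR * TR => p z.1 z.2 : R).
Hypothesis mq : measurable_fun [set: TR * TR] (fun z : TR * TR => q z.1 z.2 : R).
Hypothesis pq : {ae mu, forall t, 0 < t < T -> {ae mu, forall x, p x t = q x t}}.
Local Notation I := (`]0, T[%classic : set TR).

Lemma ae_eq_tested (eta : R -> R) (psi : R -> R -> R) :
  measurable_fun [set: TR] (eta : TR -> R) ->
  measurable_fun [set: TR * TR] (fun z : TR * TR => psi z.1 z.2 : R) ->
  \int[mu]_(t in I) \int[mu]_x (eta (p x t) * psi x t) =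
  \int[mu]_(t in I) \int[mu]_x (eta (q x t) * psi x t).
Proof.
move=> meta mpsi.
have mF r : measurable_fun [set: TR * TR] (fun z : TR * TR => r z.1 z.2 : R) ->
    measurable_fun [set: TR * TR] (fun z : TR * TR => eta (r z.1 z.2) * psi z.1 z.2 : R).
  by move=> mr; apply: measurable_funM => //; exact: measurableT_comp meta mr.
apply: ae_eq_Rintegral.
- exact: measurable_itv.
- by apply: measurable_funTS; exact: (measurable_Rintegral_param1 (mF _ mp)).
- by apply: measurable_funTS; exact: (measurable_Rintegral_param1 (mF _ mq)).
move: pq; apply: (@filterS _ _ (ae_filter_ringOfSetsType mu)) => t h.
rewrite /= in_itv/= => /h {}h; apply: ae_eq_Rintegral => //.
- exact: (measurable_fun_pair1 t (mF _ mp)).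
- exact: (measurable_fun_pair1 t (mF _ mq)).
- by move: h; apply: (@filterS _ _ (ae_filter_ringOfSetsType mu)) => x ->.
Qed.

(** For fixed [x], almost every [h] leads to a point [x + h] where the two
    functions agree. *)
Lemma ae_eq_nonlocal (delta : R) (w : R -> R) (Q : R -> R -> R) (LQ : R) (psi : R -> R -> R) :
  nonlocal_kernel delta w -> 0 <= LQ ->
  (forall a b a' b', `|Q a b - Q a' b'| <= LQ * (`|a - a'| + `|b - b'|)) ->
  measurable_fun [set: TR * TR] (fun z : TR * TR => psi z.1 z.2 : R) ->
  \int[mu]_(t in I) \int[mu]_x \int[mu]_(h in `[0, delta])
    ((psi (x + h) t - psi x t) / h * Q (p x t) (p (x + h) t) * w h) =
  \int[mu]_(t in I) \int[mu]_x \int[mu]_(h in `[0, delta])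
    ((psi (x + h) t - psi x t) / h * Q (q x t) (q (x + h) t) * w h).
Proof.
move=> wK LQ0 QL mpsi.
have mw : measurable_fun [set: TR] (w : TR -> R) by case: wK => /measurable_int/measurable_EFinP.
have mF r (mr : measurable_fun [set: TR * TR] (fun z : TR * TR => r z.1 z.2 : R)) :=
  measurable_nonlocal_density wK LQ0 QL mpsi mr.
have sh t (r : R -> R -> R) : measurable_fun [set: TR * TR] (fun z : TR * TR => r z.1 z.2 : R) ->
    forall x, measurable_fun [set: TR] (fun h : TR => r (x + h) t : R).
  move=> mr x; have mrt : measurable_fun [set: TR] (r ^~ t : TR -> R) := measurable_fun_pair1 t mr.
  rewrite (_ : (fun h => _) = (fun h : TR => r (h + x) t)); last by apply/funext => h; rewrite addrC.
  exact: measurableT_comp mrt (measurable_shift x).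
have mG t x r : measurable_fun [set: TR * TR] (fun z : TR * TR => r z.1 z.2 : R) ->
    measurable_fun [set: TR] (fun h : TR =>
    (psi (x + h) t - psi x t) / h * Q (r x t) (r (x + h) t) * w h : R).
  move=> mr; apply: measurable_funM => //; apply: measurable_funM; last first.
    by apply: (Q_measurable LQ0 QL); [exact: measurable_cst|exact: sh].
  apply: measurable_funM; last exact: measurable_inv.
  by apply: measurable_funB; [exact: sh|exact: measurable_cst].
apply: ae_eq_Rintegral.
- exact: measurable_itv.
- by apply: measurable_funTS; exact: (measurable_Rintegral_param1 (mF _ mp)).
- by apply: measurable_funTS; exact: (measurable_Rintegral_param1 (mF _ mq)).
move: pq; apply: (@filterS _ _ (ae_filter_ringOfSetsType mu)) => t h.
rewrite /= in_itv/= => /h {}h; apply: ae_eq_Rintegral => //.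
- exact: (measurable_fun_pair1 t (mF _ mp)).
- exact: (measurable_fun_pair1 t (mF _ mq)).
move: (h); apply: (@filterS _ _ (ae_filter_ringOfSetsType mu)) => x e1 _.
apply: ae_eq_Rintegral.
- exact: measurable_itv.
- by apply: measurable_funTS; exact: mG mp.
- by apply: measurable_funTS; exact: mG mq.
move: (ae_shift x h); apply: (@filterS _ _ (ae_filter_ringOfSetsType mu)) => y e _.
by rewrite [x + y]addrC e1 e.
Qed.

End almost_everywhere_equal.

Section entropy_tensor.
Context {R : realType}.
Local Notation mu := (@lebesgue_measure R).
Local Notation TR := (measurableTypeR R).
Variables (T delta : R) (w : R -> R) (g : R -> R -> R) (C : R) (u0 : R -> R).
Hypotheses (T0 : 0 < T) (delta0 : 0 < delta) (wK : nonlocal_kernel delta w) (C0 : 0 <= C).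
Hypothesis gL : forall u1 u2 v1 v2, `|g u1 v1 - g u2 v2| <= C * (`|u1 - u2| + `|v1 - v2|).
Hypothesis iu0 : mu.-integrable setT (EFin \o u0).
Variables (a b b' : R -> R) (N A : R).
Hypotheses (N0 : 0 <= N) (A0 : 0 <= A).
Hypothesis a01 : forall x, 0 <= a x <= 1.
Hypothesis aN : forall x, N < `|x| -> a x = 0.
Hypothesis aL : forall x y, `|a x - a y| <= A * `|x - y|.
Hypothesis ma : measurable_fun [set: TR] (a : TR -> R).
Hypothesis bD : forall t, is_derive t (1 : R) b (b' t).
Hypothesis b'c : continuous b'.
Hypotheses (b0 : forall t, 0 <= b t) (bT : b T = 0).
Hypothesis ab : test_function T (fun x t => a x * b t).
Variables (M : R) (v : R -> R -> R).
Hypotheses (M0 : 0 <= M).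
Hypothesis u0M : {ae mu, forall x, `|u0 x| <= M}.
Hypothesis ev : entropy_solution T delta w g u0 v.
Hypothesis vM : {ae (mu \x mu)%E, forall z, strip T z -> `|v z.1 z.2| <= M}.

(** For [c = M] and [c = - M] the entropy inequality becomes a linear
    inequality, with opposite signs. *)
Lemma entropy_tensor : tensor_functional T delta w g u0 a b b' (representative T M v) = 0.
Proof.
have mv : measurable_fun (strip T) (fun z : TR * TR => v z.1 z.2 : R) by case: ev => -[].
have mr := measurable_representative M mv; have ms := measurable_on_strip mv.
have mphi : measurable_fun [set: TR * TR] (fun z : TR * TR => a z.1 * b z.2 : R).
  by have [n [B [T' [_ _ _ /tame_measurable]]]] := test_function_tame ab.
have mb' : measurable_fun [set: TR] (b' : TR -> R) by exact: continuous_measurable_fun.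
have mphi' : measurable_fun [set: TR * TR]
    (fun z : TR * TR => partial_t (fun x t => a x * b t) z.1 z.2 : R).
  rewrite (_ : (fun z => _) = (fun z : TR * TR => a z.1 * b' z.2)).
    apply: measurable_funM; first exact: measurableT_comp ma measurable_fst.
    exact: measurableT_comp mb' measurable_snd.
  by apply/funext => z; rewrite (partial_t_tensor _ bD).
have pq : {ae mu, forall t, 0 < t < T -> {ae mu, forall x, on_strip T v x t = representative T M v x t}}.
  have := ae_representative vM.
  apply: (@filterS _ _ (ae_filter_ringOfSetsType mu)) => t h tT.
  move: (h tT); apply: (@filterS _ _ (ae_filter_ringOfSetsType mu)) => x <-.
  by rewrite /on_strip tT.
have C20 : 0 <= 2 * C by rewrite mulr_ge0.
have E c eps kap kap' : (forall p, `|p| <= M -> `|p - c| = eps * p + kap) ->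
  (forall p q, `|p| <= M -> `|q| <= M -> entropy_flux g p q c = eps * g p q + kap') ->
  0 <= eps * tensor_functional T delta w g u0 a b b' (representative T M v).
  move=> He Hq.
  rewrite -(tensor_entropy T0 delta0 wK C0 gL iu0 N0 A0 a01 aN aL ma bD b'c bT mr (representative_bound T v M0) u0M He Hq).
  have meta : measurable_fun [set: TR] ((fun p => `|p - c|) : TR -> R).
    by apply: measurableT_comp => //; exact: measurable_funB.
  rewrite -(ae_eq_tested ms mr pq meta mphi').
  rewrite -(ae_eq_nonlocal ms mr pq wK C20 (entropy_flux_lipschitz C0 gL c) mphi).
  have ab0 x t : 0 <= t -> 0 <= a x * b t by move=> _; rewrite mulr_ge0//; case/andP: (a01 x).
  have e1 : \int[mu]_(t in `]0, T[) \int[mu]_x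
        (`|on_strip T v x t - c| * partial_t (fun x0 t0 => a x0 * b t0) x t) =
      \int[mu]_(t in `]0, T[) \int[mu]_x
        (`|v x t - c| * partial_t (fun x0 t0 => a x0 * b t0) x t).
    apply: eq_Rintegral => t; rewrite inE/= in_itv/= => tT.
    by apply: eq_Rintegral => x _; rewrite /on_strip tT.
  have e3 : \int[mu]_(t in `]0, T[) \int[mu]_x \int[mu]_(h in `[0, delta])
        ((a (x + h) * b t - a x * b t) / h *
          entropy_flux g (on_strip T v x t) (on_strip T v (x + h) t) c * w h) =
      \int[mu]_(t in `]0, T[) \int[mu]_x \int[mu]_(h in `[0, delta])
        ((a (x + h) * b t - a x * b t) / h * entropy_flux g (v x t) (v (x + h) t) c * w h).
    apply: eq_Rintegral => t; rewrite inE/= in_itv/= => tT.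
    apply: eq_Rintegral => x _; apply: eq_Rintegral => h _.
    by rewrite /on_strip tT.
  have H := ev.2 c _ ab ab0.
  have transfer (A1 A2 B A3 A4 : R) : A1 = A2 -> A3 = A4 -> 0 <= A2 + B + A4 -> 0 <= A1 + B + A3.
    by move=> -> ->.
  exact: (transfer _ _ _ _ _ e1 e3 H).
apply/eqP; rewrite eq_le; apply/andP; split.
  rewrite -oppr_ge0 -mulN1r; apply: (E M (-1) M (g M M)).
    by move=> p; rewrite ler_norml => /andP[_ pM]; rewrite distrC ger0_norm ?subr_ge0//; ring.
  move=> p q; rewrite !ler_norml => /andP[_ pM] /andP[_ qM]; rewrite /entropy_flux.
  by rewrite !(max_idPr _)// !(min_idPl _)//; ring.
rewrite -[leRHS]mul1r; apply: (E (- M) 1 M (- g (- M) (- M))).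
  by move=> p; rewrite ler_norml => /andP[pM _]; rewrite ger0_norm ?subr_ge0//; ring.
move=> p q; rewrite !ler_norml => /andP[pM _] /andP[qM _]; rewrite /entropy_flux.
by rewrite !(max_idPl _)// !(min_idPr _)//; ring.
Qed.

End entropy_tensor.

(** * Contraction of the difference of two solutions *)

(** The function is truncated to satisfy the bound everywhere. *)
Lemma le_norm_Rintegral_ae d (X : measurableType d) (R : realType) (mu : {measure set X -> \bar R})
    (D : set X) (f g : X -> R) : measurable D -> measurable_fun D f ->
  mu.-integrable D (EFin \o g) -> (forall x, 0 <= g x) ->
  {ae mu, forall x, D x -> `|f x| <= g x} ->
  `|\int[mu]_(x in D) f x| <= \int[mu]_(x in D) g x.
Proof.
move=> mD mf ig g0 fg.
have mg : measurable_fun D g by apply/measurable_EFinP; exact: measurable_int ig.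
pose f' x := Num.max (- g x) (Num.min (g x) (f x)).
have mf' : measurable_fun D f'.
  by apply: measurable_maxr; [exact: measurableT_comp|exact: measurable_minr].
rewrite (@ae_eq_Rintegral _ _ _ _ _ f f')//; last first.
  move: fg; apply: (@filterS _ _ (ae_filter_ringOfSetsType mu)) => x h Dx.
  by move: (h Dx); rewrite ler_norml => /andP[h1 h2]; rewrite /f' (min_idPr _)// (max_idPr _).
apply: le_norm_Rintegral => // x _.
by rewrite ler_norml /f' le_max lexx/= ge_max ge_min lexx/= andbT ge0_cp.
Qed.

Lemma expR_integral_le {R : realType} (k s : R) : 0 < k -> 0 < s ->
  \int[@lebesgue_measure R]_(t in `[0, s]) expR (k * t) <= k^-1 * expR (k * s).
Proof.
move=> k0 s0; pose F (t : R) := k^-1 * expR (k * t).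
have dF (t : R) : is_derive t (1 : R) F (expR (k * t)).
  have h := is_deriveZ k^-1 (@is_derive1_comp _ expR (fun t => k * t + 0) t _ _
    (is_derive_expR _) (is_derive_affine k 0 t)).
  rewrite (_ : F = k^-1 *: (expR \o (fun t => k * t + 0))); last first.
    by apply/funext => x; rewrite /F !fctE/= addr0.
  by apply: (is_derive_eq h); rewrite addr0 /GRing.scale/= mulrA mulrAC mulVf ?mul1r// gt_eqF.
have Fd (x : R) : derivable F x 1 by exact: (is_derive_derive1 (dF x)).1.
have Fc (x : R) : F y @[y --> x] --> F x.
  by apply: differentiable_continuous; apply/derivable1_diffP; exact: Fd.
rewrite /Rintegral (@continuous_FTC2 _ (fun t => expR (k * t)) F)//.
- by rewrite -EFinB/= gerBl /F mulr0 expR0 mulr1 invr_ge0 ltW.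
- apply: continuous_subspaceT => x; apply: continuous_comp; last exact: continuous_expR.
  exact: mulrl_continuous.
- split => [x _||]; first exact: Fd.
  + exact: cvg_at_right_filter.
  + exact: cvg_at_left_filter.
- by move=> x _; rewrite (is_derive_derive1 (dF x)).2.
Qed.

Section flux_contraction.
Context {R : realType}.
Local Notation mu := (@lebesgue_measure R).
Local Notation TR := (measurableTypeR R).
Variables (delta : R) (w : R -> R) (g : R -> R -> R) (C : R).
Hypotheses (delta0 : 0 < delta) (wK : nonlocal_kernel delta w) (C0 : 0 <= C).
Hypothesis gL : forall u1 u2 v1 v2, `|g u1 v1 - g u2 v2| <= C * (`|u1 - u2| + `|v1 - v2|).
Local Notation D := (`[0, delta]%classic : set TR).
Hypothesis iw1 : mu.-integrable D (EFin \o (fun h => w h / h)).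
Variables (a : R -> R) (N A : R).
Hypotheses (N0 : 0 <= N) (A0 : 0 <= A).
Hypothesis a01 : forall x, 0 <= a x <= 1.
Hypothesis aN : forall x, N < `|x| -> a x = 0.
Hypothesis aL : forall x y, `|a x - a y| <= A * `|x - y|.
Hypothesis ma : measurable_fun [set: TR] (a : TR -> R).
Variables (M k : R) (p q : R -> R -> R).
Hypothesis mp : measurable_fun [set: TR * TR] (fun z : TR * TR => p z.1 z.2 : R).
Hypothesis mq : measurable_fun [set: TR * TR] (fun z : TR * TR => q z.1 z.2 : R).
Hypothesis pM : forall x t, `|p x t| <= M.
Hypothesis qM : forall x t, `|q x t| <= M.
Variable t : R.
Hypothesis k0 : 0 <= k.
Hypothesis pq : {ae mu, forall x, `|p x t - q x t| <= k}.
Local Notation W := (window (N + (delta + 1)) : set TR).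

Let a0 x : 0 <= a x.
Proof. by case/andP: (a01 x). Qed.

(** Integrability of [w h / h] allows to bound the two terms of the difference
    quotient separately, and the integral of each is that of [a].  Hence the
    bound does not involve the derivative of [a]. *)
Lemma space_flux_contraction :
  `|space_flux delta w a p g t - space_flux delta w a q g t| <=
  4 * C * k * \int[mu]_x a x * \int[mu]_(h in D) (w h / h).
Proof.
have mD : measurable D by exact: measurable_itv.
have mW : measurable W by exact: measurable_window.
have M0 : 0 <= M by exact: le_trans (pM 0 0).
have gL' x y x' y' : `|g x y - g x' y'| <= C * (`|x - x'| + `|y - y'|) by exact: gL.
pose GM := `|g 0 0| + C * (M + M).
have gB x y : `|x| <= M -> `|y| <= M -> `|g x y| <= GM.
  move=> xM yM; rewrite -[g x y](subrK (g 0 0)) (le_trans (ler_normD _ _))//.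
  rewrite addrC /GM lerD2l; apply: le_trans (gL _ _ _ _) _; rewrite !subr0.
  by rewrite ler_wpM2l// lerD.
rewrite (space_fluxE delta0 wK C0 gL N0 A0 aN aL ma mp pM) (space_fluxE delta0 wK C0 gL N0 A0 aN aL ma mq qM).
have mpt : measurable_fun [set: TR] (p ^~ t : TR -> R) := measurable_fun_pair1 t mp.
have mqt : measurable_fun [set: TR] (q ^~ t : TR -> R) := measurable_fun_pair1 t mq.
have [ip _ _] := flux_fubini delta0 wK C0 gL' gB N0 A0 ma aN aL mpt (pM ^~ t).
have [iq _ _] := flux_fubini delta0 wK C0 gL' gB N0 A0 ma aN aL mqt (qM ^~ t).
rewrite -RintegralB// -RintegralZl//.
apply: le_norm_Rintegral => //.
- by have /measurable_EFinP := measurable_int _ (integrableB mD ip iq).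
- exact: integrable_scale.
move=> h; rewrite /= in_itv/= => /andP[h0 hd].
rewrite -mulrBl normrM; have w0 : 0 <= w h by case: wK.
rewrite (ger0_norm w0) [w h / h]mulrC mulrA ler_wpM2r//.
have [->|hn] := eqVneq h 0.
  rewrite invr0 mulr0 normr_le0 subr_eq0 /flux_integral.
  by under eq_Rintegral do rewrite /dquot invr0 mulr0 mul0r; under [eqbRHS]eq_Rintegral do rewrite /dquot invr0 mulr0 mul0r.
have hp : 0 < h by rewrite lt_def hn.
have jp := flux_integrable delta0 C0 gL' gB N0 A0 ma aL mpt (pM ^~ t) h.
have jq := flux_integrable delta0 C0 gL' gB N0 A0 ma aL mqt (qM ^~ t) h.
rewrite /flux_integral -RintegralB//.
have mah : measurable_fun [set: TR] (fun x : TR => a (x + h)).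
  exact: measurableT_comp ma (measurable_shift h).
have ia := cutoff_integrable N0 a01 aN ma.
have iah : mu.-integrable setT (EFin \o (fun x => a (x + h))).
  apply: (slice_integrable (N := N + h) (c := 1) (F := fun z : TR * TR => a (z.1 + h)) _ _ _ _ 0).
  - by rewrite addr_ge0.
  - exact: measurableT_comp mah measurable_fst.
  - by move=> z; have /andP[? ?] := a01 (z.1 + h); rewrite ger0_norm.
  - move=> x _ Nx /=; apply: aN; have := ler_normB (x + h) h; rewrite addrK (ger0_norm h0).
    by move: Nx; lra.
have ia1 : mu.-integrable setT (EFin \o (fun x => 1 * a x + 1 * a (x + h))).
  by have := integrableD measurableT ia iah; apply: eq_integrable => // x _ /=; rewrite !mul1r.
pose c := 2 * C * k / h.
have c0 : 0 <= c by rewrite !mulr_ge0 ?invr_ge0// ltW.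
have -> : 4 * C * k * \int[mu]_x a x * h^-1 = \int[mu]_x (c * (1 * a x + 1 * a (x + h))).
  rewrite RintegralZl// Rintegral_lincomb// Rintegral_shift//.
  by rewrite /c; move: (\int[mu]_x _) => i; field.
have sum0 x : 0 <= c * (1 * a x + 1 * a (x + h)) by rewrite !mul1r mulr_ge0 ?addr_ge0.
apply: (@le_trans _ _ (\int[mu]_(x in W) (c * (1 * a x + 1 * a (x + h))))); last first.
  have ic := integrable_scale measurableT ia1 c.
  rewrite /Rintegral fine_le//.
  - by apply: integrable_fin_num => //; exact: integrableS ic.
  - exact: integrable_fin_num.
  - apply: ge0_subset_integral => //; first exact: measurable_int ic.
    by move=> x _; rewrite lee_fin.
apply: le_norm_Rintegral_ae => //.
- by have /measurable_EFinP := measurable_int _ (integrableB mW jp jq).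
- by apply: integrable_scale => //; exact: integrableS ia1.
have pq' := ae_shift h pq; move: pq pq'.
apply: (@filterS2 _ _ (ae_filter_ringOfSetsType mu)) => x h1 h2 _; rewrite -mulrBr normrM.
rewrite {1}/dquot normrM normfV (gtr0_norm hp) mulrAC.
have -> : c * (1 * a x + 1 * a (x + h)) = (a x + a (x + h)) * (2 * C * k) / h by rewrite /c; ring.
rewrite ler_wpM2r ?invr_ge0//; apply: ler_pM => //.
  by rewrite [leRHS]addrC (le_trans (ler_normB _ _))// !ger0_norm.
apply: le_trans (gL _ _ _ _) _; rewrite [2 * C]mulrC -mulrA ler_wpM2l//.
by rewrite mulr_natl mulr2n lerD.
Qed.

End flux_contraction.

Section box_fun_properties.
Context {R : realType}.
Local Notation TR := (measurableTypeR R).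

Lemma flat_exp0_lipschitz (x y : R) : `|flat_exp 0 x - flat_exp 0 y| <= 4 * `|x - y|.
Proof.
apply: derive_bound_lipschitz => z; first exact: (is_derive_derive1 (flat_exp_is_derive 0 z)).1.
rewrite (is_derive_derive1 (flat_exp_is_derive 0 z)).2 oppr0 mul0r add0r ger0_norm ?flat_exp_ge0//.
have [z0|z0] := ltP 0 z; last by rewrite flat_exp_neg.
rewrite -flat_exp_divr ler_pdivrMr// (le_trans (flat_exp_near0 1 z))// gtr0_norm//.
by rewrite ler_wpM2r ?(ltW z0)// expr2; lra.
Qed.

Variables (al be : R) (n : nat).

Lemma box_fun_lipschitz x y : `|box_fun al be n x - box_fun al be n y| <= 8 * n.+1%:R * `|x - y|.
Proof.
set N := n.+1%:R : R; have N0 : 0 <= N by [].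
rewrite /box_fun -/N; set a := flat_exp 0 _; set b := flat_exp 0 _; set c := flat_exp 0 _; set d := flat_exp 0 _.
have -> : a * b - c * d = (a - c) * b + c * (b - d) by ring.
have -> : 8 * N * `|x - y| = 4 * (N * `|x - y|) + 4 * (N * `|x - y|) by ring.
rewrite (le_trans (ler_normD _ _))// !normrM; apply: lerD.
  rewrite -[leRHS]mulr1; apply: ler_pM => //; last by rewrite ger0_norm ?flat_exp_ge0 ?flat_exp0_le1.
  apply: le_trans (flat_exp0_lipschitz _ _) _; rewrite -mulrBr normrM ger0_norm//.
  by rewrite (_ : x - al - (y - al) = x - y)//; ring.
rewrite -[leRHS]mul1r; apply: ler_pM => //; first by rewrite ger0_norm ?flat_exp_ge0 ?flat_exp0_le1.
apply: le_trans (flat_exp0_lipschitz _ _) _; rewrite -mulrBr normrM ger0_norm//.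
by rewrite (_ : be - x - (be - y) = y - x) 1?distrC//; ring.
Qed.

Lemma measurable_box_fun : measurable_fun [set: TR] (box_fun al be n : TR -> R).
Proof. by apply: continuous_measurable_fun; case: (smooth_box_fun al be n 0). Qed.

Lemma box_fun_itv x : 0 <= box_fun al be n x <= 1.
Proof. by rewrite box_fun_ge0 box_fun_le1. Qed.

Lemma box_fun_far x : `|al| + `|be| < `|x| -> box_fun al be n x = 0.
Proof.
move=> h; apply: box_fun_out; apply/negP => /andP[h1 h2].
have := ler_norm be; have := ler_norm (- al); have := normr_ge0 al; have := normr_ge0 be.
move: h; rewrite normrN; case: (ger0P x) => x0; lra.
Qed.

End box_fun_properties.

Lemma continuous_slope_fun' {R : realType} (s1 s2 : R) n : continuous (slope_fun' s1 s2 n).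
Proof.
have [_ [_ [c _]]] := smooth_slope_fun s1 s2 n 2.
suff -> : slope_fun' s1 s2 n = derive1 (slope_fun s1 s2 n) by [].
by apply/funext => t; rewrite (is_derive_derive1 (slope_fun_is_derive s1 s2 n t)).2.
Qed.

Section contraction.
Context {R : realType}.
Local Notation mu := (@lebesgue_measure R).
Local Notation TR := (measurableTypeR R).
Variables (T delta : R) (w : R -> R) (g : R -> R -> R) (C : R) (u0 : R -> R).
Hypotheses (T0 : 0 < T) (delta0 : 0 < delta) (wK : nonlocal_kernel delta w) (C0 : 0 <= C).
Hypothesis gL : forall u1 u2 v1 v2, `|g u1 v1 - g u2 v2| <= C * (`|u1 - u2| + `|v1 - v2|).
Local Notation D := (`[0, delta]%classic : set TR).
Local Notation I := (`]0, T[%classic : set TR).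
Hypothesis iw1 : mu.-integrable D (EFin \o (fun h => w h / h)).
Variables (M : R) (p q : R -> R -> R).
Hypothesis mp : measurable_fun [set: TR * TR] (fun z : TR * TR => p z.1 z.2 : R).
Hypothesis mq : measurable_fun [set: TR * TR] (fun z : TR * TR => q z.1 z.2 : R).
Hypothesis pM : forall x t, `|p x t| <= M.
Hypothesis qM : forall x t, `|q x t| <= M.
(** The test functions are those that approximate the indicator of a rectangle
    after integration in time. *)
Definition solves_tensor (r : R -> R -> R) : Prop := forall al be s1 s2 n,
  al < be -> 0 < s1 -> s1 < s2 -> s2 < T ->
  tensor_functional T delta w g u0 (box_fun al be n) (slope_fun s1 s2 n) (slope_fun' s1 s2 n) r = 0.
Hypothesis pS : solves_tensor p.
Hypothesis qS : solves_tensor q.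

Let M0 : 0 <= M.
Proof. exact: le_trans (pM 0 0). Qed.

Let mI : measurable I.
Proof. exact: measurable_itv. Qed.

Let Ioo : (mu I < +oo)%E.
Proof. by rewrite lebesgue_measure_itv/= lte_fin T0 -EFinB ltry. Qed.

Definition box_mean (al be t : R) : R := \int[mu]_x ((p x t - q x t) * (al < x < be)%R%:R).

Section one_box.
Variables (al be s1 s2 : R).
Hypotheses (ab : al < be) (s10 : 0 < s1) (s12 : s1 < s2) (s2T : s2 < T).

Local Notation N := (`|al| + `|be|).

Let N0 : 0 <= N.
Proof. by rewrite addr_ge0. Qed.

Local Notation a n := (box_fun al be n).
Local Notation b n := (slope_fun s1 s2 n).
Local Notation b' n := (slope_fun' s1 s2 n).
Local Notation A n := (8 * n.+1%:R : R).

Lemma box_fun_integral_le n : \int[mu]_x a n x <= be - al.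
Proof.
have mab : measurable (`[al, be]%classic : set TR) by exact: measurable_itv.
have abE : mu (`[al, be]%classic : set TR) = (be - al)%:E.
  by rewrite lebesgue_measure_itv/= lte_fin ab -EFinB.
have aboo : (mu (`[al, be]%classic : set TR) < +oo)%E by rewrite abE ltry.
have -> : \int[mu]_x a n x = \int[mu]_(x in `[al, be]) a n x.
  rewrite [RHS]Rintegral_mkcond; apply: eq_Rintegral => x _; rewrite patchE.
  case: ifPn => // /negP h; apply: box_fun_out; apply/negP => /andP[/ltW h1 /ltW h2].
  by apply: h; rewrite inE/= in_itv/= h1.
have -> : be - al = \int[mu]_(x in `[al, be]) 1.
  by rewrite Rintegral_cst// mul1r -[in LHS](_ : fine (mu (`[al, be]%classic : set TR)) = be - al)// abE.
apply: le_Rintegral => //.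
- have := cutoff_integrable N0 (box_fun_itv al be n) (@box_fun_far _ al be n) (measurable_box_fun al be n).
  by apply: integrableS.
- by apply: (integrable_bounded (M := 1)) => // x _; rewrite normr1.
- by move=> x _; case/andP: (box_fun_itv al be n x).
Qed.

Lemma box_identity n :
  \int[mu]_(t in I) (b' n t * (space_mean (a n) p t - space_mean (a n) q t)) =
  - \int[mu]_(t in I) (b n t * (space_flux delta w (a n) p g t - space_flux delta w (a n) q g t)).
Proof.
have mb' : measurable_fun I (b' n).
  by apply: measurable_funTS; apply: continuous_measurable_fun; exact: continuous_slope_fun'.
have mb : measurable_fun I (b n).
  by apply: measurable_funTS; apply: continuous_measurable_fun; case: (smooth_slope_fun s1 s2 n 0).
have I0 t : I t -> 0 <= t by rewrite /= in_itv/= => /andP[/ltW].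
have b'B t : I t -> `|b' n t| <= 1 + (s2 - s1) by move=> /I0; exact: slope_fun'_bound (ltW s12) t.
have bB t : I t -> `|b n t| <= s2 - s1.
  by move=> _; rewrite ger0_norm ?slope_fun_ge0 ?slope_fun_bound// ltW.
have A0 : 0 <= A n by rewrite mulr_ge0.
have i1 r : measurable_fun [set: TR * TR] (fun z : TR * TR => r z.1 z.2 : R) ->
    (forall x t, `|r x t| <= M) ->
    mu.-integrable I (EFin \o (fun t => b' n t * space_mean (a n) r t)).
  move=> mr rM; apply: (integrable_mulM mI mb' b'B).
  exact: (space_mean_integrable N0 (box_fun_itv al be n) (@box_fun_far _ al be n)
    (measurable_box_fun al be n) mr rM).
have i3 r : measurable_fun [set: TR * TR] (fun z : TR * TR => r z.1 z.2 : R) ->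
    (forall x t, `|r x t| <= M) ->
    mu.-integrable I (EFin \o (fun t => b n t * space_flux delta w (a n) r g t)).
  move=> mr rM; apply: (integrable_mulM mI mb bB).
  have bd := space_flux_bound delta0 wK C0 gL N0 A0 (@box_fun_far _ al be n) (box_fun_lipschitz al be n)
    (measurable_box_fun al be n) mr rM.
  apply: (integrable_bounded mI Ioo _ (fun t _ => bd t)); apply: measurable_funTS; exact: (measurable_space_flux wK C0 gL (measurable_box_fun al be n) mr).
under eq_Rintegral do rewrite mulrBr.
under [in RHS]eq_Rintegral do rewrite mulrBr.
rewrite (RintegralB mI (i1 _ mp pM) (i1 _ mq qM)) (RintegralB mI (i3 _ mp pM) (i3 _ mq qM)).
have := pS n ab s10 s12 s2T; have := qS n ab s10 s12 s2T; rewrite /tensor_functional.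
move: (Rintegral _ _ _) (Rintegral _ _ _) (Rintegral _ _ _) (Rintegral _ _ _) (Rintegral _ _ _) => j1 j2 j3 j4 j5.
by lra.
Qed.

(** The flux terms differ by at most [4 C k exp (m t) W1] times the area of the
    box; the integral in time of [exp (m t)] gains the factor [1 / m], and
    [8 C W1 <= m]. *)
Lemma box_flux_bound n (k m : R) : 0 < m -> 8 * C * \int[mu]_(h in D) (w h / h) <= m -> 0 <= k ->
  {ae mu, forall t, 0 < t < T -> {ae mu, forall x, `|p x t - q x t| <= k * expR (m * t)}} ->
  `|\int[mu]_(t in I) (b n t * (space_flux delta w (a n) p g t - space_flux delta w (a n) q g t))| <=
  k / 2 * expR (m * s2) * (be - al) * (s2 - s1).
Proof.
move=> m0 Cm k0 pq.
have mb : measurable_fun [set: TR] (b n : TR -> R).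
  by apply: continuous_measurable_fun; case: (smooth_slope_fun s1 s2 n 0).
have A0 : 0 <= A n by rewrite mulr_ge0.
set W1 := \int[mu]_(h in D) (w h / h) in Cm *.
have W10 : 0 <= W1.
  apply: Rintegral_ge0 => h; rewrite /= in_itv/= => /andP[h0 _].
  by rewrite divr_ge0//; case: wK.
have mF r : measurable_fun [set: TR * TR] (fun z : TR * TR => r z.1 z.2 : R) ->
    measurable_fun [set: TR] (space_flux delta w (a n) r g : TR -> R).
  by move=> mr; exact: (measurable_space_flux wK C0 gL (measurable_box_fun al be n) mr).
pose E := `[0, s2]%classic : set TR.
have mE : measurable E by exact: measurable_itv.
have s20 : 0 < s2 by exact: lt_trans s12.
pose c := (s2 - s1) * (4 * C * k * (be - al) * W1).
have c0 : 0 <= c by rewrite !mulr_ge0// subr_ge0 ltW.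
have ie : mu.-integrable E (EFin \o (fun t => expR (m * t))).
  apply: continuous_compact_integrable; first exact: segment_compact.
  apply: continuous_subspaceT => x; apply: continuous_comp; last exact: continuous_expR.
  exact: mulrl_continuous.
rewrite Rintegral_mkcond.
apply: (@le_trans _ _ (\int[mu]_t (c * ((fun t => expR (m * t)) \_ E) t))).
  apply: le_norm_Rintegral_ae => //.
  - apply/(measurable_restrict _ mI measurableT); apply: measurable_funTS.
    by apply: measurable_funM => //; apply: measurable_funB; exact: mF.
  - apply: integrable_scale => //.
    by have /(integrable_mkcond _ mE) := ie; rewrite restrict_EFin.
  - by move=> t; rewrite mulr_ge0// patchE; case: ifP.
  move: pq; apply: (@filterS _ _ (ae_filter_ringOfSetsType mu)) => t h _.
  rewrite patchE; case: ifPn => [|_]; last first.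
    by rewrite normr0 mulr_ge0// patchE; case: ifP.
  rewrite inE/= in_itv/= => /andP[t0 tT].
  have [st|ts] := ltP s2 t.
    rewrite (slope_fun_late _ (ltW s12) (ltW st)) mul0r normr0 mulr_ge0// patchE; by case: ifP.
  rewrite patchE mem_set; last by rewrite /E/= in_itv/= ltW.
  have {}h := h _; rewrite t0 tT in h; have {}h := h isT.
  rewrite normrM /c -mulrA; apply: ler_pM => //.
    by rewrite ger0_norm ?slope_fun_ge0 ?slope_fun_bound// ltW.
  apply: le_trans (space_flux_contraction delta0 wK C0 gL iw1 N0 A0 (box_fun_itv al be n)
    (@box_fun_far _ al be n) (box_fun_lipschitz al be n) (measurable_box_fun al be n) mp mq pM qM _ h) _.
    by rewrite mulr_ge0 ?expR_ge0.
  rewrite -/W1 [leRHS](_ : _ = 4 * C * (k * expR (m * t)) * (be - al) * W1); last by ring.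
  rewrite ler_wpM2r// ler_wpM2l ?box_fun_integral_le// !mulr_ge0 ?expR_ge0//.
rewrite RintegralZl//; last by have /(integrable_mkcond _ mE) := ie; rewrite restrict_EFin.
rewrite -Rintegral_mkcond.
apply: le_trans (ler_wpM2l c0 (expR_integral_le m0 s20)) _.
rewrite /c [leLHS](_ : _ = (s2 - s1) * (be - al) * (k / 2) * expR (m * s2) * (8 * C * W1 / m)); last first.
  by field; rewrite gt_eqF.
rewrite [leRHS](_ : _ = (s2 - s1) * (be - al) * (k / 2) * expR (m * s2)); last by ring.
by rewrite ler_piMr ?ler_pdivrMr ?mul1r// !mulr_ge0 ?subr_ge0 ?expR_ge0// ltW.
Qed.

Lemma box_mean_cvg t : space_mean (a n) p t - space_mean (a n) q t @[n --> \oo] --> box_mean al be t.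
Proof.
have mbox := measurable_box_fun al be.
have ip n := profile_integrable N0 (box_fun_itv al be n) (@box_fun_far _ al be n) (mbox n) mp pM t.
have iq n := profile_integrable N0 (box_fun_itv al be n) (@box_fun_far _ al be n) (mbox n) mq qM t.
have mpt : measurable_fun [set: TR] (p ^~ t : TR -> R) := measurable_fun_pair1 t mp.
have mqt : measurable_fun [set: TR] (q ^~ t : TR -> R) := measurable_fun_pair1 t mq.
have -> : (fun n => space_mean (a n) p t - space_mean (a n) q t) =
    (fun n => \int[mu]_x ((p x t - q x t) * a n x)).
  apply/funext => n; rewrite /space_mean -RintegralB//.
  by apply: eq_Rintegral => x _; rewrite mulrBl.
have mW : measurable (window N : set TR) by exact: measurable_window.
have Woo : (mu (window N : set TR) < +oo)%E by rewrite window_measure// ltry.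
have iW : mu.-integrable setT (EFin \o ((fun=> 2 * M) \_ (window N))).
  have /(integrable_mkcond _ mW) : mu.-integrable (window N : set TR) (EFin \o (fun=> 2 * M)).
    apply: (integrable_bounded (M := 2 * M)) => // x _.
    by rewrite ger0_norm// mulr_ge0.
  by rewrite restrict_EFin.
have mchi : measurable_fun [set: TR] (fun x : TR => ((al < x < be)%R%:R : R)).
  rewrite (_ : (fun x => _) = \1_(`]al, be[%classic : set TR)); first exact: measurable_indic.
  by apply/funext => x; rewrite indicE mem_setE in_itv.
have [|||||_ //] := @Rintegral_dominated_cvg _ _ _ mu setT (fun n x => (p x t - q x t) * a n x)
  (fun x => (p x t - q x t) * (al < x < be)%R%:R) ((fun=> 2 * M) \_ (window N)) measurableT.
- by move=> n; apply: measurable_funM => //; exact: measurable_funB.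
- by apply: measurable_funM => //; exact: measurable_funB.
- exact: iW.
- by apply: aeW => x _; apply: cvgM; [exact: cvg_cst|exact: box_fun_cvg].
move=> n x _; rewrite patchE; case: ifPn => [_|/negP xW].
  have /andP[a0 a1] := box_fun_itv al be n x.
  rewrite normrM -[leRHS]mulr1; apply: ler_pM => //; last by rewrite ger0_norm.
  by rewrite mulr_natl mulr2n (le_trans (ler_normB _ _))// lerD.
rewrite box_fun_far ?mulr0 ?normr0// ltNge; apply/negP => h.
by apply: xW; rewrite inE /window/= in_itv/= -ler_norml.
Qed.

Lemma box_mean_bound n t : `|space_mean (a n) p t - space_mean (a n) q t| <= 2 * M * fine (mu (window N : set TR)).
Proof.
have H r : measurable_fun [set: TR * TR] (fun z : TR * TR => r z.1 z.2 : R) ->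
    (forall x t, `|r x t| <= M) -> `|space_mean (a n) r t| <= M * fine (mu (window N : set TR)).
  move=> mr rM.
  apply: (slice_integral_bound (F := fun z : TR * TR => r z.1 z.2 * a n z.1) N0).
  - by apply: measurable_funM => //; exact: measurableT_comp (measurable_box_fun al be n) measurable_fst.
  - move=> z; have /andP[a0 a1] := box_fun_itv al be n z.1.
    by rewrite normrM -[leRHS]mulr1; apply: ler_pM => //; rewrite ger0_norm.
  - by move=> x s h; rewrite /= box_fun_far// mulr0.
apply: le_trans (ler_normB _ _) _; rewrite -mulrA mulr_natl mulr2n.
by apply: lerD; exact: H.
Qed.

Lemma measurable_box_mean : measurable_fun [set: TR] (box_mean al be : TR -> R).
Proof.
have mchi : measurable_fun [set: TR] (fun x : TR => ((al < x < be)%R%:R : R)).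
  rewrite (_ : (fun x => _) = \1_(`]al, be[%classic : set TR)); first exact: measurable_indic.
  by apply/funext => x; rewrite indicE mem_setE in_itv.
have mF : measurable_fun [set: TR * TR]
    (fun z : TR * TR => (p z.1 z.2 - q z.1 z.2) * (al < z.1 < be)%R%:R : R).
  by apply: measurable_funM; [exact: measurable_funB|exact: measurableT_comp mchi measurable_fst].
exact: (measurable_Rintegral_param1 mF).
Qed.

Lemma box_mean_le t : `|box_mean al be t| <= 2 * M * fine (mu (window (`|al| + `|be|) : set TR)).
Proof.
have h := cvg_norm (box_mean_cvg (t := t)).
by apply: (cvgr_to_le (h _)); apply: nearW => n; exact: box_mean_bound.
Qed.

(** Let the box and the slope become sharp in the identity for [p] minus that
    for [q]. *)
Lemma box_contraction (k m : R) : 0 < m -> 8 * C * \int[mu]_(h in D) (w h / h) <= m -> 0 <= k ->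
  {ae mu, forall t, 0 < t < T -> {ae mu, forall x, `|p x t - q x t| <= k * expR (m * t)}} ->
  `|\int[mu]_(t in `[s1, s2]) box_mean al be t| <= k / 2 * expR (m * s2) * (be - al) * (s2 - s1).
Proof.
move=> m0 Cm k0 pq.
set c := 2 * M * fine (mu (window N : set TR)).
have mB := measurable_box_mean.
have mDn n : measurable_fun [set: TR] (fun t : TR => space_mean (a n) p t - space_mean (a n) q t : R).
  have mm r : measurable_fun [set: TR * TR] (fun z : TR * TR => r z.1 z.2 : R) ->
      measurable_fun [set: TR] (space_mean (a n) r : TR -> R).
    move=> mr; apply: (measurable_Rintegral_param1 (f := fun z : TR * TR => r z.1 z.2 * a n z.1)).
    by apply: measurable_funM => //; exact: measurableT_comp (measurable_box_fun al be n) measurable_fst.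
  by apply: measurable_funB; exact: mm.
have mb' n : measurable_fun [set: TR] (b' n : TR -> R).
  by apply: continuous_measurable_fun; exact: continuous_slope_fun'.
have mchi : measurable_fun [set: TR] (fun t : TR => ((s1 <= t < s2)%R%:R : R)).
  rewrite (_ : (fun x => _) = \1_(`[s1, s2[%classic : set TR)); first exact: measurable_indic.
  by apply/funext => x; rewrite indicE mem_setE in_itv.
have c0 : 0 <= c by rewrite !mulr_ge0// fine_ge0.
have ig : mu.-integrable I (EFin \o (fun=> (1 + (s2 - s1)) * c)).
  apply: (integrable_bounded (M := (1 + (s2 - s1)) * c)) => // x _.
  by rewrite ger0_norm// mulr_ge0// addr_ge0// subr_ge0 ltW.
have I0 t : I t -> 0 <= t by rewrite /= in_itv/= => /andP[/ltW].
have [|||||_ cv] := @Rintegral_dominated_cvg _ _ _ mu I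
  (fun n t => b' n t * (space_mean (a n) p t - space_mean (a n) q t))
  (fun t => - (s1 <= t < s2)%R%:R * box_mean al be t) (fun=> (1 + (s2 - s1)) * c) mI.
- by move=> n; apply: measurable_funTS; exact: measurable_funM.
- by apply: measurable_funTS; apply: measurable_funM => //; exact: measurableT_comp.
- exact: ig.
- apply: aeW => t It; apply: cvgM; first by apply: slope_fun'_cvg; [exact: ltW|exact: I0].
  exact: box_mean_cvg.
- move=> n t It; rewrite normrM; apply: ler_pM => //; last exact: box_mean_bound.
  by apply: slope_fun'_bound; [exact: ltW|exact: I0].
have := cvg_norm cv.
have e : \int[mu]_(t in I) (- (s1 <= t < s2)%R%:R * box_mean al be t) =
    - \int[mu]_(t in `[s1, s2]) box_mean al be t.
  have Bc t : `|box_mean al be t| <= c by exact: box_mean_le.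
  have Eoo : (mu (`[s1, s2[%classic : set TR) < +oo)%E.
    by rewrite lebesgue_measure_itv/= lte_fin s12 -EFinB ltry.
  have iB : mu.-integrable (`[s1, s2[%classic : set TR) (EFin \o box_mean al be).
    by apply: (integrable_bounded (M := c)) => //; exact: measurable_funTS.
  transitivity (\int[mu]_(t in I) (((fun t => -1 * box_mean al be t) \_ (`[s1, s2[%classic : set TR)) t)).
    apply: eq_Rintegral => t _; rewrite patchE mem_setE in_itv/=.
    by case: ifP => _ /=; [ring|rewrite oppr0 mul0r].
  rewrite -Rintegral_mkcondr (_ : I `&` _ = `[s1, s2[%classic); last first.
    apply/seteqP; split => t /=; rewrite !in_itv/=; first by case.
    by move=> /andP[h1 h2]; rewrite h1 h2 (lt_le_trans s10 h1) (lt_trans h2 s2T).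
  by rewrite RintegralZl// mulN1r Rintegral_itv_bndo_bndc.
rewrite e normrN => h.
apply: (cvgr_to_le (h _)); apply: nearW => n /=.
by rewrite box_identity normrN; exact: box_flux_bound.
Qed.

End one_box.

End contraction.

Section interval_means.
Context {R : realType}.
Local Notation mu := (@lebesgue_measure R).
Local Notation TR := (measurableTypeR R).
Variables (f : TR -> R) (M K : R).
Hypotheses (mf : measurable_fun setT f) (fM : forall x, `|f x| <= M).

Let fi a b : mu.-integrable (`[a, b]%classic : set TR) (EFin \o f).
Proof.
have abo : (mu (`[a, b]%classic : set TR) < +oo)%E.
  by rewrite lebesgue_measure_itv/=; case: ifP => // _; rewrite -EFinB ltry.
by apply: (integrable_bounded (M := M)) => //; exact: measurable_funTS.
Qed.

Let join a b c : a <= b -> b <= c ->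
  \int[mu]_(x in `[a, c]) f x = \int[mu]_(x in `[a, b]) f x + \int[mu]_(x in `[b, c]) f x.
Proof.
move=> ab bc; rewrite -(Rintegral_itv_obnd_cbnd (r := b)); last first.
  by apply: integrableS (fi b c) => // t /=; rewrite !in_itv/= => /andP[/ltW -> ->].
have h := @Rintegral_itvB R f (BLeft a) (BRight c) b (fi a c) ab bc.
by rewrite -h addrC subrK.
Qed.

Let bound a b : a <= b -> `|\int[mu]_(x in `[a, b]) f x| <= M * (b - a).
Proof.
rewrite le_eqVlt => /predU1P[->|ab].
  by rewrite subrr mulr0 set_itv1 Rintegral_set1 normr0.
have abE : mu (`[a, b]%classic : set TR) = (b - a)%:E.
  by rewrite lebesgue_measure_itv/= lte_fin ab -EFinB.
have abo : (mu (`[a, b]%classic : set TR) < +oo)%E by rewrite abE ltry.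
have mab : measurable (`[a, b]%classic : set TR) by exact: measurable_itv.
have M0 : 0 <= M by exact: le_trans (fM 0).
have -> : M * (b - a) = \int[mu]_(x in `[a, b]) M.
  by rewrite (Rintegral_cst mu mab) -[in LHS](_ : fine (mu (`[a, b]%classic : set TR)) = b - a)// abE.
apply: le_norm_Rintegral => //; first exact: measurable_funTS.
by apply: (integrable_bounded (M := M)) => // x _; rewrite ger0_norm.
Qed.

(** The mean over an interval depends continuously on its end points.  Rational
    end points are countably many, as needed for statements that hold almost
    everywhere in time. *)
Lemma rational_means : (forall r s : rat, (ratr r : R) < ratr s ->
    `|\int[mu]_(x in `[(ratr r : R), (ratr s : R)]) f x| <= K * (ratr s - ratr r)) ->
  forall a b, a < b -> `|\int[mu]_(x in `[a, b]) f x| <= K * (b - a).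
Proof.
move=> H a b ab.
have K0 : 0 <= K.
  have := H 0%R 1%R; rewrite rmorph0 rmorph1 subr0 mulr1 => h.
  by apply: le_trans (h ltr01).
have M0 : 0 <= M by exact: le_trans (fM 0).
apply/ler_addgt0Pr => e e0.
pose d := Num.min ((b - a) / 2) (e / (2 * M + 1)).
have M1 : 0 < 2 * M + 1 by rewrite ltr_wpDl// mulr_ge0.
have d0 : 0 < d by rewrite /d lt_min !divr_gt0// subr_gt0.
have [|r] := rat_in_itvoo (x := a) (y := a + d); first by rewrite ltrDl.
rewrite in_itv/= => /andP[ar rd].
have [|s] := rat_in_itvoo (x := b - d) (y := b); first by rewrite gtrBl.
rewrite in_itv/= => /andP[ds sb].
have d1 : d <= (b - a) / 2 by rewrite ge_min lexx.
have d2 : (2 * M + 1) * d <= e by rewrite mulrC -ler_pdivlMr// ge_min lexx orbT.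
have rs : (ratr r : R) < ratr s by move: rd ds d1; lra.
rewrite (join (ltW ar) (ltW (lt_trans rs sb))) (join (ltW rs) (ltW sb)).
apply: le_trans (ler_normD _ _) _; apply: le_trans (lerD (lexx _) (ler_normD _ _)) _.
apply: le_trans (lerD (bound (ltW ar)) (lerD (H _ _ rs) (bound (ltW sb)))) _.
have h1 : M * (ratr r - a) <= M * d by rewrite ler_wpM2l// lerBlDl ltW.
have h2 : M * (b - ratr s) <= M * d by rewrite ler_wpM2l//; move: ds; lra.
have h3 : K * (ratr s - ratr r) <= K * (b - a) by rewrite ler_wpM2l//; move: sb ar; lra.
move: h1 h2 h3 d2 d0; lra.
Qed.

Lemma ae_bound_of_rational_means : (forall r s : rat, (ratr r : R) < ratr s ->
    `|\int[mu]_(x in `[(ratr r : R), (ratr s : R)]) f x| <= K * (ratr s - ratr r)) ->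
  {ae mu, forall x, `|f x| <= K}.
Proof.
move=> H.
have h n := ae_bound_of_means (K := fun=> K) (a0 := - n%:R) (b0 := n%:R) mf fM
  (fun a b h _ => rational_means H (proj2 (andP h))).
move/ae_foralln : h.
apply: (@filterS _ _ (ae_filter_ringOfSetsType mu)) => x /(_ (Num.truncn `|x|).+1); apply.
by rewrite -ltr_norml truncnS_gt.
Qed.

End interval_means.

Section uniqueness.
Context {R : realType}.
Local Notation mu := (@lebesgue_measure R).
Local Notation TR := (measurableTypeR R).
Variables (T delta : R) (w : R -> R) (g : R -> R -> R) (C : R) (u0 : R -> R).
Hypotheses (T0 : 0 < T) (delta0 : 0 < delta) (wK : nonlocal_kernel delta w) (C0 : 0 <= C).
Hypothesis gL : forall u1 u2 v1 v2, `|g u1 v1 - g u2 v2| <= C * (`|u1 - u2| + `|v1 - v2|).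
Local Notation D := (`[0, delta]%classic : set TR).
Hypothesis iw1 : mu.-integrable D (EFin \o (fun h => w h / h)).
Variables (M : R) (p q : R -> R -> R).
Hypothesis mp : measurable_fun [set: TR * TR] (fun z : TR * TR => p z.1 z.2 : R).
Hypothesis mq : measurable_fun [set: TR * TR] (fun z : TR * TR => q z.1 z.2 : R).
Hypothesis pM : forall x t, `|p x t| <= M.
Hypothesis qM : forall x t, `|q x t| <= M.
Hypothesis pS : solves_tensor T delta w g u0 p.
Hypothesis qS : solves_tensor T delta w g u0 q.

Let M0 : 0 <= M.
Proof. exact: le_trans (pM 0 0). Qed.

Let dM x t : `|p x t - q x t| <= 2 * M.
Proof. by rewrite mulr_natl mulr2n (le_trans (ler_normB _ _))// lerD. Qed.

Lemma box_meanE al be t : box_mean p q al be t = \int[mu]_(x in `[al, be]) (p x t - q x t).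
Proof.
have mpt : measurable_fun [set: TR] (p ^~ t : TR -> R) := measurable_fun_pair1 t mp.
have mqt : measurable_fun [set: TR] (q ^~ t : TR -> R) := measurable_fun_pair1 t mq.
have i : mu.-integrable (`[al, be]%classic : set TR) (EFin \o (fun x => p x t - q x t)).
  have abo : (mu (`[al, be]%classic : set TR) < +oo)%E.
    by rewrite lebesgue_measure_itv/=; case: ifP => // _; rewrite -EFinB ltry.
  by apply: (integrable_bounded (M := 2 * M)) => //; apply: measurable_funTS; exact: measurable_funB.
rewrite -Rintegral_itv_bndo_bndc; last first.
  by apply: integrableS i => // x /=; rewrite !in_itv/= => /andP[-> /ltW].
rewrite -Rintegral_itv_obnd_cbnd; last first.
  by apply: integrableS i => // x /=; rewrite !in_itv/= => /andP[/ltW -> /ltW].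
rewrite [RHS]Rintegral_mkcond; apply: eq_Rintegral => x _.
by rewrite patchE mem_setE in_itv/=; case: ifP => _; rewrite ?mulr1 ?mulr0.
Qed.

(** The bound on boxes is localized in time first, for boxes with rational end
    points, and then in space. *)
Lemma contraction_step (k m : R) : 0 < m -> 8 * C * \int[mu]_(h in D) (w h / h) <= m -> 0 <= k ->
  {ae mu, forall t, 0 < t < T -> {ae mu, forall x, `|p x t - q x t| <= k * expR (m * t)}} ->
  {ae mu, forall t, 0 < t < T -> {ae mu, forall x, `|p x t - q x t| <= k / 2 * expR (m * t)}}.
Proof.
move=> m0 Cm k0 pq.
pose B (r s : rat) t := (ratr r : R) < ratr s -> `|box_mean p q (ratr r) (ratr s) t| <=
  k / 2 * expR (m * t) * (ratr s - ratr r).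
have h r s : {ae mu, forall t, 0 < t < T -> B r s t}.
  have [rs|rs] := boolP ((ratr r : R) < ratr s); last first.
    by apply: aeW => t _ rs'; rewrite rs' in rs.
  have := ae_bound_of_means (K := fun t => k / 2 * expR (m * t) * (ratr s - ratr r)) (a0 := 0) (b0 := T)
    (measurable_box_mean mp mq (ratr r) (ratr s)) (box_mean_le mp mq pM qM (ratr r) (ratr s)) _.
  move=> /(_ _)/wrap[a b /andP[a0 ab] bT|].
    exact: (box_contraction T0 delta0 wK C0 gL iw1 mp mq pM qM pS qS rs a0 ab bT m0 Cm k0 pq).
  by apply: (@filterS _ _ (ae_filter_ringOfSetsType mu)) => t ht tT _; exact: ht.
pose P n t := if unpickle n is Some (r, s) then 0 < t < T -> B r s t else True.
have {}h : {ae mu, forall t, forall n, P n t}.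
  apply/ae_foralln => n; rewrite /P; case: unpickle => [[r s]|]; last exact: aeW.
  exact: h.
move: h; apply: (@filterS _ _ (ae_filter_ringOfSetsType mu)) => t h tT.
have mpt : measurable_fun [set: TR] (p ^~ t : TR -> R) := measurable_fun_pair1 t mp.
have mqt : measurable_fun [set: TR] (q ^~ t : TR -> R) := measurable_fun_pair1 t mq.
apply: (ae_bound_of_rational_means (M := 2 * M) (f := fun x => p x t - q x t)) => //.
  exact: measurable_funB.
move=> r s rs; rewrite -box_meanE.
by have := h (pickle (r, s)); rewrite /P pickleK; apply.
Qed.

(** The initial bound is [2 M], and it can be halved any number of times. *)
Lemma contraction_zero : {ae mu, forall t, 0 < t < T -> {ae mu, forall x, p x t = q x t}}.
Proof.
set W1 := \int[mu]_(h in D) (w h / h).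
have W10 : 0 <= W1.
  apply: Rintegral_ge0 => h; rewrite /= in_itv/= => /andP[h0 _].
  by rewrite divr_ge0//; case: wK.
pose m := 8 * C * W1 + 1.
have m0 : 0 < m by rewrite ltr_wpDl// !mulr_ge0.
have H j : {ae mu, forall t, 0 < t < T -> {ae mu, forall x, `|p x t - q x t| <= 2 * M * 2^-1 ^+ j * expR (m * t)}}.
  elim: j => [|j IH].
    apply: aeW => t /andP[t0 _]; apply: aeW => x.
    apply: le_trans (dM x t) _; rewrite expr0 mulr1 ler_peMr ?mulr_ge0//.
    by rewrite -expR0 ler_expR mulr_ge0 ?ltW.
  have := contraction_step m0 _ _ IH; rewrite exprSr mulrA; apply.
  - by rewrite lerDl.
  - by rewrite !mulr_ge0// exprn_ge0.
move/ae_foralln : H.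
apply: (@filterS _ _ (ae_filter_ringOfSetsType mu)) => t H tT.
have : {ae mu, forall x, forall j, `|p x t - q x t| <= 2 * M * 2^-1 ^+ j * expR (m * t)}.
  by apply/ae_foralln => j; exact: H.
apply: (@filterS _ _ (ae_filter_ringOfSetsType mu)) => x {}H.
apply/eqP; rewrite -subr_eq0 -normr_le0.
have cv : 2 * M * expR (m * t) * 2^-1 ^+ j @[j --> \oo] --> (0 : R).
  have := @cvg_geometric R (2 * M * expR (m * t)) 2^-1.
  by apply; rewrite ger0_norm// invf_lt1// ltr1n.
apply: (cvgr_to_ge cv); apply: nearW => j.
by rewrite mulrAC.
Qed.

End uniqueness.

(** * Uniqueness and convergence of the whole family *)

Section entropy_uniqueness.
Context {R : realType}.
Local Notation mu := (@lebesgue_measure R).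
Local Notation TR := (measurableTypeR R).

(** A function of bounded variation differs from its value at 0 by at most its
    variation. *)
Lemma L1_BV_ae_bounded (u0 : R -> R) : L1_BV u0 -> exists2 B, 0 <= B & {ae mu, forall x, `|u0 x| <= B}.
Proof.
move=> [_ [v u0v /TV_line_majorant[V V0 [m [mnd mV vm]]]]].
exists (`|v 0| + V); first by rewrite addr_ge0.
move: u0v; apply: (@filterS _ _ (ae_filter_ringOfSetsType mu)) => x ->.
have mm y z : m y - m z <= V by have /andP[? ?] := mV y; have /andP[? ?] := mV z; lra.
rewrite -[v x](subrK (v 0)) (le_trans (ler_normD _ _))// addrC lerD2l.
have [x0|/ltW x0] := leP 0 x; first exact: le_trans (vm _ _ x0) (mm _ _).
by rewrite distrC; exact: le_trans (vm _ _ x0) (mm _ _).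
Qed.

Variables (T delta : R) (w : R -> R) (g : R -> R -> R) (C : R) (u0 : R -> R).
Hypotheses (T0 : 0 < T) (delta0 : 0 < delta) (wK : nonlocal_kernel delta w) (C0 : 0 <= C).
Hypothesis gL : forall u1 u2 v1 v2, `|g u1 v1 - g u2 v2| <= C * (`|u1 - u2| + `|v1 - v2|).
Hypothesis bv0 : L1_BV u0.
Hypothesis w1oo : (\int[mu]_(h in `[0%R, delta]) (w h / h)%:E < +oo)%E.

Lemma singular_kernel_integrable :
  mu.-integrable (`[0, delta]%classic : set TR) (EFin \o (fun h => w h / h)).
Proof.
have mD : measurable (`[0, delta]%classic : set TR) by exact: measurable_itv.
apply/integrableP; split.
  apply/measurable_EFinP; apply: measurable_funTS; apply: measurable_funM; last exact: measurable_inv.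
  by case: wK => /measurable_int/measurable_EFinP.
apply: le_lt_trans w1oo; rewrite le_eqVlt; apply/orP; left; apply/eqP.
apply: eq_integral => h; rewrite inE/= in_itv/= => /andP[h0 _].
by rewrite ger0_norm// divr_ge0//; case: wK.
Qed.

Lemma entropy_unique_slices (u v : R -> R -> R) :
  entropy_solution T delta w g u0 u -> entropy_solution T delta w g u0 v ->
  {ae mu, forall t, 0 < t < T -> {ae mu, forall x, u x t = v x t}}.
Proof.
move=> eu ev.
have [B B0 u0B] := L1_BV_ae_bounded bv0.
have [[mfu [M1 uM]] _] := eu; have [[mfv [M2 vM]] _] := ev.
pose M := Num.max B (Num.max M1 M2).
have M0 : 0 <= M by rewrite le_max B0.
have M1M : M1 <= M by rewrite !le_max lexx orbT.
have M2M : M2 <= M by rewrite !le_max lexx !orbT.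
have uM' : {ae (mu \x mu)%E, forall z, strip T z -> `|u z.1 z.2| <= M}.
  move: uM; apply: (@filterS _ _ (ae_filter_ringOfSetsType _)) => z h /h {}h; exact: le_trans M1M.
have vM' : {ae (mu \x mu)%E, forall z, strip T z -> `|v z.1 z.2| <= M}.
  move: vM; apply: (@filterS _ _ (ae_filter_ringOfSetsType _)) => z h /h {}h; exact: le_trans M2M.
have u0M : {ae mu, forall x, `|u0 x| <= M}.
  move: u0B; apply: (@filterS _ _ (ae_filter_ringOfSetsType _)) => z h; apply: le_trans h _.
  by rewrite le_max lexx.
have S r : entropy_solution T delta w g u0 r ->
    {ae (mu \x mu)%E, forall z, strip T z -> `|r z.1 z.2| <= M} ->
    solves_tensor T delta w g u0 (representative T M r).
  move=> er rM al be s1 s2 n ab s10 s12 s2T.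
  apply: (entropy_tensor T0 delta0 wK C0 gL bv0.1 (N := `|al| + `|be|) (A := 8 * n.+1%:R) _ _
    (box_fun_itv al be n) (@box_fun_far _ al be n) (box_fun_lipschitz al be n) (measurable_box_fun al be n)
    (slope_fun_is_derive s1 s2 n) (@continuous_slope_fun' _ s1 s2 n) _ _ _ M0 u0M er rM).
  - by rewrite addr_ge0.
  - by rewrite mulr_ge0.
  - exact: (slope_fun_ge0 n (ltW s12)).
  - exact: (slope_fun_late n (ltW s12) (ltW s2T)).
  - exact: (tensor_test_function al be n (ltW s12) s2T).
have := contraction_zero T0 delta0 wK C0 gL singular_kernel_integrable
  (measurable_representative M mfu) (measurable_representative M mfv)
  (representative_bound T u M0) (representative_bound T v M0) (S _ eu uM') (S _ ev vM').
have hu := ae_representative uM'; have hv := ae_representative vM'.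
move: hu hv; apply: (@filterS3 _ _ (ae_filter_ringOfSetsType mu)) => t hu hv h tT.
move: (hu tT) (hv tT) (h tT); apply: (@filterS3 _ _ (ae_filter_ringOfSetsType mu)) => x.
by move=> -> -> ->.
Qed.

(** Equality on almost all slices is equality almost everywhere, by Fubini's
    theorem applied to the measurable set where the two functions differ. *)
Lemma entropy_unique (u v : R -> R -> R) :
  entropy_solution T delta w g u0 u -> entropy_solution T delta w g u0 v ->
  {ae (mu \x mu)%E, forall z, strip T z -> v z.1 z.2 = u z.1 z.2}.
Proof.
move=> eu ev; have := entropy_unique_slices eu ev => h.
have [[mfu _] _] := eu; have [[mfv _] _] := ev.
pose f (z : TR * TR) : R := on_strip T v z.1 z.2 - on_strip T u z.1 z.2.
have mf : measurable_fun setT f by apply: measurable_funB; exact: measurable_on_strip.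
pose A : set (TR * TR) := ~` (f @^-1` [set 0]).
have mA : measurable A.
  by apply: measurableC; rewrite -[_ @^-1` _]setTI; apply: mf.
have : {ae (mu \x mu)%E, forall z, ~ A z}.
  apply: (sections_ae mA); move: h.
  apply: (@filterS _ _ (ae_filter_ringOfSetsType mu)) => t h.
  have [tT|tT] := boolP (0 < t < T); last first.
    by apply: aeW => x; rewrite /A /f /on_strip /= (negbTE tT) subrr; apply.
  move: (h tT); apply: (@filterS _ _ (ae_filter_ringOfSetsType mu)) => x e.
  by rewrite /A /f /on_strip /= tT e subrr; apply.
apply: (@filterS _ _ (ae_filter_ringOfSetsType _)) => -[x t] /contrapT.
rewrite /f /on_strip /strip /= => /eqP; rewrite subr_eq0 => /eqP e tT.
by move: e; rewrite tT.
Qed.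

Lemma ae_exists_itv (P : R -> Prop) (a b : R) : {ae mu, forall t, P t} -> a < b ->
  exists2 t, a < t < b & P t.
Proof.
move=> [A [mA A0 PA]] ab; apply: contrapT => nP.
have : (mu (`]a, b[%classic : set TR) <= mu A)%E.
  apply: le_measure; [by rewrite inE; exact: measurable_itv|by rewrite inE|].
  move=> t /=; rewrite in_itv/= => tab; apply: PA => /= Pt; apply: nP; exists t => //.
by rewrite A0 lebesgue_measure_itv/= lte_fin ab -EFinB lee_fin leNgt subr_gt0 ab.
Qed.

(** Continuity in time turns equality at almost all times into equality at all
    times. *)
Lemma C_L1_ae_eq (u v : R -> R -> R) : C_L1 T u -> C_L1 T v ->
  {ae mu, forall t, 0 < t < T -> {ae mu, forall x, u x t = v x t}} ->
  forall t, t \in `[0, T] -> {ae mu, forall x, u x t = v x t}.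
Proof.
move=> [iu cu] [iv cv] h t tT.
have mfu s : s \in `[0, T] -> measurable_fun [set: TR] (u ^~ s : TR -> R).
  by move=> /iu/measurable_int/measurable_EFinP.
have mfv s : s \in `[0, T] -> measurable_fun [set: TR] (v ^~ s : TR -> R).
  by move=> /iv/measurable_int/measurable_EFinP.
suff L0 : L1dist setT (u ^~ t) (v ^~ t) = 0%E.
  have : ae_eq mu setT (fun x => (u x t - v x t)%:E) (cst 0%E).
    apply/ae_eq_integral_abs => //; first by apply/measurable_EFinP; apply: measurable_funB; [exact: mfu|exact: mfv].
  apply: (@filterS _ _ (ae_filter_ringOfSetsType mu)) => x /(_ I)[/eqP].
  by rewrite subr_eq0 => /eqP.
apply/eqP; rewrite eq_le L1dist_ge0 andbT; apply/lee_addgt0Pr => e e0; rewrite add0e.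
have e2 : (0 < (e / 2)%:E)%E by rewrite lte_fin divr_gt0.
have near_small (r : R -> R -> R) : (\int[mu]_x `|r x s - r x t|%:E)%E @[s --> within `[0, T] (nbhs t)] --> 0%E ->
    \forall s \near t, s \in `[0, T] -> (L1dist setT (r ^~ s) (r ^~ t) < (e / 2)%:E)%E.
  move=> cr; apply: (cr [set y | (y < (e / 2)%:E)%E]).
  have : \forall y \near (0 : R), y < e / 2 by apply: lt_nbhsl; rewrite divr_gt0.
  exact.
have [d /= d0 hd] : \forall s \near t, s \in `[0, T] ->
    (L1dist setT (u ^~ s) (u ^~ t) < (e / 2)%:E)%E /\ (L1dist setT (v ^~ s) (v ^~ t) < (e / 2)%:E)%E.
  by apply: filterS2 (near_small _ (cu t tT)) (near_small _ (cv t tT)) => s h1 h2 sT; split; [exact: h1|exact: h2].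
have [s] : exists2 s, Num.max 0 (t - d) < s < Num.min T (t + d) & (0 < s < T -> {ae mu, forall x, u x s = v x s}).
  apply: ae_exists_itv h _; move: tT; rewrite in_itv/= => /andP[t0 tT].
  by rewrite lt_min !gt_max T0/=; apply/andP; split; move: t0 tT d0; lra.
rewrite gt_max lt_min => /andP[/andP[s0 s1] /andP[s2 s3]].
rewrite s0 s2 => /(_ isT) us.
have sT : s \in `[0, T] by rewrite in_itv/= !ltW.
have [|h1 h2] := hd s _ sT; first by rewrite /ball/= ltr_norml; lra.
apply: (@le_trans _ _ (L1dist setT (u ^~ t) (u ^~ s) + L1dist setT (u ^~ s) (v ^~ t))%E).
  by apply: L1dist_triangle => //; [exact: mfu|exact: mfu|exact: mfv].
rewrite (splitr e) EFinD leeD//; first by rewrite L1distC ltW.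
rewrite (_ : L1dist _ _ _ = L1dist setT (v ^~ s) (v ^~ t)) ?ltW//.
apply: ae_eq_integral => //.
- by apply: measurable_absB; [exact: mfu|exact: mfv].
- by apply: measurable_absB; [exact: mfv|exact: mfv].
- by move: us; apply: (@filterS _ _ (ae_filter_ringOfSetsType mu)) => x ->.
Qed.

End entropy_uniqueness.

Theorem theorem3p6 (R : realType) (T delta lambda : R)
    (w : R -> R) (f : R -> R) (g : R -> R -> R) (u0 : R -> R)
    (sigma : R -> nat -> int -> R)
    (U := fun dt : R =>
       forward_euler delta w g u0 (dt / lambda) dt (sigma dt))
    (udt := fun dt : R => piecewise_constant (dt / lambda) dt (U dt)) :
  0 < T -> 0 < delta -> 0 < lambda ->
  nonlocal_kernel delta w ->
  consistent_flux g f -> monotone_flux g -> lipschitz_flux g ->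
  CFL lambda g ->
  L1_BV u0 ->
  (forall dt, 0 < dt -> forall n, admissible_slopes (U dt n) (sigma dt n)) ->
  (forall dts : nat -> R,
     (forall m, 0 < dts m) -> dts m @[m --> \oo] --> 0 ->
     exists s : nat -> nat, {homo s : m n / (m < n)%N} /\
     exists u : R -> R -> R,
       [/\ C_L1 T u,
           weak_solution T delta w g u0 u &
           forall t : R, t \in `[0, T] ->
             cvg_L1loc \oo (fun k => udt (dts (s k)) ^~ t) (u ^~ t)])
  /\
  ((\int[lebesgue_measure]_(h in `[0%R, delta]) (w h / h)%:E < +oo)%E ->
   exists u : R -> R -> R,
     [/\ C_L1 T u,
         entropy_solution T delta w g u0 u,
         forall v, entropy_solution T delta w g u0 v ->
           {ae (lebesgue_measure \x lebesgue_measure)%E,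
             forall z, strip T z -> v z.1 z.2 = u z.1 z.2} &
         forall t : R, t \in `[0, T] ->
           cvg_L1loc 0^'+ (fun dt => udt dt ^~ t) (u ^~ t)]).
Proof.
move=> T0 delta0 lam0 wK _ [g1 g2] [C gLC] _ bv0 Us.
pose C' := Num.max C 0.
have C0 : 0 <= C' by rewrite le_max lexx orbT.
have gL u1 u2 v1 v2 : `|g u1 v1 - g u2 v2| <= C' * (`|u1 - u2| + `|v1 - v2|).
  by apply: le_trans (gLC _ _ _ _) _; rewrite ler_wpM2r ?addr_ge0// le_max lexx.
have gnd v : {homo g ^~ v : x y / x <= y}.
  apply: (@lipschitz_derive_ge0_homo _ _ C') => [x y|x]; last exact: g1.
  by apply: le_trans (gL _ _ _ _) _; rewrite subrr normr0 addr0.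
have gni v x y : x <= y -> g v y <= g v x.
  move=> xy; rewrite -lerN2.
  apply: (@lipschitz_derive_ge0_homo _ (fun z => - g v z) C') xy => [{}x {}y|z dz].
    by rewrite -opprD normrN; apply: le_trans (gL _ _ _ _) _; rewrite subrr normr0 add0r.
  have dg : derivable (g v) z 1.
    by rewrite (_ : g v = - (fun z => - g v z)); [exact: derivableN|apply/funext => y0; rewrite !fctE opprK].
  by rewrite (is_derive_derive1 (is_deriveN (derivable_is_derive dg))).2 oppr_ge0; exact: g2.
have [V V0 u0V] := cell_avg_bounds bv0.
have H dts := @scheme_compactness _ T delta lambda w g C' V u0 sigma T0 delta0 lam0 wK C0 gL gnd gni Us bv0.1 u0V dts.
split.
  by move=> dts d0 dc; have [s [sh [u [cu wu _ _ ut]]]] := H dts d0 dc; exists s; split => //; exists u.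
move=> w1oo.
have [s0 [_ [u [cu _ eu _ _]]]] := H harmonic (@harmonic_gt0 R) (@cvg_harmonic R).
exists u; split => //; first by move=> v ev; exact: (entropy_unique T0 delta0 wK C0 gL bv0 w1oo eu ev).
(* If some neighbourhood A of 0 were missed by arbitrarily small steps, these
   would form a sequence; a subsequence of it converges to an entropy solution,
   which is u by uniqueness. *)
move=> t tT K cK A A0; apply: contrapT => nA.
have bad m : exists2 d : R, 0 < d < harmonic m &
    ~ A (\int[lebesgue_measure]_(x in K) `|udt d x t - u x t|%:E)%E.
  apply: contrapT => nB; apply: nA; exists (harmonic m); first exact: harmonic_gt0.
  move=> d /= hd d0; apply: contrapT => nAd; apply: nB; exists d => //.
  by rewrite d0; move: hd; rewrite sub0r normrN gtr0_norm.
pose dts m := sval (cid2 (bad m)).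
have dtsP m : 0 < dts m < harmonic m /\ ~ A (\int[lebesgue_measure]_(x in K) `|udt (dts m) x t - u x t|%:E)%E.
  by rewrite /dts; case: cid2.
have d0 m : 0 < dts m by have [/andP[]] := dtsP m.
have dc : dts m @[m --> \oo] --> 0.
  apply: (@squeeze_cvgr _ _ _ _ (cst 0) harmonic).
  - by apply: nearW => m /=; have [/andP[/ltW -> /ltW ->]] := dtsP m.
  - exact: cvg_cst.
  - exact: cvg_harmonic.
have [s [sh [u' [cu' _ eu' _ ut]]]] := H dts d0 dc.
have e := C_L1_ae_eq T0 cu' cu (entropy_unique_slices T0 delta0 wK C0 gL bv0 w1oo eu' eu) tT.
have [m _ /(_ m (leqnn m))] := ut t tT K cK A A0.
have [_] := dtsP (s m); rewrite /=; apply: contra_not; congr A.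
have mK : measurable (K : set (measurableTypeR R)).
  by apply: closed_measurable; apply: compact_closed => //; exact: norm_hausdorff.
have md : measurable_fun [set: measurableTypeR R] (udt (dts (s m)) ^~ t : measurableTypeR R -> R).
  exact: (measurable_fun_pair1 t (measurable_piecewise_constant (U (dts (s m))) (divr_gt0 (d0 _) lam0) (d0 _))).
apply: ae_eq_integral => //.
- apply: measurable_absB; first exact: measurable_funTS.
  by apply: measurable_funTS; have /measurable_int/measurable_EFinP := cu'.1 t tT.
- apply: measurable_absB; first exact: measurable_funTS.
  by apply: measurable_funTS; have /measurable_int/measurable_EFinP := cu.1 t tT.
- by move: e; apply: (@filterS _ _ (ae_filter_ringOfSetsType lebesgue_measure)) => x ->.
Qed.
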